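(* Let $\Omega\subset\mathbb{C}$ be a simply connected domain with base point $z_0$. Let $U_\lambda=(F_\lambda,X_\lambda):\Omega\to\Lambda\mathcal{G}_\tau$ be the extended lift of a Hamiltonian stationary lifted conformal Lagrangian immersion, with Lagrangian angle map $\beta$ ($\beta(z_0)=0$). Then (pointwise in $z\in\Omega$) there exist unique $U^-_\lambda\in\Lambda^-_\star\mathcal{G}^{\mathbb{C}}_\tau$ and $U^+_\lambda\in\Lambda^+\mathcal{G}^{\mathbb{C}}_\tau$ such that $U_\lambda=U^-_\lambda U^+_\lambda$, and they are given explicitly by $$U^-_\lambda=\Big(e^{\frac{\lambda^{-2}}{4}(\beta+i\gamma)L_i},\ e^{\frac{\lambda^{-2}}{4}(\beta+i\gamma)L_i}\,Q^-\big(e^{-\frac{\lambda^{-2}}{4}(\beta+i\gamma)L_i}X_\lambda\big)\Big),$$ $$U^+_\lambda=\Big(e^{-\frac{\lambda^{-2}}{4}(\beta+i\gamma)L_i}F_\lambda,\ Q^+\big(e^{-\frac{\lambda^{-2}}{4}(\beta+i\gamma)L_i}X_\lambda\big)\Big),$$ where $\gamma:\Omega\to\mathbb{R}$ solves $\gamma(z_0)=0$ and $d\big(\tfrac12(\beta+i\gamma)\big)=\frac{\partial\beta}{\partial z}dz$. Moreover $$\mu_\lambda:=(U^-_\lambda)^{-1}dU^-_\lambda=\Big(\frac{\lambda^{-2}}{2}L_i\frac{\partial\beta}{\partial z}dz,\ \lambda^{-1}(a\epsilon+bL_i\bar\epsilon)dz\Big)$$ for some holomorphic functions $a,b$ on 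$\Omega$.
   Context: $\mathbb{R}^4$ has its standard inner product $\langle\cdot,\cdot\rangle$ and symplectic form $\omega=dx^1\wedge dx^2+dx^3\wedge dx^4$. Identify $\mathbb{R}^4$ with the quaternions by $(x^1,x^2,x^3,x^4)\mapsto x^1+ix^2+jx^3+kx^4$; $L_p$ (resp. $R_p$) is the matrix of left (resp. right) multiplication by $p$. $\mathcal{G}_0=\{q^1\mathbf 1-q^2R_i-q^3R_j-q^4R_k:q\in\mathbb{R}^4,|q|=1\}$, $\mathcal{G}_2=\{e^{\theta L_i}:\theta\in\mathbb{R}\}$, $\vec{\mathcal{G}}=\mathcal{G}_0\mathcal{G}_2\simeq U(2)$, $\mathcal{G}=\vec{\mathcal{G}}\ltimes\mathbb{R}^4$ with $(G,T)(G',T')=(GG',GT'+T)$, a group of $5\times5$ matrices $\begin{pmatrix}G&T\\0&1\end{pmatrix}$; $\mathfrak{g}$ is its Lie algebra. Complexifications: $\mathcal{G}_0^{\mathbb{C}},\mathcal{G}_2^{\mathbb{C}}$ are obtained by allowing $q\in\mathbb{C}^4$ with $\sum (q^m)^2=1$ and $\theta\in\mathbb{C}$; $\vec{\mathcal{G}}^{\mathbb{C}}=\mathcal{G}_0^{\mathbb{C}}\mathcal{G}_2^{\mathbb{C}}$, $\mathcal{G}^{\mathbb{C}}=\vec{\mathcal{G}}^{\mathbb{C}}\ltimes\mathbb{C}^4$. Let $\tau(G,T)=(-L_jGL_j,-L_jT)$. Let $\epsilon=\frac12(1,0,-i,0)^T$, $\bar\epsilon=\frac12(1,0,i,0)^T$.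 The eigenspaces of (the linear action of) $\tau$ on $\mathfrak{g}^{\mathbb{C}}$ for eigenvalues $i^{k}$, $k=-1,0,1,2$, are $\mathfrak{g}_{-1}^{\mathbb{C}}=\{0\}\times(\mathbb{C}\epsilon\oplus\mathbb{C}L_i\bar\epsilon)$, $\mathfrak{g}_0^{\mathbb{C}}=\mathrm{span}_{\mathbb{C}}\{(R_i,0),(R_j,0),(R_k,0)\}$, $\mathfrak{g}_1^{\mathbb{C}}=\{0\}\times(\mathbb{C}\bar\epsilon\oplus\mathbb{C}L_i\epsilon)$, $\mathfrak{g}_2^{\mathbb{C}}=\mathbb{C}(L_i,0)$; $\alpha_k$ denotes the $\mathfrak{g}_k^{\mathbb{C}}$-component of a 1-form $\alpha$, and $\alpha_k',\alpha_k''$ its $dz$ and $d\bar z$ parts. A lifted conformal Lagrangian immersion (LCLI) is a smooth $U=(F,X):\Omega\to\mathcal{G}$ with $U(z_0)=(\mathbf 1,0)$ and $F^{-1}dX=e^fK(\epsilon\,dz+\bar\epsilon\,d\bar z)$ for some $K\in C^\infty(\Omega,\mathcal{G}_0)$, $f\in C^\infty(\Omega,\mathbb{R})$ (then $X$ is a conformal Lagrangian immersion). Its Lagrangian angle map $\beta:\Omega\to\mathbb{R}$ is defined by $F=e^{\beta L_i/2}M_0$, $M_0\in C^\infty(\Omega,\mathcal{G}_0)$, $\beta(z_0)=0$. It is Hamiltonian stationary iff $\Delta\beta=0$ (known to be equivalent to $X$ being critical for area under compactly supported Hamiltonian variations). In that case, with $\alpha=U^{-1}dU$, the form $\alpha_\lambda=\lambda^{-2}\alpha_2'+\lambda^{-1}\alpha_{-1}'+\alpha_0+\lambda\alpha_1''+\lambda^2\alpha_2''$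 is flat for all $\lambda\in\mathbb{C}\setminus\{0\}$, and the extended lift is the unique $U_\lambda=(F_\lambda,X_\lambda)$, $\lambda\in S^1$, with $dU_\lambda=U_\lambda\alpha_\lambda$, $U_\lambda(z_0)=\mathbf 1$. Loop groups (loops $\lambda\in S^1\mapsto G_\lambda$, of Sobolev class $H^s$, $s>1/2$): $\Lambda\mathcal{G}_\tau$ (resp. $\Lambda\mathcal{G}^{\mathbb{C}}_\tau$) is the group of loops in $\mathcal{G}$ (resp. $\mathcal{G}^{\mathbb{C}}$) with $G_{i\lambda}=\tau(G_\lambda)$; $\Lambda^+\mathcal{G}^{\mathbb{C}}_\tau$ is the subgroup of loops in $\Lambda\mathcal{G}^{\mathbb{C}}_\tau$ extending holomorphically to the unit disk; $\Lambda^-_\star\mathcal{G}^{\mathbb{C}}_\tau$ the subgroup of those extending holomorphically to the complement of the unit disk in $\mathbb{C}\cup\{\infty\}$ with value $\mathbf 1$ at $\infty$. $\Lambda\mathbb{C}^4_\tau$ is the space of loops $V:S^1\to\mathbb{C}^4$ with $-L_jV_\lambda=V_{i\lambda}$ (only odd powers of $\lambda$ occur); $Q^-$ and $Q^+$ are the projections of $\Lambda\mathbb{C}^4_\tau$ keeping respectively only the negative and only the positive powers of $\lambda$ in the Fourier expansion. *)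

(* Defs.v *)
From HB Require Import structures.
From mathcomp Require Import all_boot all_order all_algebra.
From mathcomp Require Import all_classical all_reals all_analysis.
From mathcomp Require Import complex.
Import Order.TTheory GRing.Theory Num.Theory.
Import numFieldNormedType.Exports.

Set Implicit Arguments.
Unset Strict Implicit.
Unset Printing Implicit Defensive.

Local Open Scope classical_set_scope.
Local Open Scope ring_scope.
Local Open Scope complex_scope.

(* The topology of R[i] is the one the library puts on any numFieldType. *)
#[export, non_forgetful_inheritance]
HB.instance Definition _ (R : realType) :=
  PseudoPointedMetric.copy R[i] R[i]^o.
#[export, non_forgetful_inheritance]
HB.instance Definition _ (R : realType) := GRing.ComAlgebra.copy R[i] R[i]^o.
#[export, non_forgetful_inheritance]
HB.instance Definition _ (R : realType) := Vector.copy R[i] R[i]^o.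
#[export, non_forgetful_inheritance]
HB.instance Definition _ (R : realType) := NormedModule.copy R[i] R[i]^o.

Definition simply_connected (R : realType) (D : set R[i]) : Prop :=
  [/\ D !=set0,
      forall x y, D x -> D y -> exists p : R -> R[i],
        [/\ {within `[0, 1], continuous p}, p 0 = x, p 1 = y &
            forall t, 0 <= t <= 1 -> D (p t)] &
      forall p : R -> R[i],
        {within `[0, 1], continuous p} -> p 0 = p 1 ->
        (forall t, 0 <= t <= 1 -> D (p t)) ->
        exists H : R * R -> R[i],
          [/\ {within `[0, 1] `*` `[0, 1], continuous H},
              forall u t, 0 <= u <= 1 -> 0 <= t <= 1 -> D (H (u, t)),
              forall t, 0 <= t <= 1 -> H (0, t) = p t /\ H (1, t) = p 0 &
              forall u, 0 <= u <= 1 -> H (u, 0) = p 0 /\ H (u, 1) = p 0]].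

(* Derivatives of f : C -> C along real directions, as needed for functions
   that are smooth on C = R^2 but not holomorphic. *)
Definition pderivable (R : realType) (v : R[i]) (f : R[i] -> R[i]) (z : R[i]) :=
  derivable (fun t : R => complex.Re (f (z + t%:C * v))) 0 1 /\
  derivable (fun t : R => complex.Im (f (z + t%:C * v))) 0 1.

Definition pderive (R : realType) (v : R[i]) (f : R[i] -> R[i]) (z : R[i]) :
    R[i] :=
  derive1 (fun t : R => complex.Re (f (z + t%:C * v))) 0 +i*
  derive1 (fun t : R => complex.Im (f (z + t%:C * v))) 0.

Definition dx (R : realType) (f : R[i] -> R[i]) := pderive 1 f.
Definition dy (R : realType) (f : R[i] -> R[i]) := pderive 'i%C f.
Definition dz (R : realType) (f : R[i] -> R[i]) (z : R[i]) : R[i] :=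
  2^-1 * (dx f z - 'i%C * dy f z).
Definition dzbar (R : realType) (f : R[i] -> R[i]) (z : R[i]) : R[i] :=
  2^-1 * (dx f z + 'i%C * dy f z).
Definition laplacian (R : realType) (f : R[i] -> R[i]) (z : R[i]) : R[i] :=
  dx (dx f) z + dy (dy f) z.

Fixpoint Ck (R : realType) (k : nat) (D : set R[i]) (f : R[i] -> R[i]) : Prop :=
  if k is k'.+1 then
    [/\ forall z, D z -> pderivable 1 f z /\ pderivable 'i%C f z,
        Ck k' D (dx f) & Ck k' D (dy f)]
  else forall z, D z -> {for z, continuous f}.
Definition smooth (R : realType) (D : set R[i]) (f : R[i] -> R[i]) :=
  forall k, Ck k D f.

Definition mxCk (R : realType) m n (k : nat) (D : set R[i])
    (A : R[i] -> 'M[R[i]]_(m, n)) :=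
  forall i j, Ck k D (fun z => A z i j).
Definition mxsmooth (R : realType) m n (D : set R[i])
    (A : R[i] -> 'M[R[i]]_(m, n)) :=
  forall k, mxCk k D A.

(* The differential of A is mxdz A dz + mxdzbar A dzbar; matrix-valued 1-forms
   are manipulated through their dz- and dzbar-coefficients. *)
Definition mxdz (R : realType) m n (A : R[i] -> 'M[R[i]]_(m, n)) (z : R[i]) :
    'M[R[i]]_(m, n) :=
  \matrix_(i, j) dz (fun w => A w i j) z.
Definition mxdzbar (R : realType) m n (A : R[i] -> 'M[R[i]]_(m, n)) (z : R[i]) :
    'M[R[i]]_(m, n) :=
  \matrix_(i, j) dzbar (fun w => A w i j) z.

Definition holomorphic (R : realType) (D : set R[i]) (f : R[i] -> R[i]) :=
  forall z, D z -> derivable f z 1.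

Definition vec4 (R : realType) (a b c d : R[i]) : 'cV[R[i]]_4 :=
  \col_k [:: a; b; c; d]`_k.

Definition quat_mul (R : realType) (p q : 'cV[R[i]]_4) : 'cV[R[i]]_4 :=
  vec4
    (p 0 0 * q 0 0 - p 1 0 * q 1 0 - p 2 0 * q 2 0 - p 3 0 * q 3 0)
    (p 0 0 * q 1 0 + p 1 0 * q 0 0 + p 2 0 * q 3 0 - p 3 0 * q 2 0)
    (p 0 0 * q 2 0 - p 1 0 * q 3 0 + p 2 0 * q 0 0 + p 3 0 * q 1 0)
    (p 0 0 * q 3 0 + p 1 0 * q 2 0 - p 2 0 * q 1 0 + p 3 0 * q 0 0).

Definition Lmul (R : realType) (p : 'cV[R[i]]_4) : 'M[R[i]]_4 :=
  \matrix_(k, l) quat_mul p (delta_mx l 0) k 0.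
Definition Rmul (R : realType) (p : 'cV[R[i]]_4) : 'M[R[i]]_4 :=
  \matrix_(k, l) quat_mul (delta_mx l 0) p k 0.

Definition Li (R : realType) : 'M[R[i]]_4 := Lmul (vec4 0 1 0 0).
Definition Lj (R : realType) : 'M[R[i]]_4 := Lmul (vec4 0 0 1 0).
Definition Ri (R : realType) : 'M[R[i]]_4 := Rmul (vec4 0 1 0 0).
Definition Rj (R : realType) : 'M[R[i]]_4 := Rmul (vec4 0 0 1 0).
Definition Rk (R : realType) : 'M[R[i]]_4 := Rmul (vec4 0 0 0 1).
Arguments Li {R}.
Arguments Lj {R}.
Arguments Ri {R}.
Arguments Rj {R}.
Arguments Rk {R}.

Definition eps (R : realType) : 'cV[R[i]]_4 := 2^-1 *: vec4 1 0 (- 'i%C) 0.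
Definition epsbar (R : realType) : 'cV[R[i]]_4 := 2^-1 *: vec4 1 0 'i%C 0.
Arguments eps {R}.
Arguments epsbar {R}.

Definition expmx (R : realType) (A : 'M[R[i]]_4) : 'M[R[i]]_4 :=
  limn (series (fun k : nat => (k`!%:R)^-1 *: A ^+ k)).

Definition G0_of (R : realType) (q1 q2 q3 q4 : R[i]) : 'M[R[i]]_4 :=
  q1%:M - q2 *: Ri - q3 *: Rj - q4 *: Rk.

(* Real matrices are regarded as complex matrices throughout, so that the real
   groups are subsets of their complexifications. *)
Definition G0 (R : realType) : set 'M[R[i]]_4 :=
  [set A | exists q1 q2 q3 q4 : R,
     q1 ^+ 2 + q2 ^+ 2 + q3 ^+ 2 + q4 ^+ 2 = 1 /\
     A = G0_of q1%:C q2%:C q3%:C q4%:C].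
Definition G2 (R : realType) : set 'M[R[i]]_4 :=
  [set A | exists theta : R, A = expmx (theta%:C *: Li)].
Definition Gvec (R : realType) : set 'M[R[i]]_4 :=
  [set A | exists B C, [/\ G0 B, G2 C & A = B *m C]].

Definition G0C (R : realType) : set 'M[R[i]]_4 :=
  [set A | exists q1 q2 q3 q4 : R[i],
     q1 ^+ 2 + q2 ^+ 2 + q3 ^+ 2 + q4 ^+ 2 = 1 /\ A = G0_of q1 q2 q3 q4].
Definition G2C (R : realType) : set 'M[R[i]]_4 :=
  [set A | exists theta : R[i], A = expmx (theta *: Li)].
Definition GvecC (R : realType) : set 'M[R[i]]_4 :=
  [set A | exists B C, [/\ G0C B, G2C C & A = B *m C]].

(* (G, T) as a 5 x 5 matrix, and the tangent vector (eta, t) at the identity. *)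
Definition aff (R : realType) (G : 'M[R[i]]_4) (T : 'cV[R[i]]_4) :
    'M[R[i]]_(4 + 1) :=
  block_mx G T 0 1%:M.
Definition lie (R : realType) (eta : 'M[R[i]]_4) (t : 'cV[R[i]]_4) :
    'M[R[i]]_(4 + 1) :=
  block_mx eta t 0 0.

Definition Grp (R : realType) : set 'M[R[i]]_(4 + 1) :=
  [set A | exists G (T : 'cV[R]_4),
     Gvec G /\ A = aff G (map_mx (real_complex R) T)].
Definition GrpC (R : realType) : set 'M[R[i]]_(4 + 1) :=
  [set A | exists G T, GvecC G /\ A = aff G T].

Definition linpart (R : realType) (A : 'M[R[i]]_(4 + 1)) : 'M[R[i]]_4 :=
  ulsubmx A.
Definition trpart (R : realType) (A : 'M[R[i]]_(4 + 1)) : 'cV[R[i]]_4 :=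
  ursubmx A.

Definition tau (R : realType) (A : 'M[R[i]]_(4 + 1)) : 'M[R[i]]_(4 + 1) :=
  aff (- (Lj *m linpart A *m Lj)) (- (Lj *m trpart A)).

(* g_k is the i^k-eigenspace of (eta, t) |-> (- Lj eta Lj, - Lj t). *)
Definition g_m1 (R : realType) : set 'M[R[i]]_(4 + 1) :=
  [set A | exists a b, A = lie 0 (a *: eps + b *: (Li *m epsbar))].
Definition g_0 (R : realType) : set 'M[R[i]]_(4 + 1) :=
  [set A | exists a b c, A = lie (a *: Ri + b *: Rj + c *: Rk) 0].
Definition g_1 (R : realType) : set 'M[R[i]]_(4 + 1) :=
  [set A | exists a b, A = lie 0 (a *: epsbar + b *: (Li *m eps))].
Definition g_2 (R : realType) : set 'M[R[i]]_(4 + 1) :=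
  [set A | exists a, A = lie (a *: Li) 0].

(* The four subspaces are independent, so the components are determined by A. *)
Definition components (R : realType) (A Am1 A0 A1 A2 : 'M[R[i]]_(4 + 1)) :=
  [/\ g_m1 Am1, g_0 A0, g_1 A1, g_2 A2 & A = Am1 + A0 + A1 + A2].

Definition LCLI (R : realType) (D : set R[i]) (z0 : R[i])
    (U : R[i] -> 'M[R[i]]_(4 + 1)) :=
  [/\ mxsmooth D U, forall z, D z -> Grp (U z), U z0 = aff 1%:M 0 &
      exists (K : R[i] -> 'M[R[i]]_4) (f : R[i] -> R),
        [/\ mxsmooth D K, forall z, D z -> G0 (K z),
            smooth D (fun z => (f z)%:C) &
            forall z, D z ->
              invmx (linpart (U z)) *m mxdz (fun w => trpart (U w)) z
                = (expR (f z))%:C *: (K z *m eps) /\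
              invmx (linpart (U z)) *m mxdzbar (fun w => trpart (U w)) z
                = (expR (f z))%:C *: (K z *m epsbar)]].

Definition lagrangian_angle (R : realType) (D : set R[i]) (z0 : R[i])
    (U : R[i] -> 'M[R[i]]_(4 + 1)) (beta : R[i] -> R) :=
  [/\ smooth D (fun z => (beta z)%:C), beta z0 = 0 &
      exists M0 : R[i] -> 'M[R[i]]_4,
        [/\ mxsmooth D M0, forall z, D z -> G0 (M0 z) &
            forall z, D z ->
              linpart (U z) = expmx ((beta z / 2)%:C *: Li) *m M0 z]].

Definition hamiltonian_stationary (R : realType) (D : set R[i])
    (beta : R[i] -> R) :=
  forall z, D z -> laplacian (fun w => (beta w)%:C) z = 0.

Definition S1 (R : realType) : set R[i] := [set l | `|l| = 1].
Arguments S1 {R}.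

(* p and q are the dz- and dzbar-coefficients of alpha = U^-1 dU. *)
Definition extended_lift (R : realType) (D : set R[i]) (z0 : R[i])
    (U : R[i] -> 'M[R[i]]_(4 + 1)) (Ul : R[i] -> R[i] -> 'M[R[i]]_(4 + 1)) :=
  exists pm1 p0 p1 p2 qm1 q0 q1 q2 : R[i] -> 'M[R[i]]_(4 + 1),
    (forall z, D z ->
       components (invmx (U z) *m mxdz U z) (pm1 z) (p0 z) (p1 z) (p2 z) /\
       components (invmx (U z) *m mxdzbar U z) (qm1 z) (q0 z) (q1 z) (q2 z)) /\
    (forall l, S1 l ->
       [/\ mxCk 1 D (Ul l), Ul l z0 = 1%:M &
           forall z, D z ->
             mxdz (Ul l) z
               = Ul l z *m (l ^- 2 *: p2 z + l^-1 *: pm1 z + p0 z) /\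
             mxdzbar (Ul l) z
               = Ul l z *m (q0 z + l *: q1 z + l ^+ 2 *: q2 z)]).

(* Loops are represented by functions on C, of which only the restriction to S1
   matters. *)
Definition cis (R : realType) (t : R) : R[i] := cos t +i* sin t.

Definition fourier (R : realType) (g : R[i] -> R[i]) (n : int) : R[i] :=
  ((2 * pi)^-1)%:C *
  ((\int[lebesgue_measure]_(t in `[0, 2 * pi])
      complex.Re (g (cis t) * cis t ^ (- n))) +i*
   (\int[lebesgue_measure]_(t in `[0, 2 * pi])
      complex.Im (g (cis t) * cis t ^ (- n)))).

(* For s > 1/2 an element of H^s(S1) is continuous, and it is the pointwise sum
   of its (absolutely convergent) Fourier series. *)
Definition Hs (R : realType) (s : R) (g : R[i] -> R[i]) :=
  (\esum_(n in [set: int])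
     ((1 + n%:~R ^+ 2) `^ s * (complex.Re `|fourier g n|) ^+ 2)%:E < +oo)%E /\
  forall l, S1 l ->
    (fun N : nat => \sum_(k < N) fourier g k%:Z * l ^ k%:Z
       + \sum_(k < N) fourier g (- k.+1%:Z) * l ^ (- k.+1%:Z)) @ \oo --> g l.

Definition loopG_tau (R : realType) (s : R)
    (g : R[i] -> 'M[R[i]]_(4 + 1)) :=
  [/\ forall i j, Hs s (fun l => g l i j), forall l, S1 l -> Grp (g l) &
      forall l, S1 l -> g ('i%C * l) = tau (g l)].

Definition loopGC_tau (R : realType) (s : R)
    (g : R[i] -> 'M[R[i]]_(4 + 1)) :=
  [/\ forall i j, Hs s (fun l => g l i j), forall l, S1 l -> GrpC (g l) &
      forall l, S1 l -> g ('i%C * l) = tau (g l)].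

Definition holomorphic_on_disk (R : realType)
    (W : R[i] -> 'M[R[i]]_(4 + 1)) :=
  [/\ forall w, `|w| <= 1 -> GrpC (W w),
      forall i j, {within [set w | `|w| <= 1], continuous (fun w => W w i j)} &
      forall i j, holomorphic [set w | `|w| < 1] (fun w => W w i j)].

Definition loop_plus (R : realType) (s : R) (g : R[i] -> 'M[R[i]]_(4 + 1)) :=
  loopGC_tau s g /\
  exists W, holomorphic_on_disk W /\ forall l, S1 l -> g l = W l.

(* The exterior of the disk, infinity included, is parametrized by w = 1 / l. *)
Definition loop_minus_star (R : realType) (s : R)
    (g : R[i] -> 'M[R[i]]_(4 + 1)) :=
  loopGC_tau s g /\
  exists W, [/\ holomorphic_on_disk W, W 0 = 1%:M &
                forall l, S1 l -> g l = W l^-1].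

Definition birkhoff (R : realType) (s : R)
    (g gm gp : R[i] -> 'M[R[i]]_(4 + 1)) :=
  [/\ loop_minus_star s gm, loop_plus s gp &
      forall l, S1 l -> g l = gm l *m gp l].

Definition Qminus (R : realType) (V : R[i] -> 'cV[R[i]]_4) (l : R[i]) :
    'cV[R[i]]_4 :=
  \col_i limn (fun N : nat => \sum_(k < N)
    fourier (fun m => V m i 0) (- k.+1%:Z) * l ^ (- k.+1%:Z)).
Definition Qplus (R : realType) (V : R[i] -> 'cV[R[i]]_4) (l : R[i]) :
    'cV[R[i]]_4 :=
  \col_i limn (fun N : nat => \sum_(k < N)
    fourier (fun m => V m i 0) k.+1%:Z * l ^ k.+1%:Z).

Definition is_gamma (R : realType) (D : set R[i]) (z0 : R[i])
    (beta gamma : R[i] -> R) :=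
  [/\ Ck 1 D (fun z => (gamma z)%:C), gamma z0 = 0 &
      forall z, D z ->
        dz (fun w => 2^-1 * (beta w +i* gamma w)) z
          = dz (fun w => (beta w)%:C) z /\
        dzbar (fun w => 2^-1 * (beta w +i* gamma w)) z = 0].

Definition Epos (R : realType) (beta gamma : R[i] -> R) (l z : R[i]) :
    'M[R[i]]_4 :=
  expmx ((l ^- 2 / 4 * (beta z +i* gamma z)) *: Li).
Definition Eneg (R : realType) (beta gamma : R[i] -> R) (l z : R[i]) :
    'M[R[i]]_4 :=
  expmx ((- (l ^- 2 / 4 * (beta z +i* gamma z))) *: Li).

Definition Uminus (R : realType) (beta gamma : R[i] -> R)
    (Ul : R[i] -> R[i] -> 'M[R[i]]_(4 + 1)) (l z : R[i]) :
    'M[R[i]]_(4 + 1) :=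
  aff (Epos beta gamma l z)
      (Epos beta gamma l z *m
         Qminus (fun m => Eneg beta gamma m z *m trpart (Ul m z)) l).
Definition Uplus (R : realType) (beta gamma : R[i] -> R)
    (Ul : R[i] -> R[i] -> 'M[R[i]]_(4 + 1)) (l z : R[i]) :
    'M[R[i]]_(4 + 1) :=
  aff (Eneg beta gamma l z *m linpart (Ul l z))
      (Qplus (fun m => Eneg beta gamma m z *m trpart (Ul m z)) l).

(* Main.v *)
Require Import Defs.
From HB Require Import structures.
From mathcomp Require Import all_boot all_order all_algebra.
From mathcomp Require Import all_classical all_reals all_analysis.
From mathcomp Require Import complex.
From mathcomp Require Import ring lra zify.
Import Order.TTheory GRing.Theory Num.Theory.
Import numFieldNormedType.Exports.

Set Implicit Arguments.
Unset Strict Implicit.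
Unset Printing Implicit Defensive.

Local Open Scope classical_set_scope.
Local Open Scope ring_scope.
Local Open Scope complex_scope.


(** Let [c = (beta + i gamma) / 4], so that [dc = (dbeta/dz) dz / 2], and let [E] be the
    exponential of [c l^-2 Li]; this is the linear part of [Uminus].

    Linear part. The linear part of [U^-1 dU] is [M0^-1 dM0 + dbeta Li / 2], where the
    first summand belongs to [g_0] and the second one to [g_2]. In the extended lift only
    the second one depends on [l], so [F_l M0^-1] solves an equation in the direction of
    the single matrix [Li] and is the exponential of [(c l^-2 + conj c l^2) Li]
    ([frame_formula]). Hence [E^-1 F_l] is the product of [M0] and of the exponential of
    [conj c l^2 Li], which is entire in [l], while [E] is entire in [l^-1].

    Translation part. The loop [Y = E^-1 X_l] is twisted, and at frequency zero the
    twisting forces its Fourier coefficient to vanish. Hence [Y] is the sum of its two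
    projections, and moving the negative one to the left factor gives the factorization
    ([birkhoff_factors]). All loops remain in [H^s], since the weights of [H^s] grow by a
    bounded factor under a shift ([hsc_expmul]); and [s > 1 / 2] makes the Fourier
    coefficients summable, so that the series converge up to the circle ([ps_diskfun]).

    Uniqueness. Two factorizations differ by a loop that extends holomorphically inside
    and outside the circle; such a loop is constant ([birkhoff_unique]). This form of the
    Liouville theorem ([disk_liouville]) comes from the mean value property, hence from
    Goursat's theorem.

    Existence of [gamma]. Locally [gamma] is twice an argument of an eigenvalue of
    [F_l M0^-1], for [l^2] equal to the imaginary unit. That [F_l M0^-1] is the exponential of
    [Re (l^-2 (beta + i g)) Li / 2] for some real number [g] and all [l] is a condition
    that persists along paths, and it determines [g]; so the global loop [F_l M0^-1]
    makes the local choices fit together ([conjugate_exists]).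

    The form [mu]. Along an eigenvector of [Li] the translation part reduces to a scalar
    function [x]. With [e] equal to the eigenvalue times [c], [h = exp (- e l^-2) x] satisfies
    [dh = (- e' l^-2 h + l^-1 m1 + ...) dz + (l m2 + ...) dzbar], where the dots stand for
    higher powers of [l]. The negative Fourier coefficients [h_n] thus form a closed
    system, [dh_n = - e' h_(n+2) dz] with the additional term [A dz] for [n = -1], where
    [A = m1 - e' h_1]; here [h_0 = 0] is used. When the negative part of [h] is multiplied
    by [exp (e l^-2)] the differential telescopes to [l^-1 exp (e l^-2) A dz]
    ([dressing_d]), so [A] is the component of the translation part of [mu]. It is
    holomorphic because [m1] and [e' h_1] have the same [dzbar]-derivative [e' m2]
    ([Adz_holomorphic]). For [m1] this is the symmetry of the second derivatives of [X],
    projected to an eigenspace of [Lj] ([mm1_d]), and [e'] is holomorphic since [beta] is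
    harmonic. *)

(** * The real-valued modulus and limits of complex functions *)

Section ComplexNorm.
Variable R : realType.
Implicit Types (z w : R[i]) (e : R).

(** The modulus as a real number; the norm of [R[i]] has its values in [R[i]]. *)
Definition cmod z : R := Num.sqrt (complex.Re z ^+ 2 + complex.Im z ^+ 2).

Lemma normE z : `|z| = (cmod z)%:C.
Proof. by rewrite normc_def. Qed.

Lemma cmodE z : cmod z = complex.Re `|z|.
Proof. by rewrite normE. Qed.

Lemma realc_inj : injective (real_complex R).
Proof. by move=> x y []. Qed.

Lemma cmod_ge0 z : 0 <= cmod z.
Proof. exact: sqrtr_ge0. Qed.

Lemma cmodM z w : cmod (z * w) = cmod z * cmod w.
Proof. by apply: realc_inj; rewrite -normE normrM !normE rmorphM. Qed.

Lemma cmodD z w : cmod (z + w) <= cmod z + cmod w.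
Proof. by rewrite -lecR rmorphD /= -!normE ler_normD. Qed.

Lemma cmodN z : cmod (- z) = cmod z.
Proof. by rewrite !cmodE normrN. Qed.

Lemma cmodB z w : cmod (z - w) <= cmod z + cmod w.
Proof. by rewrite -(cmodN w) cmodD. Qed.

Lemma cmodC z w : cmod (z - w) = cmod (w - z).
Proof. by rewrite -cmodN opprB. Qed.

Lemma cmod0 : cmod 0 = 0.
Proof. by rewrite cmodE normr0. Qed.

Lemma cmod1 : cmod 1 = 1.
Proof. by rewrite cmodE normr1. Qed.

Lemma cmodi : cmod 'i%C = 1.
Proof. by rewrite /cmod /= expr0n add0r expr1n sqrtr1. Qed.

Lemma cmod_eq0 z : (cmod z == 0) = (z == 0).
Proof. by rewrite -(inj_eq realc_inj) -normE normr_eq0. Qed.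

Lemma cmodX z n : cmod (z ^+ n) = cmod z ^+ n.
Proof. by apply: realc_inj; rewrite -normE normrX normE rmorphXn. Qed.

Lemma cmodV z : cmod z^-1 = (cmod z)^-1.
Proof. by apply: realc_inj; rewrite -normE normfV normE fmorphV. Qed.

Lemma cmod_real e : cmod e%:C = `|e|.
Proof. by rewrite /cmod /= expr0n addr0 sqrtr_sqr. Qed.

Lemma cmod_conj z : cmod z^*%C = cmod z.
Proof. by rewrite !cmodE normcJ. Qed.

Lemma ler_Re_cmod z : `|complex.Re z| <= cmod z.
Proof. by rewrite -lecR -normE normc_ge_Re. Qed.

Lemma ler_Im_cmod z : `|complex.Im z| <= cmod z.
Proof.
by rewrite -(sqrtr_sqr (complex.Im z)) ler_wsqrtr // lerDr sqr_ge0.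
Qed.

Lemma cmod_le_ReIm z : cmod z <= `|complex.Re z| + `|complex.Im z|.
Proof.
case: z => x y; rewrite (_ : x +i* y = x%:C + 'i%C * y%:C); last first.
  by apply/eqP; rewrite eq_complex /=; apply/andP; split; apply/eqP; ring.
apply: le_trans (cmodD _ _) _; rewrite cmodM cmodi mul1r !cmod_real /=.
by rewrite !(mul0r, mul1r, mulr0, addr0, add0r, subr0, oppr0).
Qed.

Lemma cmod_sqr z : (cmod z ^+ 2)%:C = z * z^*%C.
Proof. by rewrite -sqr_normc normE rmorphXn. Qed.

Lemma cmod_sum (I : Type) (r : seq I) (P : pred I) (F : I -> R[i]) :
  cmod (\sum_(i <- r | P i) F i) <= \sum_(i <- r | P i) cmod (F i).
Proof.
elim/big_rec2: _ => [|i x y _ le_yx]; first by rewrite cmod0.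
by apply: le_trans (cmodD _ _) _; rewrite lerD2l.
Qed.

Lemma cReM z w :
  complex.Re (z * w) = complex.Re z * complex.Re w - complex.Im z * complex.Im w.
Proof. by case: z w => ? ? []. Qed.

Lemma cImM z w :
  complex.Im (z * w) = complex.Re z * complex.Im w + complex.Im z * complex.Re w.
Proof. by case: z w => ? ? []. Qed.

Lemma cReD z w : complex.Re (z + w) = complex.Re z + complex.Re w.
Proof. exact: raddfD. Qed.

Lemma cImD z w : complex.Im (z + w) = complex.Im z + complex.Im w.
Proof. exact: raddfD. Qed.

Lemma complexK z : complex.Re z +i* complex.Im z = z.
Proof. by case: z. Qed.

Lemma complex_posP (eps : R[i]) : 0 < eps -> exists2 e : R, 0 < e & eps = e%:C.
Proof.
case: eps => a b; rewrite ltcE /= => /andP[/eqP b0 a0].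
by exists a => //; rewrite b0.
Qed.

Section Limits.
Context {T : Type} {F : set_system T} {FF : Filter F}.

Lemma cvgCP (f : T -> R[i]) l :
  f @ F --> l <-> forall e, 0 < e -> \forall x \near F, cmod (f x - l) < e.
Proof.
split=> [/cvgrPdist_lt fl e e0|fl].
  have /fl : 0 < e%:C by rewrite ltcR.
  by apply: filterS => x; rewrite normE ltcR cmodC.
apply/cvgrPdist_lt => eps /complex_posP[e e0 ->].
by apply: filterS (fl e e0) => x; rewrite normE ltcR cmodC.
Qed.

Lemma cvg_Re (f : T -> R[i]) l :
  f @ F --> l -> complex.Re (f x) @[x --> F] --> complex.Re l.
Proof.
move=> /cvgCP fl; apply/cvgrPdist_lt => e e0.
apply: filterS (fl e e0) => x; rewrite distrC; apply: le_lt_trans.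
by rewrite -raddfB ler_Re_cmod.
Qed.

Lemma cvg_Im (f : T -> R[i]) l :
  f @ F --> l -> complex.Im (f x) @[x --> F] --> complex.Im l.
Proof.
move=> /cvgCP fl; apply/cvgrPdist_lt => e e0.
apply: filterS (fl e e0) => x; rewrite distrC; apply: le_lt_trans.
by rewrite -raddfB ler_Im_cmod.
Qed.

Lemma cvg_complex (u v : T -> R) a b :
  u @ F --> a -> v @ F --> b -> (u x +i* v x) @[x --> F] --> (a +i* b).
Proof.
move=> /cvgrPdist_lt ua /cvgrPdist_lt vb; apply/cvgCP => e e0.
have e20 : 0 < e / 2 by rewrite divr_gt0.
apply: filterS2 (ua _ e20) (vb _ e20) => x uax vbx.
apply: le_lt_trans (cmod_le_ReIm _) _ => /=.
by rewrite -opprB normrN -(opprB b) normrN (splitr e) ltrD.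
Qed.

Lemma cvg_realc (u : T -> R) (a : R) : u @ F --> a -> (u x)%:C @[x --> F] --> a%:C.
Proof. by move=> ua; apply: (@cvg_complex u (fun=> 0)) => //; exact: cvg_cst. Qed.

Lemma cvg_cmod (f : T -> R[i]) l :
  f @ F --> l -> cmod (f x) @[x --> F] --> cmod l.
Proof.
move=> /cvgCP fl; apply/cvgrPdist_lt => e e0.
apply: filterS (fl e e0) => x; apply: le_lt_trans.
rewrite ler_norml; apply/andP; split.
  by rewrite lerNl opprB lerBlDr -{1}(subrK l (f x)) cmodD.
by rewrite lerBlDr cmodC -{1}(subrK (f x) l) cmodD.
Qed.

Lemma cvg_conjc (f : T -> R[i]) l :
  f @ F --> l -> ((f x)^*)%C @[x --> F] --> (l^*)%C.
Proof.
move=> /cvgCP fl; apply/cvgCP => e /fl; apply: filterS => x.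
by rewrite -rmorphB /= cmod_conj.
Qed.

End Limits.

Lemma cvgC_unique {T : Type} {F : set_system T} {FF : ProperFilter F}
  (f : T -> R[i]) (a b : R[i]) : f @ F --> a -> f @ F --> b -> a = b.
Proof. by move=> fa fb; apply: (cvg_unique _ fa fb). Qed.

Lemma limnC (u : nat -> R[i]) l : u @ \oo --> l -> limn u = l.
Proof. by move=> ul; apply/cvg_lim. Qed.

End ComplexNorm.

(** * Complex functions of a real variable *)

Section RealVariable.
Variable R : realType.
Implicit Types (f g : R -> R[i]) (t : R).

(** The real and the imaginary part are differentiated separately, as in [pderivable]. *)
Definition rder f t (d : R[i]) :=
  is_derive t 1 (fun x => complex.Re (f x)) (complex.Re d) /\
  is_derive t 1 (fun x => complex.Im (f x)) (complex.Im d).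

Lemma rder_eq f t a b : rder f t a -> a = b -> rder f t b.
Proof. by move=> + <-. Qed.

Lemma rder_cst c t : rder (fun=> c) t 0.
Proof. by split; exact: is_derive_cst. Qed.

Lemma rderD f g t a b : rder f t a -> rder g t b ->
  rder (fun x => f x + g x) t (a + b).
Proof.
move=> [? ?] [? ?]; split; rewrite raddfD.
  rewrite (_ : (fun x => _) = (fun x => complex.Re (f x)) \+ (fun x => complex.Re (g x))).
    exact: is_deriveD.
  by apply/funext => x; rewrite raddfD.
rewrite (_ : (fun x => _) = (fun x => complex.Im (f x)) \+ (fun x => complex.Im (g x))).
  exact: is_deriveD.
by apply/funext => x; rewrite raddfD.
Qed.

Lemma rderN f t a : rder f t a -> rder (fun x => - f x) t (- a).
Proof.
move=> [? ?]; split; rewrite raddfN.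
  rewrite (_ : (fun x => _) = - (fun x => complex.Re (f x))).
    exact: is_deriveN.
  by apply/funext => x; rewrite raddfN.
rewrite (_ : (fun x => _) = - (fun x => complex.Im (f x))).
  exact: is_deriveN.
by apply/funext => x; rewrite raddfN.
Qed.

Lemma rderB f g t a b : rder f t a -> rder g t b ->
  rder (fun x => f x - g x) t (a - b).
Proof. by move=> fa gb; apply: rderD => //; apply: rderN. Qed.

Lemma rderM f g t a b : rder f t a -> rder g t b ->
  rder (fun x => f x * g x) t (a * g t + f t * b).
Proof.
move=> [fr fi] [gr gi]; split.
  rewrite (_ : (fun x => _) =
    (fun x => complex.Re (f x)) * (fun x => complex.Re (g x))
    - (fun x => complex.Im (f x)) * (fun x => complex.Im (g x))); last first.
    by apply/funext => x; rewrite cReM.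
  apply: (is_derive_eq (is_deriveB (is_deriveM fr gr) (is_deriveM fi gi))).
  by rewrite /GRing.scale /= cReD !cReM; ring.
rewrite (_ : (fun x => _) =
  (fun x => complex.Re (f x)) * (fun x => complex.Im (g x))
  + (fun x => complex.Im (f x)) * (fun x => complex.Re (g x))); last first.
  by apply/funext => x; rewrite cImM.
apply: (is_derive_eq (is_deriveD (is_deriveM fr gi) (is_deriveM fi gr))).
by rewrite /GRing.scale /= cImD !cImM; ring.
Qed.

Lemma rderZ c f t a : rder f t a -> rder (fun x => c * f x) t (c * a).
Proof.
by move=> fa; have := rderM (rder_cst c t) fa; rewrite mul0r add0r.
Qed.

Lemma rder_conj f t a : rder f t a -> rder (fun x => (f x)^*%C) t (a^*%C).
Proof.
move=> [fr fi]; split.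
  rewrite (_ : (fun x => _) = (fun x => complex.Re (f x))).
    by case: a fr fi.
  by apply/funext => x; case: (f x).
rewrite (_ : (fun x => _) = - (fun x => complex.Im (f x))).
  by case: a fr fi => ? ? ? ? /=; exact: is_deriveN.
by apply/funext => x; rewrite /GRing.opp /=; case: (f x).
Qed.

Lemma rder_sum (I : Type) (r : seq I) (P : pred I) (F : I -> R -> R[i]) (d : I -> R[i]) t :
  (forall i, P i -> rder (F i) t (d i)) ->
  rder (fun x => \sum_(i <- r | P i) F i x) t (\sum_(i <- r | P i) d i).
Proof.
move=> Fd; elim: r => [|i r IH].
  rewrite big_nil (_ : (fun x => _) = fun=> 0); first exact: rder_cst.
  by apply/funext => x; rewrite big_nil.
rewrite big_cons (_ : (fun x => _) =
  fun x => if P i then F i x + \sum_(j <- r | P j) F j x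
           else \sum_(j <- r | P j) F j x); last first.
  by apply/funext => x; rewrite big_cons.
by case: ifPn => [/Fd Pi|//]; exact: rderD.
Qed.

Lemma rder_real (u : R -> R) t (d : R) :
  is_derive t 1 u d -> rder (fun x => (u x)%:C) t d%:C.
Proof. by move=> ud; split => //=; exact: is_derive_cst. Qed.

Lemma rder_id t : rder (fun x => x%:C) t 1.
Proof. exact: (@rder_real id). Qed.

Lemma rder_comp f (u : R -> R) t a (b : R) :
  rder f (u t) a -> is_derive t 1 u b -> rder (f \o u) t (a * b%:C).
Proof.
move=> [fr fi] ub; split.
  have -> : complex.Re (a * b%:C) = complex.Re a * b.
    by case: a {fr fi} => ? ? /=; ring.
  exact: (is_derive1_comp fr).
have -> : complex.Im (a * b%:C) = complex.Im a * b.
  by case: a {fr fi} => ? ? /=; ring.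
exact: (is_derive1_comp fi).
Qed.

Lemma rder_near f g t a : (\forall x \near t, f x = g x) ->
  rder f t a -> rder g t a.
Proof.
move=> fg [fr fi]; split.
  by apply: near_eq_is_derive fr; apply: filterS fg => x ->.
by apply: near_eq_is_derive fi; apply: filterS fg => x ->.
Qed.

Lemma rder_continuous f t a : rder f t a -> {for t, continuous f}.
Proof.
move=> [[fr _] [fi _]].
have cr : {for t, continuous (fun x => complex.Re (f x))}.
  exact/differentiable_continuous/derivable1_diffP.
have ci : {for t, continuous (fun x => complex.Im (f x))}.
  exact/differentiable_continuous/derivable1_diffP.
have := @cvg_complex _ _ (nbhs t) _ _ _ _ _ cr ci.
under [X in X @ _ --> _]eq_fun do rewrite complexK.
by rewrite complexK; apply; exact: nbhs_filter.
Qed.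

Lemma rder_slope f t d :
  (h^-1%:C * (f (h + t) - f t)) @[h --> 0^'] --> d -> rder f t d.
Proof.
move=> der.
have dr : complex.Re (h^-1%:C * (f (h + t) - f t)) @[h --> 0^'] --> complex.Re d.
  exact: cvg_Re.
have di : complex.Im (h^-1%:C * (f (h + t) - f t)) @[h --> 0^'] --> complex.Im d.
  exact: cvg_Im.
have {}dr : h^-1 *: (((fun x : R => complex.Re (f x)) \o shift t) h%:A -
   complex.Re (f t)) @[h --> 0^'] --> complex.Re d.
  apply: cvg_trans dr; apply: near_eq_cvg; near=> h.
  by rewrite /GRing.scale /= mulr1 cReM /= mul0r subr0 raddfB.
have {}di : h^-1 *: (((fun x : R => complex.Im (f x)) \o shift t) h%:A -
   complex.Im (f t)) @[h --> 0^'] --> complex.Im d.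
  apply: cvg_trans di; apply: near_eq_cvg; near=> h.
  by rewrite /GRing.scale /= mulr1 cImM /= mul0r addr0 raddfB.
split; apply: DeriveDef.
- by apply/cvg_ex; exists (complex.Re d).
- exact/cvg_lim.
- by apply/cvg_ex; exists (complex.Im d).
- exact/cvg_lim.
Unshelve. all: by end_near. Qed.

(** Applying the mean value theorem to the real and to the imaginary part costs
    the constant 2. *)
Lemma rder_mvt f (d : R -> R[i]) (a b M : R) : a <= b ->
  (forall t, a <= t <= b -> rder f t (d t)) ->
  (forall t, a <= t <= b -> cmod (d t) <= M) ->
  cmod (f b - f a) <= 2 * M * (b - a).
Proof.
move=> ab fd dM.
have cf : {within `[a, b], continuous f}.
  apply: continuous_in_subspaceT => t; rewrite inE /= in_itv /= => tab.
  exact: rder_continuous (fd _ tab).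
have tab t : t \in `]a, b[%R -> a <= t <= b.
  by rewrite in_itv /= => /andP[? ?]; rewrite !ltW.
have [c c_ab rE] := @MVT_segment R _ (fun t => complex.Re (d t)) _ _ ab
   (fun t t_ab => (fd t (tab t t_ab)).1)
   (fun x => cvg_Re (cf x)).
have [c' c'_ab iE] := @MVT_segment R _ (fun t => complex.Im (d t)) _ _ ab
   (fun t t_ab => (fd t (tab t t_ab)).2)
   (fun x => cvg_Im (cf x)).
apply: le_trans (cmod_le_ReIm _) _; rewrite !raddfB /= rE iE !normrM.
have ba : `|b - a| = b - a by rewrite ger0_norm // subr_ge0.
rewrite ba -mulrDl ler_wpM2r ?subr_ge0 // mulr2n mulrDl mul1r lerD //.
  by apply: le_trans (ler_Re_cmod _) (dM _ _); move: c_ab; rewrite in_itv.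
by apply: le_trans (ler_Im_cmod _) (dM _ _); move: c'_ab; rewrite in_itv.
Qed.

Lemma rder0_cst f : (forall t, rder f t 0) -> forall s t, f s = f t.
Proof.
move=> f0 s t; apply/eqP; rewrite eq_complex; apply/andP; split; apply/eqP.
  exact: (@is_derive_0_is_cst _ (fun x => complex.Re (f x))) (fun x => (f0 x).1).
exact: (@is_derive_0_is_cst _ (fun x => complex.Im (f x))) (fun x => (f0 x).2).
Qed.

(** A locally constant function has derivative zero. This is the connectedness of the
    line, in the form in which it is applied along paths. *)
Lemma locally_constant_cst f :
  (forall t, \forall x \near t, f x = f t) -> forall s t, f s = f t.
Proof.
move=> fl; apply: rder0_cst => t; apply: (@rder_near (fun=> f t)).
  by apply: filterS (fl t).
exact: rder_cst.
Qed.

Lemma rder_mvt_sym f (d : R -> R[i]) (a b M : R) :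
  (forall t, `|t - a| <= `|b - a| -> rder f t (d t)) ->
  (forall t, `|t - a| <= `|b - a| -> cmod (d t) <= M) ->
  cmod (f b - f a) <= 2 * M * `|b - a|.
Proof.
move=> fd dM; have [ab|/ltW ba] := leP a b.
  have H t : a <= t <= b -> `|t - a| <= `|b - a|.
    by move=> /andP[at_ tb]; rewrite !ger0_norm ?subr_ge0 // lerD2r.
  rewrite [`|b - a|]ger0_norm ?subr_ge0 //.
  by apply: (@rder_mvt f d) => // t /H; [exact: fd|exact: dM].
have H t : b <= t <= a -> `|t - a| <= `|b - a|.
  by move=> /andP[bt ta]; rewrite !ler0_norm ?subr_le0 // lerN2 lerD2r.
rewrite cmodC [`|b - a|]ler0_norm ?subr_le0 // opprB.
by apply: (@rder_mvt f d) => // t /H; [exact: fd|exact: dM].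
Qed.

End RealVariable.

(** * Dominated series *)

Section DominatedSeries.
Variable R : realType.
Implicit Types (a : nat -> R[i]) (M : nat -> R).

Lemma cvg_le_bound {T : Type} {F : set_system T} {FF : ProperFilter F}
    (u : T -> R) (a b : R) :
  u @ F --> a -> (\forall x \near F, u x <= b) -> a <= b.
Proof.
move=> /cvgrPdist_lt ua ub; rewrite leNgt; apply/negP => ba.
have /ua ua' : 0 < a - b by rewrite subr_gt0.
have [x [ux]] := filter_ex (filterI ub ua').
by move=> /ltr_normlW; rewrite ltrD2l ltrN2 ltNge ux.
Qed.

Definition csum a : R[i] := limn (series a).

Definition majorized_by M a := cvgn (series M) /\ forall n, cmod (a n) <= M n.

Lemma dominated_cvg_series M a : majorized_by M a ->
  series a @ \oo --> csum a.
Proof.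
move=> [cM aM].
have part (p : R[i] -> R) : (forall z, `|p z| <= cmod z) ->
    cvgn (series (fun n => p (a n))).
  move=> pz; apply: normed_cvg; apply: series_le_cvg cM => n.
  - exact: normr_ge0.
  - exact: le_trans (cmod_ge0 _) (aM n).
  - exact: le_trans (pz _) (aM n).
have cr := part _ (@ler_Re_cmod R); have ci := part _ (@ler_Im_cmod R).
have /cvgP : (series a n @[n --> \oo] -->
    limn (series (fun n => complex.Re (a n))) +i* limn (series (fun n => complex.Im (a n)))).
  rewrite (_ : (fun n => _) = (fun n =>
    series (fun n => complex.Re (a n)) n +i* series (fun n => complex.Im (a n)) n)).
    exact: cvg_complex.
  apply/funext => n; apply/eqP; rewrite eq_complex /series /= !raddf_sum.
  by apply/andP; split; apply/eqP; apply: eq_bigr.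
exact.
Qed.

Lemma dominated_tail M a N : majorized_by M a ->
  cmod (csum a - series a N) <= limn (series M) - series M N.
Proof.
move=> [cM aM]; have M0 n : 0 <= M n by apply: le_trans (cmod_ge0 _) (aM n).
have ca := dominated_cvg_series (conj cM aM).
have ndM : nondecreasing_seq (series M).
  by apply: nondecreasing_series => n _ _; exact: M0.
have cl : cmod (series a n - series a N) @[n --> \oo] --> cmod (csum a - series a N).
  by apply: cvg_cmod; apply: cvgB ca _; exact: cvg_cst.
apply: (cvg_le_bound cl); near=> n.
have Nn : (N <= n)%N by near: n; exists N.
apply: (@le_trans _ _ (series M n - series M N)); last first.
  by rewrite lerD2r; exact: nondecreasing_cvgn_le.
rewrite !sub_series_geq //.
apply: le_trans (cmod_sum _ _ _) _.
by apply: ler_sum => k _; exact: aM.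
Unshelve. all: by end_near. Qed.

(** Tannery's theorem: the domination makes the tails uniformly small, and a partial sum
    is a finite sum of convergent functions. *)
Lemma tannery {T : Type} {F : set_system T} {FF : ProperFilter F}
    M (phi : nat -> T -> R[i]) a :
  cvgn (series M) -> (\forall x \near F, forall n, cmod (phi n x) <= M n) ->
  (forall n, phi n @ F --> a n) ->
  csum (phi ^~ x) @[x --> F] --> csum a.
Proof.
move=> cM phiM phia.
have aM : majorized_by M a.
  split=> // n; have ca : cmod (phi n x) @[x --> F] --> cmod (a n).
    exact: cvg_cmod.
  apply: (cvg_le_bound ca).
  by apply: filterS phiM => x; apply.
apply/cvgCP => e e0.
have e30 : 0 < e / 3 by rewrite divr_gt0.
have [N _ /(_ N (leqnn _)) Ne] :
    \forall n \near \oo, `|limn (series M) - series M n| < e / 3.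
  by move/cvgrPdist_lt : cM; apply.
have tl : limn (series M) - series M N < e / 3 by apply: le_lt_trans Ne; exact: ler_norm.
have /cvgCP/(_ _ e30) fin : series (phi ^~ x) N @[x --> F] --> series a N.
  rewrite /series /=.
  by apply: cvg_big => //; exact: add_continuous.
apply: filterS2 phiM fin => x phiM fin.
rewrite (_ : csum (phi ^~ x) - csum a = (csum (phi ^~ x) - series (phi ^~ x) N)
   + (series (phi ^~ x) N - series a N) - (csum a - series a N)); last by ring.
apply: le_lt_trans (cmodB _ _) _; rewrite (_ : e = e / 3 + e / 3 + e / 3); last by field.
apply: ltrD; last by apply: le_lt_trans tl; exact: dominated_tail.
apply: le_lt_trans (cmodD _ _) _; apply: ltrD => //.
by apply: le_lt_trans tl; exact: dominated_tail.
Qed.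

Lemma eq_csum a b : a =1 b -> csum a = csum b.
Proof. by move=> /funext ->. Qed.

Lemma csumE a S : series a @ \oo --> S -> csum a = S.
Proof. exact: limnC. Qed.

Lemma csumZ M c a : majorized_by M a -> csum (fun n => c * a n) = c * csum a.
Proof.
move=> /dominated_cvg_series ca; apply: csumE.
rewrite (_ : series _ = (fun n => c * series a n)); first exact: cvgMr ca.
by apply/funext => n; rewrite /series /= mulr_sumr.
Qed.

End DominatedSeries.

(** * Differential calculus in the plane *)

Section PlaneCalculus.
Variable R : realType.
Implicit Types (f g : R[i] -> R[i]) (z w v : R[i]) (D : set R[i]).

Lemma nearCP (P : R[i] -> Prop) z :
  (\forall w \near z, P w) <->
  exists2 e : R, 0 < e & forall w, cmod (w - z) < e -> P w.
Proof.
split=> [/nbhs_ballP[eps /complex_posP[e e0 ->] eP]|[e e0 eP]].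
  exists e => // w we; apply: eP.
  by rewrite /ball /= /ball_ /= normE ltcR cmodC.
apply/nbhs_ballP; exists e%:C; first by rewrite /= ltcR.
by move=> w; rewrite /ball /= /ball_ /= normE ltcR cmodC; exact: eP.
Qed.

Lemma openCP D z : open D -> D z ->
  exists2 e : R, 0 < e & forall w, cmod (w - z) < e -> D w.
Proof. by move=> oD Dz; apply/nearCP; exact: open_nbhs_nbhs. Qed.

Lemma near_line z v (P : R[i] -> Prop) (t0 : R) :
  (\forall w \near z + t0%:C * v, P w) -> \forall t \near t0, P (z + t%:C * v).
Proof.
move=> zP; have : (z + t%:C * v) @[t --> t0] --> z + t0%:C * v.
  by apply: cvgD; [exact: cvg_cst|apply: cvgM; [exact: cvg_realc|exact: cvg_cst]].
by move=> /(_ _ zP).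
Qed.

Definition pd v f z d := rder (fun t : R => f (z + t%:C * v)) 0 d.

Lemma pd_pderive v f z d : pd v f z d -> pderivable v f z /\ pderive v f z = d.
Proof.
move=> [[rd rE] [id iE]]; split; first by split.
by rewrite /pderive !derive1E rE iE complexK.
Qed.

Lemma pderivable_pd v f z : pderivable v f z -> pd v f z (pderive v f z).
Proof.
by move=> [rd id]; split; rewrite /pderive /= derive1E; exact: derivableP.
Qed.

Lemma pd_line v f z (t0 : R) d : pd v f (z + t0%:C * v) d ->
  rder (fun t : R => f (z + t%:C * v)) t0 d.
Proof.
rewrite /pd => fd; have sh : is_derive t0 1 (fun t : R => t - t0) 1.
  rewrite -[X in is_derive _ _ _ X](subr0 1).
  exact: (is_deriveB (is_derive_id _ _) (is_derive_cst _ _ _)).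
have := @rder_comp _ (fun t : R => f (z + t0%:C * v + t%:C * v)) _ t0 d 1.
move=> /(_ (fun t => t - t0)); rewrite subrr => /(_ fd sh).
rewrite mulr1; congr rder; apply/funext => t /=; congr f.
by rewrite rmorphB /=; ring.
Qed.

(** The differential of [f] at [z] is [a dz + b dzbar], in the weak sense that the two
    partial derivatives exist and have the values that this prescribes. Under continuity
    of the coefficients, [C1_frechet] turns this into a true differential. *)
Definition has_d f z (a b : R[i]) :=
  pd 1 f z (a + b) /\ pd 'i%C f z ('i%C * (a - b)).

Lemma sqri : 'i%C * 'i%C = -1 :> R[i].
Proof. by rewrite -expr2 sqr_i. Qed.

Lemma conjc_i : ('i%C)^*%C = - 'i%C :> R[i].
Proof. by apply/eqP; rewrite eq_complex /= oppr0 !eqxx. Qed.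

Lemma conjcM z w : conjc (z * w) = conjc z * conjc w.
Proof. exact: rmorphM. Qed.

Lemma conjcD z w : conjc (z + w) = conjc z + conjc w.
Proof. exact: rmorphD. Qed.

Lemma conjcB z w : conjc (z - w) = conjc z - conjc w.
Proof. exact: rmorphB. Qed.

Lemma has_dE f z a b : has_d f z a b ->
  [/\ dz f z = a, dzbar f z = b, dx f z = a + b & dy f z = 'i%C * (a - b)].
Proof.
move=> [/pd_pderive[_ fx] /pd_pderive[_ fy]].
rewrite /dz /dzbar /dx /dy fx fy; split=> //.
  by rewrite mulrA sqri; field.
by rewrite mulrA sqri; field.
Qed.

Lemma has_dP f z : pderivable 1 f z -> pderivable 'i%C f z ->
  has_d f z (dz f z) (dzbar f z).
Proof.
move=> /pderivable_pd fx /pderivable_pd fy; split.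
  by apply: (rder_eq fx); rewrite /dz /dzbar /dx; field.
apply: (rder_eq fy); rewrite /dz /dzbar -/(dy f z); set a := dx f z.
rewrite -mulrBr (_ : _ - (a + _) = - (2 * ('i%C * dy f z))); last by ring.
by rewrite mulrN (mulrA 2^-1) mulVf ?pnatr_eq0 // mul1r mulrN mulrA sqri; ring.
Qed.

Lemma has_d_pderivable f z a b : has_d f z a b ->
  pderivable 1 f z /\ pderivable 'i%C f z.
Proof. by move=> [/pd_pderive[? _] /pd_pderive[? _]]. Qed.

Lemma has_d_eq f z a b a' b' : has_d f z a b -> a = a' -> b = b' -> has_d f z a' b'.
Proof. by move=> + <- <-. Qed.

Lemma has_d_unique f z a b a' b' : has_d f z a b -> has_d f z a' b' ->
  a = a' /\ b = b'.
Proof. by move=> /has_dE[<- <- _ _] /has_dE[<- <- _ _]. Qed.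

Lemma has_d_cst c z : has_d (fun=> c) z 0 0.
Proof. by split; rewrite ?subr0 ?addr0 ?mulr0; exact: rder_cst. Qed.

Lemma has_dD f g z a b a' b' : has_d f z a b -> has_d g z a' b' ->
  has_d (fun w => f w + g w) z (a + a') (b + b').
Proof.
move=> [fx fy] [gx gy]; split.
  by apply: (rder_eq (rderD fx gx)); ring.
by apply: (rder_eq (rderD fy gy)); ring.
Qed.

Lemma has_dN f z a b : has_d f z a b -> has_d (fun w => - f w) z (- a) (- b).
Proof.
move=> [fx fy]; split.
  by apply: (rder_eq (rderN fx)); ring.
by apply: (rder_eq (rderN fy)); ring.
Qed.

Lemma has_dB f g z a b a' b' : has_d f z a b -> has_d g z a' b' ->
  has_d (fun w => f w - g w) z (a - a') (b - b').
Proof. by move=> fd gd; apply: has_dD => //; exact: has_dN. Qed.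

Lemma has_dM f g z a b a' b' : has_d f z a b -> has_d g z a' b' ->
  has_d (fun w => f w * g w) z (a * g z + f z * a') (b * g z + f z * b').
Proof.
move=> [fx fy] [gx gy]; have z0 v : z + 0%:C * v = z by rewrite mul0r addr0.
split.
  by apply: (rder_eq (rderM fx gx)); rewrite !z0; ring.
by apply: (rder_eq (rderM fy gy)); rewrite !z0; ring.
Qed.

Lemma has_dZ c f z a b : has_d f z a b ->
  has_d (fun w => c * f w) z (c * a) (c * b).
Proof.
by move=> fd; apply: (has_d_eq (has_dM (has_d_cst c z) fd)); ring.
Qed.

Lemma has_d_conj f z a b : has_d f z a b ->
  has_d (fun w => (f w)^*%C) z (b^*%C) (a^*%C).
Proof.
move=> [fx fy]; split.
  by apply: (rder_eq (rder_conj fx)); rewrite conjcD addrC.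
apply: (rder_eq (rder_conj fy)); rewrite conjcM conjcB conjc_i; ring.
Qed.

Lemma has_d_sum (I : Type) (r : seq I) (P : pred I) (F : I -> R[i] -> R[i])
    (a b : I -> R[i]) z :
  (forall i, P i -> has_d (F i) z (a i) (b i)) ->
  has_d (fun w => \sum_(i <- r | P i) F i w) z
    (\sum_(i <- r | P i) a i) (\sum_(i <- r | P i) b i).
Proof.
move=> Fd; split.
  rewrite -big_split /=; apply: (@rder_sum _ _ _ _ (fun i t => F i (z + t%:C * 1))) => i Pi.
  exact: (Fd i Pi).1.
rewrite -sumrB mulr_sumr.
apply: (@rder_sum _ _ _ _ (fun i t => F i (z + t%:C * 'i%C))) => i Pi.
exact: (Fd i Pi).2.
Qed.

Lemma has_d_near f g z a b : (\forall w \near z, f w = g w) ->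
  has_d f z a b -> has_d g z a b.
Proof.
move=> fg [fx fy]; split.
  by apply: (rder_near _ fx); apply: (@near_line _ _ (fun w => f w = g w)); rewrite mul0r addr0.
by apply: (rder_near _ fy); apply: (@near_line _ _ (fun w => f w = g w)); rewrite mul0r addr0.
Qed.

Lemma has_d_in f g D z a b : open D -> D z -> (forall w, D w -> f w = g w) ->
  has_d f z a b -> has_d g z a b.
Proof.
move=> oD Dz fg; apply: has_d_near.
by apply: filterS (open_nbhs_nbhs (conj oD Dz)).
Qed.

Definition C1_d D f (a b : R[i] -> R[i]) :=
  [/\ forall z, D z -> has_d f z (a z) (b z),
      forall z, D z -> {for z, continuous a} &
      forall z, D z -> {for z, continuous b}].

Lemma ctsCP f z : {for z, continuous f} <->
  forall e : R, 0 < e -> \forall w \near z, cmod (f w - f z) < e.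
Proof. exact: (@cvgCP _ _ (nbhs z) (nbhs_filter z)). Qed.

Lemma cts_cst c z : {for z, continuous (fun=> c : R[i])}.
Proof. exact: cst_continuous. Qed.

Lemma ctsD f g z : {for z, continuous f} -> {for z, continuous g} ->
  {for z, continuous (fun w => f w + g w)}.
Proof. by move=> cf cg; exact: cvgD cf cg. Qed.

Lemma ctsB f g z : {for z, continuous f} -> {for z, continuous g} ->
  {for z, continuous (fun w => f w - g w)}.
Proof. by move=> cf cg; exact: cvgB cf cg. Qed.

Lemma ctsM f g z : {for z, continuous f} -> {for z, continuous g} ->
  {for z, continuous (fun w => f w * g w)}.
Proof. by move=> cf cg; exact: cvgM cf cg. Qed.

Lemma ctsZ (c : R[i]) f z : {for z, continuous f} -> {for z, continuous (fun w => c * f w)}.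
Proof. by move=> cf; exact: (@ctsM (fun=> c) f z (@cts_cst c z) cf). Qed.

Lemma cts_conj f z : {for z, continuous f} -> {for z, continuous (fun w => (f w)^*%C)}.
Proof. by move=> cf; exact: cvg_conjc cf. Qed.

Lemma cts_sum (I : Type) (r : seq I) (P : pred I) (F : I -> R[i] -> R[i]) z :
  (forall i, P i -> {for z, continuous (F i)}) ->
  {for z, continuous (fun w => \sum_(i <- r | P i) F i w)}.
Proof.
by move=> cF; apply: cvg_big cF; exact: add_continuous.
Qed.

Lemma near_continuous f g z : (\forall w \near z, f w = g w) ->
  {for z, continuous f} -> {for z, continuous g}.
Proof.
move=> fg /ctsCP cf; apply/ctsCP => e /cf; rewrite (nbhs_singleton fg).
by apply: (@filterS2 _ _ (nbhs_filter z) _ _ _ _ fg) => w ->.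
Qed.

Lemma continuous_in f g D z : open D -> D z -> (forall w, D w -> f w = g w) ->
  {for z, continuous f} -> {for z, continuous g}.
Proof.
move=> oD Dz fg; apply: near_continuous.
by apply: filterS (open_nbhs_nbhs (conj oD Dz)).
Qed.

Lemma C1_d_Ck D f a b : open D -> C1_d D f a b -> Ck 1 D f.
Proof.
move=> oD [fd ca cb]; split=> /= [z Dz|z Dz|z Dz].
- exact: has_d_pderivable (fd z Dz).
- apply: (@continuous_in (fun w => a w + b w) _ D) => //.
    by move=> w /fd/has_dE[].
  exact: cvgD (ca z Dz) (cb z Dz).
- apply: (@continuous_in (fun w => 'i%C * (a w - b w)) _ D) => //.
    by move=> w /fd/has_dE[].
  by apply/ctsZ/ctsB; [exact: ca|exact: cb].
Qed.

Lemma Ck_C1_d D f : Ck 1 D f -> C1_d D f (dz f) (dzbar f).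
Proof.
move=> [fd cx cy]; split=> z Dz.
- by have [] := fd z Dz; exact: has_dP.
- by apply/ctsZ/ctsB; [exact: cx|apply/ctsZ; exact: cy].
- by apply/ctsZ/ctsD; [exact: cx|apply/ctsZ; exact: cy].
Qed.

(** The increment is split into a horizontal and a vertical step, and the mean value
    inequality is applied to each of them. *)
Lemma C1_frechet D f a b z (e : R) : open D -> C1_d D f a b -> D z -> 0 < e ->
  \forall w \near z,
    cmod (f w - f z - (a z * (w - z) + b z * (w - z)^*%C)) <= e * cmod (w - z).
Proof.
move=> oD [fd ca cb] Dz e0.
have e40 : 0 < e / 8 by rewrite divr_gt0.
have [d1 d10 D1] := openCP oD Dz.
have /nearCP[d2 d20 D2] : \forall w \near z, cmod (a w - a z) < e / 8.
  exact: (ctsCP _ _).1 (ca z Dz) _ e40.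
have /nearCP[d3 d30 D3] : \forall w \near z, cmod (b w - b z) < e / 8.
  exact: (ctsCP _ _).1 (cb z Dz) _ e40.
pose d := Num.min d1 (Num.min d2 d3) / 2.
have d0 : 0 < d by rewrite divr_gt0 // !lt_min d10 d20.
apply/nearCP; exists d => // w.
set h := w - z; set x := complex.Re h; set y := complex.Im h => hd.
have hE : h = x%:C + y%:C * 'i%C by rewrite /x /y [LHS]complexE mulrC.
have near_pt (s t : R) : `|s| <= `|x| -> `|t| <= `|y| ->
  [/\ D (z + s%:C + t%:C * 'i%C), cmod (a (z + s%:C + t%:C * 'i%C) - a z) <= e / 8
    & cmod (b (z + s%:C + t%:C * 'i%C) - b z) <= e / 8].
  move=> sx ty; have : cmod (z + s%:C + t%:C * 'i%C - z) < d * 2.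
    rewrite (_ : z + _ + _ - z = s%:C + t%:C * 'i%C); last by ring.
    apply: le_lt_trans (cmodD _ _) _; rewrite cmodM cmodi mulr1 !cmod_real.
    rewrite mulr2n mulrDr mulr1 ltrD //.
      by apply: le_lt_trans sx _; apply: le_lt_trans hd; exact: ler_Re_cmod.
    by apply: le_lt_trans ty _; apply: le_lt_trans hd; exact: ler_Im_cmod.
  rewrite /d divfK // !lt_min => /and3P[h1 h2 h3].
  by split; [exact: D1|exact: ltW (D2 _ h2)|exact: ltW (D3 _ h3)].
have hor : cmod (f (z + x%:C) - f z - x%:C * (a z + b z)) <= e / 2 * cmod h.
  pose g (t : R) := f (z + t%:C * 1) - t%:C * (a z + b z).
  have -> : f (z + x%:C) - f z - x%:C * (a z + b z) = g x - g 0.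
    by rewrite /g mul0r mulr1 addr0 mul0r subr0 addrAC.
  apply: (@le_trans _ _ (2 * (e / 4) * `|x - 0|)).
    apply: (@rder_mvt_sym _ g (fun t => (a (z + t%:C * 1) + b (z + t%:C * 1))
        - (a z + b z))) => t; rewrite !subr0 => tx.
      apply: rderB; first by apply: pd_line; apply: (fd _ _).1;
        have [] := near_pt t 0 tx; rewrite ?normr0 // mul0r addr0 mulr1.
      by apply: (rder_eq (rderM (rder_id t) (rder_cst _ t))); ring.
    have [] := near_pt t 0 tx; rewrite ?normr0 // mul0r addr0 mulr1 => _ ha hb.
    rewrite opprD addrACA; apply: le_trans (cmodD _ _) _.
    by apply: le_trans (lerD ha hb) _; rewrite -mulrDr ?le_eqVlt; lra.
  rewrite subr0 (_ : 2 * (e / 4) = e / 2); last by field.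
  by apply: ler_wpM2l; [rewrite divr_ge0 ?ltW|exact: ler_Re_cmod].
have ver : cmod (f w - f (z + x%:C) - y%:C * ('i%C * (a z - b z))) <= e / 2 * cmod h.
  pose g (t : R) := f (z + x%:C + t%:C * 'i%C) - t%:C * ('i%C * (a z - b z)).
  have -> : f w - f (z + x%:C) - y%:C * ('i%C * (a z - b z)) = g y - g 0.
    rewrite /g !mul0r addr0 subr0 addrAC (_ : w = z + x%:C + y%:C * 'i%C) //.
    by rewrite -addrA -hE /h; ring.
  apply: (@le_trans _ _ (2 * (e / 4) * `|y - 0|)).
    apply: (@rder_mvt_sym _ g (fun t => 'i%C * (a (z + x%:C + t%:C * 'i%C)
        - b (z + x%:C + t%:C * 'i%C)) - 'i%C * (a z - b z))) => t; rewrite !subr0 => ty.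
      apply: rderB; first by apply: pd_line; apply: (fd _ _).2;
        have [] := near_pt x t (lexx _) ty.
      by apply: (rder_eq (rderM (rder_id t) (rder_cst _ t))); ring.
    have [_ ha hb] := near_pt x t (lexx _) ty.
    rewrite -mulrBr cmodM cmodi mul1r.
    rewrite (_ : _ - _ = (a (z + x%:C + t%:C * 'i%C) - a z) -
      (b (z + x%:C + t%:C * 'i%C) - b z)); last by ring.
    apply: le_trans (cmodB _ _) _.
    by apply: le_trans (lerD ha hb) _; rewrite -mulrDr ?le_eqVlt; lra.
  rewrite subr0 (_ : 2 * (e / 4) = e / 2); last by field.
  by apply: ler_wpM2l; [rewrite divr_ge0 ?ltW|exact: ler_Im_cmod].
have -> : f w - f z - (a z * h + b z * h^*%C) =
    (f (z + x%:C) - f z - x%:C * (a z + b z))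
    + (f w - f (z + x%:C) - y%:C * ('i%C * (a z - b z))).
  rewrite hE conjcD conjcM conjc_i !conjc_real; ring.
apply: le_trans (cmodD _ _) _; apply: le_trans (lerD hor ver) _.
by rewrite -mulrDl -splitr.
Qed.

Lemma C1_continuous D f a b z : open D -> C1_d D f a b -> D z ->
  {for z, continuous f}.
Proof.
move=> oD fd Dz; apply/ctsCP => e e0.
have /nearCP[d d0 dP] := C1_frechet oD fd Dz (@ltr01 R).
pose M := 1 + cmod (a z) + cmod (b z).
have M0 : 0 < M by rewrite /M -addrA ltr_pwDl // addr_ge0 ?cmod_ge0.
apply/nearCP; exists (Num.min d (e / M)); first by rewrite lt_min d0 divr_gt0.
move=> w; rewrite lt_min ltr_pdivlMr // => /andP[/dP wd we].
rewrite mul1r in wd; apply: le_lt_trans we; rewrite mulrC.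
rewrite -(subrK (a z * (w - z) + b z * (w - z)^*%C) (f w - f z)).
apply: le_trans (cmodD _ _) _.
rewrite /M -(addrA 1) mulrDl; apply: lerD; first by rewrite mul1r.
by apply: le_trans (cmodD _ _) _; rewrite !cmodM cmod_conj mulrDl.
Qed.

(** For [b = 0] the estimate of [C1_frechet] is complex differentiability. *)
Lemma C1_holomorphic D f a : open D -> C1_d D f a (fun=> 0) -> holomorphic D f.
Proof.
move=> oD fd z Dz; apply/cvg_ex; exists (a z); apply/cvgCP => e e0.
have e20 : 0 < e / 2 by rewrite divr_gt0.
have /nearCP[d d0 dP] := C1_frechet oD fd Dz e20.
apply/nbhs_ballP; exists d%:C; first by rewrite /= ltcR.
move=> h; rewrite /ball /= /ball_ /= normE ltcR add0r cmodN => hd h0.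
have := dP (z + h); rewrite addrAC subrr add0r => /(_ hd).
rewrite mul0r addr0 => le1; rewrite /GRing.scale /= mulr1 (addrC h).
have hn0 : 0 < cmod h by rewrite lt_def cmod_eq0 h0 cmod_ge0.
rewrite (_ : _ - a z = h^-1 * (f (z + h) - f z - a z * h)); last by field.
rewrite cmodM cmodV mulrC ltr_pdivrMr //; apply: le_lt_trans le1 _.
by rewrite ltr_pM2r // ltr_pdivrMr // ltr_pMr // ltr1n.
Qed.

(** By [C1_frechet] the two partial derivatives determine the derivative in every
    direction. *)
Lemma C1_line D f a b z v (t0 : R) : open D -> C1_d D f a b -> D (z + t0%:C * v) ->
  rder (fun t : R => f (z + t%:C * v)) t0
    (a (z + t0%:C * v) * v + b (z + t0%:C * v) * v^*%C).
Proof.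
move=> oD fd Dz; set w := z + _ in Dz *; set d := _ + _.
apply: rder_slope; rewrite -/w.
apply/cvgCP => e e0; have V0 : 0 < cmod v + 1 by rewrite ltr_wpDl ?cmod_ge0.
have e20 : 0 < e / (cmod v + 1) by rewrite divr_gt0.
have /nearCP[r r0 rP] := C1_frechet oD fd Dz e20.
exists (r / (cmod v + 1)); first by rewrite /= divr_gt0.
move=> h; rewrite /= sub0r normrN ltr_pdivlMr // => hr h0.
have hv : cmod (h%:C * v) <= `|h| * (cmod v + 1).
  by rewrite cmodM cmod_real ler_wpM2l // lerDl.
have := rP (w + h%:C * v); rewrite addrAC subrr add0r => /(_ (le_lt_trans hv hr)) le1.
have -> : z + (h + t0)%:C * v = w + h%:C * v by rewrite /w rmorphD /=; ring.
have hC0 : h%:C != 0 :> R[i] by rewrite -(inj_eq (@realc_inj R)) in h0.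
have -> : h^-1%:C = (h%:C)^-1 :> R[i] by rewrite fmorphV.
rewrite (_ : _ - d = (h%:C)^-1 * (f (w + h%:C * v) - f w -
  (a w * (h%:C * v) + b w * (h%:C * v)^*%C))); last first.
  by rewrite conjcM conjc_real /d; field.
have h_gt0 : 0 < `|h| by rewrite normr_gt0.
rewrite cmodM cmodV cmod_real mulrC ltr_pdivrMr //.
apply: le_lt_trans le1 _; rewrite (cmodM h%:C) cmod_real mulrCA mulrC ltr_pM2r //.
by rewrite mulrAC ltr_pdivrMr // ltr_pM2l // ltrDl.
Qed.

Lemma C1_mvt D f a b z w M : open D -> C1_d D f a b ->
  (forall u, cmod (u - z) <= cmod (w - z) -> D u /\ cmod (a u) + cmod (b u) <= M) ->
  cmod (f w - f z) <= 2 * M * cmod (w - z).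
Proof.
move=> oD fd H; set v := w - z.
have seg (t : R) : 0 <= t <= 1 -> cmod (z + t%:C * v - z) <= cmod (w - z).
  move=> /andP[t0 t1]; rewrite addrAC subrr add0r cmodM cmod_real ger0_norm //.
  by rewrite ler_piMl ?cmod_ge0.
have := @rder_mvt _ (fun t : R => f (z + t%:C * v)) (fun t =>
   a (z + t%:C * v) * v + b (z + t%:C * v) * v^*%C) 0 1 (M * cmod v) ler01.
rewrite mul0r addr0 mul1r (_ : z + v = w); last by rewrite /v addrC subrK.
rewrite subr0 mulr1 mulrA; apply=> t /seg/H[Dt Mt].
  exact: C1_line oD fd Dt.
apply: le_trans (cmodD _ _) _; rewrite !cmodM cmod_conj -mulrDl.
by rewrite ler_wpM2r ?cmod_ge0.
Qed.

Lemma C1_d0_locally_constant D f z : open D ->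
  (forall z, D z -> has_d f z 0 0) -> D z -> \forall w \near z, f w = f z.
Proof.
move=> oD f0 Dz; have fd : C1_d D f (fun=> 0) (fun=> 0).
  by split=> [w Dw|w _|w _]; [exact: f0|exact: cts_cst|exact: cts_cst].
have [e e0 eD] := openCP oD Dz; apply/nearCP; exists e => // w we.
have := @C1_mvt D f _ _ z w 0 oD fd; rewrite cmod0 addr0 mulr0 mul0r.
move=> H; apply/eqP; rewrite -subr_eq0 -cmod_eq0 eq_le cmod_ge0 andbT.
by apply: H => u /le_lt_trans/(_ we)/eD.
Qed.

(** The second difference of [f] is the increment between [0] and [h] of a function
    whose derivative is a first difference of [g]; this one is compared with the
    differential of [g]. *)
Lemma second_difference D f g a b z v v' (e : R) : open D -> D z ->
  cmod v = 1 -> cmod v' = 1 ->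
  (forall w, D w -> pd v f w (g w)) -> C1_d D g a b -> 0 < e ->
  exists2 d : R, 0 < d & forall h : R, 0 < h < d ->
    cmod (f (z + h%:C * v + h%:C * v') - f (z + h%:C * v) - f (z + h%:C * v') + f z
       - h%:C ^+ 2 * (a z * v' + b z * v'^*%C)) <= 6 * e * h ^+ 2.
Proof.
move=> oD Dz v1 v'1 fg gd e0.
have /nearCP[d1 d10 d1P] := C1_frechet oD gd Dz e0.
have [d2 d20 d2D] := openCP oD Dz.
exists (Num.min d1 d2 / 2); first by rewrite divr_gt0 // lt_min d10 d20.
move=> h; rewrite ltr_pdivlMr // lt_min => /andP[h0 /andP[hd1 hd2]].
set L := a z * v' + _.
have near_pt (t s : R) : 0 <= t <= h -> 0 <= s <= h ->
    cmod (z + t%:C * v + s%:C * v' - z) <= t + s.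
  move=> /andP[t0 th] /andP[s0 sh].
  rewrite (_ : _ - z = t%:C * v + s%:C * v'); last by ring.
  apply: le_trans (cmodD _ _) _.
  by rewrite !cmodM v1 v'1 !mulr1 !cmod_real !ger0_norm.
have hh : 0 <= h <= h by rewrite lexx ltW.
have near_D (t s : R) : 0 <= t <= h -> 0 <= s <= h ->
    D (z + t%:C * v + s%:C * v').
  move=> th sh; apply: d2D; apply: le_lt_trans (near_pt t s th sh) _.
  apply: le_lt_trans hd2; rewrite mulr2n mulrDr mulr1 lerD //.
    by case/andP: th. by case/andP: sh.
pose G (t : R) := f (z + h%:C * v' + t%:C * v) - f (z + t%:C * v) - t%:C * (h%:C * L).
have -> : f (z + h%:C * v + h%:C * v') - f (z + h%:C * v) - f (z + h%:C * v') + f z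
   - h%:C ^+ 2 * L = G h - G 0.
  by rewrite /G !mul0r !addr0 subr0 (addrAC z (h%:C * v')); ring.
apply: le_trans (@rder_mvt _ G (fun t => g (z + h%:C * v' + t%:C * v) -
   g (z + t%:C * v) - h%:C * L) 0 h (3 * e * h) (ltW h0) _ _) _.
- move=> t th; have h00 : 0 <= (0 : R) <= h by rewrite lexx ltW.
  apply: rderB.
    apply: rderB; apply: pd_line; apply: fg.
      by rewrite addrAC; exact: near_D.
    by rewrite -[X in D X]addr0 -(mul0r v'); exact: near_D.
  by apply: (rder_eq (rderM (rder_id t) (rder_cst _ t))); ring.
- move=> t th; have h00 : 0 <= (0 : R) <= h by rewrite lexx ltW.
  have tle := andP th.
  have dP (s : R) : 0 <= s <= h -> cmod (g (z + t%:C * v + s%:C * v') - g z -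
     (a z * (t%:C * v + s%:C * v') + b z * conjc (t%:C * v + s%:C * v'))) <= e * (t + s).
    move=> sh; have := d1P (z + t%:C * v + s%:C * v').
    rewrite (_ : _ + _ - z = t%:C * v + s%:C * v'); last by ring.
    have npt := near_pt t s th sh.
    rewrite (_ : _ + _ - z = t%:C * v + s%:C * v') in npt; last by ring.
    move=> H; apply: le_trans (H _) _.
      apply: le_lt_trans npt _; apply: le_lt_trans hd1.
      by rewrite mulr2n mulrDr mulr1 lerD //; [case/andP: th|case/andP: sh].
    by rewrite ler_pM2l.
  have H1 := dP h hh; have H2 := dP 0 h00; rewrite mul0r !addr0 in H2.
  rewrite (_ : _ - _ = (g (z + t%:C * v + h%:C * v') - g z -
     (a z * (t%:C * v + h%:C * v') + b z * conjc (t%:C * v + h%:C * v'))) -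
     (g (z + t%:C * v) - g z - (a z * (t%:C * v) + b z * conjc (t%:C * v)))); last first.
    rewrite (addrAC z (h%:C * v')) /L conjcD !conjcM !conjc_real; ring.
  apply: le_trans (cmodB _ _) _; apply: le_trans (lerD H1 H2) _.
  rewrite -mulrDr (_ : 3 * e * h = e * (3 * h)); last by ring.
  by apply: ler_wpM2l; [exact: ltW|case: tle => *; lra].
- by rewrite subr0; lra.
Qed.

(** The second difference is symmetric in the two directions, and both mixed derivatives
    are its limit. *)
Lemma mixed_partials D f z : open D -> Ck 2 D f -> D z ->
  dy (dx f) z = dx (dy f) z.
Proof.
move=> oD [fd cx cy] Dz.
have /Ck_C1_d xd := cx; have /Ck_C1_d yd := cy.
have [xd0 _ _] := xd; have [yd0 _ _] := yd.
have [_ _ _ ->] := has_dE (xd0 z Dz); have [_ _ -> _] := has_dE (yd0 z Dz).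
have alg (A B C F H i a b c d : R[i]) : (i * (a - b) - (c + d)) * H ^+ 2 =
    (A - B - C + F - H ^+ 2 * (c * 1 + d * 1)) - (A - C - B + F - H ^+ 2 * (a * i + b * - i)).
  by ring.
set p := 'i%C * _; set q := _ + _.
have pq (e : R) : 0 < e -> cmod (p - q) <= e.
  move=> e0; have e120 : 0 < e / 12 by rewrite divr_gt0.
  have [d1 d10 D1] := @second_difference D f (dx f) _ _ z 1 'i%C _ oD Dz (@cmod1 R)
    (@cmodi R) (fun w Dw => pderivable_pd (fd w Dw).1) xd e120.
  have [d2 d20 D2] := @second_difference D f (dy f) _ _ z 'i%C 1 _ oD Dz (@cmodi R)
    (@cmod1 R) (fun w Dw => pderivable_pd (fd w Dw).2) yd e120.
  pose h := Num.min d1 d2 / 2.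
  have m0 : 0 < Num.min d1 d2 by rewrite lt_min d10 d20.
  have hm : 0 < h < Num.min d1 d2.
    by rewrite /h divr_gt0 //= ltr_pdivrMr // ltr_pMr // ltr1n.
  have /andP[h0] := hm; rewrite lt_min => /andP[hd1 hd2].
  have := D1 h; have := D2 h; rewrite h0 hd1 hd2 => /(_ isT) H2 /(_ isT) H1.
  have hC0 : h%:C != 0 :> R[i] by rewrite (inj_eq (@realc_inj R)) gt_eqF.
  rewrite -(ler_pM2r (exprn_gt0 2 h0)) -(ger0_norm (exprn_ge0 2 (ltW h0))).
  rewrite -cmod_real -cmodM rmorphXn /=.
  clearbody h; move: H1 H2; rewrite conjc_i conjc1 (mulr1 h%:C).
  rewrite (addrAC z h%:C (h%:C * 'i%C)) => H1 H2.
  rewrite (alg (f (z + h%:C * 'i%C + h%:C)) (f (z + h%:C * 'i%C)) (f (z + h%:C)) (f z)).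
  apply: le_trans (cmodB _ _) _; apply: le_trans (lerD H2 H1) _.
  rewrite cmodX cmod_real gtr0_norm // -mulrDl.
  by apply: ler_wpM2r; [rewrite exprn_ge0 // ltW|lra].
apply/eqP; rewrite -subr_eq0 -cmod_eq0 eq_le cmod_ge0 andbT leNgt.
apply/negP => m0; have m20 : 0 < cmod (p - q) / 2 by rewrite divr_gt0.
have := pq _ m20; rewrite leNgt => /negP; apply.
by rewrite ltr_pdivrMr // ltr_pMr // ltr1n.
Qed.

Lemma dz_dzbar D f z : open D -> Ck 2 D f -> D z ->
  dzbar (dz f) z = dz (dzbar f) z /\ laplacian f z = 4 * dzbar (dz f) z.
Proof.
move=> oD f2 Dz; have := mixed_partials oD f2 Dz.
have [fd cx cy] := f2.
have [xd _ _] := Ck_C1_d cx; have [yd _ _] := Ck_C1_d cy.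
have hx := xd z Dz; have hy := yd z Dz.
have [_ _ xx xy] := has_dE hx; have [_ _ yx yy] := has_dE hy.
have [_ -> _ _] := has_dE (has_dZ 2^-1 (has_dB hx (has_dZ 'i%C hy))).
have [-> _ _ _] := has_dE (has_dZ 2^-1 (has_dD hx (has_dZ 'i%C hy))).
rewrite /laplacian xx xy yx yy.
set a1 := dz _ _; set b1 := dzbar _ _; set a2 := dz _ _; set b2 := dzbar _ _ => E.
have {E} -> : a1 = b1 - 'i%C * (a2 + b2).
  by rewrite -E mulrA sqri; ring.
split; first by congr (_ * _); ring.
by rewrite (_ : 4 * (_ * _) = 2 * (b1 - 'i%C * b2)); [ring|field].
Qed.

End PlaneCalculus.

(** * Functions along paths *)

Section Paths.
Variable R : realType.

Lemma within_comp {S T V : topologicalType} (A : set S) (c : T -> S) (p : S -> V) :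
  {within A, continuous p} -> continuous c -> (forall t, A (c t)) ->
  continuous (p \o c).
Proof.
move=> /subspace_continuousP cp cc Ac t U /(cp _ (Ac t)) /=.
move=> /(cc t); rewrite /= /nbhs /= => H.
by apply: filterS H => s; apply; exact: Ac.
Qed.

Definition clamp (t : R) : R := Num.max 0 (Num.min t 1).

Lemma clamp_itv t : 0 <= clamp t <= 1.
Proof. by rewrite /clamp le_max lexx /= ge_max ler01 ge_min lexx orbT. Qed.

Lemma clampE t : 0 <= t <= 1 -> clamp t = t.
Proof.
by move=> /andP[t0 t1]; rewrite /clamp; rewrite min_l // max_r.
Qed.

Lemma clamp_continuous : continuous clamp.
Proof.
move=> t; rewrite /clamp; apply: (@continuous_max R R (fun=> 0) (fun t => Num.min t 1)).
  exact: cst_continuous.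
by apply: (@continuous_min R R id (fun=> 1)); [exact: cvg_id|exact: cst_continuous].
Qed.

Lemma extend_path (p : R -> R[i]) : {within `[0, 1], continuous p} ->
  continuous (p \o clamp).
Proof.
move=> cp; apply: within_comp cp clamp_continuous _ => t.
by rewrite /= in_itv /= clamp_itv.
Qed.

(** The truth value of [f (p t) = f (p 0)] is a locally constant function of [t], once
    the path is extended by constants to the whole line. *)
Lemma path_constant (D : set R[i]) (T : Type) (f : R[i] -> T) (p : R -> R[i]) :
  {within `[0, 1], continuous p} -> (forall t, 0 <= t <= 1 -> D (p t)) ->
  (forall z, D z -> \forall w \near z, f w = f z) -> f (p 0) = f (p 1).
Proof.
move=> /extend_path cp Dp fl.
pose g (t : R) : R[i] := (`[< f (p (clamp t)) = f (p 0) >])%:R.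
have gl t : \forall s \near t, g s = g t.
  have := cp t _ (fl _ (Dp _ (clamp_itv t))).
  rewrite /nbhs /=; apply: (@filterS _ _ (nbhs_filter t)) => s /=.
  by rewrite /g => ->.
have := locally_constant_cst gl 0 1; rewrite /g !clampE ?lexx ?ler01 //.
rewrite asboolT // => /esym/eqP.
by case: asboolP => // _ /eqP /eqP; rewrite eq_sym oner_eq0.
Qed.

End Paths.

(** * The complex exponential *)

Section ComplexExponential.
Variable R : realType.
Implicit Types (z w : R[i]) (t : R).

Lemma cis0 : cis (0 : R) = 1.
Proof. by rewrite /cis cos0 sin0. Qed.

Lemma cisD (s t : R) : cis (s + t) = cis s * cis t.
Proof.
by apply/eqP; rewrite eq_complex /cis /= cosD sinD addrC eqxx /= addrC eqxx.
Qed.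

Lemma cisN t : cis (- t) = conjc (cis t).
Proof. by rewrite /cis cosN sinN. Qed.

Lemma cmod_cis t : cmod (cis t) = 1.
Proof. by rewrite /cmod /cis /= cos2Dsin2 sqrtr1. Qed.

Lemma S1_cis t : S1 (cis t).
Proof. by rewrite /S1 /= normE cmod_cis. Qed.

Lemma rder_cis (u : R -> R) t (d : R) : is_derive t 1 u d ->
  rder (fun x => cis (u x)) t (d%:C * ('i%C * cis (u t))).
Proof.
move=> ud; split; rewrite /cis !(cReM, cImM) /=.
  rewrite (_ : _ - _ = - sin (u t) * d); last by ring.
  exact: (is_derive1_comp (is_derive_cos (u t))).
rewrite (_ : _ + _ = cos (u t) * d); last by ring.
exact: (is_derive1_comp (is_derive_sin (u t))).
Qed.

Definition cexp z : R[i] := (expR (complex.Re z))%:C * cis (complex.Im z).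

Lemma cexp0 : cexp 0 = 1.
Proof. by rewrite /cexp /= expR0 cis0 mulr1. Qed.

Lemma cexpD z w : cexp (z + w) = cexp z * cexp w.
Proof. by rewrite /cexp cReD cImD expRD cisD rmorphM /= mulrACA. Qed.

Lemma cexpNK z : cexp z * cexp (- z) = 1.
Proof. by rewrite -cexpD subrr cexp0. Qed.

Lemma cmod_cexp z : cmod (cexp z) = expR (complex.Re z).
Proof. by rewrite /cexp cmodM cmod_cis mulr1 cmod_real ger0_norm // expR_ge0. Qed.

Lemma cmod_cexp_le z : cmod (cexp z) <= expR (cmod z).
Proof.
by rewrite cmod_cexp ler_expR; apply: le_trans (ler_Re_cmod z); exact: ler_norm.
Qed.

Lemma cexp_i t : cexp ('i%C * t%:C) = cis t.
Proof. by rewrite /cexp cReM cImM /= !(mul0r, mul1r, mulr0, subr0, addr0) expR0 mul1r add0r. Qed.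

Lemma rder_cexp (f : R -> R[i]) t d : rder f t d ->
  rder (fun x => cexp (f x)) t (d * cexp (f t)).
Proof.
move=> [fr fi]; have er := rder_real (is_derive1_comp (is_derive_expR _) fr).
apply: (rder_eq (rderM er (rder_cis fi))) => /=.
by rewrite /cexp [d in RHS]complexE rmorphM /=; ring.
Qed.

Lemma has_d_cexp (f : R[i] -> R[i]) z a b : has_d f z a b ->
  has_d (fun w => cexp (f w)) z (a * cexp (f z)) (b * cexp (f z)).
Proof.
move=> [fx fy]; have z0 v : z + 0%:C * v = z by rewrite mul0r addr0.
split; [apply: (rder_eq (rder_cexp fx))|apply: (rder_eq (rder_cexp fy))];
  by rewrite z0; ring.
Qed.

Definition cexp_coeff z (n : nat) : R[i] := z ^+ n / n`!%:R.

Lemma cmod_nat (n : nat) : cmod (n%:R : R[i]) = n%:R.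
Proof. by rewrite -(rmorph_nat (real_complex R)) cmod_real ger0_norm. Qed.

Lemma cmod_cexp_coeff z n : cmod (cexp_coeff z n) = exp_coeff (cmod z) n.
Proof. by rewrite /cexp_coeff cmodM cmodX cmodV cmod_nat /exp_coeff. Qed.

Lemma cexp_coeff_dominated z : majorized_by (exp_coeff (cmod z)) (cexp_coeff z).
Proof.
by split=> [|n]; [exact: is_cvg_series_exp_coeff|rewrite cmod_cexp_coeff].
Qed.

Lemma rderX (f : R -> R[i]) t d n : rder f t d ->
  rder (fun x => f x ^+ n.+1) t (n.+1%:R * d * f t ^+ n).
Proof.
move=> fd; elim: n => [|n IH].
  by rewrite mul1r expr0 mulr1; apply: (rder_eq fd).
rewrite (_ : (fun x => _) = fun x => f x * f x ^+ n.+1).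
  by apply: (rder_eq (rderM fd IH)); rewrite [f t ^+ n.+1]exprS -natr1; ring.
by apply/funext => x; rewrite exprS.
Qed.

(** The product of a partial sum of the series at [t z] with [exp (- t z)] has for
    derivative a single term of the series, so it is almost constant on the unit
    interval. *)
Lemma cexp_series z : series (cexp_coeff z) @ \oo --> cexp z.
Proof.
have alg (p q a b : R[i]) : p != 0 -> q != 0 -> p * a * b / (p * q) = a * (b / q).
  by move=> p0 q0; rewrite invfM; field; rewrite ?p0 ?q0.
pose S N (w : R[i]) := \sum_(k < N) cexp_coeff w k.
have SE N w : series (cexp_coeff w) N = S N w by rewrite /series /= big_mkord.
have dS N (t : R) : rder (fun t : R => S N.+1 (t%:C * z)) t (z * S N (t%:C * z)).
  rewrite /S mulr_sumr (_ : (fun t : R => _) = fun t : R =>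
     1 + \sum_(k < N) cexp_coeff (t%:C * z) k.+1); last first.
    by apply/funext => x; rewrite big_ord_recl /cexp_coeff expr0 fact0 divr1.
  rewrite -[X in rder _ _ X]add0r; apply: rderD; first exact: rder_cst.
  apply: (@rder_sum _ _ _ _ (fun (k : 'I_N) (t : R) => cexp_coeff (t%:C * z) k.+1)) => k _.
  have tz : rder (fun t : R => t%:C * z) t z.
    by apply: (rder_eq (rderM (rder_id t) (rder_cst z t))); ring.
  apply: (rder_eq (rderM (rderX k tz) (rder_cst _ t))).
  rewrite mulr0 addr0 factS natrM /cexp_coeff.
  have k0 : k.+1%:R != 0 :> R[i] by rewrite pnatr_eq0.
  have f0 : k`!%:R != 0 :> R[i] by rewrite pnatr_eq0 -lt0n fact_gt0.
  exact: alg.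
have close N : cmod (S N.+1 z * cexp (- z) - 1) <=
    2 * (cmod z * expR (cmod z)) * exp_coeff (cmod z) N.
  pose u (t : R) := S N.+1 (t%:C * z) * cexp (t%:C * (- z)).
  have u1 : u 1 = S N.+1 z * cexp (- z) by rewrite /u !mul1r.
  have u0 : u 0 = 1.
    rewrite /u !mul0r cexp0 mulr1 /S big_ord_recl /cexp_coeff expr0 fact0 divr1.
    by rewrite big1 ?addr0 // => i _; rewrite exprS mul0r mul0r.
  rewrite -u1 -[X in _ - X]u0.
  apply: le_trans (@rder_mvt _ u (fun t => - z * cexp_coeff (t%:C * z) N
     * cexp (t%:C * (- z))) 0 1 (cmod z * expR (cmod z) * exp_coeff (cmod z) N) _ _ _) _.
  - exact: ler01.
  - move=> t _; have tz : rder (fun t : R => t%:C * - z) t (- z).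
      by apply: (rder_eq (rderM (rder_id t) (rder_cst _ t))); ring.
    apply: (rder_eq (rderM (dS N t) (rder_cexp tz))).
    by rewrite /S big_ord_recr /=; ring.
  - move=> t /andP[t0 t1]; rewrite 2!cmodM cmodN cmod_cexp_coeff mulrAC.
    apply: ler_pM; rewrite ?mulr_ge0 ?cmod_ge0 ?exp_coeff_ge0 ?cmod_ge0 //.
      by rewrite exprn_ge0 ?cmod_ge0.
      apply: ler_wpM2l; first exact: cmod_ge0.
      apply: le_trans (cmod_cexp_le _) _; rewrite ler_expR cmodM cmodN cmod_real ger0_norm //.
      by rewrite ler_piMl ?cmod_ge0.
    rewrite /exp_coeff; apply: ler_wpM2r; first by rewrite invr_ge0 ler0n.
    rewrite lerXn2r ?nnegrE ?cmod_ge0 //.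
    by rewrite cmodM cmod_real ger0_norm // ler_piMl ?cmod_ge0.
  - by rewrite subr0 mulr1 mulrA.
have c0 : 2 * (cmod z * expR (cmod z)) * exp_coeff (cmod z) n @[n --> \oo] --> 0.
  rewrite -[X in _ --> X](mulr0 (2 * (cmod z * expR (cmod z)))).
  by apply: cvgM; [exact: cvg_cst|exact: cvg_exp_coeff].
have one : S n.+1 z * cexp (- z) @[n --> \oo] --> (1 : R[i]).
  apply/cvgCP => e e0; move/cvgrPdist_lt : c0 => /(_ e e0).
  apply: filterS => n; rewrite sub0r normrN => /(le_lt_trans (ler_norm _)).
  exact: le_lt_trans.
rewrite -cvg_shiftS; apply/cvgCP => e e0.
have e20 : 0 < e / expR (cmod z) by rewrite divr_gt0 ?expR_gt0.
have /cvgCP/(_ _ e20) := one; apply: filterS => n h /=; rewrite SE.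
rewrite (_ : _ - _ = (S n.+1 z * cexp (- z) - 1) * cexp z); last first.
  by rewrite mulrBl mul1r -mulrA (mulrC (cexp (- z))) cexpNK mulr1.
rewrite cmodM; move: h; rewrite ltr_pdivlMr ?expR_gt0 //; apply: le_lt_trans.
by apply: ler_wpM2l; [exact: cmod_ge0|exact: cmod_cexp_le].
Qed.

Lemma csum_cexp z : csum (cexp_coeff z) = cexp z.
Proof. by apply: csumE; exact: cexp_series. Qed.

Definition ccos z : R[i] := (cexp ('i%C * z) + cexp (- ('i%C * z))) / 2.
Definition csin z : R[i] := (cexp (- ('i%C * z)) - cexp ('i%C * z)) * 'i%C / 2.

End ComplexExponential.

(** * Quaternionic matrices *)

Section FourByFour.
Variable K : comNzRingType.
Implicit Types a b c d : K.

(** Explicit matrices over any commutative ring: the identities between them are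
    polynomial, and are checked entry by entry. *)
Definition mx4 (l : seq (seq K)) : 'M[K]_4 :=
  \matrix_(i < 4, j < 4) nth 0 (nth [::] l i) j.

Ltac mx4 := apply/matrixP; case=> [[|[|[|[|//]]]] ?]; case=> [[|[|[|[|//]]]] ?];
  rewrite !mxE /=; ring.
Ltac mulmx4 := apply/matrixP; case=> [[|[|[|[|//]]]] ?]; case=> [[|[|[|[|//]]]] ?];
  rewrite !mxE !big_ord_recl !big_ord0 !mxE /=; ring.

Definition li := mx4 [:: [:: 0; -1; 0; 0]; [:: 1; 0; 0; 0];
                         [:: 0; 0; 0; -1]; [:: 0; 0; 1; 0]].
Definition lj := mx4 [:: [:: 0; 0; -1; 0]; [:: 0; 0; 0; 1];
                         [:: 1; 0; 0; 0]; [:: 0; -1; 0; 0]].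
Definition ri := mx4 [:: [:: 0; -1; 0; 0]; [:: 1; 0; 0; 0];
                         [:: 0; 0; 0; 1]; [:: 0; 0; -1; 0]].
Definition rj := mx4 [:: [:: 0; 0; -1; 0]; [:: 0; 0; 0; -1];
                         [:: 1; 0; 0; 0]; [:: 0; 1; 0; 0]].
Definition rk := mx4 [:: [:: 0; 0; 0; -1]; [:: 0; 0; 1; 0];
                         [:: 0; -1; 0; 0]; [:: 1; 0; 0; 0]].
Definition g0 a b c d := mx4 [:: [:: a; b; c; d]; [:: - b; a; - d; c];
          [:: - c; d; a; - b]; [:: - d; - c; b; a]].

Lemma g0E a b c d : a%:M - b *: ri - c *: rj - d *: rk = g0 a b c d.
Proof. by mx4. Qed.

Lemma li_sqr : li *m li = - 1%:M.
Proof. by mulmx4. Qed.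

Lemma lj_sqr : lj *m lj = - 1%:M.
Proof. by mulmx4. Qed.

Lemma lj_li : lj *m li = - (li *m lj).
Proof. by mulmx4. Qed.

Lemma tr_li : li^T = - li.
Proof. by mx4. Qed.

Lemma tr_lj : lj^T = - lj.
Proof. by mx4. Qed.

Lemma g0_li a b c d : g0 a b c d *m li = li *m g0 a b c d.
Proof. by mulmx4. Qed.

Lemma g0_lj a b c d : g0 a b c d *m lj = lj *m g0 a b c d.
Proof. by mulmx4. Qed.

Lemma g0_tr a b c d : g0 a b c d *m (g0 a b c d)^T =
  (a ^+ 2 + b ^+ 2 + c ^+ 2 + d ^+ 2)%:M.
Proof. by mulmx4. Qed.

End FourByFour.

Section Quaternions.
Variable R : realType.
Implicit Types (z w : R[i]) (A B M : 'M[R[i]]_4) (v : 'cV[R[i]]_4).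

Ltac mx4 := apply/matrixP; case=> [[|[|[|[|//]]]] ?]; case=> [[|[|[|[|//]]]] ?];
  rewrite !mxE /=; ring.

Lemma LiE : Li = li R[i].
Proof. by mx4. Qed.

Lemma LjE : Lj = lj R[i].
Proof. by mx4. Qed.

Lemma G0_ofE (a b c d : R[i]) : G0_of a b c d = g0 a b c d.
Proof.
have -> : G0_of a b c d = a%:M - b *: Ri - c *: Rj - d *: Rk by [].
have -> : Ri = ri R[i] by mx4.
have -> : Rj = rj R[i] by mx4.
have -> : Rk = rk R[i] by mx4.
exact: g0E.
Qed.

Lemma Li_sqr : Li *m Li = - 1%:M :> 'M[R[i]]_4.
Proof. by rewrite LiE li_sqr. Qed.

Lemma Lj_sqr : Lj *m Lj = - 1%:M :> 'M[R[i]]_4.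
Proof. by rewrite LjE lj_sqr. Qed.

Lemma Lj_Li : Lj *m Li = - (Li *m Lj) :> 'M[R[i]]_4.
Proof. rewrite LiE LjE; exact: (lj_li R[i]). Qed.

Lemma tr_Li : Li^T = - Li :> 'M[R[i]]_4.
Proof. by rewrite LiE tr_li. Qed.

Lemma tr_Lj : Lj^T = - Lj :> 'M[R[i]]_4.
Proof. by rewrite LjE tr_lj. Qed.

(** Right multiplications commute with left multiplications. *)
Lemma G0C_Li A : G0C A -> A *m Li = Li *m A.
Proof. by move=> [a [b [c [d [_ ->]]]]]; rewrite G0_ofE LiE g0_li. Qed.

Lemma G0C_Lj A : G0C A -> A *m Lj = Lj *m A.
Proof. by move=> [a [b [c [d [_ ->]]]]]; rewrite G0_ofE LjE g0_lj. Qed.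

Lemma G0C_tr A : G0C A -> A *m A^T = 1%:M.
Proof. by move=> [a [b [c [d [q1 ->]]]]]; rewrite G0_ofE g0_tr q1. Qed.

Lemma G0C_trV A : G0C A -> A^T *m A = 1%:M.
Proof. by move/G0C_tr/mulmx1C. Qed.

Lemma G0_G0C A : G0 A -> G0C A.
Proof.
move=> [a [b [c [d [q1 ->]]]]]; exists a%:C, b%:C, c%:C, d%:C; split=> //.
by rewrite -!rmorphXn -!rmorphD q1.
Qed.

Lemma G0C_1 : G0C (1%:M : 'M[R[i]]_4).
Proof.
exists 1, 0, 0, 0; split; first by ring.
by rewrite /G0_of !scale0r !subr0.
Qed.

(** The exponential of [z Li], in closed form since [Li] is a square root of [- 1]; see
    [expmx_Li]. *)
Definition expLi (z : R[i]) : 'M[R[i]]_4 := (ccos z)%:M + csin z *: Li.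

Lemma ccosD z w : ccos (z + w) = ccos z * ccos w - csin z * csin w.
Proof.
rewrite /ccos /csin mulrDr opprD !cexpD.
set a := cexp _; set b := cexp _; set c := cexp _; set d := cexp _.
rewrite (_ : (_ * _ / 2) * (_ * _ / 2) = (c - a) * (d - b) * ('i%C * 'i%C) / 4).
  by rewrite sqri; field.
by field.
Qed.

Lemma csinD z w : csin (z + w) = ccos z * csin w + csin z * ccos w.
Proof. by rewrite /ccos /csin mulrDr opprD !cexpD; field. Qed.

Lemma ccosN z : ccos (- z) = ccos z.
Proof. by rewrite /ccos mulrN opprK addrC. Qed.

Lemma csinN z : csin (- z) = - csin z.
Proof. by rewrite /csin mulrN opprK; ring. Qed.

Lemma ccos0 : ccos 0 = 1 :> R[i].
Proof. by rewrite /ccos mulr0 oppr0 cexp0 -mulr2n divff // pnatr_eq0. Qed.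

Lemma csin0 : csin 0 = 0 :> R[i].
Proof. by rewrite /csin mulr0 oppr0 subrr !mul0r. Qed.

Lemma expLi0 : expLi 0 = 1%:M.
Proof. by rewrite /expLi ccos0 csin0 scale0r addr0. Qed.

Lemma expLiD z w : expLi (z + w) = expLi z *m expLi w.
Proof.
rewrite /expLi mulmxDl !mulmxDr -!scalemxAl -!scalemxAr !mul_scalar_mx !mul_mx_scalar.
rewrite Li_sqr ccosD csinD scalerDl !scalerA !scale_scalar_mx scalerN scalemx1.
rewrite raddfB /= (mulrC (csin w)) -addrA -[RHS]addrA; congr (_ + _).
by rewrite addrC addrA.
Qed.

Lemma expLiNK z : expLi z *m expLi (- z) = 1%:M.
Proof. by rewrite -expLiD subrr expLi0. Qed.

Lemma expLiKN z : expLi (- z) *m expLi z = 1%:M.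
Proof. by rewrite -expLiD addNr expLi0. Qed.

Lemma tr_expLi z : (expLi z)^T = expLi (- z).
Proof.
by rewrite /expLi linearD /= tr_scalar_mx linearZ /= tr_Li ccosN csinN scalerN scaleNr.
Qed.

Lemma expLi_commute A z : A *m Li = Li *m A -> A *m expLi z = expLi z *m A.
Proof.
move=> ALi; rewrite /expLi mulmxDr mulmxDl scalar_mxC; congr (_ + _).
by rewrite -scalemxAr -scalemxAl ALi.
Qed.

Lemma expLi_Li z : expLi z *m Li = Li *m expLi z.
Proof. by rewrite expLi_commute. Qed.

Lemma Lj_expLi z : Lj *m expLi z = expLi (- z) *m Lj.
Proof.
rewrite /expLi mulmxDr mulmxDl scalar_mxC ccosN; congr (_ + _).
by rewrite -scalemxAr -scalemxAl Lj_Li csinN scaleNr scalerN.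
Qed.

Lemma cvg_mx4 (a b : nat -> R[i]) (p q : R[i]) :
  a @ \oo --> p -> b @ \oo --> q ->
  (a n)%:M + b n *: Li @[n --> \oo] --> p%:M + q *: (Li : 'M[R[i]]_4).
Proof.
move=> ap bq; rewrite (_ : (fun n => _) = fun n => a n *: 1%:M + b n *: Li).
  have h1 : a n *: (1%:M : 'M[R[i]]_4) @[n --> \oo] --> (p%:M : 'M[R[i]]_4).
    by rewrite -(scalemx1 4 p); apply: cvgZr_tmp; exact: ap.
  have h2 : b n *: (Li : 'M[R[i]]_4) @[n --> \oo] --> q *: (Li : 'M[R[i]]_4).
    by apply: cvgZr_tmp; exact: bq.
  exact: cvgD h1 h2.
by apply/funext => n; rewrite scalemx1.
Qed.

(** The powers of [Li] are [1] and [Li] up to sign, so the matrix series splits into the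
    scalar exponential series at [i z] and at [- i z]. *)
Lemma expmx_Li z : expmx (z *: Li) = expLi z.
Proof.
pose x := 'i%C * z.
have alg1 (i t M X : R[i]) : - (t * ((M - X) * i / 2)) =
  (i * t * X + - (i * t) * M) / 2 by ring.
have alg2 (i t M X : R[i]) : (- (i * t) * M - (i * t) * X) * i / 2 =
  - (i * i) * (t * ((X + M) / 2)) by ring.
pose p (n : nat) : R[i] := (x ^+ n + (- x) ^+ n) / 2.
pose q (n : nat) : R[i] := ((- x) ^+ n - x ^+ n) * 'i%C / 2.
have powE n : (z *: Li) ^+ n = (p n)%:M + q n *: Li.
  elim: n => [|n IH].
    by rewrite /p /q !expr0 subrr !mul0r scale0r addr0 -mulr2n divff ?pnatr_eq0.
  rewrite exprS IH -[LHS]/(_ *m _) mulmxDr -scalemxAl mul_mx_scalar.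
  rewrite -scalemxAl -scalemxAr Li_sqr !scalerA scalerN scalemx1.
  rewrite addrC -raddfN /=; congr (_%:M + _ *: _); rewrite /p /q !exprS.
    exact: alg1.
  by rewrite alg2 sqri opprK mul1r.
have c1 := @cexp_series R x; have c2 := @cexp_series R (- x).
have sumE : (fun n => series (fun k => (k`!%:R)^-1 *: (z *: Li) ^+ k) n) =
    (fun n => ((series (cexp_coeff x) n + series (cexp_coeff (- x)) n) / 2)%:M +
      ((series (cexp_coeff (- x)) n - series (cexp_coeff x) n) * 'i%C / 2) *: (Li : 'M[R[i]]_4)).
  apply/funext => n; rewrite /series /= -sumrB -big_split /= !mulr_suml.
  rewrite raddf_sum /= scaler_suml -big_split /=; apply: eq_bigr => k _.
  rewrite powE scalerDr scale_scalar_mx scalerA /p /q /cexp_coeff.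
  by congr (_%:M + _ *: _); ring.
rewrite /expmx; apply/cvg_lim; first exact: norm_hausdorff.
rewrite -[X in X @ _ --> _]/(fun n => series _ n) sumE; apply: cvg_mx4.
  exact: (cvgM (cvgD c1 c2) (cvg_cst _)).
exact: (cvgM (cvgM (cvgB c2 c1) (cvg_cst _)) (cvg_cst _)).
Qed.

End Quaternions.

(** * Integrals of complex functions over a segment *)

Section ComplexIntegral.
Variable R : realType.
Implicit Types (f g : R -> R[i]) (a b t : R).
Notation mu := (@lebesgue_measure R).

Definition cint a b f : R[i] :=
  (\int[mu]_(t in `[a, b]) complex.Re (f t)) +i*
  (\int[mu]_(t in `[a, b]) complex.Im (f t)).

Lemma cts_within a b f : continuous f -> {within `[a, b], continuous f}.
Proof. exact: continuous_subspaceT. Qed.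

Lemma integrable_Re a b f : {within `[a, b], continuous f} ->
  mu.-integrable `[a, b] (EFin \o (fun t => complex.Re (f t))).
Proof.
move=> cf; apply: continuous_compact_integrable; first exact: segment_compact.
exact: (fun x => cvg_Re (cf x)).
Qed.

Lemma integrable_Im a b f : {within `[a, b], continuous f} ->
  mu.-integrable `[a, b] (EFin \o (fun t => complex.Im (f t))).
Proof.
move=> cf; apply: continuous_compact_integrable; first exact: segment_compact.
exact: (fun x => cvg_Im (cf x)).
Qed.

Lemma eq_cint a b f g : (forall t, a <= t <= b -> f t = g t) ->
  cint a b f = cint a b g.
Proof.
move=> fg; congr (_ +i* _); apply: eq_Rintegral => t;
  by rewrite inE /= in_itv /= => /fg ->.
Qed.

Lemma cintD a b f g : {within `[a, b], continuous f} ->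
  {within `[a, b], continuous g} ->
  cint a b (fun t => f t + g t) = cint a b f + cint a b g.
Proof.
move=> cf cg; apply/eqP; rewrite eq_complex /cint /=; apply/andP; split; apply/eqP.
  rewrite -RintegralD //; [|exact: integrable_Re|exact: integrable_Re].
  by apply: eq_Rintegral => t _; rewrite cReD.
rewrite -RintegralD //; [|exact: integrable_Im|exact: integrable_Im].
by apply: eq_Rintegral => t _; rewrite cImD.
Qed.

Lemma cintN a b f : {within `[a, b], continuous f} ->
  cint a b (fun t => - f t) = - cint a b f.
Proof.
move=> cf; apply/eqP; rewrite eq_complex /cint /=; apply/andP; split; apply/eqP.
  rewrite -mulN1r -RintegralZl //; last exact: integrable_Re.
  by apply: eq_Rintegral => t _; rewrite raddfN mulN1r.
rewrite -mulN1r -RintegralZl //; last exact: integrable_Im.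
by apply: eq_Rintegral => t _; rewrite raddfN mulN1r.
Qed.

Lemma within_ctsN a b f : {within `[a, b], continuous f} ->
  {within `[a, b], continuous (fun t => - f t)}.
Proof. by move=> cf x; exact: cvgN (cf x). Qed.

Lemma within_ctsZ a b (c : R[i]) f : {within `[a, b], continuous f} ->
  {within `[a, b], continuous (fun t => c * f t)}.
Proof. by move=> cf x; exact: cvgM (cvg_cst c) (cf x). Qed.

Lemma within_ctsB a b f g : {within `[a, b], continuous f} ->
  {within `[a, b], continuous g} ->
  {within `[a, b], continuous (fun t => f t - g t)}.
Proof. by move=> cf cg x; exact: cvgB (cf x) (cg x). Qed.

Lemma cintB a b f g : {within `[a, b], continuous f} ->
  {within `[a, b], continuous g} ->
  cint a b (fun t => f t - g t) = cint a b f - cint a b g.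
Proof.
by move=> cf cg; rewrite -(cintN cg) -(cintD cf (within_ctsN cg)).
Qed.

Lemma cintZ a b (c : R[i]) f : {within `[a, b], continuous f} ->
  cint a b (fun t => c * f t) = c * cint a b f.
Proof.
move=> cf; have iR := integrable_Re cf; have iI := integrable_Im cf.
have iZ k (h : R -> R) : mu.-integrable `[a, b] (EFin \o h) ->
    mu.-integrable `[a, b] (EFin \o (fun t => k * h t)).
  move=> ih; rewrite (_ : _ \o _ = (fun t => k%:E * (EFin \o h) t)%E).
    exact: integrableZl.
  by apply/funext.
apply/eqP; rewrite eq_complex cReM cImM /cint /=; apply/andP; split; apply/eqP.
  rewrite -!RintegralZl // -RintegralB //; [|exact: iZ|exact: iZ].
  by apply: eq_Rintegral => t _; rewrite cReM.
rewrite -!RintegralZl // -RintegralD //; [|exact: iZ|exact: iZ].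
by apply: eq_Rintegral => t _; rewrite cImM.
Qed.

Lemma Rint_cst a b (c : R) : a <= b -> \int[mu]_(t in `[a, b]) c = c * (b - a).
Proof.
rewrite le_eqVlt => /predU1P[->|ab].
  by rewrite set_itv1 Rintegral_set1 subrr mulr0.
rewrite Rintegral_cst //; congr (_ * _).
have := @lebesgue_measure_itv R (Interval (BLeft a) (BRight b)).
by rewrite /= lte_fin ab => H; exact: (congr1 fine H).
Qed.

Lemma Rint_le a b (f : R -> R) (M : R) : a <= b ->
  {within `[a, b], continuous f} -> (forall t, a <= t <= b -> `|f t| <= M) ->
  `|\int[mu]_(t in `[a, b]) f t| <= M * (b - a).
Proof.
move=> ab cf fM.
have fi : mu.-integrable `[a, b] (EFin \o f).
  by apply: continuous_compact_integrable => //; exact: segment_compact.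
apply: le_trans (le_normr_Rintegral _ fi) _ => //.
rewrite -(Rint_cst M ab); apply: le_Rintegral => //.
- apply: continuous_compact_integrable; first exact: segment_compact.
  by move=> x; exact: cvg_norm (cf x).
- apply: continuous_compact_integrable; first exact: segment_compact.
  by move=> x; exact: cvg_cst.
Qed.

Lemma cmod_cint_le a b f (M : R) : a <= b ->
  {within `[a, b], continuous f} -> (forall t, a <= t <= b -> cmod (f t) <= M) ->
  cmod (cint a b f) <= 2 * M * (b - a).
Proof.
move=> ab cf fM; apply: le_trans (cmod_le_ReIm _) _.
rewrite -mulrA mulr2n mulrDl mul1r; apply: lerD; apply: Rint_le => //.
- exact: (fun x => cvg_Re (cf x)).
- by move=> t /fM; apply: le_trans; exact: ler_Re_cmod.
- exact: (fun x => cvg_Im (cf x)).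
- by move=> t /fM; apply: le_trans; exact: ler_Im_cmod.
Qed.

Lemma Rint_FTC a b (f F : R -> R) : a <= b -> {within `[a, b], continuous f} ->
  (forall t, a <= t <= b -> is_derive t 1 F (f t)) ->
  \int[mu]_(t in `[a, b]) f t = F b - F a.
Proof.
rewrite le_eqVlt => /predU1P[->|ab] cf dF.
  by rewrite set_itv1 Rintegral_set1 subrr.
have cF t : a <= t <= b -> {for t, continuous F}.
  move=> /dF[Ft _]; exact/differentiable_continuous/derivable1_diffP.
rewrite /Rintegral (@continuous_FTC2 _ f F) //.
  split.
  - by move=> t; rewrite in_itv /= => /andP[/ltW at_ /ltW tb]; case: (dF t); rewrite ?at_.
  - by apply: cvg_at_right_filter; apply: cF; rewrite lexx ltW.
  - by apply: cvg_at_left_filter; apply: cF; rewrite lexx ltW.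
move=> t; rewrite in_itv /= derive1E => /andP[/ltW at_ /ltW tb].
by case: (dF t); rewrite ?at_.
Qed.

Lemma cint_FTC a b f F : a <= b -> {within `[a, b], continuous f} ->
  (forall t, a <= t <= b -> rder F t (f t)) -> cint a b f = F b - F a.
Proof.
move=> ab cf dF; apply/eqP; rewrite eq_complex !raddfB /=.
apply/andP; split; apply/eqP.
  apply: (@Rint_FTC _ _ _ (fun t => complex.Re (F t))) => //.
    exact: (fun x => cvg_Re (cf x)).
  by move=> t /dF[].
apply: (@Rint_FTC _ _ _ (fun t => complex.Im (F t))) => //.
  exact: (fun x => cvg_Im (cf x)).
by move=> t /dF[].
Qed.

Lemma cint_split a c b f : a <= c -> c <= b -> {within `[a, b], continuous f} ->
  cint a b f = cint a c f + cint c b f.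
Proof.
move=> ac cb cf.
have split (h : R -> R) : mu.-integrable `[a, b] (EFin \o h) ->
  \int[mu]_(t in `[a, b]) h t = \int[mu]_(t in `[a, c]) h t + \int[mu]_(t in `[c, b]) h t.
  move=> ih; have ac' : (BLeft a <= BRight c)%O by rewrite bnd_simp.
  have cb' : (BRight c <= BRight b)%O by rewrite bnd_simp.
  rewrite -(Rintegral_itv_obnd_cbnd (r := c)); last first.
    by apply: integrableS ih => //; apply: subset_itvr; rewrite bnd_simp.
  by rewrite -(Rintegral_itvB ih ac' cb') addrC subrK.
apply/eqP; rewrite eq_complex /cint /=; apply/andP; split; apply/eqP; apply: split.
  exact: integrable_Re.
exact: integrable_Im.
Qed.

(** A constant is integrable over a segment, and dominates the derivatives of both
    parts. *)
Lemma rder_cint a b (f d : R -> R -> R[i]) (r M : R) : 0 < r ->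
  (forall x, - r < x < r -> {within `[a, b], continuous (f x)}) ->
  (forall x t, - r < x < r -> a <= t <= b -> rder (f ^~ t) x (d x t)) ->
  (forall x t, - r < x < r -> a <= t <= b -> cmod (d x t) <= M) ->
  rder (fun x => cint a b (f x)) 0 (cint a b (d 0)).
Proof.
move=> r0 cf fd dM.
have I0 : (`]- r, r[%classic : set R) 0 by rewrite /= in_itv /= oppr_lt0 r0.
have inI x : (`]- r, r[%classic : set R) x -> - r < x < r by rewrite /= in_itv.
have inB t : (`[a, b]%classic : set R) t -> a <= t <= b by rewrite /= in_itv.
have I00 : - r < 0 < r by rewrite oppr_lt0 r0.
have iM : mu.-integrable `[a, b] (EFin \o (fun=> `|M|)).
  apply: continuous_compact_integrable; first exact: segment_compact.
  by move=> x; exact: cvg_cst.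
have main (h k : R -> R -> R) :
  (forall x, - r < x < r -> mu.-integrable `[a, b] (EFin \o h x)) ->
  (forall x t, - r < x < r -> a <= t <= b -> is_derive x 1 (h ^~ t) (k x t)) ->
  (forall x t, - r < x < r -> a <= t <= b -> `|k x t| <= `|M|) ->
  is_derive (0 : R) 1 (fun x => \int[mu]_(t in `[a, b]) h x t)
    (\int[mu]_(t in `[a, b]) k 0 t).
  move=> ih hk kM.
  have H1 x : (`]- r, r[%classic : set R) x -> mu.-integrable `[a, b] (EFin \o h x).
    by move=> Ix; apply: ih; exact: inI.
  have H2 x t : (`]- r, r[%classic : set R) x -> (`[a, b]%classic : set R) t ->
      derivable (h ^~ t) x 1.
    by move=> /inI Ix /inB Bt; case: (hk x t Ix Bt).
  have H3 x t : (`]- r, r[%classic : set R) x -> (`[a, b]%classic : set R) t ->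
      `|partial1of2 h x t| <= `|M|.
    move=> /inI Ix /inB Bt; rewrite partial1of2E.
    by case: (hk x t Ix Bt) => _ ->; exact: kM.
  have mB : measurable (`[a, b]%classic : set (measurableTypeR R)) by [].
  have M0 (t : R) : 0 <= `|M| by [].
  apply: DeriveDef.
    exact: (@derivable_under_integral R _ _ mu h _ mB 0 (- r) r I0 H1 H2 _ M0 iM H3).
  rewrite -derive1E (@differentiation_under_integral R _ _ mu h _ mB 0 (- r) r I0 H1 H2 _ M0 iM H3).
  apply: eq_Rintegral => t; rewrite inE => /inB Bt.
  by rewrite partial1of2E; case: (hk 0 t I00 Bt).
split.
  apply: (main (fun x t => complex.Re (f x t)) (fun x t => complex.Re (d x t))).
  - by move=> x /cf; exact: integrable_Re.
  - by move=> x t Ix Bt; case: (fd x t Ix Bt).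
  - move=> x t Ix Bt; apply: le_trans (ler_Re_cmod _) _.
    by apply: le_trans (dM x t Ix Bt) (ler_norm _).
apply: (main (fun x t => complex.Im (f x t)) (fun x t => complex.Im (d x t))).
- by move=> x /cf; exact: integrable_Im.
- by move=> x t Ix Bt; case: (fd x t Ix Bt).
- move=> x t Ix Bt; apply: le_trans (ler_Im_cmod _) _.
  by apply: le_trans (dM x t Ix Bt) (ler_norm _).
Qed.

(** If [f t] is not zero, then the integrand stays above half of its value at [t] on a
    small segment around [t]. *)
Lemma cint_cmod2_eq0 a b f : a < b -> continuous f ->
  cint a b (fun t => (cmod (f t) ^+ 2)%:C) = 0 -> forall t, a < t < b -> f t = 0.
Proof.
move=> ab cf; rewrite /cint /= => -[I0 _] t tab.
apply/eqP; rewrite -cmod_eq0 -sqrf_eq0; apply: contraT => nz.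
have m0 : 0 < cmod (f t) ^+ 2 by rewrite lt_def nz sqr_ge0.
have cg : continuous (fun t => cmod (f t) ^+ 2).
  by move=> x; have cx := cvg_cmod (cf x); exact: (cvgM (cx _) (cx _)).
have gi (c d : R) : mu.-integrable `[c, d] (EFin \o (fun t => cmod (f t) ^+ 2)).
  apply: continuous_compact_integrable; first exact: segment_compact.
  exact: continuous_subspaceT.
have /cvgrPdist_lt/(_ (cmod (f t) ^+ 2 / 2)) := cg t.
rewrite divr_gt0 // => /(_ isT) /nbhs_ballP[e /= e0 eP].
pose d := Num.min (e / 2) (Num.min (t - a) (b - t)).
have d0 : 0 < d by rewrite !lt_min divr_gt0 // !subr_gt0.
have dta : d <= t - a by rewrite /d !ge_min lexx !orbT.
have dbt : d <= b - t by rewrite /d !ge_min lexx !orbT.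
have de : d < e.
  by apply: (@le_lt_trans _ _ (e / 2)); rewrite ?ge_min ?lexx // ltr_pdivrMr // ltr_pMr // ltr1n.
have sub : `[t - d, t + d]%classic `<=` (`[a, b]%classic : set R).
  move=> x; rewrite /= !in_itv /= => /andP[h1 h2]; apply/andP; split.
    by apply: le_trans h1; rewrite lerBrDr addrC -lerBrDr.
  by apply: le_trans h2 _; rewrite -lerBrDl.
suff : 0 < \int[mu]_(x in `[a, b]) (cmod (f x) ^+ 2) by rewrite I0 ltxx.
apply: (@lt_le_trans _ _ (\int[mu]_(x in `[t - d, t + d]) (cmod (f t) ^+ 2 / 2))).
  rewrite Rint_cst; last by rewrite lerBlDr -addrA lerDl addr_ge0 // ltW.
  by apply: mulr_gt0; [exact: divr_gt0|lra].
apply: (@le_trans _ _ (\int[mu]_(x in `[t - d, t + d]) (cmod (f x) ^+ 2))).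
  apply: le_Rintegral => //.
    apply: continuous_compact_integrable; first exact: segment_compact.
    by move=> x; exact: cvg_cst.
  move=> x; rewrite /= in_itv /= => /andP[h1 h2].
  have : `|cmod (f t) ^+ 2 - cmod (f x) ^+ 2| < cmod (f t) ^+ 2 / 2.
    apply: eP; rewrite /ball /=; apply: le_lt_trans de.
    by rewrite distrC ler_distl h1.
  by move=> /ltr_normlW; lra.
rewrite /Rintegral; apply: fine_le.
- exact: integrable_fin_num.
- exact: integrable_fin_num.
- apply: ge0_subset_integral => //; last by move=> x _; rewrite lee_fin sqr_ge0.
  exact: measurable_int (gi a b).
Qed.

End ComplexIntegral.

(** * Goursat's theorem for rectangles *)

Section Goursat.
Variable R : realType.
Implicit Types (f H : R[i] -> R[i]) (D : set R[i]) (x y a b s : R).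

Definition pt x y : R[i] := x%:C + 'i%C * y%:C.

Lemma pt_cvg_x y x : (pt t y) @[t --> x] --> pt x y.
Proof. by apply: cvgD; [exact: cvg_realc|exact: cvg_cst]. Qed.

Lemma pt_cvg_y x y : (pt x t) @[t --> y] --> pt x y.
Proof.
by apply: cvgD; [exact: cvg_cst|apply: cvgM; [exact: cvg_cst|exact: cvg_realc]].
Qed.

(** The integral of [H dz] along the boundary of a rectangle. *)
Definition bdint H x1 x2 y1 y2 : R[i] :=
  cint x1 x2 (fun x => H (pt x y1)) + 'i%C * cint y1 y2 (fun y => H (pt x2 y))
  - cint x1 x2 (fun x => H (pt x y2)) - 'i%C * cint y1 y2 (fun y => H (pt x1 y)).

Definition rect x1 x2 y1 y2 : set R[i] :=
  [set z | x1 <= complex.Re z <= x2 /\ y1 <= complex.Im z <= y2].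

Lemma Re_pt x y : complex.Re (pt x y) = x.
Proof. by rewrite /pt /=; ring. Qed.

Lemma Im_pt x y : complex.Im (pt x y) = y.
Proof. by rewrite /pt /=; ring. Qed.

Lemma rect_pt x1 x2 y1 y2 x y : x1 <= x <= x2 -> y1 <= y <= y2 ->
  rect x1 x2 y1 y2 (pt x y).
Proof. by move=> xx yy; split; rewrite ?Re_pt ?Im_pt. Qed.

Definition cts_at_rect H x1 x2 y1 y2 :=
  forall z, rect x1 x2 y1 y2 z -> {for z, continuous H}.

Lemma cts_hor H x1 x2 y1 y2 y : cts_at_rect H x1 x2 y1 y2 -> y1 <= y <= y2 ->
  {within `[x1, x2], continuous (fun x => H (pt x y))}.
Proof.
move=> cH yy; apply: continuous_in_subspaceT => x; rewrite inE /= in_itv /= => xx.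
apply: (@continuous_comp _ _ _ (fun t => pt t y) H); first exact: pt_cvg_x.
by apply: cH; exact: rect_pt.
Qed.

Lemma cts_ver H x1 x2 y1 y2 x : cts_at_rect H x1 x2 y1 y2 -> x1 <= x <= x2 ->
  {within `[y1, y2], continuous (fun y => H (pt x y))}.
Proof.
move=> cH xx; apply: continuous_in_subspaceT => y; rewrite inE /= in_itv /= => yy.
apply: (@continuous_comp _ _ _ (fun t => pt x t) H); first exact: pt_cvg_y.
by apply: cH; exact: rect_pt.
Qed.

Lemma bdint_split H x1 x x2 y1 y y2 : cts_at_rect H x1 x2 y1 y2 ->
  x1 <= x <= x2 -> y1 <= y <= y2 ->
  bdint H x1 x2 y1 y2 = bdint H x1 x y1 y + bdint H x x2 y1 y +
    bdint H x1 x y y2 + bdint H x x2 y y2.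
Proof.
move=> cH /[dup] xx /andP[xl xr] /[dup] yy /andP[yl yr].
have x12 := le_trans xl xr; have y12 := le_trans yl yr.
rewrite /bdint.
rewrite (@cint_split _ x1 x x2 (fun x => H (pt x y1))) //; last first.
  by apply: cts_hor cH _; rewrite lexx.
rewrite (@cint_split _ x1 x x2 (fun x => H (pt x y2))) //; last first.
  by apply: cts_hor cH _; rewrite lexx andbT.
rewrite (@cint_split _ y1 y y2 (fun y => H (pt x1 y))) //; last first.
  by apply: cts_ver cH _; rewrite lexx.
rewrite (@cint_split _ y1 y y2 (fun y => H (pt x2 y))) //; last first.
  by apply: cts_ver cH _; rewrite lexx andbT.
have alg (j h1 h1' h2 h2' h h' v1 v1' v2 v2' v v' : R[i]) :
  h1 + h1' + j * (v2 + v2') - (h2 + h2') - j * (v1 + v1') =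
  (h1 + j * v - h - j * v1) + (h1' + j * v2 - h' - j * v) +
  (h + j * v' - h2 - j * v1') + (h' + j * v2' - h2' - j * v') by ring.
exact: alg.
Qed.

Lemma bdintB H G x1 x2 y1 y2 : x1 <= x2 -> y1 <= y2 ->
  cts_at_rect H x1 x2 y1 y2 -> cts_at_rect G x1 x2 y1 y2 ->
  bdint (fun z => H z - G z) x1 x2 y1 y2 = bdint H x1 x2 y1 y2 - bdint G x1 x2 y1 y2.
Proof.
move=> x12 y12 cH cG.
have hy1 : y1 <= y1 <= y2 by rewrite lexx.
have hy2 : y1 <= y2 <= y2 by rewrite lexx andbT.
have hx1 : x1 <= x1 <= x2 by rewrite lexx.
have hx2 : x1 <= x2 <= x2 by rewrite lexx andbT.
rewrite /bdint (cintB (cts_hor cH hy1) (cts_hor cG hy1)).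
rewrite (cintB (cts_hor cH hy2) (cts_hor cG hy2)).
rewrite (cintB (cts_ver cH hx1) (cts_ver cG hx1)).
rewrite (cintB (cts_ver cH hx2) (cts_ver cG hx2)).
ring.
Qed.

Lemma bdint_le H x1 x2 y1 y2 (M : R) : x1 <= x2 -> y1 <= y2 ->
  cts_at_rect H x1 x2 y1 y2 ->
  (forall z, rect x1 x2 y1 y2 z -> cmod (H z) <= M) ->
  cmod (bdint H x1 x2 y1 y2) <= 4 * M * ((x2 - x1) + (y2 - y1)).
Proof.
move=> x12 y12 cH HM.
have hor y : y1 <= y <= y2 ->
    cmod (cint x1 x2 (fun x => H (pt x y))) <= 2 * M * (x2 - x1).
  move=> yy; apply: cmod_cint_le => //; first exact: cts_hor cH yy.
  by move=> x xx; apply: HM; exact: rect_pt.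
have ver x : x1 <= x <= x2 ->
    cmod ('i%C * cint y1 y2 (fun y => H (pt x y))) <= 2 * M * (y2 - y1).
  move=> xx; rewrite cmodM cmodi mul1r; apply: cmod_cint_le => //.
    exact: cts_ver cH xx.
  by move=> y yy; apply: HM; exact: rect_pt.
rewrite /bdint; apply: le_trans (cmodB _ _) _.
apply: le_trans (lerD (cmodB _ _) (lexx _)) _.
apply: le_trans (lerD (lerD (cmodD _ _) (lexx _)) (lexx _)) _.
have y1y : y1 <= y1 <= y2 by rewrite lexx.
have y2y : y1 <= y2 <= y2 by rewrite lexx andbT.
have x1x : x1 <= x1 <= x2 by rewrite lexx.
have x2x : x1 <= x2 <= x2 by rewrite lexx andbT.
have := hor _ y1y; have := hor _ y2y; have := ver _ x1x; have := ver _ x2x.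
by lra.
Qed.

Lemma affine_cts (p q : R[i]) z : {for z, continuous (fun w => p + q * w)}.
Proof. by apply: ctsD; [exact: cts_cst|apply: ctsZ; exact: cvg_id]. Qed.

(** An affine function has a primitive. *)
Lemma bdint_affine (p q : R[i]) x1 x2 y1 y2 : x1 <= x2 -> y1 <= y2 ->
  bdint (fun z => p + q * z) x1 x2 y1 y2 = 0.
Proof.
move=> x12 y12; pose G z := p * z + q / 2 * z ^+ 2.
have cA : cts_at_rect (fun z => p + q * z) x1 x2 y1 y2 by move=> z _; exact: affine_cts.
have hor y : y1 <= y <= y2 ->
    cint x1 x2 (fun x => p + q * pt x y) = G (pt x2 y) - G (pt x1 y).
  move=> yy; apply: (@cint_FTC _ _ _ _ (fun x => G (pt x y))) => //.
    exact: (cts_hor cA).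
  move=> x _; have dp : rder (fun x => pt x y) x 1.
    by apply: (rder_eq (rderD (rder_id x) (rder_cst _ x))); rewrite addr0.
  apply: (rder_eq (rderD (rderZ p dp) (rderZ (q / 2) (rderX 1 dp)))).
  by rewrite expr1; field.
have ver x : x1 <= x <= x2 ->
    'i%C * cint y1 y2 (fun y => p + q * pt x y) = G (pt x y2) - G (pt x y1).
  move=> xx; rewrite -cintZ; last exact: (cts_ver cA).
  apply: (@cint_FTC _ _ _ _ (fun y => G (pt x y))) => //.
    by apply: within_ctsZ; exact: (cts_ver cA).
  move=> y _; have dp : rder (fun y => pt x y) y 'i%C.
    by apply: (rder_eq (rderD (rder_cst _ y) (rderZ 'i%C (rder_id y)))); rewrite add0r mulr1.
  apply: (rder_eq (rderD (rderZ p dp) (rderZ (q / 2) (rderX 1 dp)))).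
  by rewrite expr1; field.
rewrite /bdint !hor ?ver ?lexx ?x12 ?y12 //; ring.
Qed.

Lemma holomorphic_frechet D f z : holomorphic D f -> D z ->
  exists d : R[i], forall e : R, 0 < e -> \forall w \near z,
    cmod (f w - f z - d * (w - z)) <= e * cmod (w - z).
Proof.
move=> hf /hf /cvg_ex[/= d /cvgCP fd]; exists d => e /fd.
move=> /nbhs_ballP[r /complex_posP[r' r'0 ->] rP].
apply/nearCP; exists r' => // w wr.
have [->|wz] := eqVneq w z; first by rewrite !subrr mulr0 subr0 cmod0 mulr0.
have wz0 : w - z != 0 by rewrite subr_eq0.
have := rP (w - z); rewrite /ball /= /ball_ /= normE ltcR add0r cmodN => /(_ wr wz0).
rewrite /GRing.scale /= mulr1 subrK => /ltW le1.
rewrite (_ : _ - d * _ = (w - z) * ((w - z)^-1 * (f w - f z) - d)); last by field.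
by rewrite cmodM mulrC ler_wpM2r ?cmod_ge0.
Qed.

Lemma holomorphic_continuous D f z : holomorphic D f -> D z -> {for z, continuous f}.
Proof.
move=> hf /hf; rewrite derivable1_diffP; exact: differentiable_continuous.
Qed.

Lemma nested_limit (u : nat -> R) (A : R) : 0 <= A ->
  (forall n, u n <= u n.+1 /\ u n.+1 + A / 2 ^+ n.+1 <= u n + A / 2 ^+ n) ->
  exists l, forall n, u n <= l <= u n + A / 2 ^+ n.
Proof.
move=> A0 uA.
have nd : nondecreasing_seq u by apply/nondecreasing_seqP => n; exact: (uA n).1.
have ni : nonincreasing_seq (fun n => u n + A / 2 ^+ n).
  by apply/nonincreasing_seqP => n; exact: (uA n).2.
have An n : 0 <= A / 2 ^+ n by rewrite divr_ge0 // exprn_ge0.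
have um n m : u n <= u m + A / 2 ^+ m.
  case: (leqP n m) => [/nd le_nm|/ltnW /ni le_mn].
    by apply: le_trans le_nm _; rewrite lerDl.
  by apply: le_trans le_mn; rewrite lerDl.
exists (sup (range u)) => n; apply/andP; split.
  apply: ub_le_sup; last by exists n.
  by exists (u 0 + A / 2 ^+ 0) => _ [m _ <-]; exact: um.
apply: ge_sup; first by exists (u 0), 0%N.
by move=> _ [m _ <-]; exact: um.
Qed.

(** By bisection: if the integral exceeds [e], then it exceeds [e / 4^n] along one of
    the rectangles of generation [n], and these can be chosen nested. Near their common
    point [H] is affine up to an error that makes the integrals smaller than that. *)
Lemma goursat D H x1 x2 y1 y2 : x1 <= x2 -> y1 <= y2 ->
  rect x1 x2 y1 y2 `<=` D -> holomorphic D H -> bdint H x1 x2 y1 y2 = 0.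
Proof.
move=> x12 y12 QD hH.
pose A := x2 - x1; pose B := y2 - y1.
have A0 : 0 <= A by rewrite subr_ge0. have B0 : 0 <= B by rewrite subr_ge0.
suff small (e : R) : 0 < e -> cmod (bdint H x1 x2 y1 y2) <= e.
  apply/eqP; rewrite -cmod_eq0 eq_le cmod_ge0 andbT leNgt.
  apply/negP => m0; have := small _ (divr_gt0 m0 (ltr0n R 2)).
  by rewrite leNgt ltr_pdivrMr // ltr_pMr // ltr1n.
move=> e0; rewrite leNgt; apply/negP => big.
pose side n : R := (2 ^+ n)^-1.
have side0 n : 0 < side n by rewrite invr_gt0 exprn_gt0.
have sideS n : side n = side n.+1 + side n.+1.
  have h : 2^-1 + 2^-1 = 1 :> R by lra.
  by rewrite /side exprS invfM -mulrDl h mul1r.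
pose inQ (c : R * R) n := [&& x1 <= c.1, c.1 + A * side n <= x2,
  y1 <= c.2 & c.2 + B * side n <= y2].
(* The rectangle of generation [n] with lower left corner [c] violates the inequality. *)
pose bad (c : R * R) n := inQ c n /\
  e * side n ^+ 2 < cmod (bdint H c.1 (c.1 + A * side n) c.2 (c.2 + B * side n)).
have cH : cts_at_rect H x1 x2 y1 y2.
  by move=> z /QD; exact: holomorphic_continuous hH.
have sub c n : inQ c n -> rect c.1 (c.1 + A * side n) c.2 (c.2 + B * side n)
    `<=` rect x1 x2 y1 y2.
  move=> /and4P[h1 h2 h3 h4] z [/andP[z1 z2] /andP[z3 z4]]; split; apply/andP; split.
  - exact: le_trans z1. - exact: le_trans h2.
  - exact: le_trans z3. - exact: le_trans h4.
have step c n : exists c' : R * R, bad c n -> bad c' n.+1 /\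
    (c.1 <= c'.1 /\ c'.1 + A * side n.+1 <= c.1 + A * side n) /\
    (c.2 <= c'.2 /\ c'.2 + B * side n.+1 <= c.2 + B * side n).
  case: (pselect (bad c n)) => [bc|nb]; last by exists c.
  have [/[dup] Qc /and4P[h1 h2 h3 h4] bc1] := bc.
  have As : 0 <= A * side n.+1 by rewrite mulr_ge0 // ltW.
  have Bs : 0 <= B * side n.+1 by rewrite mulr_ge0 // ltW.
  have AS : A * side n = A * side n.+1 + A * side n.+1 by rewrite -mulrDr -sideS.
  have BS : B * side n = B * side n.+1 + B * side n.+1 by rewrite -mulrDr -sideS.
  pose a' := c.1 + A * side n.+1; pose b' := c.2 + B * side n.+1.
  have aE : c.1 + A * side n = a' + A * side n.+1 by rewrite AS addrA.
  have bE : c.2 + B * side n = b' + B * side n.+1 by rewrite BS addrA.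
  have la : c.1 <= a' by rewrite lerDl. have lb : c.2 <= b' by rewrite lerDl.
  have la2 : a' <= a' + A * side n.+1 by rewrite lerDl.
  have lb2 : b' <= b' + B * side n.+1 by rewrite lerDl.
  apply: contrapT => /forallNP nex.
  have good (c' : R * R) : inQ c' n.+1 ->
     (c.1 <= c'.1 /\ c'.1 + A * side n.+1 <= c.1 + A * side n) ->
     (c.2 <= c'.2 /\ c'.2 + B * side n.+1 <= c.2 + B * side n) ->
     cmod (bdint H c'.1 (c'.1 + A * side n.+1) c'.2 (c'.2 + B * side n.+1)) <=
       e * side n.+1 ^+ 2.
    move=> Q' i1 i2; rewrite leNgt; apply/negP => big'.
    by apply: (nex c') => _; split.
  move: bc1; apply/negP; rewrite -leNgt aE bE.
  rewrite (@bdint_split H c.1 a' _ c.2 b') ?la ?lb //; last first.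
    by rewrite -aE -bE => z /(sub _ _ Qc); exact: cH.
  rewrite aE in h2; rewrite bE in h4.
  have g1 := good c; have g2 := good (a', c.2); have g3 := good (c.1, b').
  have g4 := good (a', b'); rewrite /inQ /= aE bE -/a' -/b' in g1 g2 g3 g4.
  have h2' : a' <= x2 := le_trans la2 h2.
  have h4' : b' <= y2 := le_trans lb2 h4.
  have h1' := le_trans h1 la; have h3' := le_trans h3 lb.
  rewrite h1 h2' h3 h4' !lexx in g1; rewrite h1' h2 h3 h4' !lexx in g2.
  rewrite h1 h2' h3' h4 !lexx in g3; rewrite h1' h2 h3' h4 !lexx in g4.
  have {}g1 := g1 isT (conj isT la2) (conj isT lb2).
  have {}g2 := g2 isT (conj la isT) (conj isT lb2).
  have {}g3 := g3 isT (conj isT la2) (conj lb isT).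
  have {}g4 := g4 isT (conj la isT) (conj lb isT).
  apply: le_trans (cmodD _ _) _; apply: le_trans (lerD (cmodD _ _) (lexx _)) _.
  apply: le_trans (lerD (lerD (cmodD _ _) (lexx _)) (lexx _)) _.
  rewrite (sideS n).
  apply: le_trans (lerD (lerD (lerD g1 g2) g3) g4) _.
  by rewrite le_eqVlt; apply/orP; left; apply/eqP; ring.
have [nxt nxtP] := choice (fun cn : (R * R) * nat => step cn.1 cn.2).
pose c := fix c n := if n is n'.+1 then nxt (c n', n') else (x1, y1).
have badc n : bad (c n) n.
  elim: n => [|n IH]; last exact: (nxtP (c n, n) IH).1.
  rewrite /bad /inQ /side /= expr0 invr1 !mulr1 expr1n mulr1 /A /B.
  by rewrite !lexx /= ![_ + (_ - _)]addrC !subrK !lexx; split.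
have nest n := (nxtP (c n, n) (badc n)).2.
have [lx lxP] : exists l, forall n, (c n).1 <= l <= (c n).1 + A / 2 ^+ n.
  by apply: nested_limit => // n; exact: (nest n).1.
have [ly lyP] : exists l, forall n, (c n).2 <= l <= (c n).2 + B / 2 ^+ n.
  by apply: nested_limit => // n; exact: (nest n).2.
pose w := pt lx ly.
have Qw n : rect (c n).1 ((c n).1 + A * side n) (c n).2 ((c n).2 + B * side n) w.
  by apply: rect_pt; [exact: lxP|exact: lyP].
have Dw : D w by apply/QD/(sub _ _ (badc 0%N).1)/Qw.
have [d dP] := holomorphic_frechet hH Dw.
pose e' := e / (4 * (A + B) ^+ 2 + 1).
have K0 : 0 < 4 * (A + B) ^+ 2 + 1 by rewrite ltr_wpDl // mulr_ge0 // sqr_ge0.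
have e'0 : 0 < e' by rewrite divr_gt0.
have /nearCP[r r0 rP] := dP _ e'0.
have [n nr] : exists n, (A + B) * side n < r.
  have : (A + B) * side n @[n --> \oo] --> (A + B) * 0.
    apply: cvgM; first exact: cvg_cst.
    have := @cvg_geometric R 1 (2^-1); rewrite ger0_norm // => /(_ _).
    rewrite (_ : geometric 1 2^-1 = side).
      by apply; rewrite invf_lt1 // ltr1n.
    by apply/funext => n; rewrite /geometric /side /= mul1r exprVn.
  rewrite mulr0 => /cvgrPdist_lt/(_ r r0)[N _ /(_ N (leqnn N))].
  by rewrite /= sub0r normrN => /(le_lt_trans (ler_norm _)); exists N.
have [Qn] := badc n; apply/negP; rewrite -leNgt.
set X1 := (c n).1; set Y1 := (c n).2; set X2 := X1 + _; set Y2 := Y1 + _.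
have X12 : X1 <= X2 by rewrite lerDl mulr_ge0 // ltW.
have Y12 : Y1 <= Y2 by rewrite lerDl mulr_ge0 // ltW.
have dist z : rect X1 X2 Y1 Y2 z -> cmod (z - w) <= (A + B) * side n.
  move=> [/andP[z1 z2] /andP[z3 z4]]; apply: le_trans (cmod_le_ReIm _) _.
  have [/andP[w1 w2] /andP[w3 w4]] := Qw n.
  rewrite (_ : complex.Re (z - w) = complex.Re z - complex.Re w); last exact: raddfB.
  rewrite (_ : complex.Im (z - w) = complex.Im z - complex.Im w); last exact: raddfB.
  rewrite mulrDl; apply: lerD; rewrite ler_norml.
    by move: z1 z2 w1 w2; rewrite /X1 /X2 => *; apply/andP; split; lra.
  by move: z3 z4 w3 w4; rewrite /Y1 /Y2 => *; apply/andP; split; lra.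
pose L z := (H w - d * w) + d * z.
have cHn : cts_at_rect H X1 X2 Y1 Y2 by move=> z /(sub _ _ Qn); exact: cH.
have cLn : cts_at_rect L X1 X2 Y1 Y2 by move=> z _; exact: affine_cts.
have := bdintB X12 Y12 cHn cLn; rewrite bdint_affine // subr0 => <-.
apply: le_trans (@bdint_le _ _ _ _ _ (e' * ((A + B) * side n)) X12 Y12 _ _) _.
- by move=> z Qz; apply: ctsB; [exact: cHn|exact: cLn].
- move=> z Qz; have zw := dist z Qz.
  rewrite (_ : _ - L z = H z - H w - d * (z - w)); last by rewrite /L; ring.
  apply: le_trans (rP _ (le_lt_trans zw nr)) _.
  by rewrite ler_pM2l.
- rewrite (_ : X2 - X1 + (Y2 - Y1) = (A + B) * side n); last by rewrite /X2 /Y2; ring.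
  rewrite (_ : 4 * _ * _ = e' * (4 * (A + B) ^+ 2) * side n ^+ 2); last by ring.
  apply: ler_wpM2r; first by rewrite exprn_ge0 // ltW.
  rewrite /e' mulrAC ler_pdivrMr // ler_pM2l //.
  by rewrite lerDl.
Qed.

End Goursat.

(** * The mean value property *)

Section MeanValue.
Variable R : realType.
Notation mu := (@lebesgue_measure R).
Implicit Types (W : R[i] -> R[i]).

Lemma cts_cint (a b M : R) (f : R -> R -> R[i]) :
  (forall x, continuous (f x)) -> (forall t, continuous (f ^~ t)) ->
  (forall x t, cmod (f x t) <= M) -> continuous (fun x => cint a b (f x)).
Proof.
move=> cf cft fM x.
have Ix : x \in (`]x - 1, x + 1[%classic : set R).
  by rewrite inE /= in_itv /= ltrDl ltrBlDr ltrDl ltr01.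
have mB : measurable (`[a, b]%classic : set (measurableTypeR R)) by [].
have main (h : R -> R -> R) : (forall x, continuous (h x)) ->
    (forall t, continuous (h ^~ t)) -> (forall x t, `|h x t| <= M) ->
    {for x, continuous (fun x => \int[mu]_(t in `[a, b]) h x t)}.
  move=> ch cht hM.
  have H1 y : (`]x - 1, x + 1[%classic : set R) y -> mu.-integrable `[a, b] (EFin \o h y).
    move=> _; apply: continuous_compact_integrable; first exact: segment_compact.
    exact: continuous_subspaceT.
  have H2 : {ae mu, forall t, (`[a, b]%classic : set R) t ->
      {in (`]x - 1, x + 1[%classic : set R), continuous (h ^~ t)}}.
    by apply: aeW => t _ y _; exact: cht.
  have H3 : mu.-integrable `[a, b] (EFin \o (fun=> M)).
    apply: continuous_compact_integrable; first exact: segment_compact.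
    by move=> y; exact: cvg_cst.
  have H4 y : (`]x - 1, x + 1[%classic : set R) y ->
      {ae mu, forall t, (`[a, b]%classic : set R) t -> `|h y t| <= M}.
    by move=> _; apply: aeW => t _; exact: hM.
  exact: (@continuity_under_integral R _ _ mu h _ mB (x - 1) (x + 1) H1 H2 _ H3 H4 x Ix).
apply: cvg_complex.
  apply: (main (fun x t => complex.Re (f x t))) => [y t|t y|y t].
  - exact: cvg_Re (cf y t). - exact: cvg_Re (cft t y).
  - exact: le_trans (ler_Re_cmod _) (fM y t).
apply: (main (fun x t => complex.Im (f x t))) => [y t|t y|y t].
- exact: cvg_Im (cf y t). - exact: cvg_Im (cft t y).
- exact: le_trans (ler_Im_cmod _) (fM y t).
Qed.

Lemma cint_cst (a b : R) (c : R[i]) : a <= b ->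
  cint a b (fun=> c) = (b - a)%:C * c.
Proof.
move=> ab; have cc : {within `[a, b], continuous (fun=> c : R[i])}.
  by move=> x; exact: cvg_cst.
have dF t : a <= t <= b -> rder (fun t : R => t%:C * c) t c.
  by move=> _; apply: (rder_eq (rderM (rder_id t) (rder_cst c t))); ring.
by rewrite (cint_FTC ab cc dF) -mulrBl -rmorphB.
Qed.

Definition disk : set R[i] := [set w | `|w| <= 1].
Definition odisk : set R[i] := [set w | `|w| < 1].

Lemma cis_continuous : continuous (@cis R).
Proof. by move=> t; apply: cvg_complex; [exact: continuous_cos|exact: continuous_sin]. Qed.

Lemma cis_2pi : cis (2 * pi) = 1 :> R[i].
Proof. by rewrite /cis mulr_natl cos2pi sin2pi. Qed.

Lemma pi2_ge0 : 0 <= 2 * pi :> R.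
Proof. by rewrite mulr_ge0 // pi_ge0. Qed.

Lemma clamp_disk (r t : R) : disk ((clamp r)%:C * cis t).
Proof.
rewrite /disk /= normE lecR cmodM cmod_cis mulr1 cmod_real.
by have /andP[r0 r1] := clamp_itv r; rewrite ger0_norm.
Qed.

Lemma cexp_holomorphic : holomorphic setT (@cexp R).
Proof.
apply: (@C1_holomorphic _ setT _ (@cexp R)); first exact: openT.
have id_d z : has_d (fun w : R[i] => w) z 1 0.
  split; apply: (rder_eq (rderD (rder_cst z 0) (rderM (rder_id 0) (rder_cst _ 0)))); ring.
have ed z : has_d (@cexp R) z (cexp z) 0.
  by apply: (has_d_eq (has_d_cexp (id_d z))); ring.
split; [by move=> z _; exact: ed| |by move=> z _; exact: cts_cst].
move=> z _; apply/ctsCP => e e0.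
have cr : continuous (fun w : R[i] => complex.Re w).
    by move=> w; exact: (@cvg_Re _ _ _ (nbhs_filter w) id w).
have ci : continuous (fun w : R[i] => complex.Im w).
    by move=> w; exact: (@cvg_Im _ _ _ (nbhs_filter w) id w).
have c1 : {for z, continuous (fun w : R[i] => (expR (complex.Re w))%:C)}.
  have h : {for z, continuous (fun w : R[i] => expR (complex.Re w))}.
    by apply: (@continuous_comp _ _ _ (fun w : R[i] => complex.Re w) expR);
      [exact: cr|exact: continuous_expR].
  exact: (@cvg_realc R _ (nbhs z) (nbhs_filter z) _ _ h).
have c2 : {for z, continuous (fun w : R[i] => cis (complex.Im w))}.
  by apply: (@continuous_comp _ _ _ (fun w : R[i] => complex.Im w) (@cis R)); [exact: ci|exact: cis_continuous].
exact: (ctsCP _ _).1 (ctsM c1 c2) e e0.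
Qed.

(** The mean value property: in logarithmic coordinates the circles around the origin
    become vertical segments, and Goursat's theorem shows that the mean over a circle
    does not depend on its radius. *)
Lemma mean_value W : {within disk, continuous W} -> holomorphic odisk W ->
  cint 0 (2 * pi) (fun t => W (cis t)) = (2 * pi)%:C * W 0.
Proof.
move=> cW hW.
(* Clamping the radius extends the integrand continuously to all radii. *)
pose G (r t : R) := W ((clamp r)%:C * cis t).
have cG : continuous (fun rt : R * R => G rt.1 rt.2).
  apply: (@within_comp _ _ _ _ (fun rt : R * R => (clamp rt.1)%:C * cis rt.2) W cW).
    move=> [r t]; apply: cvgM.
      apply: cvg_realc; apply: (@continuous_comp _ _ _ fst (@clamp R)).
        exact: cvg_fst. exact: clamp_continuous.
    apply: (@continuous_comp _ _ _ snd (@cis R)).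
      exact: cvg_snd. exact: cis_continuous.
  by move=> [r t]; exact: clamp_disk.
have cG1 r : continuous (G r).
  by move=> t; exact: (cvg_comp2 (cvg_cst r) (@cvg_id _ (nbhs t)) (cG (r, t))).
have cG2 t : continuous (G ^~ t).
  by move=> r; exact: (cvg_comp2 (@cvg_id _ (nbhs r)) (cvg_cst t) (cG (r, t))).
have [M GM] : exists M, forall r t, cmod (G (clamp r) (clamp t * (2 * pi))) <= M.
  have cK : compact (`[0, 1]%classic `*` `[0, 1]%classic : set (R * R)).
    by apply: compact_setX; exact: segment_compact.
  pose h (rt : R * R) := cmod (G rt.1 (rt.2 * (2 * pi))).
  have ch : continuous h.
    move=> [r t]; apply: cvg_cmod.
    exact: (cvg_comp2 cvg_fst (cvgM cvg_snd (cvg_cst _)) (cG (r, t * (2 * pi)))).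
  have /compact_bounded[M [_ HM]] := continuous_compact (continuous_subspaceT ch) cK.
  exists (M + 1) => r t; have := HM (M + 1); rewrite ltrDl ltr01 => /(_ isT).
  move=> /(_ (h (clamp r, clamp t))); rewrite /h /= ger0_norm ?cmod_ge0 //; apply.
  by exists (clamp r, clamp t) => //; split; rewrite /= in_itv /= clamp_itv.
have clampK r : clamp (clamp r) = clamp r by rewrite clampE // clamp_itv.
(* Clamping the angle too makes the integrand bounded, without changing the integral. *)
pose G' (r t : R) := G r (clamp (t / (2 * pi)) * (2 * pi)).
have pi20 : 2 * pi != 0 :> R by rewrite mulf_neq0 ?pnatr_eq0 // gt_eqF // pi_gt0.
have GG' r t : 0 <= t <= 2 * pi -> G r t = G' r t.
  move=> /andP[t0 t1]; rewrite /G' clampE ?divfK //.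
  by rewrite divr_ge0 ?pi2_ge0 //= ler_pdivrMr ?mul1r // lt_def pi20 pi2_ge0.
pose J r := cint 0 (2 * pi) (G' r).
have JE r : J r = cint 0 (2 * pi) (G r) by apply: eq_cint => t /GG' ->.
have cJ : continuous J.
  apply: (@cts_cint _ _ M).
  - move=> r t; have ct : {for t, continuous (fun t : R => clamp (t / (2 * pi)) * (2 * pi))}.
      apply: cvgM; last exact: cvg_cst.
      have c1 : {for t, continuous (fun t : R => t / (2 * pi))}.
        by apply: cvgM; [exact: cvg_id|exact: cvg_cst].
      exact: (cvg_comp _ _ c1 (@clamp_continuous R _)).
    exact: (cvg_comp _ _ ct (cG1 r _)).
  - by move=> t; exact: cG2.
  - by move=> r t; have := GM r (t / (2 * pi)); rewrite /G' /G clampK.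
have clampr r : 0 < r < 1 -> clamp r = r by move=> /andP[/ltW r0 /ltW r1]; rewrite clampE // r0.
have alg (S a b : R[i]) : S + 'i%C * a - S - 'i%C * b = 0 -> b = a.
  rewrite (_ : _ - _ = 'i%C * (a - b)); last by ring.
  move=> /eqP; rewrite mulf_eq0 subr_eq0 eq_complex /= oner_eq0 andbF /=.
  by move=> /eqP ->.
have Jc r1 r2 : 0 < r1 -> r1 <= r2 -> r2 < 1 -> J r1 = J r2.
  move=> r10 r12 r21; have r20 := lt_le_trans r10 r12.
  pose D : set R[i] := [set z | complex.Re z < 0].
  have hH : holomorphic D (W \o (@cexp R)).
    move=> z Dz; apply/derivable1_diffP; apply: differentiable_comp.
      exact/derivable1_diffP/cexp_holomorphic.
    apply/derivable1_diffP/hW; rewrite /odisk /= normE cmod_cexp ltcR.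
    by rewrite -expR0 ltr_expR.
  have ln12 : ln r1 <= ln r2 by rewrite ler_ln ?posrE.
  have QD : rect (ln r1) (ln r2) 0 (2 * pi) `<=` D.
    move=> z [/andP[_ z1] _]; apply: le_lt_trans z1 _.
    by rewrite -ln1 ltr_ln ?posrE.
  have expE r t : 0 < r < 1 -> (W \o @cexp R) (pt (ln r) t) = G r t.
    move=> r01; rewrite /= /cexp Re_pt Im_pt lnK ?posrE; last by case/andP: r01.
    by rewrite /G clampr.
  have := goursat ln12 pi2_ge0 QD hH; rewrite /bdint.
  have -> : cint (ln r1) (ln r2) (fun x => (W \o @cexp R) (pt x (2 * pi))) =
      cint (ln r1) (ln r2) (fun x => (W \o @cexp R) (pt x 0)).
    by apply: eq_cint => x _; rewrite /= /cexp !Re_pt !Im_pt cis_2pi cis0.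
  rewrite !JE.
  have E r : 0 < r < 1 -> cint 0 (2 * pi) (fun y => (W \o @cexp R) (pt (ln r) y)) =
    cint 0 (2 * pi) (G r) by move=> r01; apply: eq_cint => y _; exact: expE.
  rewrite !E; last 2 first.
  - by rewrite r10 (le_lt_trans r12).
  - by rewrite r20.
  exact: alg.
have half01 : 0 < (2^-1 : R) < 1 by rewrite invr_gt0 ltr0n /= invf_lt1 // ltr1n.
have Jhalf r : 0 < r < 1 -> J r = J 2^-1.
  move=> /andP[r0 r1]; have [h0 h1] := andP half01.
  by case: (leP r 2^-1) => [|/ltW] le; [exact: Jc|apply/esym; exact: Jc].
(* The mean is constant for [0 < r < 1], hence by continuity up to both ends. *)
have end_ (r : R) : (forall e : R, 0 < e -> exists r', [/\ 0 < r' < 1 & `|r - r'| < e]) ->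
    J r = J 2^-1.
  move=> Hr; apply/eqP; rewrite -subr_eq0 -cmod_eq0 eq_le cmod_ge0 andbT leNgt.
  apply/negP => m0; have /cvgCP/(_ _ m0)/nbhs_ballP[d /= d0 dP] := cJ r.
  have [r' [r'01 rr']] := Hr d d0.
  by have := dP r' rr'; rewrite (Jhalf _ r'01) cmodC ltxx.
have J0 : J 0 = J 2^-1.
  apply: end_ => e e0; exists (Num.min (e / 2) 2^-1); split.
    by rewrite lt_min divr_gt0 //= invr_gt0 ltr0n /= gt_min (andP half01).2 orbT.
  rewrite sub0r normrN ger0_norm; last by rewrite le_min divr_ge0 ?ltW.
  by rewrite gt_min ltr_pdivrMr // ltr_pMr // ltr1n.
have J1 : J 1 = J 2^-1.
  apply: end_ => e e0; exists (1 - Num.min (e / 2) 2^-1); split.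
    rewrite subr_gt0 gt_min (andP half01).2 orbT /= ltrBlDr ltrDl.
    by rewrite lt_min divr_gt0 //= invr_gt0.
  rewrite opprB addrC subrK ger0_norm; last by rewrite le_min divr_ge0 ?ltW.
  by rewrite gt_min ltr_pdivrMr // ltr_pMr // ltr1n.
have clamp0 : clamp (0 : R) = 0 by rewrite clampE // lexx ler01.
have clamp1 : clamp (1 : R) = 1 by rewrite clampE // lexx ler01.
transitivity (J 1).
  by rewrite JE; apply: eq_cint => t _; rewrite /G clamp1 mul1r.
have := cint_cst (W 0) pi2_ge0; rewrite subr0 => <-; rewrite J1 -J0 JE.
by apply: eq_cint => t _; rewrite /G clamp0 mul0r.
Qed.

End MeanValue.

(** * Sums over the integers *)

Section SymmetricSums.
Variable V : zmodType.
Implicit Types a b : int -> V.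

(** The partial sums by which [Hs] sums a Fourier series: [n] ranges over [- N <= n <
    N]. *)
Definition psum a (N : nat) : V :=
  \sum_(k < N) a k%:Z + \sum_(k < N) a (- k.+1%:Z).

Lemma psum0 a : psum a 0 = 0.
Proof. by rewrite /psum !big_ord0 addr0. Qed.

Lemma psumS a N : psum a N.+1 = psum a N + (a N%:Z + a (- N.+1%:Z)).
Proof. by rewrite /psum !big_ord_recr /= addrACA. Qed.

Lemma psumD a b N : psum (fun n => a n + b n) N = psum a N + psum b N.
Proof. by rewrite /psum !big_split /= addrACA. Qed.

Lemma eq_psum a b N : a =1 b -> psum a N = psum b N.
Proof. by move=> ab; congr (_ + _); apply: eq_bigr => k _; rewrite ab. Qed.

Lemma psum_shift1 a N : psum (fun n => a (n + 1)) N = psum a N + a N%:Z - a (- N%:Z).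
Proof.
elim: N => [|N IH]; first by rewrite !psum0 add0r subrr.
rewrite !psumS IH (_ : N%:Z + 1 = N.+1%:Z); last by rewrite -addn1 PoszD.
rewrite (_ : - N.+1%:Z + 1 = - N%:Z); last by rewrite -addn1 PoszD opprD subrK.
set x := psum a N; set p := a N%:Z; set q := a (- N%:Z); set r := a _; set t := a _.
by rewrite (addrACA (x + p)) addNr addr0 (addrA x) (addrAC _ t) addrK.
Qed.

Lemma psum_sum (I : Type) (r : seq I) (P : pred I) (F : I -> int -> V) N :
  psum (fun n => \sum_(i <- r | P i) F i n) N = \sum_(i <- r | P i) psum (F i) N.
Proof.
rewrite /psum big_split /=; congr (_ + _); exact: exchange_big.
Qed.

End SymmetricSums.

Section BoundedSums.
Variable R : realType.

Lemma cvgCD {T : Type} {F : set_system T} {FF : Filter F} (f g : T -> R[i]) (a b : R[i]) :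
  f @ F --> a -> g @ F --> b -> (f x + g x) @[x --> F] --> a + b.
Proof. by move=> fa gb; exact: (cvgD fa gb). Qed.

Lemma cvgCB {T : Type} {F : set_system T} {FF : Filter F} (f g : T -> R[i]) (a b : R[i]) :
  f @ F --> a -> g @ F --> b -> (f x - g x) @[x --> F] --> a - b.
Proof. by move=> fa gb; exact: (cvgB fa gb). Qed.

Lemma cvgCM {T : Type} {F : set_system T} {FF : Filter F} (f g : T -> R[i]) (a b : R[i]) :
  f @ F --> a -> g @ F --> b -> (f x * g x) @[x --> F] --> a * b.
Proof. by move=> fa gb; exact: (cvgM fa gb). Qed.

Implicit Types (u w : int -> R) (a b : int -> R[i]) (M : R) (s : R).

Lemma cvg_sumC {T I : Type} {F : set_system T} {FF : Filter F} (r : seq I) (P : pred I)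
    (f : I -> T -> R[i]) (l : I -> R[i]) :
  (forall i, P i -> f i @ F --> l i) ->
  (\sum_(i <- r | P i) f i x) @[x --> F] --> \sum_(i <- r | P i) l i.
Proof. by move=> fl; apply: cvg_big fl; exact: add_continuous. Qed.

Definition bnd u M := forall N, psum u N <= M.

Lemma psum_le u w N : (forall n, u n <= w n) -> psum u N <= psum w N.
Proof. by move=> uw; apply: lerD; apply: ler_sum. Qed.

Lemma bnd_le u w M : (forall n, u n <= w n) -> bnd w M -> bnd u M.
Proof. by move=> uw wM N; apply: le_trans (wM N); exact: psum_le. Qed.

Lemma psum_scale u c N : psum (fun n => c * u n) N = c * psum u N.
Proof. by rewrite /psum -!mulr_sumr mulrDr. Qed.

Lemma bnd_scale u c M : 0 <= c -> bnd u M -> bnd (fun n => c * u n) (c * M).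
Proof. by move=> c0 uM N; rewrite psum_scale ler_wpM2l. Qed.

Lemma bndD u w M M' : bnd u M -> bnd w M' -> bnd (fun n => u n + w n) (M + M').
Proof. by move=> uM wM N; rewrite psumD lerD. Qed.

Lemma bnd_shift1 u M : (forall n, 0 <= u n) -> bnd u M -> bnd (fun n => u (n + 1)) M.
Proof.
move=> u0 uM N; rewrite psum_shift1; apply: le_trans (uM N.+1).
rewrite psumS addrA; apply: le_trans (_ : psum u N + u N%:Z <= _).
  by rewrite gerBl.
by rewrite lerDl.
Qed.

Lemma bnd_shiftN1 u M : (forall n, 0 <= u n) -> bnd u M -> bnd (fun n => u (n - 1)) M.
Proof.
move=> u0 uM N; apply: le_trans (uM N.+1).
have E := psum_shift1 (fun n => u (n - 1)) N.
rewrite (@eq_psum _ _ u) in E; last by move=> n; rewrite addrK.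
move: (psum (fun n => u (n - 1)) N) E => x E.
have -> : x = psum u N - u (N%:Z - 1) + u (- N%:Z - 1).
  by rewrite E (addrAC x) addrK subrK.
rewrite psumS -opprD -[N%:Z + 1]PoszD addn1 -addrA lerD2l addrC.
by have := u0 (N%:Z - 1); have := u0 N%:Z; lra.
Qed.

Lemma bnd_shift u M (j : int) : (forall n, 0 <= u n) -> bnd u M ->
  bnd (fun n => u (n + j)) M.
Proof.
move=> u0 uM; elim/int_ind: j => [|j IH|j IH].
- by apply: bnd_le uM => n; rewrite addr0.
- apply: bnd_le (bnd_shift1 (fun n => u0 (n + j%:Z)) IH) => n.
  by rewrite -addn1 PoszD addrAC addrA.
- apply: bnd_le (bnd_shiftN1 (fun n => u0 (n - j%:Z)) IH) => n.
  by rewrite -addn1 PoszD opprD addrAC addrA.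
Qed.

Lemma bnd_term u M (n : int) : (forall n, 0 <= u n) -> bnd u M -> u n <= M.
Proof.
move=> u0 uM; have := bnd_shift n u0 uM 1%N.
rewrite psumS psum0 !add0r => h; apply: le_trans h.
by rewrite lerDl.
Qed.

Definition absum a M := bnd (fun n => cmod (a n)) M.

Definition zsum a : R[i] := csum (fun k => a k%:Z) + csum (fun k => a (- k.+1%:Z)).

Lemma bnd_cvg u M : (forall n, 0 <= u n) -> bnd u M ->
  cvgn (series (fun k => u k%:Z)) /\ cvgn (series (fun k => u (- k.+1%:Z))).
Proof.
move=> u0 uM; split; apply: nondecreasing_is_cvgn.
- by apply: nondecreasing_series.
- exists M => _ [N _ <-]; apply: le_trans (uM N); rewrite /series /= big_mkord.
  by rewrite lerDl; apply: sumr_ge0.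
- by apply: nondecreasing_series.
- exists M => _ [N _ <-]; apply: le_trans (uM N); rewrite /series /= big_mkord.
  by rewrite lerDr; apply: sumr_ge0.
Qed.

Lemma bnd_majorized u M a : bnd u M -> (forall n, cmod (a n) <= u n) ->
  majorized_by (fun k => u k%:Z) (fun k => a k%:Z) /\
  majorized_by (fun k => u (- k.+1%:Z)) (fun k => a (- k.+1%:Z)).
Proof.
move=> uM au; have u0 n : 0 <= u n := le_trans (cmod_ge0 _) (au n).
by have [c1 c2] := bnd_cvg u0 uM; split; split=> // k; exact: au.
Qed.

Lemma absum_majorized a M : absum a M ->
  majorized_by (fun k => cmod (a k%:Z)) (fun k => a k%:Z) /\
  majorized_by (fun k => cmod (a (- k.+1%:Z))) (fun k => a (- k.+1%:Z)).
Proof. by move=> /bnd_majorized; apply. Qed.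

Lemma absum_cvg a M : absum a M -> psum a @ \oo --> zsum a.
Proof.
move=> /absum_majorized[/dominated_cvg_series h1 /dominated_cvg_series h2].
rewrite (_ : psum a = fun N => series (fun k => a k%:Z) N + series (fun k => a (- k.+1%:Z)) N).
  exact: (cvgCD h1 h2).
by apply/funext => N; rewrite /psum /series /= !big_mkord.
Qed.

Lemma zsumE a z : absum a z -> forall S, psum a @ \oo --> S -> zsum a = S.
Proof. by move=> /absum_cvg az S aS; apply: (cvgC_unique az aS). Qed.

Lemma eq_zsum a b : a =1 b -> zsum a = zsum b.
Proof. by move=> /funext ->. Qed.

Lemma absum_le a b M : absum a M -> (forall n, cmod (b n) <= cmod (a n)) -> absum b M.
Proof. by move=> aM ba; apply: bnd_le aM. Qed.

Lemma absumD a b M M' : absum a M -> absum b M' -> absum (fun n => a n + b n) (M + M').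
Proof. by move=> aM bM; apply: bnd_le (bndD aM bM) => n; exact: cmodD. Qed.

Lemma absumZ c a M : absum a M -> absum (fun n => c * a n) (cmod c * M).
Proof.
move=> aM; apply: bnd_le (bnd_scale (cmod_ge0 c) aM) => n.
by rewrite cmodM.
Qed.

Lemma absum_shift a M j : absum a M -> absum (fun n => a (n + j)) M.
Proof. by move=> aM; apply: (@bnd_shift (fun n => cmod (a n))) => // n; exact: cmod_ge0. Qed.

Lemma absum_term a M n : absum a M -> cmod (a n) <= M.
Proof. by move=> aM; apply: (@bnd_term (fun n => cmod (a n))) => // k; exact: cmod_ge0. Qed.

Lemma cmod_psum_le a M N : absum a M -> cmod (psum a N) <= M.
Proof.
move=> aM; apply: le_trans (aM N); apply: le_trans (cmodD _ _) _.
by apply: lerD; exact: cmod_sum.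
Qed.

Lemma zsumD a b M M' : absum a M -> absum b M' ->
  zsum (fun n => a n + b n) = zsum a + zsum b.
Proof.
move=> aM bM; apply: (zsumE (absumD aM bM)).
rewrite (_ : psum _ = fun N => psum a N + psum b N).
  exact: (cvgCD (absum_cvg aM) (absum_cvg bM)).
by apply/funext => N; exact: psumD.
Qed.

Lemma zsumZ c a M : absum a M -> zsum (fun n => c * a n) = c * zsum a.
Proof.
move=> aM; apply: (zsumE (absumZ c aM)).
rewrite (_ : psum _ = fun N => c * psum a N).
  exact: (cvgCM (cvg_cst c) (absum_cvg aM)).
by apply/funext => N; rewrite /psum -!mulr_sumr mulrDr.
Qed.

Lemma absum_cvg0 a M : absum a M ->
  (fun N => a N%:Z) @ \oo --> (0 : R[i]) /\ (fun N => a (- N%:Z)) @ \oo --> (0 : R[i]).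
Proof.
move=> aM; have [[c1 _] [c2 _]] := absum_majorized aM.
split.
  apply/cvgCP => e e0; have /cvgrPdist_lt/(_ e e0) := cvg_series_cvg_0 c1.
  apply: filterS => n; rewrite sub0r normrN ger0_norm ?cmod_ge0 //.
  by rewrite subr0.
rewrite -cvg_shiftS; apply/cvgCP => e e0.
have /cvgrPdist_lt/(_ e e0) := cvg_series_cvg_0 c2.
apply: filterS => n; rewrite sub0r normrN ger0_norm ?cmod_ge0 //.
by rewrite subr0.
Qed.

Lemma zsum_shift1 a M : absum a M -> zsum (fun n => a (n + 1)) = zsum a.
Proof.
move=> aM; apply: (zsumE (absum_shift 1 aM)).
rewrite (_ : psum _ = fun N => psum a N + a N%:Z - a (- N%:Z)).
  have [c1 c2] := absum_cvg0 aM.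
  have h := cvgCB (cvgCD (absum_cvg aM) c1) c2; rewrite addr0 subr0 in h.
  exact: h.
by apply/funext => N; exact: psum_shift1.
Qed.

Lemma zsum_shift a M (j : int) : absum a M -> zsum (fun n => a (n + j)) = zsum a.
Proof.
move=> aM; elim/int_ind: j => [|j IH|j IH].
- by apply: eq_zsum => n; rewrite addr0.
- rewrite -IH -(zsum_shift1 (absum_shift j%:Z aM)); apply: eq_zsum => n.
  by rewrite -addn1 PoszD addrAC addrA.
- rewrite -IH -(zsum_shift1 (absum_shift (- j.+1%:Z) aM)); apply: eq_zsum => n.
  by rewrite -addn1 PoszD opprD addrACA subrr addr0.
Qed.

Lemma ztannery {T : Type} {F : set_system T} {FF : ProperFilter F}
    u M (phi : int -> T -> R[i]) a :
  (forall n, 0 <= u n) -> bnd u M ->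
  (\forall x \near F, forall n, cmod (phi n x) <= u n) ->
  (forall n, phi n @ F --> a n) ->
  zsum (phi ^~ x) @[x --> F] --> zsum a.
Proof.
move=> u0 uM phiu phia; have [c1 c2] := bnd_cvg u0 uM.
apply: cvgD.
  apply: (tannery (phi := fun k => phi k%:Z) c1) => [|k]; last exact: phia.
  by apply: filterS phiu => x h k; exact: h.
apply: (tannery (phi := fun k => phi (- k.+1%:Z)) c2) => [|k]; last exact: phia.
by apply: filterS phiu => x h k; exact: h.
Qed.

End BoundedSums.

(** * Sobolev weights *)

Section Weights.
Variable R : realType.
Implicit Types (a b : int -> R[i]) (s : R) (n m : int).

Definition wt s n : R := (1 + n%:~R ^+ 2) `^ s.

Lemma wt_base n : 1 <= 1 + n%:~R ^+ 2 :> R.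
Proof. by rewrite lerDl sqr_ge0. Qed.

Lemma wt_gt0 s n : 0 < wt s n.
Proof. by apply: powR_gt0; apply: lt_le_trans (wt_base n). Qed.

Lemma wt_ge0 s n : 0 <= wt s n.
Proof. exact/ltW/wt_gt0. Qed.

(** Peetre's inequality. *)
Lemma wt_shift s n m : 0 <= s ->
  wt s (n + m) <= (2 * (1 + m%:~R ^+ 2)) `^ s * wt s n.
Proof.
move=> s0; have b1 := wt_base n; have b2 := wt_base m.
rewrite -powRM; last 2 first.
- by rewrite mulr_ge0 // (le_trans _ b2).
- by rewrite (le_trans _ b1).
apply: ge0_ler_powR => //; rewrite ?nnegrE.
- exact: le_trans (wt_base _).
- by rewrite !mulr_ge0 // ?(le_trans _ b1) // (le_trans _ b2).
rewrite rmorphD /=; set x := n%:~R; set y := m%:~R.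
have : 0 <= (x - y) ^+ 2 by exact: sqr_ge0.
have : 0 <= (x * y) ^+ 2 by exact: sqr_ge0.
have : 0 <= x ^+ 2 by exact: sqr_ge0.
by have : 0 <= y ^+ 2; [exact: sqr_ge0|nra].
Qed.

(** Membership in [H^s], read on the Fourier coefficients. *)
Definition hsc s a := exists M, bnd (fun n => wt s n * cmod (a n) ^+ 2) M.

Lemma hsc_le s a b : hsc s a -> (forall n, cmod (b n) <= cmod (a n)) -> hsc s b.
Proof.
move=> [M aM] ba; exists M; apply: bnd_le aM => n.
by rewrite ler_wpM2l ?wt_ge0 // lerXn2r ?nnegrE ?cmod_ge0.
Qed.

Lemma hscZ s c a : hsc s a -> hsc s (fun n => c * a n).
Proof.
move=> [M aM]; exists (cmod c ^+ 2 * M).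
apply: bnd_le (bnd_scale (sqr_ge0 _) aM) => n.
by rewrite cmodM exprMn mulrCA.
Qed.

Lemma hscD s a b : hsc s a -> hsc s b -> hsc s (fun n => a n + b n).
Proof.
move=> [M aM] [M' bM']; exists (2 * M + 2 * M').
apply: bnd_le (bndD (bnd_scale _ aM) (bnd_scale _ bM')) => // n.
rewrite ![2 * (_ * _)]mulrCA -mulrDr; apply: ler_wpM2l; first exact: wt_ge0.
apply: (@le_trans _ _ ((cmod (a n) + cmod (b n)) ^+ 2)).
  by rewrite lerXn2r ?nnegrE ?addr_ge0 ?cmod_ge0 // cmodD.
by have := sqr_ge0 (cmod (a n) - cmod (b n)); nra.
Qed.

(** The series of [n^(-2s)] is controlled by the telescoping series of
    [n^(1-2s) - (n+1)^(1-2s)]. *)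
Lemma psum_wtV s : 1 / 2 < s -> exists M, bnd (fun n => (wt s n)^-1) M.
Proof.
move=> s12; pose r : R := 2 * s - 1.
have r0 : 0 < r by rewrite /r; lra.
have s0 : 0 <= s by apply: le_trans (ltW s12); rewrite divr_ge0.
have key k : (wt s k.+2%:Z)^-1 <= r^-1 * (k.+1%:R `^ (- r) - k.+2%:R `^ (- r)).
  have k1 : (0 : R) < k.+1%:R by rewrite ltr0n.
  have k12 : (k.+1%:R : R) < k.+2%:R by rewrite ltr_nat.
  have dF (x : R) : x \in `]k.+1%:R, k.+2%:R[%R ->
      is_derive x 1 (fun x : R => x `^ (- r)) (- r * x `^ (- r - 1)).
    rewrite in_itv /= => /andP[x1 _]; exact: is_derive1_powR (lt_trans k1 x1).
  have cF : {within `[(k.+1%:R : R), k.+2%:R], continuous (fun x : R => x `^ (- r))}.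
    apply: continuous_in_subspaceT => x; rewrite inE /= in_itv /= => /andP[x1 _].
    have [dx _] := is_derive1_powR (- r) (lt_le_trans k1 x1).
    exact/differentiable_continuous/derivable1_diffP.
  have [c] := MVT k12 dF cF; rewrite in_itv /= => /andP[c1 c2] E.
  have c0 : 0 < c := lt_trans k1 c1.
  have -> : k.+1%:R `^ (- r) - k.+2%:R `^ (- r) = r * c `^ (- (2 * s)).
    rewrite -opprB E (_ : - r - 1 = - (2 * s)); last by rewrite /r; ring.
    by rewrite (_ : k.+2%:R - k.+1%:R = 1); [ring|rewrite -(natrB _ (leqnSn _)) subSnn].
  rewrite mulKf ?gt_eqF // powRN lef_pV2 ?posrE ?powR_gt0 ?wt_gt0 //.
  rewrite powRrM /wt; apply: ge0_ler_powR => //; rewrite ?nnegrE ?powR_ge0 //.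
  rewrite (powR_mulrn 2 (ltW c0)); apply: (@le_trans _ _ (k.+2%:R ^+ 2)).
    by rewrite lerXn2r ?nnegrE ?ltW // ltW.
  by rewrite lerDr.
have sumle N : \sum_(k < N) (wt s k.+2%:Z)^-1 <= r^-1.
  apply: (@le_trans _ _ (\sum_(k < N) r^-1 * (k.+1%:R `^ (- r) - k.+2%:R `^ (- r)))).
    by apply: ler_sum.
  rewrite -mulr_sumr (_ : \sum_(k < N) _ = 1 - N.+1%:R `^ (- r)); last first.
    elim: N => [|N IH]; first by rewrite big_ord0 powR1 subrr.
    by rewrite big_ord_recr /= IH addrA subrK.
  by rewrite ler_piMr ?invr_ge0 ?ltW // gerBl powR_ge0.
have wN n : wt s (- n) = wt s n by rewrite /wt rmorphN /= sqrrN.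
have w1 n : (wt s n)^-1 <= 1.
  rewrite invf_le1 ?wt_gt0 // /wt -[leLHS](powRr0 (1 + n%:~R ^+ 2)).
  by apply: ler_powR; rewrite ?wt_base.
have w0 n : 0 <= (wt s n)^-1 by rewrite invr_ge0 wt_ge0.
exists (3 + r^-1 + r^-1) => N.
have sle N' : \sum_(k < N') (wt s k.+1%:Z)^-1 <= 1 + r^-1.
  case: N' => [|N']; first by rewrite big_ord0 addr_ge0 // invr_ge0 ltW.
  by rewrite big_ord_recl; apply: lerD => //; exact: sumle.
apply: (@le_trans _ _ ((1 + (1 + r^-1)) + (1 + r^-1))); last by lra.
apply: lerD; last first.
  apply: le_trans (sle N); apply: ler_sum => k _; by rewrite wN.
case: N => [|N]; first by rewrite big_ord0 !addr_ge0 // invr_ge0 ltW.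
by rewrite big_ord_recl; apply: lerD => //; exact: sle.
Qed.

(** A coefficient is bounded either by the inverse weight or by its weighted square, and
    the inverse weights are summable because [s > 1 / 2]. *)
Lemma hsc_absum s a : 1 / 2 < s -> hsc s a -> exists M, absum a M.
Proof.
move=> s12 [M aM]; have [M' wM'] := psum_wtV s12.
exists (M + M'); apply: bnd_le (bndD aM wM') => n.
have w0 := wt_gt0 s n; have [small|big] := leP (wt s n * cmod (a n)) 1.
  apply: le_trans (_ : (wt s n)^-1 <= _); last first.
    by rewrite lerDr mulr_ge0 ?wt_ge0 // sqr_ge0.
  by rewrite -[leRHS]mul1r ler_pdivlMr // mulrC.
apply: le_trans (_ : wt s n * cmod (a n) ^+ 2 <= _); last first.
  by rewrite lerDl invr_ge0 wt_ge0.
by rewrite expr2 mulrA ler_peMl ?cmod_ge0 // ltW.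
Qed.

Lemma hsc_delta s (m : int) (c : R[i]) : hsc s (fun n => if n == m then c else 0).
Proof.
pose u n : R := wt s n * cmod (if n == m then c else 0) ^+ 2.
exists (u m); suff key N : psum u N <= u m by exact: key.
have u0 n : n != m -> u n = 0 by move=> /negbTE nm; rewrite /u nm cmod0 expr0n mulr0.
have um : 0 <= u m by rewrite mulr_ge0 ?wt_ge0 // sqr_ge0.
have bound (f : nat -> int) : injective f -> \sum_(k < N) u (f k) <= u m.
  move=> fi; elim: N => [|K IH]; first by rewrite big_ord0.
  rewrite big_ord_recr /=; have [fK|/u0 ->] := eqVneq (f K) m; last by rewrite addr0.
  rewrite fK big1 ?add0r // => k _; apply: u0; rewrite -fK (inj_eq fi).
  by rewrite neq_ltn ltn_ord.
clearbody u; rewrite /psum; case: m um u0 bound => m' um u0 bound.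
  rewrite [X in _ + X]big1 ?addr0; last by move=> k _; apply: u0.
  by apply: bound => x y [].
rewrite [X in X + _]big1 ?add0r; last by move=> k _; apply: u0.
have ni : injective Negz by move=> x y [].
exact: bound Negz ni.
Qed.

(** The Cauchy-Schwarz inequality for the weights [d]. *)
Lemma sum_cauchy (K : nat) (d : nat -> R) (x : nat -> R) :
  (forall k, 0 <= d k) ->
  (\sum_(k < K) d k * x k) ^+ 2 <= (\sum_(k < K) d k) * (\sum_(k < K) d k * x k ^+ 2).
Proof.
move=> d0; elim: K => [|K IH]; first by rewrite !big_ord0 expr0n mul0r.
rewrite !big_ord_recr /=.
set S := \sum_(k < K) d k * x k in IH *; set P := \sum_(k < K) d k in IH *.
set Q := \sum_(k < K) d k * x k ^+ 2 in IH *.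
set p := d K; set y := x K; have p0 : 0 <= p by exact: d0.
have P0 : 0 <= P by exact: sumr_ge0.
have Q0 : 0 <= Q by apply: sumr_ge0 => k _; rewrite mulr_ge0 // sqr_ge0.
have -> : (S + p * y) ^+ 2 = S ^+ 2 + p * (2 * (S * y)) + (p * y) ^+ 2 by ring.
have -> : (P + p) * (Q + p * y ^+ 2) = P * Q + p * (P * y ^+ 2 + Q) + (p * y) ^+ 2 by ring.
rewrite lerD2r; apply: lerD => //; apply: ler_wpM2l => //.
have [P00|Pn0] := eqVneq P 0.
  have S0 : S = 0.
    apply/eqP; rewrite -sqrf_eq0 eq_le sqr_ge0 andbT; apply: le_trans IH _.
    by rewrite P00 mul0r.
  by rewrite S0 P00 !mul0r mulr0 add0r.
have Pp : 0 < P by rewrite lt_def Pn0.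
rewrite -(ler_pM2l Pp).
have := sqr_ge0 (P * y - S); nra.
Qed.

End Weights.

(** * Multiplication by exponentials *)

Section ExponentialMultiplier.
Variable R : realType.
Implicit Types (a b : int -> R[i]) (s : R) (c l : R[i]) (n m : int).

Lemma expR_partial_le (x : R) N : 0 <= x -> \sum_(k < N) exp_coeff x k <= expR x.
Proof.
move=> x0; rewrite -(big_mkord xpredT) -[leLHS]/(series (exp_coeff x) N).
apply: nondecreasing_cvgn_le; last exact: is_cvg_series_exp_coeff.
by apply: nondecreasing_series => n _ _; exact: exp_coeff_ge0.
Qed.

Lemma psum_cvg {T : Type} {F : set_system T} {FF : Filter F} (u : int -> T -> R[i]) a N :
  (forall n, u n @ F --> a n) -> psum (u ^~ x) N @[x --> F] --> psum a N.
Proof.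
move=> ua; apply: cvgCD.
  by apply: cvg_sumC => k _; exact: ua.
by apply: cvg_sumC => k _; exact: ua.
Qed.

Lemma psum_csum (u : nat -> int -> R[i]) M N :
  (forall n, majorized_by M (fun k => u k n)) ->
  psum (fun n => csum (fun k => u k n)) N = csum (fun k => psum (u k) N).
Proof.
move=> uM; apply/esym/csumE.
rewrite (_ : series _ = fun K => psum (fun n => series (fun k => u k n) K) N).
  by apply: psum_cvg => n; exact: dominated_cvg_series (uM n).
by apply/funext => K; rewrite /series /= psum_sum.
Qed.

(** The Fourier coefficients of the product with [exp (c l^m)]. *)
Definition expmul c m a (n : int) : R[i] :=
  csum (fun k : nat => cexp_coeff c k * a (n - m * k%:Z)).

Lemma expmul_majorized c m a M : absum a M -> forall n,
  majorized_by (fun k => exp_coeff (cmod c) k * M)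
    (fun k : nat => cexp_coeff c k * a (n - m * k%:Z)).
Proof.
move=> aM n; split=> [|k].
  apply/cvg_ex; exists (expR (cmod c) * M).
  rewrite (_ : series _ = fun N => series (exp_coeff (cmod c)) N * M).
    by apply: cvgM; [exact: is_cvg_series_exp_coeff|exact: cvg_cst].
  by apply/funext => N; rewrite /series /= mulr_suml.
rewrite cmodM cmod_cexp_coeff; apply: ler_wpM2l.
  exact: exp_coeff_ge0 (cmod_ge0 _).
exact: absum_term.
Qed.

Lemma wt_shiftX s n m k : 0 <= s ->
  wt s (n + m * k%:Z) <= ((2 * (1 + m%:~R ^+ 2)) `^ s) ^+ k * wt s n.
Proof.
move=> s0; elim: k => [|k IH]; first by rewrite mulr0 addr0 mul1r.
rewrite (_ : n + m * k.+1%:Z = n + m * k%:Z + m); last first.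
  by rewrite -addn1 PoszD mulrDr mulr1 addrA.
apply: le_trans (wt_shift _ _ s0) _; rewrite [X in _ <= X * _]exprS -mulrA.
by apply: ler_wpM2l IH; exact: powR_ge0.
Qed.

(** The Cauchy-Schwarz inequality with the weights [|c|^k / k!] bounds the square of a
    partial sum by a sum of squares of shifted coefficients. By [wt_shiftX] a shift by
    [m k] costs the factor [C^k], which the exponential series absorbs. *)
Lemma hsc_expmul s c m a M : 0 <= s -> absum a M -> hsc s a -> hsc s (expmul c m a).
Proof.
move=> s0 aM [B aB]; pose C : R := (2 * (1 + m%:~R ^+ 2)) `^ s.
have C0 : 0 <= C by exact: powR_ge0.
pose d k := exp_coeff (cmod c) k.
have d0 k : 0 <= d k by exact: exp_coeff_ge0 (cmod_ge0 _).
have B0 : 0 <= B.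
  by apply: le_trans (aB 0%N); rewrite psum0.
exists (expR (cmod c) * (expR (cmod c * C) * B)) => N.
pose bK K n := \sum_(k < K) cexp_coeff c k * a (n - m * k%:Z).
have part K : psum (fun n => wt s n * cmod (bK K n) ^+ 2) N <=
    expR (cmod c) * (expR (cmod c * C) * B).
  apply: (@le_trans _ _ (psum (fun n => expR (cmod c) *
     (\sum_(k < K) d k * C ^+ k * (wt s (n - m * k%:Z) * cmod (a (n - m * k%:Z)) ^+ 2))) N)).
    apply: psum_le => n; rewrite mulrC.
    apply: (@le_trans _ _ ((\sum_(k < K) d k * cmod (a (n - m * k%:Z))) ^+ 2 * wt s n)).
      apply: ler_wpM2r; first exact: wt_ge0.
      rewrite lerXn2r ?nnegrE ?cmod_ge0 //.
        by apply: sumr_ge0 => k _; rewrite mulr_ge0 ?cmod_ge0.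
      apply: le_trans (cmod_sum _ _ _) _; apply: ler_sum => k _.
      by rewrite cmodM cmod_cexp_coeff.
    apply: (@le_trans _ _ ((\sum_(k < K) d k) *
        (\sum_(k < K) d k * cmod (a (n - m * k%:Z)) ^+ 2) * wt s n)).
      apply: ler_wpM2r; first exact: wt_ge0.
      exact: (sum_cauchy K (fun k => cmod (a (n - m * k%:Z))) d0).
    rewrite -mulrA; apply: ler_pM.
    - exact: sumr_ge0.
    - by rewrite mulr_ge0 ?wt_ge0 //; apply: sumr_ge0 => k _; rewrite mulr_ge0 // sqr_ge0.
    - exact: expR_partial_le (cmod_ge0 _).
    rewrite mulr_suml; apply: ler_sum => k _.
    rewrite -(mulrA (d k) _ (wt s n)) -(mulrA (d k) (C ^+ k)).
    apply: ler_wpM2l; first exact: d0.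
    rewrite mulrC mulrA; apply: ler_wpM2r; first exact: sqr_ge0.
    by rewrite -{1}(subrK (m * k%:Z) n); exact: wt_shiftX.
  rewrite psum_scale; apply: ler_wpM2l; first exact: expR_ge0.
  rewrite psum_sum; apply: (@le_trans _ _ (\sum_(k < K) d k * C ^+ k * B)).
    apply: ler_sum => k _; rewrite psum_scale; apply: ler_wpM2l.
      by rewrite mulr_ge0 // exprn_ge0.
    apply: (bnd_shift (u := fun n => wt s n * cmod (a n) ^+ 2)) => // n.
    by rewrite mulr_ge0 ?wt_ge0 // sqr_ge0.
  rewrite -mulr_suml; apply: ler_wpM2r => //.
  apply: le_trans (expR_partial_le K _); last by rewrite mulr_ge0 ?cmod_ge0.
  by apply: ler_sum => k _; rewrite /d /exp_coeff [X in _ <= X / _]exprMn mulrAC.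
pose G n K : R[i] := ((wt s n * cmod (bK K n) ^+ 2)%:C).
have lim : psum (G ^~ K) N @[K --> \oo] -->
    psum (fun n => ((wt s n * cmod (expmul c m a n) ^+ 2)%:C : R[i])) N.
  apply: psum_cvg => n; apply: cvg_realc; apply: cvgM; first exact: cvg_cst.
  have h : cmod (bK K n) @[K --> \oo] --> cmod (expmul c m a n).
    apply: cvg_cmod; have := dominated_cvg_series (expmul_majorized c m aM n).
    rewrite (_ : series _ = bK ^~ n) //.
    by apply/funext => K; rewrite /series /= big_mkord.
  exact: (@cvgM _ _ _ _ _ _ _ _ h h).
have realE (u : int -> R) : psum (fun n => (u n)%:C : R[i]) N = (psum u N)%:C.
  by rewrite /psum rmorphD /= !rmorph_sum.
rewrite realE in lim.
have {}lim : psum (fun n => wt s n * cmod (bK K n) ^+ 2) N @[K --> \oo] -->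
    psum (fun n => wt s n * cmod (expmul c m a n) ^+ 2) N.
  by have /(_ _) := cvg_Re lim; under eq_fun do rewrite realE /=; exact.
by apply: (cvg_le_bound lim); exact: nearW.
Qed.

Lemma cmod_expz l n : S1 l -> cmod (l ^ n) = 1.
Proof.
move=> l1; have c1 : cmod l = 1 by rewrite cmodE l1.
by case: n => k; rewrite ?NegzE -?invr_expz -exprnP ?cmodV cmodX c1 expr1n ?invr1.
Qed.

Lemma absum_Xn a M l : S1 l -> absum a M -> absum (fun n => a n * l ^ n) M.
Proof.
move=> l1 aM; apply: absum_le aM _ => n.
by rewrite cmodM cmod_expz // mulr1.
Qed.

Lemma S1_neq0 l : S1 l -> l != 0.
Proof. by move=> l1; rewrite -normr_eq0 l1 oner_eq0. Qed.

(** The two summations are interchanged by Tannery's theorem, for the exponential series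
    as the outer one. *)
Lemma zsum_expmul c m a M M' l : absum a M -> absum (expmul c m a) M' -> S1 l ->
  zsum (fun n => expmul c m a n * l ^ n) = cexp (c * l ^ m) * zsum (fun n => a n * l ^ n).
Proof.
move=> aM bM l1; have l0 := S1_neq0 l1.
pose A n := a n * l ^ n; have AM : absum A M by exact: absum_Xn.
apply: (zsumE (absum_Xn l1 bM)).
have majA n : majorized_by (fun k => exp_coeff (cmod (c * l ^ m)) k * M)
    (fun k : nat => cexp_coeff (c * l ^ m) k * A (n - m * k%:Z)).
  exact: expmul_majorized.
rewrite (_ : psum _ = fun N => csum (fun k =>
    cexp_coeff (c * l ^ m) k * psum (fun n => A (n - m * k%:Z)) N)); last first.
  apply/funext => N; transitivity (psum (fun n =>
      csum (fun k => cexp_coeff (c * l ^ m) k * A (n - m * k%:Z))) N).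
    apply: eq_psum => n; rewrite mulrC /expmul.
    rewrite -(csumZ (l ^ n) (expmul_majorized c m aM n)); apply: eq_csum => k.
    rewrite /A /cexp_coeff exprMn mulrA -(mulrA (c ^+ k)).
    rewrite (_ : (l ^ m) ^+ k = l ^ (m * k%:Z)); last by rewrite exprnP exprz_exp.
    rewrite (_ : l ^ n = l ^ (m * k%:Z) * l ^ (n - m * k%:Z)); last first.
      by rewrite -expfzDr // addrC subrK.
    by ring.
  rewrite (psum_csum N majA); apply: eq_csum => k.
  by rewrite /psum -!mulr_sumr mulrDr.
rewrite (_ : cexp (c * l ^ m) * _ = csum (fun k => cexp_coeff (c * l ^ m) k * zsum A)).
  apply: (tannery (M := fun k => exp_coeff (cmod (c * l ^ m)) k * M)
    (phi := fun k N => cexp_coeff (c * l ^ m) k * psum (fun n => A (n - m * k%:Z)) N)).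
  - exact: (expmul_majorized (c * l ^ m) m AM 0).1.
  - apply: nearW => N k; rewrite cmodM cmod_cexp_coeff; apply: ler_wpM2l.
      exact: exp_coeff_ge0 (cmod_ge0 _).
    exact: cmod_psum_le (absum_shift (- (m * k%:Z)) AM).
  - move=> k; apply: cvgCM; first exact: cvg_cst.
    rewrite -(zsum_shift (- (m * k%:Z)) AM); apply: absum_cvg.
    exact: absum_shift AM.
rewrite -csum_cexp mulrC -(csumZ (zsum A) (cexp_coeff_dominated (c * l ^ m))).
by apply: eq_csum => k; rewrite mulrC.
Qed.

End ExponentialMultiplier.

(** * Fourier coefficients *)

Section FourierCoefficients.
Variable R : realType.
Implicit Types (a b : int -> R[i]) (g h : R[i] -> R[i]) (s t : R) (l : R[i]) (n m : int).

Lemma cis_exp t n : cis t ^ n = cis (n%:~R * t).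
Proof.
have pos (k : nat) : cis t ^ k%:Z = cis (k%:R * t).
  elim: k => [|k IH]; first by rewrite mul0r cis0.
  by rewrite -exprnP exprS exprnP IH -cisD -natr1 mulrDl mul1r addrC.
case: n => [k|k]; first by rewrite pos.
rewrite NegzE -invr_expz pos rmorphN /= mulNr.
have nz := S1_neq0 (S1_cis (k.+1%:R * t)).
by apply: (mulfI nz); rewrite mulfV // -cisD subrr cis0.
Qed.

Lemma cis_int_cts n : continuous (fun t : R => cis t ^ n).
Proof.
move=> t; have : {for t, continuous (fun t : R => cis (n%:~R * t))}.
  have c1 : {for t, continuous (fun t : R => n%:~R * t)}.
    by apply: cvgM; [exact: cvg_cst|exact: cvg_id].
  exact: (cvg_comp _ _ c1 (@cis_continuous R _)).
by under [X in {for _, continuous X} -> _]eq_fun do rewrite -cis_exp.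
Qed.

Lemma cint_cis n : cint 0 (2 * pi) (fun t : R => cis t ^ n) =
  if n == 0 then (2 * pi)%:C else 0.
Proof.
have [->|n0] := eqVneq n 0.
  by have := cint_cst (1 : R[i]) (pi2_ge0 R); rewrite subr0 mulr1.
pose F (t : R) := ('i%C * n%:~R%:C)^-1 * cis (n%:~R * t) : R[i].
have nC : n%:~R%:C != 0 :> R[i] by rewrite (inj_eq (@realc_inj R)) intr_eq0.
have i0 : 'i%C != 0 :> R[i] by rewrite eq_complex /= oner_eq0 andbF.
rewrite (@cint_FTC _ _ _ _ F) ?pi2_ge0 //.
- have -> : F (2 * pi) = F 0.
    rewrite /F mulr0 cis0 -cis_exp cis_2pi exp1rz //.
  by rewrite subrr.
- by apply: cts_within; exact: cis_int_cts.
- move=> t _; have d1 : is_derive t 1 (fun t : R => n%:~R * t) (n%:~R).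
    apply: (is_derive_eq (is_deriveM (is_derive_cst _ _ _) (is_derive_id t 1))).
    by rewrite /GRing.scale /= mulr0 addr0 mulr1.
  apply: (rder_eq (rderZ _ (rder_cis d1))); rewrite cis_exp.
  by rewrite (mulrA _ 'i%C) (mulrC _ 'i%C) mulrA mulVf ?mul1r // mulf_neq0.
Qed.

Lemma zsum_delta n (c : R[i]) : zsum (fun j => if j == n then c else 0) = c.
Proof.
have M0 : absum (fun j => if j == (0 : int) then c else 0) (cmod c).
  move=> N; case: N => [|N]; first by rewrite psum0 cmod_ge0.
  rewrite /psum big_ord_recl big1 ?addr0 => [|k _]; last by rewrite cmod0.
  by rewrite big1 ?addr0 // => k _; rewrite cmod0.
rewrite (@eq_zsum _ _ (fun j => (fun j => if j == (0 : int) then c else 0) (j + - n))).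
  rewrite (zsum_shift (- n) M0); apply: (zsumE M0).
  rewrite -cvg_shiftS (_ : (fun N => _) = fun=> c); first exact: cvg_cst.
  apply/funext => N /=; rewrite /psum big_ord_recl big1 ?addr0 //.
  by rewrite big1 ?addr0.
by move=> j /=; rewrite subr_eq0.
Qed.

Lemma absum_delta n (c : R[i]) : exists M, absum (fun j => if j == n then c else 0) M.
Proof.
have s1 : 1 / 2 < (1 : R) by rewrite ltr_pdivrMr // mul1r ltr1n.
exact: (hsc_absum s1 (hsc_delta 1 n c)).
Qed.

Lemma zsum_tail a M e : absum a M -> 0 < e :> R ->
  exists N0, forall N, (N0 <= N)%N ->
  forall b, (forall n, cmod (b n) <= cmod (a n)) -> cmod (zsum b - psum b N) < e.
Proof.
move=> aM e0; have [[c1 _] [c2 _]] := absum_majorized aM.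
have e20 : 0 < e / 2 by rewrite divr_gt0.
have [N1 _ N1P] := (cvgrPdist_lt _ _).1 c1 _ e20.
have [N2 _ N2P] := (cvgrPdist_lt _ _).1 c2 _ e20.
exists (maxn N1 N2) => N; rewrite geq_max => /andP[NN1 NN2] b ba.
have m1 : majorized_by (fun k => cmod (a k%:Z)) (fun k => b k%:Z) by split.
have m2 : majorized_by (fun k => cmod (a (- k.+1%:Z))) (fun k => b (- k.+1%:Z)) by split.
rewrite (_ : zsum b - psum b N =
  (csum (fun k => b k%:Z) - series (fun k => b k%:Z) N) +
  (csum (fun k => b (- k.+1%:Z)) - series (fun k => b (- k.+1%:Z)) N)); last first.
  by rewrite /zsum /psum /series /= !big_mkord opprD addrACA.
rewrite (splitr e); apply: le_lt_trans (cmodD _ _) _; apply: ltrD.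
  apply: le_lt_trans (dominated_tail N m1) _.
  exact: le_lt_trans (ler_norm _) (N1P N NN1).
apply: le_lt_trans (dominated_tail N m2) _.
exact: le_lt_trans (ler_norm _) (N2P N NN2).
Qed.

Lemma wiener_cts a M : absum a M ->
  continuous (fun t : R => zsum (fun n => a n * cis t ^ n)).
Proof.
move=> aM t.
apply: (@ztannery R _ _ (nbhs_pfilter t) (fun n => cmod (a n)) M
  (fun n (t : R) => a n * cis t ^ n)) => //.
- by move=> n; exact: cmod_ge0.
- apply: nearW => x n; rewrite cmodM cis_exp cmod_cis mulr1.
  exact: lexx.
- by move=> n; apply: cvgCM; [exact: cvg_cst|exact: cis_int_cts].
Qed.

Lemma pi2_neq0 : (2 * pi)%:C != 0 :> R[i].
Proof. by rewrite (inj_eq (@realc_inj R)) mulf_neq0 ?pnatr_eq0 // gt_eqF // pi_gt0. Qed.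

Lemma fourierE g n : fourier g n =
  ((2 * pi)%:C)^-1 * cint 0 (2 * pi) (fun t => g (cis t) * cis t ^ (- n)).
Proof. by rewrite /fourier fmorphV. Qed.

(** The symmetric partial sums converge uniformly on the circle, so the integral may be
    computed term by term. *)
Lemma fourier_rep g a M : absum a M ->
  (forall l, S1 l -> g l = zsum (fun n => a n * l ^ n)) ->
  forall n, fourier g n = a n.
Proof.
move=> aM ga n; rewrite fourierE.
suff -> : cint 0 (2 * pi) (fun t => g (cis t) * cis t ^ (- n)) = (2 * pi)%:C * a n.
  by rewrite mulrA mulVf ?mul1r // pi2_neq0.
pose b (t : R) j := a j * cis t ^ (j - n).
have bE (t : R) : g (cis t) * cis t ^ (- n) = zsum (b t).
  rewrite ga; last exact: S1_cis.
  rewrite mulrC -(zsumZ (cis t ^ (- n)) (absum_Xn (S1_cis t) aM)); apply: eq_zsum => j.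
  by rewrite mulrCA -expfzDr ?(S1_neq0 (S1_cis _)) // addrC.
have ba t j : cmod (b t j) <= cmod (a j).
  by rewrite /b cmodM cis_exp cmod_cis mulr1.
have cb : continuous (fun t => zsum (b t)).
  move=> t; apply: (@ztannery R _ _ (nbhs_pfilter t) (fun n => cmod (a n)) M
    (fun n (t : R) => b t n)) => //.
  - by move=> j; exact: cmod_ge0.
  - by apply: nearW => x j; exact: ba.
  - by move=> j; apply: cvgCM; [exact: cvg_cst|exact: cis_int_cts].
have cbj j : continuous (b ^~ j).
  by move=> t; apply: cvgCM; [exact: cvg_cst|exact: cis_int_cts].
have cps N : continuous (fun t => psum (b t) N).
  by move=> t; apply: (psum_cvg (u := fun j t => b t j)) => j; exact: cbj.
have cint_sum (I : Type) (r : seq I) (F : I -> R -> R[i]) :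
    (forall i, continuous (F i)) -> cint 0 (2 * pi) (fun t => \sum_(i <- r) F i t) =
    \sum_(i <- r) cint 0 (2 * pi) (F i).
  move=> cF; elim: r => [|i r IH].
    rewrite big_nil (@eq_cint _ _ _ _ (fun=> 0)) => [|t _]; last by rewrite big_nil.
    by have := cint_cst (0 : R[i]) (pi2_ge0 R); rewrite mulr0.
  rewrite big_cons -IH -cintD.
  - by apply: eq_cint => t _; rewrite big_cons.
  - exact: (@cts_within R 0 (2 * pi) _ (cF i)).
  - apply: cts_within => t.
    by apply: cvg_sumC => j _; exact: cF.
have ints N : cint 0 (2 * pi) (fun t => psum (b t) N) =
    psum (fun j => if j == n then (2 * pi)%:C * a n else 0) N.
  have one j : cint 0 (2 * pi) (b ^~ j) = if j == n then (2 * pi)%:C * a n else 0.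
    rewrite cintZ; last by apply: cts_within; exact: cis_int_cts.
    by rewrite cint_cis subr_eq0; case: eqP => [->|_]; [rewrite mulrC|rewrite mulr0].
  rewrite /psum cintD.
  - rewrite (@cint_sum _ (index_enum 'I_N) (fun k t => b t k%:Z)); last by move=> k; exact: cbj.
    rewrite (@cint_sum _ (index_enum 'I_N) (fun k t => b t (- k.+1%:Z))); last by move=> k; exact: cbj.
    by congr (_ + _); apply: eq_bigr => k _; exact: one.
  - apply: cts_within => t.
    by apply: cvg_sumC => k _; exact: cbj.
  - apply: cts_within => t.
    by apply: cvg_sumC => k _; exact: cbj.
rewrite (eq_cint (fun t _ => bE t)).
have [M' dM] := absum_delta n ((2 * pi)%:C * a n).
apply: (@cvgC_unique R nat \oo _ (fun N => psum (fun j => if j == n then (2 * pi)%:C * a n else 0) N));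
  last first.
  by rewrite -{2}(zsum_delta n ((2 * pi)%:C * a n)); exact: absum_cvg dM.
apply/cvgCP => e e0.
have p0 : 0 < 4 * pi + 1 :> R by rewrite ltr_wpDl // mulr_ge0 // pi_ge0.
have e'0 : 0 < e / (4 * pi + 1) by rewrite divr_gt0.
have [N0 N0P] := zsum_tail aM e'0.
exists N0 => // N /= NN; rewrite -ints cmodC -cintB; [|exact: (@cts_within R 0 (2 * pi) _ cb)|exact: (@cts_within R 0 (2 * pi) _ (cps N))].
apply: (@le_lt_trans _ _ (2 * (e / (4 * pi + 1)) * (2 * pi - 0))).
  apply: cmod_cint_le; first exact: pi2_ge0.
    exact: (within_ctsB (@cts_within R 0 (2 * pi) _ cb) (@cts_within R 0 (2 * pi) _ (cps N))).
  by move=> t _; apply/ltW/N0P => // j; exact: ba.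
rewrite subr0 (_ : 2 * _ * _ = e * (4 * pi) / (4 * pi + 1)); last first.
  have alg (x q : R) : 4 * q + 1 != 0 -> 2 * (x / (4 * q + 1)) * (2 * q) = x * (4 * q) / (4 * q + 1).
    by move=> h; field.
  exact: alg (lt0r_neq0 p0).
by rewrite ltr_pdivrMr // ltr_pM2l // ltrDl.
Qed.

Lemma esum_int (u : int -> R) : (forall n, 0 <= u n) ->
  (\esum_(n in [set: int]) (u n)%:E =
   \sum_(k <oo) (u k%:Z)%:E + \sum_(k <oo) (u (- k.+1%:Z))%:E)%E.
Proof.
move=> u0; have u0E n : (0 <= (u n)%:E)%E by rewrite lee_fin.
rewrite (esumID (range Posz)) //; congr (_ + _)%E.
  rewrite setTI (@esum_image _ _ _ setT Posz) //; last by move=> x y _ _ [].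
  by rewrite -nneseries_esumT.
rewrite setTI (_ : ~` range Posz = range Negz); last first.
  apply/seteqP; split=> [[k|k] /= h|_ [k _ <-] [j _]] //.
    by exfalso; apply: h; exists k.
  by exists k.
rewrite (@esum_image _ _ _ setT Negz) //; last by move=> x y _ _ [].
by rewrite -nneseries_esumT.
Qed.

Lemma esum_bnd (u : int -> R) : (forall n, 0 <= u n) ->
  (\esum_(n in [set: int]) (u n)%:E < +oo)%E <-> exists M, bnd u M.
Proof.
move=> u0; rewrite esum_int //.
have p0 (v : nat -> R) : (forall k, 0 <= v k) -> (0 <= \sum_(k <oo) (v k)%:E)%E.
  by move=> v0; apply: nneseries_ge0 => k _ _; rewrite lee_fin.
have le1 (v : nat -> R) N : (forall k, 0 <= v k) ->
    ((\sum_(k < N) v k)%:E <= \sum_(k <oo) (v k)%:E)%E.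
  move=> v0; rewrite -sumEFin -(big_mkord xpredT (fun k => (v k)%:E)).
  by apply: nneseries_lim_ge => k _ _; rewrite lee_fin.
split=> [fin|[M uM]].
  have u0p k : 0 <= u k%:Z by []. have u0n k : 0 <= u (- k.+1%:Z) by [].
  set X := (\sum_(k <oo) (u k%:Z)%:E)%E in fin *.
  set Y := (\sum_(k <oo) (u (- k.+1%:Z))%:E)%E in fin *.
  have XY : (0 <= X + Y)%E by apply: adde_ge0; apply: p0.
  exists (fine (X + Y)) => N; rewrite -lee_fin fineK ?ge0_fin_numE //.
  by rewrite /psum EFinD; apply: leeD; exact: le1.
have le2 (v : nat -> R) : (forall k, 0 <= v k) -> (forall N, \sum_(k < N) v k <= M) ->
    (\sum_(k <oo) (v k)%:E <= M%:E)%E.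
  move=> v0 vM; apply: lime_le.
    by apply: is_cvg_nneseries => k _ _; rewrite lee_fin.
  by apply: nearW => N; rewrite big_mkord sumEFin lee_fin.
apply: (@le_lt_trans _ _ (M%:E + M%:E)%E); last by rewrite -EFinD ltry.
apply: leeD; apply: le2 => // N; apply: le_trans (uM N).
  by rewrite lerDl sumr_ge0.
by rewrite lerDr sumr_ge0.
Qed.

(** By [Hs_rep] and [Hrep_fourier] this says that [g] is in [H^s] and that its Fourier
    coefficients are the [a n]. *)
Definition Hrep s g a := hsc s a /\
  forall l, S1 l -> g l = zsum (fun n => a n * l ^ n).

Lemma wt_HsE s g n : (1 + n%:~R ^+ 2) `^ s * (complex.Re `|fourier g n|) ^+ 2 =
  wt s n * cmod (fourier g n) ^+ 2.
Proof. by rewrite cmodE. Qed.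

Lemma Hs_rep s g : 1 / 2 < s -> Hs s g -> Hrep s g (fourier g).
Proof.
move=> s12 [fin lim].
have hs : hsc s (fourier g).
  apply/esum_bnd; first by move=> n; rewrite mulr_ge0 ?wt_ge0 // sqr_ge0.
  by under eq_esum do rewrite -wt_HsE.
split=> // l l1; have [M aM] := hsc_absum s12 hs.
exact: (cvgC_unique (lim l l1) (absum_cvg (absum_Xn l1 aM))).
Qed.

Lemma Hrep_fourier s g a : 1 / 2 < s -> Hrep s g a -> forall n, fourier g n = a n.
Proof. by move=> s12 [/(hsc_absum s12)[M aM]]; exact: fourier_rep aM. Qed.

Lemma Hrep_Hs s g a : 1 / 2 < s -> Hrep s g a -> Hs s g.
Proof.
move=> s12 /[dup] ga [hs gE]; have fE := Hrep_fourier s12 ga.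
have [M aM] := hsc_absum s12 hs; split.
  under eq_esum do rewrite wt_HsE fE.
  by apply/esum_bnd => // n; rewrite mulr_ge0 ?wt_ge0 // sqr_ge0.
move=> l l1; rewrite gE //; have := absum_cvg (absum_Xn l1 aM).
rewrite /psum; under [X in X @ _ --> _ -> _]eq_fun => N do
  (under eq_bigr do rewrite -fE; under [X in _ + X]eq_bigr do rewrite -fE).
exact.
Qed.

Lemma HrepD s g h a b : 1 / 2 < s -> Hrep s g a -> Hrep s h b ->
  Hrep s (fun l => g l + h l) (fun n => a n + b n).
Proof.
move=> s12 [ha gE] [hb hE]; split; first exact: hscD.
have [M aM] := hsc_absum s12 ha; have [M' bM] := hsc_absum s12 hb.
move=> l l1; rewrite gE // hE // -(zsumD (absum_Xn l1 aM) (absum_Xn l1 bM)).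
by apply: eq_zsum => n; rewrite mulrDl.
Qed.

Lemma HrepZ s c g a : 1 / 2 < s -> Hrep s g a -> Hrep s (fun l => c * g l) (fun n => c * a n).
Proof.
move=> s12 [ha gE]; split; first exact: hscZ.
have [M aM] := hsc_absum s12 ha.
move=> l l1; rewrite gE // -(zsumZ c (absum_Xn l1 aM)).
by apply: eq_zsum => n; rewrite mulrA.
Qed.

Lemma eq_Hrep s g h a : (forall l, S1 l -> g l = h l) -> Hrep s g a -> Hrep s h a.
Proof. by move=> gh [ha gE]; split=> // l l1; rewrite -gh // gE. Qed.

Lemma Hrep_cst s (c : R[i]) : Hrep s (fun=> c) (fun n => if n == 0 then c else 0).
Proof.
split; first exact: hsc_delta.
move=> l l1; rewrite -[LHS](zsum_delta 0); apply: eq_zsum => n.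
by case: eqP => [->|_]; rewrite ?mulr1 ?mul0r.
Qed.

Lemma Hrep_cexp s c m g a : 1 / 2 < s -> Hrep s g a ->
  Hrep s (fun l => cexp (c * l ^ m) * g l) (expmul c m a).
Proof.
move=> s12 [ha gE]; have [M aM] := hsc_absum s12 ha.
have s0 : 0 <= s by apply: le_trans (ltW s12); rewrite divr_ge0.
have hb := hsc_expmul c m s0 aM ha; have [M' bM] := hsc_absum s12 hb.
by split=> // l l1; rewrite gE // (zsum_expmul aM bM).
Qed.

Lemma Hrep_proj s a (p : pred int) : hsc s a ->
  Hrep s (fun l => zsum (fun n => (if p n then a n else 0) * l ^ n))
    (fun n => if p n then a n else 0).
Proof.
move=> ha; split=> //; apply: hsc_le ha _ => n.
by case: ifP => // _; rewrite cmod0 cmod_ge0.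
Qed.

End FourierCoefficients.

(** * The disk algebra *)

Section DiskAlgebra.
Variable R : realType.
Implicit Types (f g : R[i] -> R[i]) (w u l c : R[i]) (a : nat -> R[i]) (M : nat -> R).
Local Notation disk := (@disk R).
Local Notation odisk := (@odisk R).

Lemma within_disk_proper w : disk w -> ProperFilter (within disk (nbhs w)).
Proof.
move=> dw; apply: Build_ProperFilter_ex => P; rewrite /within /= => h.
by exists w; exact: (nbhs_singleton h).
Qed.

(** The disk algebra. *)
Definition diskfun f :=
  (forall w, disk w -> f x @[x --> within disk (nbhs w)] --> f w) /\
  holomorphic odisk f.

Lemma diskfun_within f : diskfun f -> {within disk, continuous f}.
Proof. by move=> [fc _]; apply/subspace_continuousP => w /fc. Qed.

Lemma diskfun_cst c : diskfun (fun=> c).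
Proof. by split=> [w _|w _]; [exact: cvg_cst|exact: derivable_cst]. Qed.

Lemma diskfunD f g : diskfun f -> diskfun g -> diskfun (fun w => f w + g w).
Proof.
move=> [fc fh] [gc gh]; split=> w dw; last exact: (derivableD (fh w dw) (gh w dw)).
by have := within_disk_proper dw => pf; exact: (cvgCD (fc w dw) (gc w dw)).
Qed.

Lemma diskfunM f g : diskfun f -> diskfun g -> diskfun (fun w => f w * g w).
Proof.
move=> [fc fh] [gc gh]; split=> w dw; last exact: (derivableM (fh w dw) (gh w dw)).
by have := within_disk_proper dw => pf; exact: (cvgCM (fc w dw) (gc w dw)).
Qed.

Lemma diskfunN f : diskfun f -> diskfun (fun w => - f w).
Proof.
move=> fd; rewrite (_ : (fun _ => _) = fun w => (-1) * f w).
  exact: diskfunM (diskfun_cst _) fd.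
by apply/funext => w; rewrite mulN1r.
Qed.

Lemma diskfunB f g : diskfun f -> diskfun g -> diskfun (fun w => f w - g w).
Proof. by move=> fd gd; exact: (diskfunD fd (diskfunN gd)). Qed.

Lemma diskfun_sum (I : Type) (r : seq I) (F : I -> R[i] -> R[i]) :
  (forall i, diskfun (F i)) -> diskfun (fun w => \sum_(i <- r) F i w).
Proof.
move=> Fd; elim: r => [|i r IH].
  rewrite (_ : (fun _ => _) = fun=> 0); first exact: diskfun_cst.
  by apply/funext => w; rewrite big_nil.
rewrite (_ : (fun _ => _) = fun w => F i w + \sum_(j <- r) F j w).
  exact: (diskfunD (Fd i) IH).
by apply/funext => w; rewrite big_cons.
Qed.

Lemma derivable_comp_affine f u z : derivable f (u * z) 1 ->
  derivable (fun w => f (u * w)) z 1.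
Proof.
move=> /derivable1_diffP df; apply/derivable1_diffP.
have du : differentiable (fun w : R[i] => u * w) z.
  by apply/derivable1_diffP; apply: derivableM; [exact: derivable_cst|exact: derivable_id].
exact: (differentiable_comp du df).
Qed.

Lemma diskfun_entire f : (forall z, derivable f z 1) -> diskfun f.
Proof.
move=> fh; split=> w _; last exact: fh.
apply: cvg_within_filter.
by apply: (@holomorphic_continuous _ setT) => // z _.
Qed.

Lemma diskfun_cexp c : diskfun (fun w => cexp (c * w ^+ 2)).
Proof.
apply: diskfun_entire => z; apply/derivable1_diffP.
have du : differentiable (fun w : R[i] => c * w ^+ 2) z.
  by apply/derivable1_diffP; apply: derivableM; [exact: derivable_cst|exact: exprn_derivable].
have df : differentiable (@cexp R) (c * z ^+ 2) by exact/derivable1_diffP/cexp_holomorphic.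
exact: (differentiable_comp du df).
Qed.

Lemma odisk_disk w : odisk w -> disk w.
Proof. exact: ltW. Qed.

Lemma disk_cmod w : disk w <-> cmod w <= 1.
Proof. by rewrite /disk /= normE lecR. Qed.

Lemma odisk_cmod w : odisk w <-> cmod w < 1.
Proof. by rewrite /odisk /= normE ltcR. Qed.

Lemma S1_cmod l : S1 l <-> cmod l = 1.
Proof. by rewrite /S1 /= normE; split=> [/realc_inj|->]. Qed.

Lemma S1_disk l : S1 l -> disk l.
Proof. by move=> l1; rewrite /disk /= l1. Qed.

Lemma S1V l : S1 l -> S1 l^-1.
Proof. by move=> /S1_cmod l1; apply/S1_cmod; rewrite cmodV l1 invr1. Qed.

Lemma S1M l u : S1 l -> S1 u -> S1 (l * u).
Proof. by move=> /S1_cmod l1 /S1_cmod u1; apply/S1_cmod; rewrite cmodM l1 u1 mulr1. Qed.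

Lemma S1_conj l : S1 l -> conjc l = l^-1.
Proof.
move=> l1; have l0 := S1_neq0 l1; apply: (mulfI l0); rewrite mulfV //.
by rewrite -cmod_sqr (S1_cmod _).1 // expr1n.
Qed.

Lemma within_disk_map (k : R[i] -> R[i]) w : {for w, continuous k} ->
  (forall x, disk x -> disk (k x)) ->
  k @ within disk (nbhs w) --> within disk (nbhs (k w)).
Proof.
move=> kc kd P hP; have := kc _ hP; rewrite !nbhs_simpl /= => h.
by apply: filterS h => x /= h dx; apply: h; exact: kd.
Qed.

Lemma diskfun_rot u f : S1 u -> diskfun f -> diskfun (fun w => f (u * w)).
Proof.
move=> /S1_cmod u1 [fc fh]; split=> w dw.
  have du x : disk x -> disk (u * x).
    by move=> dx; apply/disk_cmod; rewrite cmodM u1 mul1r; apply/disk_cmod.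
  have kc : {for w, continuous (fun x => u * x)} by apply: ctsZ; exact: cvg_id.
  exact: (cvg_comp _ _ (within_disk_map kc du) (fc _ (du _ dw))).
apply: derivable_comp_affine; apply: fh.
by apply/odisk_cmod; rewrite cmodM u1 mul1r; apply/odisk_cmod.
Qed.

Lemma conj_continuous z : {for z, continuous (fun w : R[i] => conjc w)}.
Proof. by apply: (cts_conj (f := id)); exact: cvg_id. Qed.

(** The difference quotients of the reflected function are the conjugates of those of
    [f]. *)
Lemma diskfun_conj f : diskfun f -> diskfun (fun w => conjc (f (conjc w))).
Proof.
move=> [fc fh]; split=> w dw.
  have dc x : disk x -> disk (conjc x).
    by move=> dx; apply/disk_cmod; rewrite cmod_conj; apply/disk_cmod.
  have pf := within_disk_proper dw.
  have h := cvg_comp _ _ (within_disk_map (@conj_continuous w) dc) (fc _ (dc _ dw)).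
  exact: (cvg_conjc h).
have dc : odisk (conjc w) by apply/odisk_cmod; rewrite cmod_conj; apply/odisk_cmod.
have [d dP] := holomorphic_frechet fh dc.
apply/cvg_ex; exists (conjc d); apply/cvgCP => e e0.
have e20 : 0 < e / 2 by rewrite divr_gt0.
have /nearCP[r r0 rP] := dP _ e20.
apply/nbhs_ballP; exists r%:C; first by rewrite /= ltcR.
move=> h; rewrite /ball /= /ball_ /= normE ltcR add0r cmodN => hd h0.
have := rP (conjc w + conjc h); rewrite addrAC subrr add0r cmod_conj => /(_ hd) le1.
rewrite /GRing.scale /= mulr1 (addrC h) conjcD.
have hn0 : 0 < cmod h by rewrite lt_def cmod_eq0 h0 cmod_ge0.
rewrite -(cmod_conj (_ - conjc d)) conjcB conjcM conjcB !conjcK.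
have ch0 : conjc h != 0 by rewrite -cmod_eq0 cmod_conj cmod_eq0.
have -> : conjc h^-1 = (conjc h)^-1 by rewrite fmorphV.
rewrite (_ : _ - d = (conjc h)^-1 * (f (conjc w + conjc h) - f (conjc w) - d * conjc h)); last by field.
rewrite cmodM cmodV cmod_conj mulrC ltr_pdivrMr //; apply: le_lt_trans le1 _.
by rewrite ltr_pM2r // ltr_pdivrMr // ltr_pMr // ltr1n.
Qed.

Lemma diskfun_circle f : diskfun f -> continuous (fun t : R => f (cis t)).
Proof.
move=> /diskfun_within fc.
apply: (within_comp fc); first exact: cis_continuous.
by move=> t; apply: S1_disk; exact: S1_cis.
Qed.

(** A function holomorphic both inside and outside the unit circle is constant: the
    mean over the circle of [|f - f 0|^2] is that of the product of [f - f 0] with the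
    reflection of its continuation across the circle, hence vanishes. *)
Lemma disk_liouville f g : diskfun f -> diskfun g ->
  (forall l, S1 l -> f l^-1 = g l) -> forall l, S1 l -> g l = f 0.
Proof.
(* The mean gives no information at the ends of the interval [0 < t < 2 pi]; the
   rotation by [- l] moves the point [l] to [t = pi]. *)
move=> fd gd fg l l1; pose u := - l; pose c := f 0.
have u1 : S1 u by apply/S1_cmod; rewrite cmodN; apply/S1_cmod.
pose h w := (g (u * w) - c) * (conjc (f (conjc (u * w))) - conjc c).
have hd : diskfun h.
  apply: diskfunM; apply: diskfunB; try exact: diskfun_cst.
    exact: (diskfun_rot u1 gd).
  exact: (diskfun_rot u1 (diskfun_conj fd)).
have hE t : h (cis t) = (cmod (g (u * cis t) - c) ^+ 2)%:C.
  have s1 : S1 (u * cis t) by apply: S1M => //; exact: S1_cis.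
  have := fg _ s1; rewrite -(S1_conj s1) => fgE.
  by rewrite /h fgE cmod_sqr conjcB.
have := mean_value (diskfun_within hd) hd.2.
rewrite {2}/h mulr0 conjc0 subrr mulr0 mulr0 => h0.
have {}h0 : cint 0 (2 * pi) (fun t => (cmod (g (u * cis t) - c) ^+ 2)%:C) = 0.
  by rewrite -h0; apply: eq_cint => t _; rewrite hE.
have pi0 : 0 < 2 * pi :> R by rewrite mulr_gt0 // pi_gt0.
have gc : continuous (fun t : R => g (u * cis t) - c).
  exact: (diskfun_circle (diskfunB (diskfun_rot u1 gd) (diskfun_cst c))).
have := cint_cmod2_eq0 pi0 gc h0.
move=> /(_ pi); rewrite pi_gt0 ltr_pMl ?pi_gt0 // ltr1n => /(_ isT) /eqP.
rewrite (_ : cis pi = -1); last by rewrite /cis cospi sinpi; apply/eqP; rewrite eq_complex /= oppr0 !eqxx.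
by rewrite /u mulrNN mulr1 subr_eq0 => /eqP.
Qed.

(** The exponents start at [1], since the two projections have no constant term. *)
Definition ps a w := csum (fun k => a k * w ^+ k.+1).

Lemma ps0 a : ps a 0 = 0.
Proof.
apply: csumE; rewrite (_ : series _ = fun=> 0); first exact: cvg_cst.
apply/funext => N; rewrite /series /= big1 // => k _.
by rewrite expr0n mulr0.
Qed.

Lemma geometric_le (r : R) k : 0 <= r < 1 -> k.+1%:R * r ^+ k <= (1 - r)^-1.
Proof.
move=> /andP[r0 r1]; have r10 : 0 < 1 - r by rewrite subr_gt0.
rewrite -[leRHS]mul1r ler_pdivlMr //.
apply: (@le_trans _ _ ((\sum_(j < k.+1) r ^+ j) * (1 - r))).
  apply: ler_wpM2r; first exact: ltW.
  rewrite mulr_natl -[in leLHS](card_ord k.+1) -sumr_const; apply: ler_sum => j _.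
  by apply: ler_wiXn2l => //; [exact: ltW|rewrite -ltnS].
rewrite mulrC -[X in X * _]opprB mulNr -subrX1 opprB lerBlDr lerDl.
exact: exprn_ge0.
Qed.

Lemma cts_id w : {for w, continuous (fun x : R[i] => x)}.
Proof. exact: cvg_id. Qed.

Lemma ctsX n w : {for w, continuous (fun x : R[i] => x ^+ n)}.
Proof.
elim: n => [|n IH]; first exact: cts_cst.
have c : {for w, continuous (fun x : R[i] => x * x ^+ n)} 
  by exact: (ctsM (@cts_id w) IH).
by under [X in {for _, continuous X}]eq_fun do rewrite exprS.
Qed.

Lemma ps_majorized a M w : majorized_by M a -> disk w ->
  majorized_by M (fun k => a k * w ^+ k.+1).
Proof.
move=> [cM aM] /disk_cmod dw; split=> // k.
rewrite cmodM cmodX; apply: le_trans (aM k).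
by rewrite ler_piMr ?cmod_ge0 // exprn_ile1 ?cmod_ge0.
Qed.

(** The difference quotient of [w^(k + 1)] is a geometric sum, bounded near a point of
    the open disk independently of [k] by [geometric_le]; so Tannery's theorem
    differentiates the series. *)
Lemma ps_diskfun a M : majorized_by M a -> diskfun (ps a).
Proof.
move=> /[dup] maj [cM aM]; split=> w dw.
  have pf := within_disk_proper dw.
  apply: (tannery (M := M) (phi := fun k w => a k * w ^+ k.+1)) => //.
    apply: (@filterS _ _ (nbhs_filter w) setT); last exact: filterT.
    by move=> x _ dx; exact: (ps_majorized maj dx).2.
  move=> k; apply: cvgCM; first exact: cvg_cst.
  have c : {for w, continuous (fun x : R[i] => x ^+ k.+1)} by exact: ctsX.
  exact: (@cvg_within_filter _ _ _ _ _ _ _ c).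
move/odisk_cmod in dw.
pose r := (cmod w + 1) / 2.
have r1 : r < 1 by rewrite /r ltr_pdivrMr //; lra.
have wr : cmod w < r by rewrite /r ltr_pdivlMr //; lra.
have r0 : 0 <= r by apply: le_trans (ltW wr); exact: cmod_ge0.
pose phi k (h : R[i]) := a k * \sum_(i < k.+1) (w + h) ^+ (k - i) * w ^+ i.
apply/cvg_ex; exists (csum (fun k => phi k 0)).
have cM' : cvgn (series (fun k => M k * (1 - r)^-1)).
  rewrite (_ : series _ = fun N => series M N * (1 - r)^-1).
    by apply: is_cvgM => //; exact: is_cvg_cst.
  by apply/funext => N; rewrite /series /= mulr_suml.
have lim : csum (phi ^~ h) @[h --> 0^'] --> csum (fun k => phi k 0).
  apply: (tannery (M := fun k => M k * (1 - r)^-1)) => //.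
    have d0 : 0 < r - cmod w by rewrite subr_gt0.
    apply: nbhs_dnbhs; apply/nearCP; exists (r - cmod w) => // h; rewrite subr0 => hh k.
    rewrite /phi cmodM; apply: ler_pM => //; try exact: cmod_ge0.
    apply: le_trans (geometric_le k _); last by rewrite r0.
    apply: le_trans (cmod_sum _ _ _) _.
    rewrite mulr_natl -[in leRHS](card_ord k.+1) -sumr_const; apply: ler_sum => j _.
    have jk : (j <= k)%N by rewrite -ltnS.
    rewrite (_ : r ^+ k = r ^+ (k - j) * r ^+ j); last by rewrite -exprD subnK.
    rewrite cmodM !cmodX; apply: ler_pM.
    - by rewrite exprn_ge0 // cmod_ge0.
    - by rewrite exprn_ge0 // cmod_ge0.
    - rewrite lerXn2r ?nnegrE ?cmod_ge0 //; apply: le_trans (cmodD _ _) _.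
      by rewrite -lerBrDl ltW.
    by rewrite lerXn2r ?nnegrE ?cmod_ge0 // ltW.
  move=> k; apply: cvg_within_filter.
  apply: cvgCM; first exact: cvg_cst.
  apply: cvg_sumC => j _; apply: cvgCM; last exact: cvg_cst.
  have c1 : {for 0, continuous (fun h : R[i] => w + h)}.
    exact: (ctsD (@cts_cst R w 0) (@cts_id 0)).
  exact: (cvg_comp _ _ c1 (@ctsX (k - j) (w + 0))).
apply: cvg_trans lim; apply: near_eq_cvg; near=> h.
have h0 : h != 0 by near: h; exact: nbhs_dnbhs_neq.
have hw : disk (w + h).
  apply/disk_cmod; apply: le_trans (cmodD _ _) _; rewrite -lerBrDl.
  rewrite -(subr0 h); near: h; apply: nbhs_dnbhs; apply/nearCP.
  by exists (1 - cmod w); [rewrite subr_gt0|move=> h /ltW].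
rewrite /GRing.scale /= mulr1 (addrC h); apply: csumE.
rewrite (_ : series _ = fun N => h^-1 * (series (fun k => a k * (w + h) ^+ k.+1) N -
    series (fun k => a k * w ^+ k.+1) N)); last first.
  apply/funext => N; rewrite /series /= -sumrB mulr_sumr; apply: eq_bigr => k _.
  rewrite /phi -mulrBr subrXX (_ : w + h - w = h); last by rewrite addrAC subrr add0r.
  by rewrite (mulrCA (a k)) mulKf.
apply: cvgCM; first exact: cvg_cst.
apply: cvgCB; apply: dominated_cvg_series; apply: ps_majorized maj _ => //.
by apply: odisk_disk; apply/odisk_cmod.
Unshelve. all: by end_near. Qed.

End DiskAlgebra.

(** * The complexified affine group *)

Section AffineGroup.
Variable R : realType.
Implicit Types (G H A B : 'M[R[i]]_4) (T S V : 'cV[R[i]]_4) (c l : R[i]) (s : R).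

Lemma affM G T H S : aff G T *m aff H S = aff (G *m H) (G *m S + T).
Proof.
by rewrite /aff mulmx_block !mulmx0 !mul0mx !addr0 !add0r !mulmx1.
Qed.

Lemma aff1 : aff 1%:M 0 = 1%:M :> 'M[R[i]]_(4 + 1).
Proof. by rewrite /aff -scalar_mx_block. Qed.

Lemma linpart_aff G T : linpart (aff G T) = G.
Proof. exact: block_mxKul. Qed.

Lemma trpart_aff G T : trpart (aff G T) = T.
Proof. exact: block_mxKur. Qed.

Lemma aff_inj G T H S : aff G T = aff H S -> G = H /\ T = S.
Proof.
move=> E; have := congr1 (@linpart R) E; have := congr1 (@trpart R) E.
by rewrite !linpart_aff !trpart_aff.
Qed.

Lemma aff_lie G T A V : aff G T *m lie A V = lie (G *m A) (G *m V).
Proof. by rewrite /aff /lie mulmx_block !mulmx0 !mul0mx !addr0. Qed.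

Lemma invmx_aff G T H : G *m H = 1%:M -> invmx (aff G T) = aff H (- (H *m T)).
Proof.
move=> GH; have E : aff G T *m aff H (- (H *m T)) = 1%:M.
  by rewrite affM GH mulmxN mulmxA GH mul1mx addNr aff1.
have [u _] := mulmx1_unit E.
by rewrite -[RHS](mulKmx u) E mulmx1.
Qed.

Lemma aff_entries (T : Type) (P : (T -> R[i]) -> Prop) (G : T -> 'M[R[i]]_4)
    (V : T -> 'cV[R[i]]_4) :
  (forall c, P (fun=> c)) -> (forall i j, P (fun x => G x i j)) ->
  (forall i, P (fun x => V x i 0)) ->
  forall i j, P (fun x => aff (G x) (V x) i j).
Proof.
move=> Pc PG PV i j; rewrite /aff.
case: (split_ordP i) => i' ->; case: (split_ordP j) => j' ->.
- by under eq_fun do rewrite block_mxEul.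
- under eq_fun do rewrite block_mxEur.
  by rewrite ord1.
- by under eq_fun do rewrite block_mxEdl mxE.
- by under eq_fun do rewrite block_mxEdr.
Qed.

Lemma GvecC_expLi A : GvecC A <-> exists2 B, G0C B & exists c, A = B *m expLi c.
Proof.
split=> [[B [C [B0 [c ->] ->]]]|[B B0 [c ->]]].
  by exists B => //; exists c; rewrite expmx_Li.
by exists B, (expLi c); split=> //; exists c; rewrite expmx_Li.
Qed.

Lemma GvecC_tr A : GvecC A -> A^T *m A = 1%:M /\ A *m A^T = 1%:M.
Proof.
move=> /GvecC_expLi[B B0 [c ->]]; rewrite trmx_mul tr_expLi; split.
  by rewrite mulmxA -(mulmxA (expLi _)) G0C_trV // mulmx1 expLiKN.
by rewrite mulmxA -(mulmxA B) expLiNK mulmx1; exact: G0C_tr.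
Qed.

Lemma GrpC_expLi c A T : G0C A -> GrpC (aff (expLi c *m A) T).
Proof.
move=> A0; exists (expLi c *m A), T; split=> //; apply/GvecC_expLi; exists A => //.
by exists c; rewrite expLi_commute // G0C_Li.
Qed.

Lemma GrpC_aff (M : 'M[R[i]]_(4 + 1)) : GrpC M ->
  M = aff (linpart M) (trpart M) /\ GvecC (linpart M).
Proof. by move=> [G [T [G0 ->]]]; rewrite linpart_aff trpart_aff. Qed.

Lemma tau_aff G T : tau (aff G T) = aff (- (Lj *m G *m Lj)) (- (Lj *m T)).
Proof. by rewrite /tau linpart_aff trpart_aff. Qed.

Lemma tau_expLi c A T : G0C A -> tau (aff (expLi c *m A) T) = aff (expLi (- c) *m A) (- (Lj *m T)).
Proof.
move=> A0; rewrite tau_aff; congr (aff _ _).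
by rewrite mulmxA Lj_expLi -!mulmxA G0C_Lj // (mulmxA Lj) Lj_sqr mulNmx mul1mx mulmxN opprK.
Qed.

End AffineGroup.

(** * Uniqueness of the Birkhoff factorization *)

Section BirkhoffUniqueness.
Variable R : realType.
Implicit Types (s : R) (l w : R[i]).

Lemma holomorphic_on_disk_entries (W : R[i] -> 'M[R[i]]_(4 + 1)) :
  holomorphic_on_disk W <->
  (forall w, disk w -> GrpC (W w)) /\ forall i j, diskfun (fun w => W w i j).
Proof.
split=> [[gW cW hW]|[gW dW]].
  by split=> // i j; split; [apply/subspace_continuousP/cW|exact: hW].
split=> // i j; [exact: diskfun_within (dW i j)|exact: (dW i j).2].
Qed.

Lemma diskfun_mulmx m n p (A : R[i] -> 'M[R[i]]_(m, n)) (B : R[i] -> 'M[R[i]]_(n, p)) :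
  (forall i j, diskfun (fun w => A w i j)) -> (forall i j, diskfun (fun w => B w i j)) ->
  forall i j, diskfun (fun w => (A w *m B w) i j).
Proof.
move=> dA dB i j; rewrite (_ : (fun _ => _) = fun w => \sum_k A w i k * B w k j).
  by apply: diskfun_sum => k; exact: diskfunM.
by apply/funext => w; rewrite mxE.
Qed.

Lemma diskfun_mxB m n (A B : R[i] -> 'M[R[i]]_(m, n)) :
  (forall i j, diskfun (fun w => A w i j)) -> (forall i j, diskfun (fun w => B w i j)) ->
  forall i j, diskfun (fun w => (A w - B w) i j).
Proof.
move=> dA dB i j; rewrite (_ : (fun _ => _) = fun w => A w i j - B w i j).
  exact: (diskfunB (dA i j) (dB i j)).
by apply/funext => w; rewrite !mxE.
Qed.

Lemma mx_liouville m n (A B : R[i] -> 'M[R[i]]_(m, n)) :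
  (forall i j, diskfun (fun w => A w i j)) -> (forall i j, diskfun (fun w => B w i j)) ->
  (forall l, S1 l -> A l^-1 = B l) -> forall l, S1 l -> B l = A 0.
Proof.
move=> dA dB AB l l1; apply/matrixP => i j.
by apply: (disk_liouville (dA i j) (dB i j)) => // u u1; rewrite AB.
Qed.

(** Two factorizations differ by a loop that extends to both sides of the circle, hence
    is constant, and its value is read off at infinity. The linear parts are compared
    first; once they agree, the same argument applies to the translation parts. *)
Lemma birkhoff_unique s (g gm gp hm hp : R[i] -> 'M[R[i]]_(4 + 1)) :
  birkhoff s g gm gp -> birkhoff s g hm hp ->
  forall l, S1 l -> hm l = gm l /\ hp l = gp l.
Proof.
move=> [[_ [W [/holomorphic_on_disk_entries[gW dW] W0 gmW]]] [_ [Z [/holomorphic_on_disk_entries[gZ dZ] gpZ]]] gE].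
move=> [[_ [W' [/holomorphic_on_disk_entries[gW' dW'] W'0 hmW]]] [_ [Z' [/holomorphic_on_disk_entries[gZ' dZ'] hpZ]]] hE].
have lin (M : R[i] -> 'M[R[i]]_(4 + 1)) : (forall i j, diskfun (fun w => M w i j)) ->
    forall i j, diskfun (fun w => linpart (M w) i j).
  move=> dM i j; rewrite (_ : (fun _ => _) = fun w => M w (lshift 1 i) (lshift 1 j)) //.
  by apply/funext => w; rewrite /linpart !mxE.
have trp (M : R[i] -> 'M[R[i]]_(4 + 1)) : (forall i j, diskfun (fun w => M w i j)) ->
    forall i j, diskfun (fun w => trpart (M w) i j).
  move=> dM i j; rewrite (_ : (fun _ => _) = fun w => M w (lshift 1 i) (rshift 4 j)) //.
  by apply/funext => w; rewrite /trpart !mxE.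
have trd m n (M : R[i] -> 'M[R[i]]_(m, n)) : (forall i j, diskfun (fun w => M w i j)) ->
    forall i j, diskfun (fun w => (M w)^T i j).
  by move=> dM i j; under eq_fun do rewrite mxE.
have WV l : S1 l -> disk l^-1 by move=> l1; exact/S1_disk/S1V.
have prod l : S1 l ->
    linpart (W l^-1) *m linpart (Z l) = linpart (W' l^-1) *m linpart (Z' l) /\
    linpart (W l^-1) *m trpart (Z l) + trpart (W l^-1) =
    linpart (W' l^-1) *m trpart (Z' l) + trpart (W' l^-1).
  move=> l1; have := gE l l1; rewrite hE // gmW // gpZ // hmW // hpZ //.
  rewrite (GrpC_aff (gW _ (WV l l1))).1 (GrpC_aff (gW' _ (WV l l1))).1.
  rewrite (GrpC_aff (gZ _ (S1_disk l1))).1 (GrpC_aff (gZ' _ (S1_disk l1))).1.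
  rewrite !affM !linpart_aff !trpart_aff.
  by move=> /aff_inj[-> ->].
have tW w : disk w -> (linpart (W w))^T *m linpart (W w) = 1%:M /\
    linpart (W w) *m (linpart (W w))^T = 1%:M.
  by move=> dw; apply: GvecC_tr; exact: (GrpC_aff (gW w dw)).2.
have tW' w : disk w -> (linpart (W' w))^T *m linpart (W' w) = 1%:M /\
    linpart (W' w) *m (linpart (W' w))^T = 1%:M.
  by move=> dw; apply: GvecC_tr; exact: (GrpC_aff (gW' w dw)).2.
have tZ w : disk w -> (linpart (Z w))^T *m linpart (Z w) = 1%:M /\
    linpart (Z w) *m (linpart (Z w))^T = 1%:M.
  by move=> dw; apply: GvecC_tr; exact: (GrpC_aff (gZ w dw)).2.
have l10 : linpart 1%:M = 1%:M :> 'M[R[i]]_4 by rewrite -aff1 linpart_aff.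
have t10 : trpart 1%:M = 0 :> 'cV[R[i]]_4 by rewrite -aff1 trpart_aff.
pose A w := (linpart (W' w))^T *m linpart (W w).
pose B w := linpart (Z' w) *m (linpart (Z w))^T.
have AB l : S1 l -> A l^-1 = B l.
  move=> l1; have [p1 _] := prod l l1; rewrite /A /B.
  rewrite -[LHS]mulmx1 -(tZ l (S1_disk l1)).2 !mulmxA -(mulmxA _ (linpart (W _))).
  by rewrite p1 !mulmxA (tW' _ (WV l l1)).1 mul1mx.
have dA i j : diskfun (fun w => A w i j).
  by apply: diskfun_mulmx => {}i {}j; [apply: trd|]; apply: lin.
have dB i j : diskfun (fun w => B w i j).
  by apply: diskfun_mulmx => {}i {}j; [|apply: trd]; apply: lin.
have A0 : A 0 = 1%:M by rewrite /A W'0 W0 l10 trmx1 mulmx1.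
have B1 l : S1 l -> B l = 1%:M by move=> l1; rewrite (mx_liouville dA dB AB) // A0.
have Weq l : S1 l -> linpart (W' l^-1) = linpart (W l^-1).
  move=> l1; have := AB l l1; rewrite B1 // /A => E.
  by rewrite -[LHS]mulmx1 -E mulmxA (tW' _ (WV l l1)).2 mul1mx.
have Zeq l : S1 l -> linpart (Z' l) = linpart (Z l).
  move=> l1; have := B1 l l1; rewrite /B => E.
  by rewrite -[RHS]mul1mx -E -mulmxA (tZ _ (S1_disk l1)).1 mulmx1.
pose C w := (linpart (W w))^T *m (trpart (W w) - trpart (W' w)).
pose E w := trpart (Z' w) - trpart (Z w).
have CE l : S1 l -> C l^-1 = E l.
  move=> l1; have [_] := prod l l1; rewrite Weq // => p2; rewrite /C /E.
  have -> : trpart (W l^-1) - trpart (W' l^-1) =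
      linpart (W l^-1) *m (trpart (Z' l) - trpart (Z l)).
    rewrite mulmxBr; apply/eqP; rewrite subr_eq addrAC -p2.
    by rewrite addrAC subrr add0r.
  by rewrite mulmxA (tW _ (WV l l1)).1 mul1mx.
have dC i j : diskfun (fun w => C w i j).
  apply: diskfun_mulmx => {}i {}j; first by apply: trd; apply: lin.
  by apply: (diskfun_mxB (A := fun w => trpart (W w))); apply: trp.
have dE i j : diskfun (fun w => E w i j).
  by apply: (diskfun_mxB (A := fun w => trpart (Z' w))); apply: trp.
have E0 l : S1 l -> E l = 0.
  by move=> l1; rewrite (mx_liouville dC dE CE) // /C W0 W'0 t10 subrr mulmx0.
move=> l l1; have dV := WV l l1; have dl := S1_disk l1.
rewrite hmW // gmW // hpZ // gpZ //.
rewrite (GrpC_aff (gW _ dV)).1 (GrpC_aff (gW' _ dV)).1.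
rewrite (GrpC_aff (gZ _ dl)).1 (GrpC_aff (gZ' _ dl)).1 Weq // Zeq //.
have /eqP := E0 l l1; rewrite /E subr_eq0 => /eqP ->; split=> //.
congr (aff _ _); have := CE l l1; rewrite E0 // /C => /(congr1 (mulmx (linpart (W l^-1)))).
by rewrite mulmxA (tW _ dV).2 mul1mx mulmx0 => /eqP; rewrite subr_eq0 => /eqP ->.
Qed.

End BirkhoffUniqueness.

(** * Existence of the Birkhoff factorization *)

Section VectorLoops.
Variables (R : realType) (s : R).
Hypothesis s12 : 1 / 2 < s.
Implicit Types (V : R[i] -> 'cV[R[i]]_4) (v w : int -> 'cV[R[i]]_4) (c l : R[i]) (n m : int).

Lemma Hrep0 : Hrep s (fun=> 0) (fun=> 0 : R[i]).
Proof.
have [h1 h2] := Hrep_cst s (0 : R[i]); split.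
  by apply: hsc_le h1 _ => n; rewrite cmod0 cmod_ge0.
move=> l l1; rewrite [LHS](h2 l l1); apply: eq_zsum => n.
by case: ifP; rewrite mul0r.
Qed.

Lemma Hrep_sum (I : Type) (r : seq I) (g : I -> R[i] -> R[i]) (a : I -> int -> R[i]) :
  (forall i, Hrep s (g i) (a i)) ->
  Hrep s (fun l => \sum_(i <- r) g i l) (fun n => \sum_(i <- r) a i n).
Proof.
move=> ga; elim: r => [|i r IH].
  under eq_fun do rewrite big_nil; under [X in Hrep _ _ X]eq_fun do rewrite big_nil.
  exact: Hrep0.
under eq_fun do rewrite big_cons; under [X in Hrep _ _ X]eq_fun do rewrite big_cons.
exact: (HrepD s12 (ga i) IH).
Qed.

Lemma eq_Hrepr (g : R[i] -> R[i]) (a b : int -> R[i]) : a =1 b -> Hrep s g a -> Hrep s g b.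
Proof. by move=> /funext ->. Qed.

Lemma Hrep_unique (g h : R[i] -> R[i]) a b : Hrep s g a -> Hrep s h b ->
  (forall l, S1 l -> g l = h l) -> a =1 b.
Proof.
move=> ga hb gh n; rewrite -(Hrep_fourier s12 ga n).
have hb' : Hrep s g b by apply: eq_Hrep hb => l l1; rewrite gh.
by rewrite (Hrep_fourier s12 hb').
Qed.

Lemma S1_i : S1 ('i%C : R[i]).
Proof. by apply/S1_cmod; exact: cmodi. Qed.

Lemma Hrep_turn (g : R[i] -> R[i]) a : Hrep s g a ->
  Hrep s (fun l => g ('i%C * l)) (fun n => 'i%C ^ n * a n).
Proof.
move=> [ha gE]; split.
  by apply: hsc_le ha _ => n; rewrite cmodM cmod_expz ?mul1r //; exact: S1_i.
move=> l l1; rewrite gE; last exact: (S1M S1_i l1).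
apply: eq_zsum => n; rewrite exprzMl; first by rewrite mulrA (mulrC (a n)).
  by rewrite unitfE (S1_neq0 S1_i).
by rewrite unitfE (S1_neq0 l1).
Qed.

Definition vrep V v := forall i, Hrep s (fun l => V l i 0) (fun n => v n i 0).

Lemma vrep_unique V V' v w : vrep V v -> vrep V' w ->
  (forall l, S1 l -> V l = V' l) -> forall n, v n = w n.
Proof.
move=> Vv Vw VV n; apply/colP => i.
by apply: (Hrep_unique (Vv i) (Vw i)) => l l1; rewrite VV.
Qed.

Lemma vrep_exists V : (forall i, Hs s (fun l => V l i 0)) ->
  vrep V (fun n => \col_i fourier (fun l => V l i 0) n).
Proof.
by move=> VH i; under [X in Hrep _ _ X]eq_fun do rewrite mxE; exact: Hs_rep.
Qed.

Lemma vrepD V V' v w : vrep V v -> vrep V' w ->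
  vrep (fun l => V l + V' l) (fun n => v n + w n).
Proof.
move=> Vv Vw i; under eq_fun do rewrite mxE; under [X in Hrep _ _ X]eq_fun do rewrite mxE.
exact: (HrepD s12 (Vv i) (Vw i)).
Qed.

Lemma vrep_mul A V v : vrep V v -> vrep (fun l => A *m V l) (fun n => A *m v n).
Proof.
move=> Vv i; under eq_fun do rewrite mxE; under [X in Hrep _ _ X]eq_fun do rewrite mxE.
by apply: Hrep_sum => j; exact: (HrepZ (A i j) s12 (Vv j)).
Qed.

Lemma vrep_turn V v : vrep V v -> vrep (fun l => V ('i%C * l)) (fun n => 'i%C ^ n *: v n).
Proof.
by move=> Vv i; under [X in Hrep _ _ X]eq_fun do rewrite mxE; exact: (Hrep_turn (Vv i)).
Qed.

(** [expLi (c l^m)] is a combination of the exponentials of [i c l^m] and of [- i c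
    l^m]. *)
Lemma vrep_expLi c m V v : vrep V v ->
  exists w, vrep (fun l => expLi (c * l ^ m) *m V l) w.
Proof.
move=> Vv; pose p i := expmul ('i%C * c) m (fun n => v n i 0).
pose q i := expmul (- ('i%C * c)) m (fun n => v n i 0).
have pq i : Hrep s (fun l => cexp ('i%C * c * l ^ m) * V l i 0) (p i) /\
    Hrep s (fun l => cexp (- ('i%C * c) * l ^ m) * V l i 0) (q i).
  by split; exact: (Hrep_cexp _ _ s12 (Vv i)).
have cos_rep : vrep (fun l => ccos (c * l ^ m) *: V l)
    (fun n => \col_i (2^-1 * (p i n + q i n))).
  move=> i; under [X in Hrep _ _ X]eq_fun do rewrite mxE.
  apply: eq_Hrep (HrepZ 2^-1 s12 (HrepD s12 (pq i).1 (pq i).2)) => l _.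
  by rewrite mxE /ccos !mulrA mulNr -mulrDl mulrA (mulrC 2^-1).
have sin_rep : vrep (fun l => csin (c * l ^ m) *: V l)
    (fun n => \col_i ('i%C / 2 * (q i n + -1 * p i n))).
  move=> i; under [X in Hrep _ _ X]eq_fun do rewrite mxE.
  apply: eq_Hrep (HrepZ ('i%C / 2) s12 (HrepD s12 (pq i).2 (HrepZ (-1) s12 (pq i).1))) => l _.
  rewrite mxE /csin (_ : - ('i%C * c) * l ^ m = - ('i%C * (c * l ^ m))); last by rewrite mulNr mulrA.
  rewrite -[_ * c * _]mulrA; move: (cexp ('i%C * _)) (cexp (- _)) (V l i 0) => x y z.
  by ring.
exists (fun n => \col_i (2^-1 * (p i n + q i n)) + Li *m \col_i ('i%C / 2 * (q i n + -1 * p i n))).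
have := vrepD cos_rep (vrep_mul Li sin_rep).
rewrite (_ : (fun l => ccos _ *: _ + _) = fun l => expLi (c * l ^ m) *m V l) //.
apply/funext => l; rewrite /expLi mulmxDl mul_scalar_mx -scalemxAl.
by rewrite -scalemxAr.
Qed.

Lemma expLi_entry (z : R[i]) i j : expLi z i j = ccos z * (i == j)%:R + csin z * Li i j.
Proof. by rewrite /expLi; move: Li => L; rewrite !mxE mulr_natr. Qed.

Lemma diskfun_expLi c i j : diskfun (fun w : R[i] => expLi (c * w ^+ 2) i j).
Proof.
under eq_fun do rewrite expLi_entry /ccos /csin.
have E (w : R[i]) : - ('i%C * (c * w ^+ 2)) = - ('i%C * c) * w ^+ 2 by rewrite mulNr mulrA.
under eq_fun do rewrite E mulrA.
have h1 := diskfun_cexp ('i%C * c); have h2 := diskfun_cexp (- ('i%C * c)).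
apply: diskfunD; apply: (diskfunM _ (diskfun_cst _)); apply: (diskfunM _ (diskfun_cst _)).
  exact: (diskfunD h1 h2).
exact: (diskfunM (diskfunB h2 h1) (diskfun_cst _)).
Qed.

Definition twisted V := forall l, S1 l -> V ('i%C * l) = - (Lj *m V l).

Lemma twisted_coeff V v : vrep V v -> twisted V -> forall n, 'i%C ^ n *: v n = - (Lj *m v n).
Proof.
move=> Vv Vt; have h := vrep_mul (- Lj) Vv.
move=> n; rewrite -mulNmx; apply: (vrep_unique (vrep_turn Vv) h) => l l1.
by rewrite Vt // mulNmx.
Qed.

(** At frequency zero the twisting reads [v 0 = - Lj (v 0)], whereas [Lj] has no
    eigenvalue [- 1]. *)
Lemma twisted_coeff0 V v : vrep V v -> twisted V -> v 0 = 0.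
Proof.
move=> Vv /(twisted_coeff Vv)/(_ 0); rewrite scale1r => E.
have E2 : Lj *m v 0 = v 0.
  by rewrite [in LHS]E mulmxN mulmxA Lj_sqr mulNmx mul1mx opprK.
apply/colP => i; rewrite mxE; have : v 0 i 0 *+ 2 = 0.
  by rewrite mulr2n {1}E E2 mxE addNr.
by move/eqP; rewrite mulrn_eq0 /= => /eqP.
Qed.

Lemma Qminus_zsum V v l : vrep V v -> S1 l -> forall i,
  Qminus V l i 0 = ps (fun k => v (- k.+1%:Z) i 0) l^-1 /\
  Qminus V l i 0 = zsum (fun n => (if n < 0 then v n i 0 else 0) * l ^ n).
Proof.
move=> Vv l1 i.
have E k : v (- k.+1%:Z) i 0 * l ^ (- k.+1%:Z) = v (- k.+1%:Z) i 0 * l^-1 ^+ k.+1.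
  by rewrite exprVn -invr_expz.
have QE : Qminus V l i 0 = ps (fun k => v (- k.+1%:Z) i 0) l^-1.
  rewrite mxE /ps /csum /series; congr (limn _); apply/funext => N /=.
  rewrite big_mkord; apply: eq_bigr => k _.
  by rewrite (Hrep_fourier s12 (Vv i)) E.
split=> //; rewrite QE /zsum (_ : csum _ = 0) ?add0r.
  by apply: eq_csum => k /=; rewrite -E.
apply: csumE; rewrite (_ : series _ = fun=> 0); first exact: cvg_cst.
by apply/funext => N; rewrite /series /= big1 // => k _; rewrite mul0r.
Qed.

Lemma Qplus_ps V v l i : vrep V v -> Qplus V l i 0 = ps (fun k => v k.+1%:Z i 0) l.
Proof.
move=> Vv; rewrite mxE /ps /csum /series; congr (limn _); apply/funext => N /=.
by rewrite big_mkord; apply: eq_bigr => k _; rewrite (Hrep_fourier s12 (Vv i)).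
Qed.

Lemma csum_shift (a : nat -> R[i]) M : majorized_by M a -> a 0%N = 0 ->
  csum (fun k => a k.+1) = csum a.
Proof.
move=> aM a0; apply: csumE; have := dominated_cvg_series aM; rewrite -(cvg_shiftS (series a)).
rewrite (_ : (fun n : nat => series a n.+1) = series (fun k => a k.+1)) //.
by apply/funext => N; rewrite /series /= big_nat_recl // a0 add0r.
Qed.

Lemma Q_split V v l : vrep V v -> v 0 = 0 -> S1 l -> V l = Qminus V l + Qplus V l.
Proof.
move=> Vv v0 l1; apply/colP => i; rewrite mxE.
rewrite (Qminus_zsum Vv l1 i).2 (Qplus_ps _ _ Vv) (Vv i).2 //.
have [M aM] := hsc_absum s12 (Vv i).1.
have [maj _] := absum_majorized (absum_Xn l1 aM).
rewrite [LHS]/zsum [X in _ = X + _]/zsum [X in _ = X + _ + _](_ : _ = 0); last first.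
  apply: csumE; rewrite (_ : series _ = fun=> 0); first exact: cvg_cst.
  by apply/funext => N; rewrite /series /= big1 // => k _; rewrite mul0r.
rewrite add0r addrC; congr (_ + _).
by rewrite -(csum_shift maj) // v0 mxE mul0r.
Qed.

Lemma Qminus_rep V v : vrep V v ->
  vrep (Qminus V) (fun n => if n < 0 then v n else 0).
Proof.
move=> Vv i; have h := Hrep_proj (fun n : int => n < 0) (Vv i).1.
have h' : Hrep s (fun l => Qminus V l i 0) (fun n => if n < 0 then v n i 0 else 0).
  by apply: eq_Hrep h => l l1; rewrite (Qminus_zsum Vv l1 i).2.
by apply: eq_Hrepr h' => n; case: ifP => // _; rewrite mxE.
Qed.

Lemma Qplus_rep V v : vrep V v -> v 0 = 0 ->
  vrep (Qplus V) (fun n => v n + -1 *: (if n < 0 then v n else 0)).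
Proof.
move=> Vv v0 i; have := vrepD Vv (vrep_mul (-1)%:M (Qminus_rep Vv)).
move=> /(_ i) h; have h' : Hrep s (fun l => Qplus V l i 0)
    (fun n => (v n + (-1)%:M *m (if n < 0 then v n else 0)) i 0).
  apply: eq_Hrep h => l l1; rewrite mul_scalar_mx scaleN1r {1}(Q_split Vv v0 l1).
  by rewrite addrAC subrr add0r.
by apply: eq_Hrepr h' => n; rewrite mul_scalar_mx.
Qed.

Lemma vrep_ps_diskfun V v i : vrep V v ->
  diskfun (ps (fun k => v (- k.+1%:Z) i 0)) /\ diskfun (ps (fun k => v k.+1%:Z i 0)).
Proof.
move=> /(_ i)[hv _]; have [M aM] := hsc_absum s12 hv.
have [[m1 _] [m2 _]] := absum_majorized aM; split.
  by apply: (@ps_diskfun _ _ (fun k => cmod (v (- k.+1%:Z) i 0))).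
have [[m3 _] _] := absum_majorized (absum_shift 1 aM).
apply: (@ps_diskfun _ _ (fun k => cmod (v (k%:Z + 1) i 0))); split=> // k.
by rewrite addrC -intS.
Qed.

Lemma twisted_Q V v : vrep V v -> twisted V ->
  forall l, S1 l -> Qminus V ('i%C * l) = - (Lj *m Qminus V l) /\
    Qplus V ('i%C * l) = - (Lj *m Qplus V l).
Proof.
move=> Vv Vt l l1; have v0 := twisted_coeff0 Vv Vt.
have il1 := S1M S1_i l1.
have Qm : Qminus V ('i%C * l) = - (Lj *m Qminus V l).
  have h1 := vrep_turn (Qminus_rep Vv); have h2 := vrep_mul (- Lj) (Qminus_rep Vv).
  apply/colP => i; rewrite -mulNmx (h1 i).2 // (h2 i).2 //.
  apply: eq_zsum => n; congr (_ * _); case: ifP => _; last by rewrite scaler0 mulmx0.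
  by rewrite (twisted_coeff Vv Vt) mulNmx.
split=> //; have := Vt l l1; rewrite (Q_split Vv v0 il1) Qm {1}(Q_split Vv v0 l1).
by rewrite mulmxDr opprD => /addrI.
Qed.

(** With [E] the exponential of [c l^-2 Li], the left factor has linear part [E] and
    carries the negative part of [E^-1 X]. This leaves on the right the exponential of
    [d l^2 Li], which is entire in [l], and the positive part of [E^-1 X]. *)
Lemma birkhoff_factors (c d : R[i]) (M : 'M[R[i]]_4) (F : R[i] -> 'M[R[i]]_4)
    (X : R[i] -> 'cV[R[i]]_4) (x : int -> 'cV[R[i]]_4) :
  G0C M -> vrep X x -> twisted X ->
  (forall l, S1 l -> F l = expLi (c * l ^ (-2) + d * l ^ 2) *m M) ->
  let V l := expLi (- (c * l ^ (-2))) *m X l in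
  birkhoff s (fun l => aff (F l) (X l))
    (fun l => aff (expLi (c * l ^ (-2))) (expLi (c * l ^ (-2)) *m Qminus V l))
    (fun l => aff (expLi (- (c * l ^ (-2))) *m F l) (Qplus V l)).
Proof.
move=> M0 Xx Xt FE V.
have [v Vv] : exists v, vrep V v.
  have [v vv] := vrep_expLi (- c) (-2) Xx; exists v.
  by move=> i; apply: eq_Hrep (vv i) => l _; rewrite /V mulNr.
have i2 : ('i%C : R[i]) ^ (2 : int) = -1 by rewrite -exprnP expr2 sqri.
have il l m : S1 l -> ('i%C * l) ^ m = 'i%C ^ m * l ^ m.
  move=> l1; apply: exprzMl; rewrite unitfE; [exact: (S1_neq0 S1_i)|exact: S1_neq0 l1].
have il2 l : S1 l -> c * ('i%C * l) ^ (-2) = - (c * l ^ (-2)).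
  by move=> l1; rewrite il // -[X in _ * (X * _)]invr_expz i2 invrN1 mulN1r mulrN.
have Vt : twisted V.
  move=> l l1; rewrite /V il2 // Xt // opprK mulmxN mulmxA.
  by rewrite Lj_expLi opprK mulmxA.
have v0 := twisted_coeff0 Vv Vt.
have UpE l : S1 l -> expLi (- (c * l ^ (-2))) *m F l = expLi (d * l ^ 2) *m M.
  by move=> l1; rewrite FE // mulmxA -expLiD addKr.
have HE (e : R[i]) (m : int) (N : 'M[R[i]]_4) i j :
    exists a, Hrep s (fun l => (expLi (e * l ^ m) *m N) i j) a.
  have h : vrep (fun l => col j N) (fun n => \col_i (if n == 0 then N i j else 0)).
    move=> k; under [X in Hrep _ _ X]eq_fun do rewrite mxE.
    by under [X in Hrep _ X _]eq_fun do rewrite mxE; exact: Hrep_cst.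
  have [w hw] := vrep_expLi e m h; exists (fun n => w n i 0).
  apply: eq_Hrep (hw i) => l _.
  by rewrite !mxE; apply: eq_bigr => k _; rewrite !mxE.
have HsE1 (e : R[i]) (m : int) i j : Hs s (fun l => expLi (e * l ^ m) i j).
  have [a] := HE e m 1%:M i j; under [X in Hrep _ X _]eq_fun do rewrite mulmx1.
  exact: Hrep_Hs s12.
split.
- split.
    split.
    + apply: aff_entries; [by move=> a; exact: Hrep_Hs s12 (Hrep_cst s a)|exact: HsE1|].
      have [w hw] := vrep_expLi c (-2) (Qminus_rep Vv).
      by move=> i; exact: Hrep_Hs s12 (hw i).
    + by move=> l l1; rewrite -[X in aff X]mulmx1; exact: GrpC_expLi (G0C_1 R).
    + move=> l l1; rewrite il2 // -[expLi (c * l ^ (-2))]mulmx1 tau_expLi; last exact: G0C_1.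
      rewrite !(mulmx1 (expLi _)) (twisted_Q Vv Vt l1).1 mulmxN; congr (aff _ (- _)).
      by rewrite [RHS]mulmxA Lj_expLi -mulmxA.
  exists (fun w : R[i] => aff (expLi (c * w ^+ 2))
    (expLi (c * w ^+ 2) *m \col_i ps (fun k => v (- k.+1%:Z) i 0) w)); split.
  + apply/holomorphic_on_disk_entries; split.
      by move=> u _; rewrite -[X in aff X]mulmx1; exact: GrpC_expLi (G0C_1 R).
    apply: aff_entries; [exact: diskfun_cst|exact: diskfun_expLi|] => i.
    apply: diskfun_mulmx => [i' j'|i' j']; first exact: diskfun_expLi.
    by under [X in diskfun X]eq_fun do rewrite mxE; exact: (vrep_ps_diskfun i' Vv).1.
  + by rewrite expr0n mulr0 expLi0 mul1mx -aff1; congr (aff _ _); apply/colP => i; rewrite !mxE ps0.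
  + move=> l l1; rewrite (_ : l^-1 ^+ 2 = l ^ (-2)); last by rewrite exprVn.
    congr (aff _ (_ *m _)); apply/colP => i.
    by rewrite (Qminus_zsum Vv l1 i).1 mxE.
- split.
    split.
    + apply: aff_entries; [by move=> a; exact: Hrep_Hs s12 (Hrep_cst s a)| |].
        move=> i j; have [a ha] := HE d 2 M i j; apply: Hrep_Hs s12 (eq_Hrep _ ha) => l l1.
        by rewrite UpE.
      by move=> i; exact: Hrep_Hs s12 (Qplus_rep Vv v0 i).
    + by move=> l l1; rewrite UpE //; exact: GrpC_expLi.
    + move=> l l1; rewrite (UpE l l1) (UpE _ (S1M S1_i l1)).
      rewrite (tau_expLi _ _ M0) (twisted_Q Vv Vt l1).2.
      by rewrite (_ : d * ('i%C * l) ^ 2 = - (d * l ^ 2)) // (il _ _ l1) i2 mulN1r mulrN.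
  exists (fun w : R[i] => aff (expLi (d * w ^+ 2) *m M) (\col_i ps (fun k => v k.+1%:Z i 0) w)); split.
  + apply/holomorphic_on_disk_entries; split.
      by move=> w _; exact: GrpC_expLi.
    apply: aff_entries; first exact: diskfun_cst.
      by apply: diskfun_mulmx => i' j'; [exact: diskfun_expLi|exact: diskfun_cst].
    by move=> i; under [X in diskfun X]eq_fun do rewrite mxE; exact: (vrep_ps_diskfun i Vv).2.
  + move=> l l1; rewrite UpE //; congr (aff _ _); apply/colP => i.
    by rewrite (Qplus_ps _ _ Vv) mxE.
move=> l l1; rewrite affM mulmxA expLiNK mul1mx; congr (aff _ _).
rewrite -mulmxDr addrC -(Q_split Vv v0 l1) /V mulmxA expLiNK mul1mx //.
Qed.

End VectorLoops.

(** * Termwise differentiation *)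

Section TermwiseDifferentiation.
Variable R : realType.
Implicit Types (f g : R -> R[i]) (t : R).

Lemma slope_rder f t d : rder f t d ->
  (h^-1%:C * (f (h + t) - f t)) @[h --> 0^'] --> d.
Proof.
move=> [[cr er] [ci ei]].
have dr : h^-1 *: (((fun x : R => complex.Re (f x)) \o shift t) h%:A -
   complex.Re (f t)) @[h --> 0^'] --> complex.Re d by rewrite -er; exact: cr.
have di : h^-1 *: (((fun x : R => complex.Im (f x)) \o shift t) h%:A -
   complex.Im (f t)) @[h --> 0^'] --> complex.Im d by rewrite -ei; exact: ci.
rewrite -[X in _ --> X]complexK.
have := @cvg_complex R R 0^' _ _ _ _ _ dr di => /(_ _) c.
apply: cvg_trans c; apply: near_eq_cvg; near=> h.
rewrite /GRing.scale /= mulr1; apply/eqP; rewrite eq_complex /=.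
by rewrite cReM cImM /= !mul0r subr0 addr0 !raddfB /= !eqxx.
Unshelve. all: by end_near. Qed.

(** Tannery's theorem for the difference quotients, which the mean value inequality
    bounds by the derivatives. *)
Lemma pd_zsum (v z : R[i]) (u d : int -> R[i] -> R[i]) (W : int -> R) (r B : R) :
  0 < r -> cmod v = 1 -> (forall n, 0 <= W n) -> bnd W B ->
  (forall n w, cmod (w - z) < r -> pd v (u n) w (d n w)) ->
  (forall n w, cmod (w - z) < r -> cmod (d n w) <= W n) ->
  (forall w, cmod (w - z) < r -> exists M, absum (u ^~ w) M) ->
  pd v (fun w => zsum (u ^~ w)) z (zsum (d ^~ z)).
Proof.
move=> r0 v1 W0 WB ud dW uM; apply: rder_slope.
have inb (t : R) : `|t| < r -> cmod (z + t%:C * v - z) < r.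
  by move=> tr; rewrite addrAC subrr add0r cmodM v1 mulr1 cmod_real.
pose phi n (h : R) := h^-1%:C * (u n (z + h%:C * v) - u n z).
have lim : zsum (phi ^~ h) @[h --> 0^'] --> zsum (d ^~ z).
  apply: (@ztannery R R 0^' _ (fun n => 2 * W n) (2 * B) phi).
  - by move=> n; rewrite mulr_ge0.
  - exact: bnd_scale.
  - near=> h => n.
    have hr : `|h| < r.
      by near: h; exact: dnbhs0_lt.
    have h0 : h != 0 by near: h; exact: nbhs_dnbhs_neq.
    have := @rder_mvt_sym R (fun t : R => u n (z + t%:C * v)) (fun t => d n (z + t%:C * v)) 0 h (W n).
    rewrite !subr0 mul0r addr0 => mvt.
    rewrite /phi cmodM cmod_real normfV mulrC ler_pdivrMr ?normr_gt0 //.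
    apply: mvt => t; rewrite subr0 => th.
      by apply: pd_line; apply: ud; apply: inb; exact: le_lt_trans th hr.
    by apply: dW; apply: inb; exact: le_lt_trans th hr.
  move=> n; have := slope_rder (ud n z _); rewrite subrr cmod0 => /(_ r0).
  by under eq_fun do rewrite addr0 mul0r addr0.
apply: cvg_trans lim; apply: near_eq_cvg; near=> h.
have hr : `|h| < r.
  by near: h; exact: dnbhs0_lt.
have [M1 M1P] := uM _ (inb h hr).
have [|M0 M0P] := uM z _; first by rewrite subrr cmod0.
rewrite /phi addr0 mul0r addr0.
have -> : zsum (u ^~ (z + h%:C * v)) - zsum (u ^~ z) =
    zsum (fun n => u n (z + h%:C * v) + -1 * u n z).
  by rewrite (zsumD M1P (absumZ (-1) M0P)) (zsumZ _ M0P) mulN1r.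
rewrite -(zsumZ _ (absumD M1P (absumZ (-1) M0P))).
by apply: eq_zsum => n; rewrite mulN1r.
Unshelve. all: by end_near. Qed.

Lemma has_d_zsum (z : R[i]) (u a b : int -> R[i] -> R[i]) (W : int -> R) (r B : R) :
  0 < r -> (forall n, 0 <= W n) -> bnd W B ->
  (forall n w, cmod (w - z) < r -> has_d (u n) w (a n w) (b n w)) ->
  (forall n w, cmod (w - z) < r -> cmod (a n w) <= W n /\ cmod (b n w) <= W n) ->
  (forall w, cmod (w - z) < r -> exists M, absum (u ^~ w) M) ->
  has_d (fun w => zsum (u ^~ w)) z (zsum (a ^~ z)) (zsum (b ^~ z)).
Proof.
move=> r0 W0 WB ud dW uM; have zr : cmod (z - z) < r by rewrite subrr cmod0.
have aM : absum (a ^~ z) B by apply: bnd_le WB => n; exact: (dW n z zr).1.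
have bM : absum (b ^~ z) B by apply: bnd_le WB => n; exact: (dW n z zr).2.
have W20 n : 0 <= 2 * W n by rewrite mulr_ge0.
have ler2 (p q : R[i]) (x : R) : cmod p <= x -> cmod q <= x -> cmod p + cmod q <= 2 * x.
  by move=> px qx; rewrite mulr_natl mulr2n lerD.
split.
  rewrite -(zsumD aM bM).
  apply: (@pd_zsum 1 z u (fun n w => a n w + b n w) _ r _ r0 (cmod1 R) W20 (bnd_scale (ler0n R 2) WB)) => //.
    by move=> n w wr; exact: (ud n w wr).1.
  move=> n w wr; apply: le_trans (cmodD _ _) _.
  by have [? ?] := dW n w wr; exact: ler2.
have -> : 'i%C * (zsum (a ^~ z) - zsum (b ^~ z)) = zsum (fun n => 'i%C * (a n z + -1 * b n z)).
  by rewrite (zsumZ _ (absumD aM (absumZ (-1) bM))) (zsumD aM (absumZ (-1) bM)) (zsumZ _ bM) mulN1r.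
apply: (@pd_zsum 'i%C z u (fun n w => 'i%C * (a n w + -1 * b n w)) _ r _ r0 (cmodi R) W20 (bnd_scale (ler0n R 2) WB)) => //.
  by move=> n w wr; rewrite mulN1r; exact: (ud n w wr).2.
move=> n w wr; rewrite cmodM cmodi mul1r mulN1r; apply: le_trans (cmodB _ _) _.
by have [? ?] := dW n w wr; exact: ler2.
Qed.

End TermwiseDifferentiation.

(** * Differentiation of Fourier coefficients *)

Section FourierFamilies.
Variables (R : realType) (s : R).
Hypothesis s12 : 1 / 2 < s.
Implicit Types (g a b : R[i] -> R[i] -> R[i]) (z w l : R[i]) (n m : int).

Lemma hsc_shift (a : int -> R[i]) m : hsc s a -> hsc s (fun n => a (n - m)).
Proof.
have s0 : 0 <= s by apply: le_trans (ltW s12); rewrite divr_ge0.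
move=> [B aB]; pose C : R := (2 * (1 + m%:~R ^+ 2)) `^ s.
exists (C * B); apply: (@bnd_le _ _ (fun n => C * (wt s (n - m) * cmod (a (n - m)) ^+ 2))).
  move=> n; rewrite mulrA; apply: ler_wpM2r; first exact: sqr_ge0.
  by have := wt_shift (n - m) m s0; rewrite subrK.
apply: bnd_scale; first exact: powR_ge0.
apply: (bnd_shift (u := fun n => wt s n * cmod (a n) ^+ 2)) => // n.
by rewrite mulr_ge0 ?wt_ge0 // sqr_ge0.
Qed.

Lemma Hrep_shift (g : R[i] -> R[i]) (a : int -> R[i]) m : Hrep s g a ->
  Hrep s (fun l => l ^ m * g l) (fun n => a (n - m)).
Proof.
move=> [ha gE]; split; first exact: hsc_shift.
move=> l l1; have [M aM] := hsc_absum s12 ha; have aM' := absum_Xn l1 aM.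
rewrite gE // -(zsum_shift (- m) aM') -(zsumZ _ (absum_shift (- m) aM')).
apply: eq_zsum => n; rewrite mulrCA -expfzDr ?(S1_neq0 l1) //.
by rewrite (addrC m) subrK.
Qed.

Lemma Hrep_own (g : R[i] -> R[i]) (a : int -> R[i]) : Hrep s g a -> Hrep s g (fourier g).
Proof. by move=> ga; rewrite (funext (Hrep_fourier s12 ga)). Qed.

Lemma Hrep_circle (g : R[i] -> R[i]) (a : int -> R[i]) : Hrep s g a ->
  continuous (fun t : R => g (cis t)).
Proof.
move=> [ha gE]; have [M aM] := hsc_absum s12 ha; have := wiener_cts aM.
rewrite (_ : (fun t => zsum _) = fun t : R => g (cis t)) //.
by apply/funext => t; rewrite gE //; exact: S1_cis.
Qed.

Definition circle_bdd g z := exists r M : R, 0 < r /\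
  forall l w, S1 l -> cmod (w - z) < r -> cmod (g l w) <= M.

Lemma circle_bddD g g' z : circle_bdd g z -> circle_bdd g' z -> circle_bdd (fun l w => g l w + g' l w) z.
Proof.
move=> [r [M [r0 gM]]] [r' [M' [r'0 gM']]]; exists (Num.min r r'), (M + M').
split=> [|l w l1]; first by rewrite lt_min r0.
rewrite lt_min => /andP[wr wr']; apply: le_trans (cmodD _ _) _.
by apply: lerD; [exact: gM|exact: gM'].
Qed.

Lemma circle_bddM g g' z : circle_bdd g z -> circle_bdd g' z -> circle_bdd (fun l w => g l w * g' l w) z.
Proof.
move=> [r [M [r0 gM]]] [r' [M' [r'0 gM']]]; exists (Num.min r r'), (M * M').
split=> [|l w l1]; first by rewrite lt_min r0.
rewrite lt_min => /andP[wr wr']; rewrite cmodM.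
by apply: ler_pM; rewrite ?cmod_ge0 //; [exact: gM|exact: gM'].
Qed.

Lemma circle_bdd_cts (f : R[i] -> R[i]) z : {for z, continuous f} -> circle_bdd (fun _ w => f w) z.
Proof.
move=> /ctsCP/(_ 1 ltr01)/nearCP[r r0 rP]; exists r, (cmod (f z) + 1); split=> // l w _ wr.
rewrite -[X in cmod X](subrK (f z)) addrC; apply: le_trans (cmodD _ _) _.
by rewrite lerD2l; apply/ltW/rP.
Qed.

Lemma circle_bdd_pow m z : circle_bdd (fun l _ => l ^ m) z.
Proof. by exists 1, 1; split=> // l w l1 _; rewrite cmod_expz. Qed.

Lemma circle_bdd_cexp g z : circle_bdd g z -> circle_bdd (fun l w => cexp (g l w)) z.
Proof.
move=> [r [M [r0 gM]]]; exists r, (expR M); split=> // l w l1 wr.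
by apply: le_trans (cmod_cexp_le _) _; rewrite ler_expR gM.
Qed.

Variable D : set R[i].
Hypothesis oD : open D.

(** The regularity that allows differentiation of the Fourier coefficients of [g] under
    the integral sign. *)
Definition circle_family g a b :=
  [/\ forall l, S1 l -> C1_d D (g l) (a l) (b l),
      forall z, D z -> circle_bdd a z /\ circle_bdd b z &
      forall z, D z -> exists c, Hrep s (g ^~ z) c].

Lemma family_ball g a b z : circle_family g a b -> D z -> exists r M : R,
  [/\ 0 < r, 0 <= M & forall l w, S1 l -> cmod (w - z) < r ->
    [/\ D w, cmod (a l w) <= M, cmod (b l w) <= M &
        cmod (g l w - g l z) <= 4 * M * cmod (w - z)]].
Proof.
move=> [gC ab _] Dz; have [[r1 [M1 [r10 aM]]] [r2 [M2 [r20 bM]]]] := ab z Dz.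
have [r3 r30 rD] := openCP oD Dz.
pose M := Num.max `|M1| `|M2|.
have M0 : 0 <= M by rewrite le_max normr_ge0.
have bnds l w : S1 l -> cmod (w - z) < Num.min (Num.min r1 r2) r3 ->
    [/\ D w, cmod (a l w) <= M & cmod (b l w) <= M].
  move=> l1; rewrite !lt_min => /andP[/andP[w1 w2] w3]; split; first exact: rD.
    by apply: le_trans (aM l w l1 w1) _; rewrite le_max ler_norm.
  by apply: le_trans (bM l w l1 w2) _; rewrite le_max (ler_norm M2) orbT.
exists (Num.min (Num.min r1 r2) r3), M; split=> // [|l w l1 wr].
  by rewrite !lt_min r10 r20.
have [Dw aw bw] := bnds l w l1 wr; split=> //.
have -> : 4 * M = 2 * (M + M) by ring.
apply: (C1_mvt oD (gC l l1)) => u uw.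
have [Du au bu] := bnds l u l1 (le_lt_trans uw wr).
by split=> //; exact: lerD.
Qed.

(** At [z] the loop is bounded, being the sum of its Fourier series; the mean value
    inequality gives the bound at nearby points. *)
Lemma family_bdd g a b z : circle_family g a b -> D z -> circle_bdd g z.
Proof.
move=> fg Dz; have [r [M [r0 M0 rP]]] := family_ball fg Dz.
have [c gc] := (let: And3 _ _ h := fg in h) z Dz.
have [B cB] := hsc_absum s12 gc.1.
exists r, (B + 4 * M * r); split=> // l w l1 wr.
have [_ _ _ mv] := rP l w l1 wr.
rewrite -[X in cmod X](subrK (g l z)) addrC; apply: le_trans (cmodD _ _) _.
apply: lerD.
  rewrite gc.2 //; have cB' := absum_Xn l1 cB.
  have cl : cmod (psum (fun n => c n * l ^ n) N) @[N --> \oo] -->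
      cmod (zsum (fun n => c n * l ^ n)) by apply: cvg_cmod; exact: absum_cvg cB'.
  apply: (cvg_le_bound cl); apply: nearW => N.
  exact: cmod_psum_le cB'.
apply: le_trans mv _; apply: ler_wpM2l; last exact: ltW.
by rewrite mulr_ge0.
Qed.

Lemma family_cts_fourier g a b n z : circle_family g a b -> D z ->
  {for z, continuous (fun w => fourier (g ^~ w) n)}.
Proof.
move=> fg Dz; have [r [M [r0 M0 rP]]] := family_ball fg Dz.
have gH := let: And3 _ _ h := fg in h.
have gcont w : D w -> continuous (fun t : R => g (cis t) w * cis t ^ (- n)).
  move=> Dw t; have [c gc] := gH w Dw.
  by apply: cvgCM; [exact: (Hrep_circle gc)|exact: cis_int_cts].
pose C : R := cmod ((2 * pi)%:C)^-1 * (2 * (4 * M) * (2 * pi)).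
have C0 : 0 <= C by rewrite mulr_ge0 ?cmod_ge0 // !mulr_ge0 // pi_ge0.
apply/ctsCP => e e0; apply/nearCP.
exists (Num.min r (e / (C + 1))); first by rewrite lt_min r0 divr_gt0 // ltr_wpDl.
move=> w; rewrite lt_min => /andP[wr we].
have Dw : D w by have [] := rP 1 w (normr1 _) wr.
rewrite !fourierE -mulrBr cmodM -cintB;
  [|exact: (@cts_within R 0 (2 * pi) _ (gcont w Dw))|exact: (@cts_within R 0 (2 * pi) _ (gcont z Dz))].
apply: (@le_lt_trans _ _ (C * cmod (w - z))).
  rewrite /C -mulrA; apply: ler_wpM2l; first exact: cmod_ge0.
  rewrite (_ : 2 * (4 * M) * (2 * pi) * cmod (w - z) = 2 * (4 * M * cmod (w - z)) * (2 * pi - 0)); last first.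
    by rewrite subr0; ring.
  apply: cmod_cint_le; first exact: pi2_ge0.
    exact: (within_ctsB (@cts_within R 0 (2 * pi) _ (gcont w Dw)) (@cts_within R 0 (2 * pi) _ (gcont z Dz))).
  move=> t _; rewrite -mulrBl cmodM (cmod_expz _ (S1_cis t)) mulr1.
  by have [] := rP (cis t) w (S1_cis t) wr.
apply: (@le_lt_trans _ _ ((C + 1) * cmod (w - z))).
  by apply: ler_wpM2r; rewrite ?cmod_ge0 // lerDl.
by rewrite mulrC -ltr_pdivlMr // ltr_wpDl.
Qed.

Lemma pd_fourier g (d : R[i] -> R[i] -> R[i]) v n z (r M : R) : 0 < r -> cmod v = 1 ->
  (forall w, cmod (w - z) < r -> exists c, Hrep s (g ^~ w) c) ->
  (forall l w, S1 l -> cmod (w - z) < r -> pd v (g l) w (d l w)) ->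
  (forall l w, S1 l -> cmod (w - z) < r -> cmod (d l w) <= M) ->
  pd v (fun w => fourier (g ^~ w) n) z (fourier (d ^~ z) n).
Proof.
move=> r0 v1 gH gd dM.
have inb (t : R) : - r < t < r -> cmod (z + t%:C * v - z) < r.
  by rewrite -ltr_norml => tr; rewrite addrAC subrr add0r cmodM v1 mulr1 cmod_real.
rewrite /pd (_ : (fun t : R => fourier _ n) = fun t : R => ((2 * pi)%:C)^-1 *
   cint 0 (2 * pi) (fun x => g (cis x) (z + t%:C * v) * cis x ^ (- n))); last first.
  by apply/funext => t; rewrite fourierE.
rewrite fourierE; apply: rderZ.
rewrite (_ : cint 0 (2 * pi) (fun t => d _ z * _) =
   cint 0 (2 * pi) ((fun (x t : R) => d (cis t) (z + x%:C * v) * cis t ^ (- n)) 0)); last first.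
  by apply: eq_cint => t _; rewrite mul0r addr0.
apply: (@rder_cint R 0 (2 * pi) (fun x t => g (cis t) (z + x%:C * v) * cis t ^ (- n))
  (fun x t => d (cis t) (z + x%:C * v) * cis t ^ (- n)) r M) => //.
- move=> x xr; apply: cts_within => t; have [c gc] := gH _ (inb x xr).
  by apply: cvgCM; [exact: (Hrep_circle gc)|exact: cis_int_cts].
- move=> x t xr _; have h := pd_line (gd _ _ (S1_cis t) (inb x xr)).
  by apply: rder_eq (rderM h (rder_cst (cis t ^ (- n)) x)) _; rewrite mulr0 addr0.
- move=> x t xr _; rewrite cmodM (cmod_expz _ (S1_cis t)) mulr1.
  exact: dM (S1_cis t) (inb x xr).
Qed.

Lemma family_has_d_fourier g a b (al be : int -> R[i]) n z : circle_family g a b -> D z ->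
  Hrep s (a ^~ z) al -> Hrep s (b ^~ z) be ->
  has_d (fun w => fourier (g ^~ w) n) z (al n) (be n).
Proof.
move=> fg Dz aal bbe; have [r [M [r0 M0 rP]]] := family_ball fg Dz.
have [gC _ gH] := fg.
have Dr w : cmod (w - z) < r -> D w by move=> wr; have [] := rP 1 w (normr1 _) wr.
have gd l w : S1 l -> cmod (w - z) < r -> has_d (g l) w (a l w) (b l w).
  by move=> l1 wr; have [h _ _] := gC l l1; exact: h (Dr w wr).
have ab l w : S1 l -> cmod (w - z) < r -> cmod (a l w) + cmod (b l w) <= M + M.
  by move=> l1 wr; have [_ h1 h2 _] := rP l w l1 wr; exact: lerD.
split.
  rewrite -(Hrep_fourier s12 (HrepD s12 aal bbe)).
  apply: (@pd_fourier g (fun l w => a l w + b l w) 1 n z r (M + M)) => //.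
  - exact: cmod1.
  - by move=> w wr; exact: gH (Dr w wr).
  - by move=> l w l1 wr; exact: (gd l w l1 wr).1.
  - by move=> l w l1 wr; apply: le_trans (cmodD _ _) _; exact: ab.
have -> : 'i%C * (al n - be n) = (fun n => 'i%C * (al n + -1 * be n)) n by rewrite mulN1r.
rewrite -(Hrep_fourier s12 (HrepZ 'i%C s12 (HrepD s12 aal (HrepZ (-1) s12 bbe)))).
apply: (@pd_fourier g (fun l w => 'i%C * (a l w + -1 * b l w)) 'i%C n z r (M + M)) => //.
- exact: cmodi.
- by move=> w wr; exact: gH (Dr w wr).
- by move=> l w l1 wr; rewrite mulN1r; exact: (gd l w l1 wr).2.
- move=> l w l1 wr; rewrite cmodM cmodi mul1r mulN1r; apply: le_trans (cmodB _ _) _.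
  exact: ab.
Qed.

End FourierFamilies.

(** * Exponentials times monomials *)

Section DeltaCoefficients.
Variable R : realType.
Implicit Types (e c l : R[i]) (n m j : int).

(** The Fourier coefficients of [c l^j]. *)
Definition delta j c n : R[i] := if n == j then c else 0.

Lemma csum_single (K : nat) c : csum (fun k => if k == K then c else 0) = c.
Proof.
apply: csumE; apply: cvg_near_cst; exists K.+1 => // N /= KN.
rewrite /series /= (bigD1_seq K) ?iota_uniq ?mem_index_iota //= eqxx big1 ?addr0 //.
by move=> k /negbTE ->.
Qed.

Lemma expmul_delta e m j c (k : nat) : m != 0 ->
  expmul e m (delta j c) (j + m * k%:Z) = cexp_coeff e k * c.
Proof.
move=> m0; rewrite -[RHS](csum_single k); apply: eq_csum => k'; rewrite /delta.
rewrite -addrA -mulrBr -[X in _ == X]addr0 (inj_eq (addrI j)) mulf_eq0 (negbTE m0) /= subr_eq0.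
by rewrite eqz_nat eq_sym; case: eqP => [->|_]; rewrite ?mulr0.
Qed.

Lemma expmul_delta0 e m j c n : (forall k : nat, n != j + m * k%:Z) ->
  expmul e m (delta j c) n = 0.
Proof.
move=> nk; apply: csumE; rewrite (_ : series _ = fun=> 0); first exact: cvg_cst.
apply/funext => N; rewrite /series /= big1 // => k _.
by rewrite /delta subr_eq (negbTE (nk k)) mulr0.
Qed.

(** A majorant that does not depend on [e], as termwise differentiation requires. *)
Lemma expmul_delta_le e (rho : R) m j c n : m != 0 -> cmod e <= rho ->
  cmod (expmul e m (delta j c) n) <= cmod c * cmod (expmul rho%:C m (delta j 1) n).
Proof.
move=> m0 er; have rho0 : 0 <= rho by apply: le_trans er; exact: cmod_ge0.
have [[k ->]|nk] := pselect (exists k : nat, n = j + m * k%:Z).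
  rewrite !expmul_delta // mulr1 [X in X <= _]cmodM mulrC; apply: ler_wpM2l; first exact: cmod_ge0.
  rewrite !cmod_cexp_coeff /exp_coeff /=; apply: ler_wpM2r; first by rewrite invr_ge0.
  by rewrite lerXn2r ?nnegrE ?cmod_ge0 // cmod_real ger0_norm.
rewrite !expmul_delta0 ?cmod0 ?mulr0 // => k; apply/eqP => nE; apply: nk; by exists k.
Qed.

Lemma expmul_delta_absum e m j c : exists M, absum (expmul e m (delta j c)) M.
Proof.
have s1 : 1 / 2 < (1 : R) by rewrite ltr_pdivrMr // mul1r ltr1n.
have hd := hsc_delta 1 j c; have [M aM] := hsc_absum s1 hd.
have s0 : 0 <= (1 : R) by exact: ler01.
have h : hsc 1 (expmul e m (delta j c)) by exact: (hsc_expmul e m s0 aM hd).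
exact: (hsc_absum s1 h).
Qed.

Lemma zsum_expmul_delta e m j c l : S1 l ->
  zsum (fun n => expmul e m (delta j c) n * l ^ n) = cexp (e * l ^ m) * (c * l ^ j).
Proof.
move=> l1; have [M aM] := absum_delta j c; have [M' bM] := expmul_delta_absum e m j c.
rewrite (zsum_expmul aM bM l1); congr (_ * _).
rewrite -[RHS](zsum_delta j); apply: eq_zsum => n; rewrite /delta.
by case: eqP => [->|_] //; rewrite mul0r.
Qed.

Lemma Hrep_delta s c : Hrep s (fun=> c) (delta 0 c).
Proof. exact: Hrep_cst. Qed.

End DeltaCoefficients.

(** * The scalar equation *)

Section ScalarModel.
Variables (R : realType) (s : R).
Hypothesis s12 : 1 / 2 < s.
Variable D : set R[i].
Hypothesis oD : open D.
(** This is the equation of the component of [X] along an eigenvector of [Li]: the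
    coefficient of [dz] has frequency [-1] and that of [dzbar] has frequency [1], up to
    the exponential factor that comes from the linear part. *)
Variables (e e' et m1 m2 : R[i] -> R[i]) (x : R[i] -> R[i] -> R[i]).
Implicit Types (z w l : R[i]) (n m : int).

Hypothesis eC : C1_d D e e' (fun=> 0).
Hypothesis et_cts : forall z, D z -> {for z, continuous et}.
Hypothesis m1_cts : forall z, D z -> {for z, continuous m1}.
Hypothesis m2_cts : forall z, D z -> {for z, continuous m2}.
Hypothesis xd : forall l, S1 l -> forall z, D z -> has_d (x l) z
  (l ^ (-1) * (cexp (e z * l ^ (-2) + et z * l ^ 2) * m1 z))
  (l ^ 1 * (cexp (e z * l ^ (-2) + et z * l ^ 2) * m2 z)).
Hypothesis xH : forall z, D z -> exists c, Hrep s (x ^~ z) c.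

Definition hfam l w := cexp (- e w * l ^ (-2)) * x l w.
Definition hcoef n w := fourier (hfam ^~ w) n.

Lemma ctsMr (c : R[i]) (f : R[i] -> R[i]) z : {for z, continuous f} ->
  {for z, continuous (fun w => f w * c)}.
Proof. by move=> fc; exact: (ctsM fc (@cts_cst R c z)). Qed.

Lemma ctsN (f : R[i] -> R[i]) z : {for z, continuous f} ->
  {for z, continuous (fun w => - f w)}.
Proof.
move=> fc; under [X in {for _, continuous X}]eq_fun do rewrite -mulN1r.
exact: ctsZ fc.
Qed.

Lemma cts_cexp (f : R[i] -> R[i]) z : {for z, continuous f} -> {for z, continuous (fun w => cexp (f w))}.
Proof.
move=> fc; have c : {for f z, continuous (@cexp R)}.
  exact: (holomorphic_continuous (@cexp_holomorphic R)).
exact: (cvg_comp _ _ fc c).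
Qed.

Let e_cts z : D z -> {for z, continuous e}.
Proof. exact: C1_continuous oD eC. Qed.

Let e'_cts z : D z -> {for z, continuous e'}.
Proof. by case: eC => _ h _; exact: h. Qed.

Lemma xfamily : circle_family s D x
  (fun l z => l ^ (-1) * (cexp (e z * l ^ (-2) + et z * l ^ 2) * m1 z))
  (fun l z => l ^ 1 * (cexp (e z * l ^ (-2) + et z * l ^ 2) * m2 z)).
Proof.
have expc z l : D z -> {for z, continuous (fun z => cexp (e z * l ^ (-2) + et z * l ^ 2))}.
  move=> Dz; apply: cts_cexp.
  exact: (ctsD (ctsMr (e_cts Dz)) (ctsMr (et_cts Dz))).
have expl z : D z -> circle_bdd (fun l z => cexp (e z * l ^ (-2) + et z * l ^ 2)) z.
  move=> Dz; apply: circle_bdd_cexp; apply: circle_bddD; apply: circle_bddM; try exact: circle_bdd_pow.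
    exact: circle_bdd_cts (e_cts Dz).
  exact: circle_bdd_cts (et_cts Dz).
split; [|  |exact: xH].
  move=> l l1; split=> [z Dz|z Dz|z Dz]; first exact: xd.
    exact: (ctsZ (ctsM (expc z l Dz) (m1_cts Dz))).
  exact: (ctsZ (ctsM (expc z l Dz) (m2_cts Dz))).
move=> z Dz; split; apply: (circle_bddM (@circle_bdd_pow _ _ z)); apply: (circle_bddM (expl z Dz)).
  exact: circle_bdd_cts (m1_cts Dz).
exact: circle_bdd_cts (m2_cts Dz).
Qed.

(** Without the factor [exp (e l^-2)] there is only one term of negative frequency left,
    besides the one that multiplies the family itself by [l^-2]. *)
Lemma hfamily : circle_family s D hfam
  (fun l z => - e' z * (l ^ (-2) * hfam l z) + l ^ (-1) * (cexp (et z * l ^ 2) * m1 z))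
  (fun l z => l ^ 1 * (cexp (et z * l ^ 2) * m2 z)).
Proof.
have expm z l : cexp (- e z * l ^ (-2)) * cexp (e z * l ^ (-2) + et z * l ^ 2) = cexp (et z * l ^ 2).
  by rewrite -cexpD mulNr addKr.
have hd l z : S1 l -> D z -> has_d (hfam l) z
    (- e' z * (l ^ (-2) * hfam l z) + l ^ (-1) * (cexp (et z * l ^ 2) * m1 z))
    (l ^ 1 * (cexp (et z * l ^ 2) * m2 z)).
  move=> l1 Dz; have [ed _ _] := eC.
  have d1 := has_d_cexp (has_dM (has_dN (ed z Dz)) (has_d_cst (l ^ (-2)) z)).
  apply: (has_d_eq (has_dM d1 (xd l1 Dz))); rewrite /hfam -expm.
    by move: (cexp _) (cexp _) (x l z) => E1 E2 X; ring.
  by move: (cexp _) (cexp _) (x l z) => E1 E2 X; ring.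
have ec z l : D z -> {for z, continuous (fun z => cexp (et z * l ^ 2))}.
  by move=> Dz; apply: cts_cexp; exact: (ctsMr (et_cts Dz)).
have el z : D z -> circle_bdd (fun l z => cexp (et z * l ^ 2)) z.
  move=> Dz; apply: circle_bdd_cexp; apply: circle_bddM; last exact: circle_bdd_pow.
  exact: circle_bdd_cts (et_cts Dz).
have hl z : D z -> circle_bdd hfam z.
  move=> Dz; apply: circle_bddM (family_bdd s12 oD xfamily Dz).
  apply: circle_bdd_cexp; apply: circle_bddM; last exact: circle_bdd_pow.
  exact: (circle_bdd_cts (ctsN (e_cts Dz))).
have hc z l : S1 l -> D z -> {for z, continuous (hfam l)}.
  move=> l1 Dz; apply: ctsM.
    by apply: cts_cexp; exact: (ctsMr (ctsN (e_cts Dz))).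
  by have [xC _ _] := xfamily; exact: C1_continuous oD (xC l l1) Dz.
have Ne'c z : D z -> {for z, continuous (fun z => - e' z)}.
  by move=> Dz; exact: (ctsN (e'_cts Dz)).
split.
- move=> l l1; split=> z Dz; first exact: hd.
    apply: (ctsD (ctsM (Ne'c z Dz) (ctsZ (hc z l l1 Dz)))).
    exact: (ctsZ (ctsM (ec z l Dz) (m1_cts Dz))).
  exact: (ctsZ (ctsM (ec z l Dz) (m2_cts Dz))).
- move=> z Dz; split.
    apply: circle_bddD; apply: circle_bddM.
    + exact: circle_bdd_cts (Ne'c z Dz).
    + exact: circle_bddM (@circle_bdd_pow _ _ z) (hl z Dz).
    + exact: circle_bdd_pow.
    + exact: circle_bddM (el z Dz) (circle_bdd_cts (m1_cts Dz)).
  exact: circle_bddM (@circle_bdd_pow _ _ z) (circle_bddM (el z Dz) (circle_bdd_cts (m2_cts Dz))).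
move=> z Dz; have [c xc] := xH Dz.
by exists (expmul (- e z) (-2) c); exact: Hrep_cexp s12 xc.
Qed.

Lemma hcoef_rep z : D z -> Hrep s (hfam ^~ z) (hcoef ^~ z).
Proof.
by move=> Dz; have [_ _ hH] := hfamily; have [c hc] := hH z Dz; exact: (Hrep_own s12 hc).
Qed.

Lemma hcoef_cts n z : D z -> {for z, continuous (hcoef n)}.
Proof. by move=> Dz; exact: (family_cts_fourier s12 oD hfamily Dz). Qed.

Lemma hcoef_d n z : D z -> has_d (hcoef n) z
  (- e' z * hcoef (n + 2) z + expmul (et z) 2 (delta 0 (m1 z)) (n + 1))
  (expmul (et z) 2 (delta 0 (m2 z)) (n - 1)).
Proof.
move=> Dz; apply: (family_has_d_fourier s12 oD
  (al := fun n => - e' z * hcoef (n + 2) z + expmul (et z) 2 (delta 0 (m1 z)) (n + 1))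
  (be := fun n => expmul (et z) 2 (delta 0 (m2 z)) (n - 1)) n hfamily Dz).
  apply: (HrepD s12).
    apply: (HrepZ _ s12); apply: eq_Hrepr (Hrep_shift s12 (-2) (hcoef_rep Dz)) => j.
    by rewrite opprK.
  have h := Hrep_shift s12 (-1) (Hrep_cexp (et z) 2 s12 (Hrep_delta s (m1 z))).
  by apply: eq_Hrepr h => j; rewrite opprK.
exact: (Hrep_shift s12 1 (Hrep_cexp (et z) 2 s12 (Hrep_delta s (m2 z)))).
Qed.

Hypothesis hcoef0 : forall z, D z -> hcoef 0 z = 0.

(** The coefficient of [l^-1 dz] in the differential of [hfam]: the factor [l^-2] lowers
    the frequency of [hcoef 1] to [-1]. *)
Definition Adz z := m1 z - e' z * hcoef 1 z.

Definition hneg n w := if n < 0 then hcoef n w else 0.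

(** The equations of the negative coefficients form a closed system. Only [hcoef 0] and
    [hcoef 1] could enter from outside; the former vanishes, and the latter is part of
    [Adz]. *)
Lemma hneg_d n z : D z -> has_d (hneg n) z (- e' z * hneg (n + 2) z + delta (-1) (Adz z) n) 0.
Proof.
move=> Dz; rewrite /hneg; case: (ltP n 0) => n0; last first.
  apply: (has_d_eq (has_d_cst 0 z)) => //.
  rewrite ltNge (le_trans n0) ?lerDl //= mulr0 add0r /delta.
  by case: eqP => // nE; rewrite nE in n0.
have h2 : expmul (et z) 2 (delta 0 (m2 z)) (n - 1) = 0.
  by apply: expmul_delta0 => k; apply/eqP; lia.
apply: (has_d_eq (hcoef_d n Dz)) => //.
have [->|n1] := eqVneq n (-1).
  rewrite (_ : -1 + 2 = 1 :> int) // (_ : -1 + 1 = 0 + 2 * (0%N : int) :> int) // expmul_delta //.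
  by rewrite /delta eqxx /= /cexp_coeff expr0 mul1r fact0 invr1 mul1r mulr0 add0r mulNr addrC.
rewrite expmul_delta0; last by move=> k; apply/eqP => nE; move/eqP: n1; apply; lia.
rewrite /delta (negbTE n1) addr0 addr0; have [->|n2] := eqVneq n (-2).
  by rewrite (_ : -2 + 2 = 0 :> int) // hcoef0 // ltxx.
by rewrite (_ : n + 2 < 0) //; lia.
Qed.

Definition dressing_coef n w := expmul (e w) (-2) (hneg ^~ w) n.

Lemma expmul_finite (c : R[i]) (a : int -> R[i]) n (K : nat) :
  (forall j, 0 <= j -> a j = 0) -> 0 <= n + 2 * K.+1%:Z ->
  expmul c (-2) a n = \sum_(k < K.+1) cexp_coeff c k * a (n + 2 * k%:Z).
Proof.
move=> a0 nK; apply: csumE; apply: cvg_near_cst; exists K.+1 => // N /= KN.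
rewrite /series /= (big_cat_nat (n := K.+1)) //= big_mkord [X in _ + X]big_nat_cond [X in _ + X]big1 ?addr0.
  by apply: eq_bigr => k _; rewrite mulNr opprK.
move=> k /andP[/andP[Kk _] _]; rewrite mulNr opprK a0 ?mulr0 //; lia.
Qed.

Lemma has_dX (f : R[i] -> R[i]) z a (k : nat) : has_d f z a 0 ->
  has_d (fun w => f w ^+ k.+1) z (k.+1%:R * a * f z ^+ k) 0.
Proof.
move=> fd; elim: k => [|k IH].
  by apply: (has_d_eq fd) => //; rewrite expr0 mulr1 mul1r.
rewrite (_ : (fun _ => _) = fun w => f w * f w ^+ k.+1); last by apply/funext => w; rewrite exprS.
apply: (has_d_eq (has_dM fd IH)); last by rewrite mul0r mulr0 addr0.
by rewrite -(natr1 k.+1) exprS; move: (f z) (f z ^+ k) (k.+1%:R) => p q y; ring.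
Qed.

(** The sum telescopes: the derivative of a coefficient of the exponential series
    cancels the term in [n + 2] that [hneg_d] yields for the preceding summand. *)
Lemma dressing_coef_d n z : D z ->
  has_d (dressing_coef n) z (expmul (e z) (-2) (delta (-1) (Adz z)) n) 0.
Proof.
move=> Dz; have [ed _ _] := eC.
have c0 w : cexp_coeff (e w) 0 = 1 by rewrite /cexp_coeff expr0 fact0 divr1.
have cd k : has_d (fun w => cexp_coeff (e w) k.+1) z (e' z * cexp_coeff (e z) k) 0.
  apply: (has_d_eq (has_dM (has_dX k (ed z Dz)) (has_d_cst (k.+1`!%:R^-1) z))); last first.
    by rewrite mul0r mulr0 addr0.
  rewrite mulr0 addr0 /cexp_coeff factS natrM invfM.
  have k0 : (k.+1%:R : R[i]) != 0 by rewrite pnatr_eq0.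
  have f0 : (k`!%:R : R[i]) != 0 by rewrite pnatr_eq0 -lt0n fact_gt0.
  by move: (e z ^+ k) k0 f0 => p; move: (k.+1%:R) (k`!%:R) => u v u0 v0; field; rewrite u0 v0.
have step K : has_d (fun w => \sum_(k < K.+1) cexp_coeff (e w) k * hneg (n + 2 * k%:Z) w) z
    (- e' z * cexp_coeff (e z) K * hneg (n + 2 * K.+1%:Z) z +
     \sum_(k < K.+1) cexp_coeff (e z) k * delta (-1) (Adz z) (n + 2 * k%:Z)) 0.
  elim: K => [|K IH].
    under eq_fun do rewrite big_ord1 c0 mul1r.
    apply: (has_d_eq (hneg_d (n + 2 * 0) Dz)) => //.
    by rewrite big_ord1 c0 !mulr1 mul1r mulr0 addr0.
  under eq_fun do rewrite big_ord_recr /=.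
  apply: (has_d_eq (has_dD IH (has_dM (cd K) (hneg_d (n + 2 * K.+1%:Z) Dz)))); last first.
    by rewrite mul0r mulr0 !addr0.
  rewrite [in RHS]big_ord_recr /= (_ : n + 2 * K.+2 = n + 2 * K.+1%:Z + 2); last by lia.
  move: (\sum_(k < K.+1) _) (cexp_coeff _ K) (cexp_coeff _ K.+1) (hneg _ z) (hneg _ z) (delta _ _ _) => S E E' H H' d.
  by ring.
have nK : 0 <= n + 2 * (`|n|%N).+1%:Z by lia.
apply: (has_d_in oD Dz _ (has_d_eq (step `|n|%N) _ _)) => //.
- move=> w _; apply/esym/expmul_finite => // j j0.
  by rewrite /hneg ltNge j0.
- rewrite [in LHS]/hneg ltNge nK /= mulr0 add0r; apply/esym/expmul_finite => // j j0.
  by rewrite /delta; case: eqP => // jE; rewrite jE in j0.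
Qed.

Definition dressing l w := cexp (e w * l ^ (-2)) * zsum (fun n => hneg n w * l ^ n).

Lemma dressing_coef_rep w : D w -> Hrep s (dressing ^~ w) (dressing_coef ^~ w).
Proof.
move=> Dw; apply: (Hrep_cexp _ _ s12).
exact: Hrep_proj (fun n : int => n < 0) (hcoef_rep Dw).1.
Qed.

Lemma Adz_cts z : D z -> {for z, continuous Adz}.
Proof. by move=> Dz; exact: (ctsB (m1_cts Dz) (ctsM (e'_cts Dz) (hcoef_cts Dz))). Qed.

Lemma dressing_d l : S1 l -> C1_d D (dressing l)
  (fun z => cexp (e z * l ^ (-2)) * (Adz z * l ^ (-1))) (fun=> 0).
Proof.
move=> l1; split=> [z Dz|z Dz|z Dz]; last exact: cts_cst.
  have [r1 r10 r1D] := openCP oD Dz.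
  have [r2 [rho [r20 erho]]] := circle_bdd_cts (e_cts Dz).
  have [r3 [MA [r30 AMA]]] := circle_bdd_cts (Adz_cts Dz).
  pose r := Num.min (Num.min r1 r2) r3.
  have r0 : 0 < r by rewrite !lt_min r10 r20.
  pose W n := MA * cmod (expmul rho%:C (-2) (delta (-1) 1) n).
  have MA0 : 0 <= MA.
    apply: le_trans (AMA 1 z (normr1 _) _); first exact: cmod_ge0.
    by rewrite subrr cmod0.
  have [B BM] := expmul_delta_absum rho%:C (-2) (-1) 1.
  have h : has_d (fun w => zsum (fun n => dressing_coef n w * l ^ n)) z
      (zsum (fun n => expmul (e z) (-2) (delta (-1) (Adz z)) n * l ^ n)) (zsum (fun=> 0)).
    apply: (@has_d_zsum R z (fun n w => dressing_coef n w * l ^ n)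
      (fun n w => expmul (e w) (-2) (delta (-1) (Adz w)) n * l ^ n) (fun n w => 0) W r (MA * B)) => //.
    - by move=> n; rewrite mulr_ge0 ?cmod_ge0.
    - exact: bnd_scale.
    - move=> n w; rewrite !lt_min => /andP[/andP[w1 _] _].
      apply: (has_d_eq (has_dM (dressing_coef_d n (r1D w w1)) (has_d_cst (l ^ n) w))).
        by rewrite mulr0 addr0.
      by rewrite mulr0 mul0r addr0.
    - move=> n w; rewrite !lt_min => /andP[/andP[_ w2] w3]; rewrite cmod0; split.
        rewrite cmodM cmod_expz // mulr1.
        have := expmul_delta_le (-1) (Adz w) n (isT : (-2 : int) != 0) (erho 1 w (normr1 _) w2).
        move/le_trans; apply; apply: ler_wpM2r; first exact: cmod_ge0.
        exact: AMA (normr1 _) w3.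
      by rewrite mulr_ge0 ?cmod_ge0.
    move=> w; rewrite !lt_min => /andP[/andP[w1 _] _].
    have [M aM] := hsc_absum s12 (dressing_coef_rep (r1D w w1)).1.
    by exists M; exact: absum_Xn.
  apply: (has_d_in oD Dz _ (has_d_eq h _ _)).
  - by move=> w Dw; rewrite (dressing_coef_rep Dw).2.
  - by rewrite zsum_expmul_delta.
  by rewrite -[RHS](zsum_delta 0 0); apply: eq_zsum => n; case: ifP.
apply: ctsM; last exact: (ctsMr (Adz_cts Dz)).
by apply: cts_cexp; exact: (ctsMr (e_cts Dz)).
Qed.

Variables (m1' e'' : R[i] -> R[i]).
Hypothesis m1C : C1_d D m1 m1' (fun z => e' z * m2 z).
Hypothesis e'C : C1_d D e' e'' (fun=> 0).

(** The [dzbar]-derivative of [hcoef 1] is [m2], so the two terms [e' m2] cancel. *)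
Lemma Adz_holomorphic : holomorphic D Adz.
Proof.
have [m1d m1'c _] := m1C; have [e'd e''c _] := e'C.
apply: (@C1_holomorphic R D Adz (fun z => m1' z - (e'' z * hcoef 1 z +
   e' z * (- e' z * hcoef 3 z + et z * m1 z)))); first exact: oD.
split=> [z Dz|z Dz|z Dz]; last exact: cts_cst.
  have h : has_d (hcoef 1) z (- e' z * hcoef 3 z + et z * m1 z) (m2 z).
    apply: (has_d_eq (hcoef_d 1 Dz)).
      rewrite (_ : 1 + 1 = 0 + 2 * 1%N :> int) // expmul_delta //.
      by rewrite /cexp_coeff expr1 (_ : 1`! = 1%N) // divr1.
    rewrite (_ : 1 - 1 = 0 + 2 * 0%N :> int) // expmul_delta //.
    by rewrite /cexp_coeff expr0 fact0 divr1 mul1r.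
  apply: (has_d_eq (has_dB (m1d z Dz) (has_dM (e'd z Dz) h))) => //.
  by rewrite mul0r add0r subrr.
apply: (ctsB (m1'c z Dz)); apply: (ctsD (ctsM (e''c z Dz) (hcoef_cts Dz))).
apply: (ctsM (e'_cts Dz)); apply: ctsD; last exact: (ctsM (et_cts Dz) (m1_cts Dz)).
exact: (ctsM (ctsN (e'_cts Dz)) (hcoef_cts Dz)).
Qed.

End ScalarModel.

(** * Differentials of matrix functions *)

Section MatrixDifferentials.
Variable R : realType.
Implicit Types (z w : R[i]) (D : set R[i]).

Definition mhas_d m n (A : R[i] -> 'M[R[i]]_(m, n)) z (P Q : 'M[R[i]]_(m, n)) :=
  forall i j, has_d (fun w => A w i j) z (P i j) (Q i j).

Lemma mhas_dE m n (A : R[i] -> 'M[R[i]]_(m, n)) z P Q : mhas_d A z P Q ->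
  mxdz A z = P /\ mxdzbar A z = Q.
Proof.
by move=> h; split; apply/matrixP => i j; rewrite mxE; have [] := has_dE (h i j).
Qed.

Lemma mxCk1_d m n k (A : R[i] -> 'M[R[i]]_(m, n)) D z : mxCk k.+1 D A -> D z ->
  mhas_d A z (mxdz A z) (mxdzbar A z).
Proof.
by move=> AC Dz i j; rewrite !mxE; have [h _ _] := AC i j; have [] := h z Dz; exact: has_dP.
Qed.

Lemma mhas_d_eq m n (A : R[i] -> 'M[R[i]]_(m, n)) z P Q P' Q' :
  mhas_d A z P Q -> P = P' -> Q = Q' -> mhas_d A z P' Q'.
Proof. by move=> h <- <-. Qed.

Lemma mhas_d_cst m n (A : 'M[R[i]]_(m, n)) z : mhas_d (fun=> A) z 0 0.
Proof. by move=> i j; rewrite !mxE; exact: has_d_cst. Qed.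

Lemma mhas_dM m n p (A : R[i] -> 'M[R[i]]_(m, n)) (B : R[i] -> 'M[R[i]]_(n, p)) z P Q P' Q' :
  mhas_d A z P Q -> mhas_d B z P' Q' ->
  mhas_d (fun w => A w *m B w) z (P *m B z + A z *m P') (Q *m B z + A z *m Q').
Proof.
move=> hA hB i j; under eq_fun do rewrite mxE.
apply: (has_d_eq (has_d_sum (index_enum _) (fun k _ => has_dM (hA i k) (hB k j)))).
  by rewrite !mxE big_split.
by rewrite !mxE big_split.
Qed.

Lemma mhas_d_tr m n (A : R[i] -> 'M[R[i]]_(m, n)) z P Q :
  mhas_d A z P Q -> mhas_d (fun w => (A w)^T) z P^T Q^T.
Proof. by move=> h i j; under eq_fun do rewrite mxE; rewrite !mxE; exact: h. Qed.

Lemma mhas_d_unique m n (A : R[i] -> 'M[R[i]]_(m, n)) z P Q P' Q' :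
  mhas_d A z P Q -> mhas_d A z P' Q' -> P = P' /\ Q = Q'.
Proof.
move=> h h'; split; apply/matrixP => i j; have [? ?] := has_d_unique (h i j) (h' i j) => //.
Qed.

Lemma mhas_d_in m n (A B : R[i] -> 'M[R[i]]_(m, n)) D z P Q : open D -> D z ->
  (forall w, D w -> A w = B w) -> mhas_d A z P Q -> mhas_d B z P Q.
Proof. by move=> oD Dz AB h i j; apply: (has_d_in oD Dz _ (h i j)) => w Dw; rewrite AB. Qed.

Lemma mhas_d_expLi (th : R[i] -> R[i]) z a b : has_d th z a b ->
  mhas_d (fun w => expLi (th w)) z (a *: (Li *m expLi (th z))) (b *: (Li *m expLi (th z))).
Proof.
move=> hth.
have hc : has_d (fun w => ccos (th w)) z (- a * csin (th z)) (- b * csin (th z)).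
  have h1 := has_d_cexp (has_dZ 'i%C hth); have h2 := has_d_cexp (has_dN (has_dZ 'i%C hth)).
  apply: (has_d_eq (has_dM (has_dD h1 h2) (has_d_cst 2^-1 z))); rewrite /csin;
    move: (cexp _) (cexp _) => x y; ring.
have hs : has_d (fun w => csin (th w)) z (a * ccos (th z)) (b * ccos (th z)).
  have h1 := has_d_cexp (has_dZ 'i%C hth); have h2 := has_d_cexp (has_dN (has_dZ 'i%C hth)).
  have h := has_dM (has_dM (has_dB h2 h1) (has_d_cst 'i%C z)) (has_d_cst 2^-1 z).
  have alg (c x y X : R[i]) : X = 0 -> ((- ('i%C * c) * x - 'i%C * c * y) * 'i%C + X * 0) / 2 + X * 0 =
      - ('i%C * 'i%C) * (c * ((y + x) / 2)).
    by move=> ->; ring.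
  apply: (has_d_eq h); rewrite /ccos !mulr0 !addr0.
    transitivity (- ('i%C * 'i%C) * (a * ((cexp ('i%C * th z) + cexp (- ('i%C * th z))) / 2))).
      by move: (cexp _) (cexp _) => x y; ring.
    by rewrite sqri opprK mul1r.
  transitivity (- ('i%C * 'i%C) * (b * ((cexp ('i%C * th z) + cexp (- ('i%C * th z))) / 2))).
    by move: (cexp _) (cexp _) => x y; ring.
  by rewrite sqri opprK mul1r.
have LE : Li *m expLi (th z) = - csin (th z) *: 1%:M + ccos (th z) *: (Li : 'M[R[i]]_4).
  rewrite /expLi mulmxDr mul_mx_scalar -scalemxAr Li_sqr scalerN -scaleNr addrC.
  by rewrite scalemx1.
move=> i j; under eq_fun do rewrite expLi_entry.
have h := has_dD (has_dM hc (has_d_cst ((i == j)%:R : R[i]) z)) (has_dM hs (has_d_cst (Li i j : R[i]) z)).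
apply: (has_d_eq h); rewrite LE; move: Li => L; rewrite !mxE; ring.
Qed.

Lemma mul_Li m (A : 'M[R[i]]_(m, 4)) i : (A *m Li) i 0 = A i 1 /\ (A *m Li) i 1 = - A i 0.
Proof.
rewrite LiE !mxE; split.
  rewrite (bigD1 (1 : 'I_4)) //= big1 ?addr0 => [|[[|[|[|[|k]]]] //= hk] _]; rewrite !mxE /= ?mulr0 //.
  by rewrite mulr1.
rewrite (bigD1 (0 : 'I_4)) //= big1 ?addr0 => [|[[|[|[|[|k]]]] //= hk] _]; rewrite !mxE /= ?mulr0 //.
by rewrite mulrN1.
Qed.

End MatrixDifferentials.

(** * Arguments of circle-valued functions *)

Section LocalAngle.
Variable R : realType.
Implicit Types (z w v l : R[i]) (D : set R[i]).

Lemma conjcN z : conjc (- z) = - conjc z.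
Proof. by rewrite -[- z]sub0r conjcB conjc0 sub0r. Qed.

Lemma conjc_half : conjc (2^-1 : R[i]) = 2^-1.
Proof. by rewrite fmorphV rmorph_nat. Qed.

(** In the right and in the left half-plane [atan (Im / Re)] is a branch of the
    argument, up to a constant. *)
Lemma is_derive_argument (r : R -> R[i]) (t k : R) : complex.Re (r t) != 0 ->
  rder r t ('i%C * k%:C * r t) ->
  is_derive t 1 (fun x => atan (complex.Im (r x) / complex.Re (r x))) k.
Proof.
move=> re0 [dr di].
have E1 : complex.Re ('i%C * k%:C * r t) = - k * complex.Im (r t).
  by rewrite !cReM !cImM /=; ring.
have E2 : complex.Im ('i%C * k%:C * r t) = k * complex.Re (r t).
  by rewrite !cImM !cReM /=; ring.
rewrite E1 in dr; rewrite E2 in di.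
have dV := is_deriveV re0 dr.
have dq := is_deriveM di dV.
have da := is_derive1_atan (complex.Im (r t) / complex.Re (r t)).
have dc := @is_derive1_comp R atan (fun x => complex.Im (r x) / complex.Re (r x)) t _ _ da dq.
apply: (is_derive_eq dc); rewrite /GRing.scale /=.
move: re0; move: (complex.Re (r t)) (complex.Im (r t)) => x y x0.
have xy0 : x ^+ 2 + y ^+ 2 != 0.
  by rewrite gt_eqF // ltr_wpDr ?sqr_ge0 // lt_def sqr_ge0 sqrf_eq0 x0.
have q0 : 1 + (y / x) ^+ 2 != 0 by rewrite gt_eqF // ltr_wpDr ?sqr_ge0.
field; rewrite x0 /=.
by move: xy0; rewrite addrC.
Qed.

(** Rotated so as to take the value [1] at [z1], the function stays near [z1] in the
    right half-plane, where [atan] gives an argument. *)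
Lemma local_argument D (n1 : R[i] -> R[i]) (k : R[i] -> R[i]) z1 : open D -> D z1 ->
  (forall z, D z -> has_d n1 z ('i%C * k z * n1 z) ('i%C * conjc (k z) * n1 z)) ->
  (forall z, D z -> {for z, continuous n1}) ->
  (forall z, D z -> n1 z * conjc (n1 z) = 1) ->
  exists (g : R[i] -> R) (r : R), [/\ 0 < r, g z1 = 0 & forall w, cmod (w - z1) < r ->
    D w /\ has_d (fun x => (g x)%:C) w (k w) (conjc (k w))].
Proof.
move=> oD Dz1 nd nc n1E; pose q w := n1 w * conjc (n1 z1).
have qc : {for z1, continuous q} by exact: (ctsM (nc z1 Dz1) (@cts_cst R _ z1)).
have q1 : q z1 = 1 by exact: n1E.
have [r1 r10 r1D] := openCP oD Dz1.
have /nearCP[r2 r20 r2P] := (ctsCP _ _).1 qc 1 ltr01.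
pose g w := atan (complex.Im (q w) / complex.Re (q w)).
exists g, (Num.min r1 r2); split; first by rewrite lt_min r10.
  by rewrite /g q1 /= mul0r atan0.
move=> w; rewrite lt_min => /andP[w1 w2]; split; first exact: r1D.
have re0 : complex.Re (q w) != 0.
  rewrite gt_eqF //; have := r2P w w2; rewrite q1 => h.
  have := le_lt_trans (ler_Re_cmod _) h; rewrite ltr_norml => /andP[+ _].
  by rewrite raddfB /= ltrBrDl addrN.
have qd : has_d q w ('i%C * k w * q w) ('i%C * conjc (k w) * q w).
  apply: (has_d_eq (has_dM (nd w (r1D w w1)) (has_d_cst (conjc (n1 z1)) w))).
    by rewrite mulr0 addr0 /q mulrA.
  by rewrite mulr0 addr0 /q mulrA.
have reE : (complex.Re (k w) *+ 2)%:C = k w + conjc (k w).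
  apply/eqP; rewrite eq_complex; case: (k w) => x y /=.
  by rewrite mulr2n subrr !eqxx.
have imE : (- (complex.Im (k w) *+ 2))%:C = 'i%C * (k w - conjc (k w)).
  apply/eqP; rewrite eq_complex; case: (k w) => x y /=.
  apply/andP; split; apply/eqP; ring.
have dir v (kv : R) d : v != 0 -> pd v q w ('i%C * kv%:C * q w) -> kv%:C = d ->
    pd v (fun x => (g x)%:C) w d.
  move=> v0 pq <-; apply: rder_real.
  have e0 : q (w + 0%:C * v) = q w by rewrite mul0r addr0.
  apply: (@is_derive_argument (fun t : R => q (w + t%:C * v)) 0 kv).
    by rewrite e0.
  by rewrite e0.
split.
  apply: (dir 1 _ _ (oner_neq0 _) _ reE); apply: rder_eq qd.1 _.
  by rewrite reE; ring.
apply: (dir 'i%C _ _ _ _ imE); first by rewrite -cmod_eq0 cmodi oner_eq0.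
apply: rder_eq qd.2 _; rewrite imE; ring.
Qed.

End LocalAngle.

(** * The conjugate function *)

Section ConjugateFunction.
Variables (R : realType) (D : set R[i]) (z0 : R[i]).
Hypotheses (oD : open D) (Dz0 : D z0).
Hypothesis pathD : forall x y, D x -> D y -> exists p : R -> R[i],
  [/\ {within `[0, 1], continuous p}, p 0 = x, p 1 = y & forall t, 0 <= t <= 1 -> D (p t)].
(** The loop [N] is a frame that turns only in the direction of [Li]; it replaces a
    topological argument for the existence of a global conjugate function of [beta]. *)
Variables (beta : R[i] -> R) (b : R[i] -> R[i]) (N : R[i] -> R[i] -> 'M[R[i]]_4).
Implicit Types (z w l : R[i]) (gamma : R[i] -> R).

Hypothesis beta0 : beta z0 = 0.
Hypothesis betad : forall z, D z -> has_d (fun w => (beta w)%:C) z (b z) (conjc (b z)).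
Hypothesis N0 : forall l, S1 l -> N l z0 = 1%:M.
Hypothesis Nd : forall l, S1 l -> forall z, D z -> mhas_d (N l) z
  ((l ^ (-2) * b z / 2) *: (N l z *m Li)) ((l ^ 2 * conjc (b z) / 2) *: (N l z *m Li)).

Hypothesis Nc : forall l, S1 l -> forall z, D z -> forall i j,
  {for z, continuous (fun w => N l w i j)}.

(** For [l] on the circle this is half of the real part of [l^-2 (u + i v)]. *)
Definition angle l (u v : R) : R := 2^-1 * (complex.Re (l ^ 2) * u + complex.Im (l ^ 2) * v).

(** The Cauchy-Riemann equations for [beta + i gamma]. *)
Definition conj_d gamma z :=
  has_d (fun w => (gamma w)%:C) z (- 'i%C * b z) ('i%C * conjc (b z)).

Lemma S1_conj2 l : S1 l -> conjc (l ^ 2) = l ^ (-2).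
Proof.
by move=> l1; rewrite -exprnP expr2 conjcM S1_conj // -expr2 exprVn.
Qed.

Lemma angle_d gamma l z : S1 l -> D z -> conj_d gamma z ->
  has_d (fun w => (angle l (beta w) (gamma w))%:C) z (l ^ (-2) * b z / 2) (l ^ 2 * conjc (b z) / 2).
Proof.
move=> l1 Dz gd; set L := l ^ 2; have Lc := S1_conj2 l1; rewrite -/L in Lc.
have h := has_dZ 2^-1 (has_dD (has_dZ (complex.Re L)%:C (betad Dz)) (has_dZ (complex.Im L)%:C gd)).
have E : (fun w => (angle l (beta w) (gamma w))%:C) =
   fun w => 2^-1 * ((complex.Re L)%:C * (beta w)%:C + (complex.Im L)%:C * (gamma w)%:C).
  by apply/funext => w; rewrite /angle -/L !(rmorphM, rmorphD) /= fmorphV rmorph_nat.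
rewrite E; apply: (has_d_eq h).
  have -> : l ^ (-2) = (complex.Re L)%:C - 'i%C * (complex.Im L)%:C.
    by rewrite -Lc; apply/eqP; rewrite eq_complex; case: (L) => x y /=; apply/andP; split; apply/eqP; ring.
  by move: (b z) (_%:C) (_%:C) => p x y; ring.
have -> : L = (complex.Re L)%:C + 'i%C * (complex.Im L)%:C.
  by apply/eqP; rewrite eq_complex; case: (L) => x y /=; apply/andP; split; apply/eqP; ring.
rewrite !(cReD, cImD, cReM, cImM) /=.
move: (conjc (b z)) (complex.Re L) (complex.Im L) => p x y.
rewrite !(mul0r, mul1r, mulr0, subr0, addr0, add0r).
by move: (x%:C) (y%:C) => X Y; ring.
Qed.

Lemma N_rotated_d gamma l z : S1 l -> D z -> conj_d gamma z ->
  mhas_d (fun w => N l w *m expLi (- (angle l (beta w) (gamma w))%:C)) z 0 0.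
Proof.
move=> l1 Dz gd; have h := mhas_dM (Nd l1 Dz) (mhas_d_expLi (has_dN (angle_d l1 Dz gd))).
apply: (mhas_d_eq h).
  by rewrite -scalemxAl -scalemxAr scaleNr mulmxA subrr.
by rewrite -scalemxAl -scalemxAr scaleNr mulmxA subrr.
Qed.

Lemma mhas_d0_locally_constant m n (A : R[i] -> 'M[R[i]]_(m, n)) (E : set R[i]) z : open E ->
  (forall z, E z -> mhas_d A z 0 0) -> E z -> \forall w \near z, A w = A z.
Proof.
move=> oE Ad Ez.
have h i j : \forall w \near z, A w i j = A z i j.
  apply: (C1_d0_locally_constant (D := E) (f := fun w => A w i j) oE) => // w Ew.
  by have := Ad w Ew i j; rewrite !mxE.
have : \forall w \near z, forall k : 'I_m * 'I_n, A w k.1 k.2 = A z k.1 k.2.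
  by apply: (@filter_forall _ _ _ _ (nbhs_filter z)) => -[i j]; exact: h.
by apply: filterS => w hw; apply/matrixP => i j; exact: (hw (i, j)).
Qed.

(** The quotient of the two sides has differential zero. *)
Lemma N_angle gamma : gamma z0 = 0 -> (forall z, D z -> conj_d gamma z) ->
  forall l z, S1 l -> D z -> N l z = expLi (angle l (beta z) (gamma z))%:C.
Proof.
move=> g0 gd l z l1 Dz; have [p [pc p0 p1 pD]] := pathD Dz0 Dz.
pose A w := N l w *m expLi (- (angle l (beta w) (gamma w))%:C).
have loc w : D w -> \forall x \near w, A x = A w.
  move=> Dw; apply: (mhas_d0_locally_constant oD) Dw => x Dx.
  exact: N_rotated_d (gd x Dx).
have := path_constant pc pD loc; rewrite p0 p1 /A N0 // g0 beta0.
rewrite /angle !mulr0 addr0 mulr0 oppr0 expLi0 mulmx1 => E.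
by rewrite -[LHS]mulmx1 -(expLiKN (angle l (beta z) (gamma z))%:C) mulmxA -E mul1mx.
Qed.

Lemma S1_sq (y : R) : -1 <= y <= 1 -> exists2 l : R[i], S1 l & complex.Im (l ^ 2) = y.
Proof.
move=> y1; exists (cis (asin y / 2)); first exact: S1_cis.
rewrite cis_exp (_ : 2%:~R * (asin y / 2) = asin y); last by rewrite mulrC divfK.
by rewrite /= asinK // in_itv.
Qed.

Lemma csin_real (t : R) : csin t%:C = (sin t)%:C.
Proof.
rewrite /csin -mulrN -rmorphN /= !cexp_i cisN.
have -> : conjc (cis t) - cis t = - (2 * 'i%C * (sin t)%:C).
  by apply/eqP; rewrite eq_complex /=; apply/andP; split; apply/eqP; ring.
have alg (j x : R[i]) : - (2 * j * x) * j / 2 = - (j * j) * x by field.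
by rewrite alg sqri opprK mul1r.
Qed.

(** Since [Im (l^2)] takes all values between [-1] and [1], some [l] makes the two
    angles differ by a nonzero amount smaller than [pi], which the sine detects. *)
Lemma angle_inj (u v v' : R) :
  (forall l, S1 l -> expLi (angle l u v)%:C = expLi (angle l u v')%:C) -> v = v'.
Proof.
move=> h; apply/eqP; rewrite -subr_eq0; apply/negPn/negP => d0.
set d := v - v' in d0; pose y := Num.min 1 (pi / `|d|).
have nd0 : 0 < `|d| by rewrite normr_gt0.
have y0 : 0 < y by rewrite lt_min ltr01 divr_gt0 // pi_gt0.
have y1 : y <= 1 by rewrite ge_min lexx.
have [l l1 lE] : exists2 l : R[i], S1 l & complex.Im (l ^ 2) = y.
  by apply: S1_sq; rewrite y1 andbT (le_trans _ (ltW y0)) // lerN10.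
have := h l l1; have -> : (angle l u v)%:C = (angle l u v')%:C + (2^-1 * (y * d))%:C.
  by rewrite -rmorphD /=; congr (_%:C); rewrite /angle lE /d; ring.
rewrite expLiD => /(congr1 (mulmx (expLi (- (angle l u v')%:C)))).
rewrite mulmxA expLiKN mul1mx => /(congr1 (fun M : 'M[R[i]]_4 => M 1 0)).
rewrite expLi_entry (_ : (1 : 'I_4) == 0 = false) // LiE !mxE /= mulr0 add0r mulr1.
set t := 2^-1 * (y * d) => sin0.
have st : sin t = 0 by move: sin0; rewrite csin_real => /eqP; rewrite (inj_eq (@realc_inj R)) => /eqP.
have tE : `|t| = y * `|d| / 2.
  by rewrite /t !normrM (ger0_norm (ltW y0)) ger0_norm ?invr_ge0 // mulrC.
have t0 : 0 < `|t| by rewrite tE divr_gt0 // mulr_gt0.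
have tpi : `|t| < pi.
  rewrite tE ltr_pdivrMr //; apply: (@le_lt_trans _ _ pi); last first.
    by rewrite mulr_natr mulr2n ltrDl pi_gt0.
  by rewrite -ler_pdivlMr // ge_min lexx orbT.
have : 0 < sin `|t| by apply: sin_gt0_pi; rewrite t0.
by case: (ger0P t) => _; rewrite ?sinN st ?oppr0 ltxx.
Qed.

(** Where [l^2] is the imaginary unit, the angle does not involve [beta]: twice an
    argument of the complex coordinate [n1] of [N] is a conjugate function. For the
    other [l] the formula follows because the quotient of its two sides has differential
    zero. *)
Lemma local_conjugate z1 : D z1 -> exists (g : R[i] -> R) (r : R), [/\ 0 < r, g z1 = 0 &
  forall w, cmod (w - z1) < r -> [/\ D w, conj_d g w &
    forall l, S1 l -> N l w = N l z1 *m expLi (angle l (beta w - beta z1) (g w))%:C]].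
Proof.
move=> Dz1; pose l0 : R[i] := cis (pi / 4).
have l01 : S1 l0 by exact: S1_cis.
have l02 : l0 ^ 2 = 'i%C.
  rewrite cis_exp (_ : 2%:~R * (pi / 4) = pi / 2); last by field.
  by rewrite /cis cos_pihalf sin_pihalf.
have l02N : l0 ^ (-2) = - 'i%C by rewrite -S1_conj2 // l02 conjc_i.
pose n1 w := N l0 w 0 0 - 'i%C * N l0 w 0 1.
have i2 := sqri R.
have n1d z : D z -> has_d n1 z (2^-1 * b z * n1 z) (- 2^-1 * conjc (b z) * n1 z).
  move=> Dz; have h00 := Nd l01 Dz 0 0; have h01 := Nd l01 Dz 0 1.
  have [e00 e01] := mul_Li (N l0 z) 0.
  apply: (has_d_eq (has_dB h00 (has_dZ 'i%C h01))); rewrite [in LHS]mxE [X in _ - _ * X = _]mxE e00 e01 /n1.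
    rewrite l02N; move: (N l0 z 0 0) (N l0 z 0 1) (b z) => x y p.
    transitivity (2^-1 * p * (- ('i%C * 'i%C) * x - 'i%C * y)); first by ring.
    by rewrite i2 opprK mul1r.
  rewrite l02; move: (N l0 z 0 0) (N l0 z 0 1) (conjc (b z)) => x y p.
  transitivity (- 2^-1 * p * (- ('i%C * 'i%C) * x - 'i%C * y)); first by ring.
  by rewrite i2 opprK mul1r.
have n1c z : D z -> {for z, continuous n1}.
  by move=> Dz; exact: (ctsB (@Nc l0 l01 z Dz 0 0) (ctsZ (@Nc l0 l01 z Dz 0 1))).
have n1E z : D z -> n1 z * conjc (n1 z) = 1.
  move=> Dz; have [p [pc p0 p1 pD]] := pathD Dz0 Dz.
  have loc w : D w -> \forall x \near w, n1 x * conjc (n1 x) = n1 w * conjc (n1 w).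
    apply: (C1_d0_locally_constant (f := fun x => n1 x * conjc (n1 x)) oD) => {}w Dw.
    have c2 := conjc_half R.
    have cN : conjc (- 2^-1 : R[i]) = - 2^-1 by rewrite conjcN c2.
    apply: (has_d_eq (has_dM (n1d w Dw) (has_d_conj (n1d w Dw)))).
      rewrite !conjcM conjcK cN.
      by move: (n1 w) (conjc (n1 w)) (b w) (conjc (b w)) => x y q q'; ring.
    rewrite !conjcM c2.
    by move: (n1 w) (conjc (n1 w)) (b w) (conjc (b w)) => x y q q'; ring.
  have := path_constant pc pD loc; rewrite p0 p1 => <-.
  have -> : n1 z0 = 1 by rewrite /n1 N0 // !mxE /= mulr0 subr0.
  by rewrite conjc1 mulr1.
pose k z := - 'i%C * b z / 2.
have kc z : conjc (k z) = 'i%C * conjc (b z) / 2.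
  by rewrite /k !conjcM conjcN conjc_i opprK conjc_half.
have n1k z : D z -> has_d n1 z ('i%C * k z * n1 z) ('i%C * conjc (k z) * n1 z).
  move=> Dz; apply: (has_d_eq (n1d z Dz)).
    by rewrite /k !mulrA mulrN i2 opprK mul1r (mulrC (b z)).
  rewrite kc; transitivity ('i%C * 'i%C * (2^-1 * conjc (b z) * n1 z)); last by ring.
  by rewrite i2; ring.
have [g [r [r0 g1 rP]]] := local_argument oD Dz1 n1k n1c n1E.
have gd w : cmod (w - z1) < r -> conj_d (fun w => 2 * g w) w.
  move=> wr; have [_ h] := rP w wr.
  have E : (fun w => (2 * g w)%:C) = fun w => 2 * (g w)%:C :> R[i].
    by apply/funext => x; rewrite rmorphM /= rmorph_nat.
  rewrite /conj_d E; apply: (has_d_eq (has_dZ 2 h)).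
    by rewrite /k mulrC divfK ?pnatr_eq0.
  by rewrite kc mulrC divfK ?pnatr_eq0.
exists (fun w => 2 * g w), r; split=> //; first by rewrite g1 mulr0.
move=> w wr; have [Dw _] := rP w wr; split=> //; first exact: gd.
move=> l l1; pose A w := N l w *m expLi (- (angle l (beta w) (2 * g w))%:C).
pose B : set R[i] := [set w | cmod (w - z1) < r].
have oB : open B.
  rewrite openE => x Bx; apply/nearCP; exists (r - cmod (x - z1)); first by rewrite subr_gt0.
  move=> y yx; rewrite /B /= -(subrK x y) -addrA; apply: le_lt_trans (cmodD _ _) _.
  by rewrite -ltrBrDr.
have Ad x : B x -> mhas_d A x 0 0.
  by move=> xr; have [Dx _] := rP x xr; exact: (N_rotated_d l1 Dx (gd x xr)).
have AE : A w = A z1.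
  apply/matrixP => i j; apply/eqP; rewrite -subr_eq0 -cmod_eq0 eq_le cmod_ge0 andbT.
  have BC : C1_d B (fun x => A x i j) (fun=> 0) (fun=> 0).
    split=> [x Bx|x _|x _]; [|exact: cts_cst|exact: cts_cst].
    by have := Ad x Bx i j; rewrite !mxE.
  rewrite -[leRHS](mul0r (cmod (w - z1))) -[X in _ <= X * _](mulr0 2).
  apply: (C1_mvt oB BC) => u uw; rewrite !cmod0 addr0; split=> //.
  exact: le_lt_trans uw wr.
have : N l w = A z1 *m expLi (angle l (beta w) (2 * g w))%:C.
  by rewrite -AE /A -mulmxA expLiKN mulmx1.
rewrite /A g1 mulr0 -mulmxA -expLiD => ->; congr (_ *m expLi _).
by rewrite -rmorphN -rmorphD /=; congr (_%:C); rewrite /angle; ring.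
Qed.

(** The set of the points at which [N] has the form of [N_angle], for some real number
    in the place of [gamma z], is open and closed along paths by [local_conjugate],
    hence is all of [D]. By [angle_inj] the number is unique, so locally it differs by a
    constant from a conjugate function. *)
Lemma conjugate_exists : exists gamma, gamma z0 = 0 /\ forall z, D z -> conj_d gamma z.
Proof.
pose S z := exists g : R, forall l, S1 l -> N l z = expLi (angle l (beta z) g)%:C.
have angleD l u v u' v' : (angle l (u + u') (v + v'))%:C = (angle l u v)%:C + (angle l u' v')%:C :> R[i].
  by rewrite -rmorphD /=; congr (_%:C); rewrite /angle; ring.
have local z1 : D z1 -> exists (g : R[i] -> R) (r : R), [/\ 0 < r, g z1 = 0 &
   forall w, cmod (w - z1) < r -> [/\ D w, conj_d g w &
     forall l, S1 l -> N l w = N l z1 *m expLi (angle l (beta w - beta z1) (g w))%:C]].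
  exact: local_conjugate.
have Sloc z1 : D z1 -> \forall w \near z1, S w = S z1.
  move=> Dz1; have [g [r [r0 g1 rP]]] := local z1 Dz1.
  apply/nearCP; exists r; first exact: r0.
  move=> w wr; have [Dw _ NE] := rP w wr; apply/propext; split=> -[v vP].
    exists (v - g w) => l l1.
    have -> : N l z1 = N l w *m expLi (- (angle l (beta w - beta z1) (g w))%:C).
      by rewrite (NE l l1) -mulmxA expLiNK mulmx1.
    rewrite (vP l l1) -expLiD -rmorphN -rmorphD /=; congr (expLi _%:C).
    by rewrite /angle; ring.
  exists (v + g w) => l l1; rewrite (NE l l1) (vP l l1) -expLiD -angleD.
  by rewrite (addrC (beta z1)) subrK.
have SD z : D z -> S z.
  move=> Dz; have [p [pc p0 p1 pD]] := pathD Dz0 Dz.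
  have := path_constant pc pD Sloc; rewrite p0 p1 => <-.
  by exists 0 => l l1; rewrite N0 // beta0 /angle !mulr0 addr0 mulr0 expLi0.
have [gamma gammaP] : exists gamma : R[i] -> R, forall z, D z ->
    forall l, S1 l -> N l z = expLi (angle l (beta z) (gamma z))%:C.
  have /choice[f fP] : forall z, exists v : R, D z -> forall l, S1 l -> N l z = expLi (angle l (beta z) v)%:C.
    move=> z; case: (pselect (D z)) => [/SD[v vP]|nDz]; first by exists v.
    by exists 0.
  by exists f.
exists gamma; split.
  apply: (@angle_inj 0) => l l1; rewrite -{1}beta0 -gammaP // N0 //.
  by rewrite /angle !mulr0 addr0 mulr0 expLi0.
move=> z1 Dz1; have [g [r [r0 g1 rP]]] := local z1 Dz1.
have gE w : cmod (w - z1) < r -> gamma w = gamma z1 + g w.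
  move=> wr; have [Dw _ NE] := rP w wr.
  apply: (@angle_inj (beta w)) => l l1; rewrite -gammaP // NE // gammaP // -expLiD -angleD.
  by rewrite (addrC (beta z1)) subrK.
have zr : cmod (z1 - z1) < r by rewrite subrr cmod0.
have [_ gd _] := rP z1 zr.
have h := has_dD (has_d_cst (gamma z1)%:C z1) gd.
have near_z1 : \forall w \near z1, (gamma z1)%:C + (g w)%:C = (gamma w)%:C :> R[i].
  by apply/nearCP; exists r => // w wr; rewrite -rmorphD /= -gE.
by apply: (has_d_eq (has_d_near near_z1 h)); rewrite add0r.
Qed.

End ConjugateFunction.

(** * Eigenspaces of Lj *)

Section Eigenspaces.
Variable R : realType.
Implicit Types (x y : 'cV[R[i]]_4) (B : 'M[R[i]]_4) (a b k : R[i]).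

(** The eigenspaces of [Lj]: the translation parts of [g_m1] and of [g_1]. *)
Definition Vm x := Lj *m x = 'i%C *: x.
Definition Vp x := Lj *m x = - 'i%C *: x.

Lemma sum4 (F : 'I_4 -> R[i]) : \sum_k F k = F 0 + F 1 + F 2 + F 3.
Proof.
rewrite !big_ord_recl big_ord0 addr0 !addrA.
have -> : lift ord0 ord0 = 1 :> 'I_4 by exact/val_inj.
have -> : lift ord0 (lift ord0 ord0) = 2 :> 'I_4 by exact/val_inj.
by have -> : lift ord0 (lift ord0 (lift ord0 ord0)) = 3 :> 'I_4 by exact/val_inj.
Qed.

Lemma Li_entries x : [/\ (Li *m x) 0 0 = - x 1 0, (Li *m x) 1 0 = x 0 0,
  (Li *m x) 2 0 = - x 3 0 & (Li *m x) 3 0 = x 2 0].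
Proof.
by rewrite LiE; split; rewrite !mxE sum4 !mxE /= ?(mul0r, mulN1r, mul1r, add0r, addr0).
Qed.

Lemma Lj_entries x : [/\ (Lj *m x) 0 0 = - x 2 0, (Lj *m x) 1 0 = x 3 0,
  (Lj *m x) 2 0 = x 0 0 & (Lj *m x) 3 0 = - x 1 0].
Proof.
by rewrite LjE; split; rewrite !mxE sum4 !mxE /= ?(mul0r, mulN1r, mul1r, add0r, addr0).
Qed.

Lemma col4P x y : x 0 0 = y 0 0 -> x 1 0 = y 1 0 -> x 2 0 = y 2 0 -> x 3 0 = y 3 0 -> x = y.
Proof.
move=> h0 h1 h2 h3; apply/colP => -[[|[|[|[|k]]]] //= hk].
- by rewrite (_ : Ordinal hk = 0) //; exact/val_inj.
- by rewrite (_ : Ordinal hk = 1) //; exact/val_inj.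
- by rewrite (_ : Ordinal hk = 2) //; exact/val_inj.
- by rewrite (_ : Ordinal hk = 3) //; exact/val_inj.
Qed.

Lemma Vm_eps : Vm eps.
Proof.
have [e0 e1 e2 e3] := Lj_entries eps; have i2 := sqri R; apply: col4P.
- by rewrite e0 !mxE /= mulrN opprK mulr1 mulrC.
- by rewrite e1 !mxE /= !mulr0.
- rewrite e2 !mxE /= mulr1; have alg (j h : R[i]) : j * (h * - j) = - (j * j) * h by ring.
  by rewrite alg i2 opprK mul1r.
- by rewrite e3 !mxE /= !mulr0 oppr0.
Qed.

Lemma Vp_epsbar : Vp epsbar.
Proof.
have [e0 e1 e2 e3] := Lj_entries epsbar; have i2 := sqri R; apply: col4P.
- by rewrite e0 !mxE /= mulr1 mulNr mulrC.
- by rewrite e1 !mxE /= !mulr0.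
- by rewrite e2 !mxE /= mulr1 mulNr mulrCA i2 mulrN1 opprK.
- by rewrite e3 !mxE /= !mulr0 oppr0.
Qed.

Lemma Li_Vm x : Vm x -> Vp (Li *m x).
Proof. by rewrite /Vp mulmxA Lj_Li mulNmx -mulmxA => ->; rewrite -scalemxAr scaleNr. Qed.

Lemma Li_Vp x : Vp x -> Vm (Li *m x).
Proof. by rewrite /Vm mulmxA Lj_Li mulNmx -mulmxA => ->; rewrite -scalemxAr scaleNr opprK. Qed.

Lemma VmD x y : Vm x -> Vm y -> Vm (x + y).
Proof. by rewrite /Vm mulmxDr scalerDr => -> ->. Qed.

Lemma VmZ a x : Vm x -> Vm (a *: x).
Proof. by rewrite /Vm -scalemxAr => ->; rewrite !scalerA mulrC. Qed.

Lemma VpD x y : Vp x -> Vp y -> Vp (x + y).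
Proof. by rewrite /Vp mulmxDr scalerDr => -> ->. Qed.

Lemma VpZ a x : Vp x -> Vp (a *: x).
Proof. by rewrite /Vp -scalemxAr => ->; rewrite !scalerA mulrC. Qed.

Lemma ci_neq0 : 'i%C != 0 :> R[i].
Proof. by rewrite -cmod_eq0 cmodi oner_eq0. Qed.

Lemma VmVp_sum x y x' y' : Vm x -> Vp y -> Vm x' -> Vp y' -> x + y = x' + y' ->
  x = x' /\ y = y'.
Proof.
move=> hx hy hx' hy' E; have := congr1 (mulmx Lj) E.
rewrite !mulmxDr hx hy hx' hy' !scaleNr -!scalerBr => /(scalerI ci_neq0) E'.
have h : x *+ 2 = x' *+ 2.
  have := f_equal2 (fun p q => p + q) E E'.
  by rewrite /= addrACA subrr addr0 addrACA subrr addr0 -!mulr2n.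
have xx : x = x'.
  apply/colP => i; have := congr1 (fun v : 'cV[R[i]]_4 => v i 0) h.
  have alg (p : R[i]) : p = (p + p) / 2 by field.
  by rewrite !mulr2n !mxE => e; rewrite [LHS]alg e -alg.
by split=> //; move: E; rewrite xx => /addrI.
Qed.

Lemma Vm0 : Vm 0. Proof. by rewrite /Vm mulmx0 scaler0. Qed.
Lemma Vp0 : Vp 0. Proof. by rewrite /Vp mulmx0 scaler0. Qed.

Lemma Vm_coord x : Vm x -> x = (2 * x 0 0) *: eps + (2 * x 1 0) *: (Li *m epsbar).
Proof.
move=> hx; have [e0 e1 e2 e3] := Lj_entries x; have [f0 f1 f2 f3] := Li_entries epsbar.
have x3 : x 3 0 = 'i%C * x 1 0 by rewrite -e1 hx mxE.
have x2 : x 2 0 = - 'i%C * x 0 0 by rewrite -[LHS]opprK -e0 hx mxE mulNr.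
have half (p q : R[i]) : 2 * p * (2^-1 * q) = p * q by field.
apply: col4P; rewrite mxE [X in _ = X + _]mxE [X in _ = _ + X]mxE ?f0 ?f1 ?f2 ?f3 !mxE /=.
- by rewrite half mulr1 !mulr0 oppr0 mulr0 addr0.
- by rewrite !half mulr1 mulr0 add0r.
- by rewrite half x2 !mulr0 oppr0 mulr0 addr0 mulrC.
- by rewrite half x3 !mulr0 add0r half mulrC.
Qed.

Lemma Vm_commute B x : B *m Lj = Lj *m B -> Vm x -> Vm (B *m x).
Proof. by move=> BL; rewrite /Vm mulmxA -BL -mulmxA => ->; rewrite -scalemxAr. Qed.

Lemma Vp_commute B x : B *m Lj = Lj *m B -> Vp x -> Vp (B *m x).
Proof. by move=> BL; rewrite /Vp mulmxA -BL -mulmxA => ->; rewrite -scalemxAr. Qed.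

(** [Li] anticommutes with [Lj], so conjugation by [Lj] changes the sign of the trace. *)
Lemma tr_commute_Lj B : B *m Lj = Lj *m B -> \tr (B *m Li) = 0.
Proof.
move=> BL; have h : \tr (B *m Li) = - \tr (B *m Li).
  have E : B *m Li = - (B *m Li *m Lj *m Lj).
    by rewrite -(mulmxA (B *m Li)) Lj_sqr mulmxN mulmx1 opprK.
  rewrite {1}E raddfN /= mxtrace_mulC !mulmxA -BL -(mulmxA B) Lj_Li mulmxN mulNmx.
  by rewrite raddfN /= opprK E raddfN /= opprK !mulmxA.
have : \tr (B *m Li) *+ 2 = 0 by rewrite mulr2n {1}h addNr.
by move/eqP; rewrite mulrn_eq0 /= => /eqP.
Qed.

Lemma tr_LiLi : \tr (Li *m Li : 'M[R[i]]_4) = - 4.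
Proof. by rewrite Li_sqr raddfN /= mxtrace1. Qed.

Lemma commute_Li_split B B' a b : B *m Lj = Lj *m B -> B' *m Lj = Lj *m B' ->
  B + a *: Li = B' + b *: Li -> B = B' /\ a = b.
Proof.
move=> hB hB' E; have ab : a = b.
  have := congr1 (fun M => \tr (M *m Li)) E.
  rewrite !mulmxDl !mxtraceD (tr_commute_Lj hB) (tr_commute_Lj hB') !add0r -!scalemxAl !mxtraceZ tr_LiLi.
  by apply: mulIf; rewrite oppr_eq0 pnatr_eq0.
by split=> //; move: E; rewrite ab => /addIr.
Qed.

Lemma R_commute a b k :
  (a *: Ri + b *: Rj + k *: Rk) *m Lj = Lj *m (a *: Ri + b *: Rj + k *: Rk) :> 'M[R[i]]_4.
Proof.
have -> : a *: Ri + b *: Rj + k *: Rk = G0_of 0 (- a) (- b) (- k) :> 'M[R[i]]_4.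
  rewrite /G0_of (scaleNr a) (scaleNr b) (scaleNr k) (opprK (a *: Ri)) (opprK (b *: Rj)).
  by rewrite (opprK (k *: Rk)) (raddf0 (scalar_mx (n := 4))) (add0r (a *: Ri)).
by rewrite G0_ofE LjE g0_lj.
Qed.

Lemma lie_inj (A B : 'M[R[i]]_4) x y : lie A x = lie B y -> A = B /\ x = y.
Proof.
move=> E; have := congr1 (@linpart R) E; have := congr1 (@trpart R) E.
by rewrite /linpart /trpart /lie !block_mxKul !block_mxKur.
Qed.

Lemma lieD (A B : 'M[R[i]]_4) x y : lie A x + lie B y = lie (A + B) (x + y).
Proof. by rewrite /lie add_block_mx !addr0. Qed.

Lemma lieZ a (A : 'M[R[i]]_4) x : a *: lie A x = lie (a *: A) (a *: x).
Proof. by rewrite /lie scale_block_mx !scaler0. Qed.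

(** The trace against [Li] separates the components in [g_0] and [g_2], and the
    eigenvalue of [Lj] separates those in [g_m1] and [g_1]. *)
Lemma components_lie B a x y (Am1 A0 A1 A2 : 'M[R[i]]_(4 + 1)) :
  B *m Lj = Lj *m B -> Vm x -> Vp y -> components (lie (B + a *: Li) (x + y)) Am1 A0 A1 A2 ->
  [/\ Am1 = lie 0 x, A0 = lie B 0, A1 = lie 0 y & A2 = lie (a *: Li) 0].
Proof.
move=> hB hx hy [[a1 [b1 ->]] [a2 [b2 [c2 ->]]] [a3 [b3 ->]] [a4 ->]].
rewrite !lieD !addr0 !add0r => /lie_inj[E1 E2].
have [-> ->] := commute_Li_split hB (R_commute _ _ _) E1.
have [-> ->] // := VmVp_sum hx hy (VmD (VmZ a1 Vm_eps) (VmZ b1 (Li_Vp Vp_epsbar)))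
  (VpD (VpZ a3 Vp_epsbar) (VpZ b3 (Li_Vm Vm_eps))) E2.
Qed.

End Eigenspaces.

(** * Eigenvectors of Li *)

Section ComplexEigenvectors.
Variable R : realType.
Implicit Types (x y : 'cV[R[i]]_4) (k z : R[i]).

(** The left eigenvectors of [Li] for the eigenvalue [k = 'i, - 'i]; they turn [expLi] into
    a scalar exponential. *)
Definition phi (k : R[i]) (lo : bool) x : R[i] :=
  if lo then x 2 0 + k * x 3 0 else x 0 0 + k * x 1 0.

Lemma phiD k lo x y : phi k lo (x + y) = phi k lo x + phi k lo y.
Proof. by case: lo; rewrite /phi !mxE; ring. Qed.

Lemma phiZ k lo a x : phi k lo (a *: x) = a * phi k lo x.
Proof. by case: lo; rewrite /phi !mxE; ring. Qed.

Lemma phi_Li k lo x : k * k = -1 -> phi k lo (Li *m x) = k * phi k lo x.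
Proof.
move=> k2; have [e0 e1 e2 e3] := Li_entries x; case: lo; rewrite /phi ?e0 ?e1 ?e2 ?e3.
  by rewrite mulrDr mulrA k2 mulN1r addrC.
by rewrite mulrDr mulrA k2 mulN1r addrC.
Qed.

Lemma ik2 (s : bool) : (if s then 'i%C else - 'i%C) * (if s then 'i%C else - 'i%C) = -1 :> R[i].
Proof. by case: s; rewrite ?mulrNN sqri. Qed.

Lemma phi_expLi (s lo : bool) z x : let k : R[i] := if s then 'i%C else - 'i%C in
  phi k lo (expLi z *m x) = cexp (k * z) * phi k lo x.
Proof.
move=> k; have k2 : k * k = -1 by exact: ik2.
rewrite /expLi mulmxDl mul_scalar_mx -scalemxAl phiD !phiZ phi_Li //.
rewrite mulrA -mulrDl; congr (_ * _); rewrite /ccos /csin /k.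
have alg1 (j p q : R[i]) : (p + q) / 2 + (q - p) * j / 2 * j = (p + q) / 2 + (j * j) * ((q - p) / 2) by ring.
case: s k k2 => /= _ _.
  by move: (cexp _) (cexp _) => p q; rewrite alg1 sqri; field.
have -> : - 'i%C * z = - ('i%C * z) by rewrite mulNr.
move: (cexp _) (cexp _) => p q.
have alg2 (j : R[i]) : (q + p) / 2 + (p - q) * j / 2 * - j = (p + q) / 2 - (j * j) * ((p - q) / 2) by ring.
by rewrite alg2 sqri; field.
Qed.

Lemma phi_inv x :
  [/\ x 0 0 = 2^-1 * (phi 'i%C false x + phi (- 'i%C) false x),
      x 1 0 = - 'i%C / 2 * (phi 'i%C false x - phi (- 'i%C) false x),
      x 2 0 = 2^-1 * (phi 'i%C true x + phi (- 'i%C) true x) &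
      x 3 0 = - 'i%C / 2 * (phi 'i%C true x - phi (- 'i%C) true x)].
Proof.
have alg (j a b : R[i]) : - j / 2 * (a + j * b - (a + - j * b)) = - (j * j) * b by field.
by rewrite /phi; split; rewrite ?alg ?sqri ?opprK ?mul1r //; field.
Qed.

Lemma phi_coord (i : 'I_4) : exists (lo : bool) (a b : R[i]), forall x,
  x i 0 = a * phi 'i%C lo x + b * phi (- 'i%C) lo x.
Proof.
case: i => [[|[|[|[|j]]]] //= hj]; [exists false, 2^-1, 2^-1
  |exists false, (- 'i%C / 2), ('i%C / 2)|exists true, 2^-1, 2^-1
  |exists true, (- 'i%C / 2), ('i%C / 2)] => x; have [e0 e1 e2 e3] := phi_inv x.
- by rewrite (_ : Ordinal hj = 0) ?e0 ?mulrDr //; exact/val_inj.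
- rewrite (_ : Ordinal hj = 1) ?e1; last exact/val_inj.
  by rewrite mulrBr -mulNr -mulNr opprK.
- by rewrite (_ : Ordinal hj = 2) ?e2 ?mulrDr //; exact/val_inj.
- rewrite (_ : Ordinal hj = 3) ?e3; last exact/val_inj.
  by rewrite mulrBr -mulNr -mulNr opprK.
Qed.

End ComplexEigenvectors.

(** * Regularity of vector functions *)

Section VectorCalculus.
Variable R : realType.
Implicit Types (z w : R[i]) (D : set R[i]).

Definition mcts m n (A : R[i] -> 'M[R[i]]_(m, n)) z :=
  forall i j, {for z, continuous (fun w => A w i j)}.

Lemma mctsM m n p (A : R[i] -> 'M[R[i]]_(m, n)) (B : R[i] -> 'M[R[i]]_(n, p)) z :
  mcts A z -> mcts B z -> mcts (fun w => A w *m B w) z.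
Proof.
move=> cA cB i j; under [X in {for _, continuous X}]eq_fun do rewrite mxE.
by apply: cts_sum => k _; exact: (ctsM (cA i k) (cB k j)).
Qed.

Lemma mcts_cst m n (A : 'M[R[i]]_(m, n)) z : mcts (fun=> A) z.
Proof. by move=> i j; exact: cts_cst. Qed.

Lemma mctsZ m n (f : R[i] -> R[i]) (A : R[i] -> 'M[R[i]]_(m, n)) z :
  {for z, continuous f} -> mcts A z -> mcts (fun w => f w *: A w) z.
Proof.
move=> cf cA i j; under [X in {for _, continuous X}]eq_fun do rewrite mxE.
exact: (ctsM cf (cA i j)).
Qed.

Lemma mctsD m n (A B : R[i] -> 'M[R[i]]_(m, n)) z :
  mcts A z -> mcts B z -> mcts (fun w => A w + B w) z.
Proof.
move=> cA cB i j; under [X in {for _, continuous X}]eq_fun do rewrite mxE.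
exact: (ctsD (cA i j) (cB i j)).
Qed.

Lemma mcts_expLi (f : R[i] -> R[i]) z : {for z, continuous f} -> mcts (fun w => expLi (f w)) z.
Proof.
move=> cf i j; under [X in {for _, continuous X}]eq_fun do rewrite expLi_entry.
have c1 := cts_cexp (ctsZ (c := 'i%C) cf); have c2 := cts_cexp (ctsN (ctsZ (c := 'i%C) cf)).
have cc : {for z, continuous (fun w => ccos (f w))} by exact: (ctsMr (ctsD c1 c2)).
have cs : {for z, continuous (fun w => csin (f w))} by exact: (ctsMr (ctsMr (ctsB c2 c1))).
exact: (ctsD (ctsMr cc) (ctsMr cs)).
Qed.

Lemma mcts_in m n (A B : R[i] -> 'M[R[i]]_(m, n)) D z : open D -> D z ->
  (forall w, D w -> A w = B w) -> mcts A z -> mcts B z.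
Proof. by move=> oD Dz AB cA i j; apply: (continuous_in oD Dz _ (cA i j)) => w Dw; rewrite AB. Qed.

Lemma mxCk_cts m n (A : R[i] -> 'M[R[i]]_(m, n)) D z : open D -> mxCk 1 D A -> D z ->
  mcts A z /\ (mcts (mxdz A) z /\ mcts (mxdzbar A) z).
Proof.
move=> oD AC Dz.
have h i j : C1_d D (fun w => A w i j) (dz (fun w => A w i j)) (dzbar (fun w => A w i j)).
  exact: Ck_C1_d (AC i j).
split; first by move=> i j; exact: C1_continuous oD (h i j) Dz.
split=> i j; under [X in {for _, continuous X}]eq_fun do rewrite mxE.
  by have [_ c _] := h i j; exact: c.
by have [_ _ c] := h i j; exact: c.
Qed.

Lemma mhas_d_aff (G : R[i] -> 'M[R[i]]_4) (V : R[i] -> 'cV[R[i]]_4) z P Q p q :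
  mhas_d G z P Q -> mhas_d V z p q -> mhas_d (fun w => aff (G w) (V w)) z (lie P p) (lie Q q).
Proof.
move=> hG hV i j; rewrite /aff /lie.
case: (split_ordP i) => i' ->; case: (split_ordP j) => j' ->.
- by under eq_fun do rewrite block_mxEul; rewrite !block_mxEul.
- by under eq_fun do rewrite block_mxEur; rewrite !block_mxEur.
- by under eq_fun do rewrite block_mxEdl; rewrite !block_mxEdl !mxE; exact: has_d_cst.
- by under eq_fun do rewrite block_mxEdr; rewrite !block_mxEdr [X in has_d _ _ X]mxE [X in has_d _ _ _ X]mxE; exact: has_d_cst.
Qed.

Lemma mhas_d_linpart (A : R[i] -> 'M[R[i]]_(4 + 1)) z (P Q : 'M[R[i]]_4) p q :
  mhas_d A z (lie P p) (lie Q q) ->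
  mhas_d (fun w => linpart (A w)) z P Q /\ mhas_d (fun w => trpart (A w)) z p q.
Proof.
move=> h; split=> i j.
  have := h (lshift 1 i) (lshift 1 j); rewrite /lie !block_mxEul => h'.
  by under eq_fun do rewrite /linpart !mxE.
have := h (lshift 1 i) (rshift 4 j); rewrite /lie !block_mxEur => h'.
by under eq_fun do rewrite /trpart !mxE.
Qed.

Lemma mhas_d_phi (V : R[i] -> 'cV[R[i]]_4) z p q :
  (forall s lo : bool, let k : R[i] := if s then 'i%C else - 'i%C in
    has_d (fun w => phi k lo (V w)) z (phi k lo p) (phi k lo q)) ->
  mhas_d V z p q.
Proof.
move=> h i j; rewrite (ord1 j); have [lo [a [b ab]]] := phi_coord R i.
rewrite (ab p) (ab q); under eq_fun do rewrite ab.
exact: (has_dD (has_dZ a (h true lo)) (has_dZ b (h false lo))).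
Qed.

Lemma mcts_phi (V : R[i] -> 'cV[R[i]]_4) z :
  (forall s lo : bool, {for z, continuous (fun w => phi (if s then 'i%C else - 'i%C) lo (V w))}) ->
  mcts V z.
Proof.
move=> h i j; rewrite (ord1 j); have [lo [a [b ab]]] := phi_coord R i.
under [X in {for _, continuous X}]eq_fun do rewrite ab.
exact: (ctsD (ctsZ (c := a) (h true lo)) (ctsZ (c := b) (h false lo))).
Qed.

Lemma C1_d_dz (f a b : R[i] -> R[i]) D : open D -> C1_d D f a b -> C1_d D f (dz f) (dzbar f).
Proof. by move=> oD fC; apply: Ck_C1_d; exact: C1_d_Ck fC. Qed.

Lemma Ck2_C1 (f : R[i] -> R[i]) D : open D -> Ck 2 D f ->
  C1_d D (dz f) (dz (dz f)) (dzbar (dz f)) /\ C1_d D (dzbar f) (dz (dzbar f)) (dzbar (dzbar f)).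
Proof.
move=> oD [_ /Ck_C1_d[xd xa xb] /Ck_C1_d[yd ya yb]].
have h1 z : D z -> has_d (dz f) z (2^-1 * (dz (dx f) z - 'i%C * dz (dy f) z))
    (2^-1 * (dzbar (dx f) z - 'i%C * dzbar (dy f) z)).
  by move=> Dz; exact: (has_dZ 2^-1 (has_dB (xd z Dz) (has_dZ 'i%C (yd z Dz)))).
have h2 z : D z -> has_d (dzbar f) z (2^-1 * (dz (dx f) z + 'i%C * dz (dy f) z))
    (2^-1 * (dzbar (dx f) z + 'i%C * dzbar (dy f) z)).
  by move=> Dz; exact: (has_dZ 2^-1 (has_dD (xd z Dz) (has_dZ 'i%C (yd z Dz)))).
split; apply: C1_d_dz; first [exact: oD | split; [exact: h1| |] | split; [exact: h2| |]].
- by move=> z Dz; exact: (ctsZ (ctsB (xa z Dz) (ctsZ (ya z Dz)))).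
- by move=> z Dz; exact: (ctsZ (ctsB (xb z Dz) (ctsZ (yb z Dz)))).
- by move=> z Dz; exact: (ctsZ (ctsD (xa z Dz) (ctsZ (ya z Dz)))).
- by move=> z Dz; exact: (ctsZ (ctsD (xb z Dz) (ctsZ (yb z Dz)))).
Qed.

End VectorCalculus.

(** * The moving frame *)

Section MovingFrame.
Variable R : realType.
Implicit Types (z w : R[i]) (D : set R[i]).

Lemma invmx_eq n (A B : 'M[R[i]]_n) : A *m B = 1%:M -> invmx A = B.
Proof. by move=> AB; have [u _] := mulmx1_unit AB; rewrite -[RHS](mulKmx u) AB mulmx1. Qed.

Lemma mxd_commute (A : R[i] -> 'M[R[i]]_4) (L : 'M[R[i]]_4) D z : open D -> mxCk 1 D A ->
  (forall w, D w -> A w *m L = L *m A w) -> D z ->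
  mxdz A z *m L = L *m mxdz A z /\ mxdzbar A z *m L = L *m mxdzbar A z.
Proof.
move=> oD AC AL Dz; have Ad := mxCk1_d AC Dz.
have h1 := mhas_dM Ad (mhas_d_cst L z); have h2 := mhas_dM (mhas_d_cst L z) Ad.
have [E1 E2] := mhas_d_unique (mhas_d_in oD Dz AL h1) h2.
by move: E1 E2; rewrite !mulmx0 !mul0mx !addr0 !add0r.
Qed.

Lemma mxd_orthogonal (A : R[i] -> 'M[R[i]]_4) D z : open D -> mxCk 1 D A ->
  (forall w, D w -> (A w)^T *m A w = 1%:M) -> D z ->
  (A z)^T *m mxdz A z = - ((mxdz A z)^T *m A z) /\
  (A z)^T *m mxdzbar A z = - ((mxdzbar A z)^T *m A z).
Proof.
move=> oD AC AA Dz; have Ad := mxCk1_d AC Dz.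
have h1 := mhas_dM (mhas_d_tr Ad) Ad.
have [E1 E2] := mhas_d_unique (mhas_d_in oD Dz AA h1) (mhas_d_cst 1%:M z).
by split; apply/eqP; rewrite -addr_eq0 addrC; apply/eqP.
Qed.

Lemma real_has_d (u : R[i] -> R) D z : Ck 1 D (fun w => (u w)%:C) -> D z ->
  has_d (fun w => (u w)%:C) z (dz (fun w => (u w)%:C) z) (conjc (dz (fun w => (u w)%:C) z)).
Proof.
move=> /Ck_C1_d[ud _ _] Dz; have h := ud z Dz; have := has_d_conj h.
under [X in has_d X _ _ _ -> _]eq_fun do rewrite conjc_real.
by move=> h'; have [_ E] := has_d_unique h h'; rewrite {1}E in h.
Qed.

Variables (D : set R[i]) (U : R[i] -> 'M[R[i]]_(4 + 1)) (beta : R[i] -> R).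
Variables (M0 : R[i] -> 'M[R[i]]_4) (t1 t2 : R[i] -> 'cV[R[i]]_4).
Hypothesis oD : open D.
Hypothesis UC : mxCk 1 D U.
Hypothesis Ugrp : forall z, D z -> Grp (U z).
Hypothesis betaC : Ck 1 D (fun z => (beta z)%:C).
Hypothesis M0C : mxCk 1 D M0.
Hypothesis M0G : forall z, D z -> G0C (M0 z).
Hypothesis FE : forall z, D z -> linpart (U z) = expmx ((beta z / 2)%:C *: Li) *m M0 z.
Hypothesis Xz : forall z, D z ->
  invmx (linpart (U z)) *m mxdz (fun w => trpart (U w)) z = t1 z.
Hypothesis Xzb : forall z, D z ->
  invmx (linpart (U z)) *m mxdzbar (fun w => trpart (U w)) z = t2 z.
Hypothesis t1V : forall z, D z -> Vm (t1 z).
Hypothesis t2V : forall z, D z -> Vp (t2 z).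

Definition bz z := dz (fun w => (beta w)%:C) z.

Lemma beta_d z : D z -> has_d (fun w => (beta w)%:C) z (bz z) (conjc (bz z)).
Proof. exact: real_has_d. Qed.

Lemma half_beta_d z : D z -> has_d (fun w => (beta w / 2)%:C) z (bz z / 2) (conjc (bz z) / 2).
Proof.
move=> Dz; have h := has_dM (beta_d Dz) (has_d_cst (2^-1 : R[i]) z).
rewrite (_ : (fun w => (beta w / 2)%:C) = fun w => (beta w)%:C * 2^-1); last first.
  by apply/funext => w; rewrite rmorphM /= fmorphV rmorph_nat.
by apply: (has_d_eq h); rewrite mulr0 addr0.
Qed.

Lemma M0_tr z : D z -> (M0 z)^T *m M0 z = 1%:M /\ M0 z *m (M0 z)^T = 1%:M.
Proof. by move=> Dz; split; [apply: G0C_trV|apply: G0C_tr]; exact: M0G. Qed.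

Lemma M0_Li z : D z -> M0 z *m Li = Li *m M0 z.
Proof. by move=> Dz; exact: G0C_Li (M0G Dz). Qed.

Lemma M0t_Li z : D z -> (M0 z)^T *m Li = Li *m (M0 z)^T.
Proof.
move=> Dz; apply: trmx_inj; rewrite !trmx_mul trmxK tr_Li mulNmx mulmxN.
by rewrite M0_Li.
Qed.

Lemma M0t_Lj z : D z -> (M0 z)^T *m Lj = Lj *m (M0 z)^T.
Proof.
move=> Dz; apply: trmx_inj; rewrite !trmx_mul trmxK tr_Lj mulNmx mulmxN.
by rewrite (G0C_Lj (M0G Dz)).
Qed.

Lemma UE z : D z -> U z = aff (linpart (U z)) (trpart (U z)).
Proof. by move=> /Ugrp[G [T [_ ->]]]; rewrite linpart_aff trpart_aff. Qed.

Lemma linpartV z : D z -> linpart (U z) *m ((M0 z)^T *m expLi (- (beta z / 2)%:C)) = 1%:M.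
Proof.
move=> Dz; rewrite FE // expmx_Li mulmxA -(mulmxA _ (M0 z)) (M0_tr Dz).2 mulmx1.
exact: expLiNK.
Qed.

(** The linear part is [exp (beta Li / 2) M0]. The translation parts are written as sums
    of vectors from the two eigenspaces of [Lj], as in [components_lie]. *)
Lemma maurer_cartan z : D z ->
  invmx (U z) *m mxdz U z = lie ((M0 z)^T *m mxdz M0 z + (bz z / 2) *: Li) (t1 z + 0) /\
  invmx (U z) *m mxdzbar U z =
    lie ((M0 z)^T *m mxdzbar M0 z + (conjc (bz z) / 2) *: Li) (0 + t2 z).
Proof.
move=> Dz.
have Fd : mhas_d (fun w => linpart (U w)) z
    ((bz z / 2) *: (Li *m expLi (beta z / 2)%:C) *m M0 z + expLi (beta z / 2)%:C *m mxdz M0 z)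
    ((conjc (bz z) / 2) *: (Li *m expLi (beta z / 2)%:C) *m M0 z + expLi (beta z / 2)%:C *m mxdzbar M0 z).
  apply: (mhas_d_in oD Dz _ (mhas_dM (mhas_d_expLi (half_beta_d Dz)) (mxCk1_d M0C Dz))).
  by move=> w Dw; rewrite FE // expmx_Li.
have XC : mxCk 1 D (fun w => trpart (U w)).
  move=> i j; have := UC (lshift 1 i) (rshift 4 j); congr (Ck 1 D _).
  by apply/funext => w; rewrite /trpart !mxE.
have Ud := mhas_d_in oD Dz (fun w Dw => esym (UE Dw)) (mhas_d_aff Fd (mxCk1_d XC Dz)).
have [-> ->] := mhas_dE Ud.
have iF := invmx_eq (linpartV Dz).
have iU := invmx_aff (trpart (U z)) (linpartV Dz).
rewrite -UE // in iU; rewrite iU !aff_lie addr0 add0r -(Xz Dz) -(Xzb Dz) iF.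
have E (a : R[i]) (P : 'M[R[i]]_4) : (M0 z)^T *m expLi (- (beta z / 2)%:C) *m
    (a *: (Li *m expLi (beta z / 2)%:C) *m M0 z + expLi (beta z / 2)%:C *m P) =
    (M0 z)^T *m P + a *: Li.
  rewrite mulmxDr addrC; congr (_ + _).
    by rewrite -mulmxA (mulmxA (expLi _)) expLiKN mul1mx.
  rewrite -!scalemxAl -scalemxAr; congr (_ *: _).
  rewrite -(expLi_Li) -!mulmxA (mulmxA (expLi (- _))) expLiKN mul1mx.
  by rewrite -M0_Li // mulmxA (M0_tr Dz).1 mul1mx.
by rewrite !E.
Qed.

(** [M0] commutes with [Lj], hence so does [M0^-1 dM0], which is therefore the component
    in [g_0]. *)
Lemma maurer_cartan_components z (pm1 p0 p1 p2 qm1 q0 q1 q2 : 'M[R[i]]_(4 + 1)) : D z ->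
  components (invmx (U z) *m mxdz U z) pm1 p0 p1 p2 ->
  components (invmx (U z) *m mxdzbar U z) qm1 q0 q1 q2 ->
  [/\ p2 = lie ((bz z / 2) *: Li) 0, p0 = lie ((M0 z)^T *m mxdz M0 z) 0 & pm1 = lie 0 (t1 z)] /\
  [/\ q2 = lie ((conjc (bz z) / 2) *: Li) 0, q0 = lie ((M0 z)^T *m mxdzbar M0 z) 0 &
      q1 = lie 0 (t2 z)].
Proof.
move=> Dz; have [-> ->] := maurer_cartan Dz.
have M0L w : D w -> M0 w *m Lj = Lj *m M0 w by move=> Dw; exact: G0C_Lj (M0G Dw).
have [c1 c2] := mxd_commute oD M0C M0L Dz.
have comm (P : 'M[R[i]]_4) : P *m Lj = Lj *m P -> (M0 z)^T *m P *m Lj = Lj *m ((M0 z)^T *m P).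
  by move=> PL; rewrite -mulmxA PL mulmxA M0t_Lj // mulmxA.
move=> /(components_lie (comm _ c1) (t1V Dz) (Vp0 R))[-> -> _ ->].
by move=> /(components_lie (comm _ c2) (Vm0 R) (t2V Dz))[_ -> -> ->].
Qed.

Section ExtendedFrame.
Variables (l : R[i]) (Ul : R[i] -> 'M[R[i]]_(4 + 1)).
Hypothesis UlC : mxCk 1 D Ul.
Hypothesis Ulgrp : forall z, D z -> Grp (Ul z).
Hypothesis Uld : forall z, D z ->
  mxdz Ul z = Ul z *m (l ^- 2 *: lie ((bz z / 2) *: Li) 0 + l^-1 *: lie 0 (t1 z)
    + lie ((M0 z)^T *m mxdz M0 z) 0) /\
  mxdzbar Ul z = Ul z *m (lie ((M0 z)^T *m mxdzbar M0 z) 0 + l *: lie 0 (t2 z)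
    + l ^+ 2 *: lie ((conjc (bz z) / 2) *: Li) 0).

Lemma extended_frame_d z : D z ->
  mhas_d (fun w => linpart (Ul w)) z
    (linpart (Ul z) *m ((l ^- 2 * (bz z / 2)) *: Li + (M0 z)^T *m mxdz M0 z))
    (linpart (Ul z) *m ((M0 z)^T *m mxdzbar M0 z + (l ^+ 2 * (conjc (bz z) / 2)) *: Li)) /\
  mhas_d (fun w => trpart (Ul w)) z
    (l^-1 *: (linpart (Ul z) *m t1 z)) (l *: (linpart (Ul z) *m t2 z)).
Proof.
move=> Dz; apply: mhas_d_linpart; have := mxCk1_d UlC Dz; have [-> ->] := Uld Dz.
rewrite !lieZ !lieD !scaler0 !addr0 !add0r !scalerA.
have -> : Ul z = aff (linpart (Ul z)) (trpart (Ul z)).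
  by have [G [T [_ ->]]] := Ulgrp Dz; rewrite linpart_aff trpart_aff.
by rewrite !aff_lie linpart_aff -!scalemxAr.
Qed.

(** The component in [g_0] is the same for all [l], and cancels against the derivative
    of [M0]. *)
Lemma relative_frame_d z : D z ->
  mhas_d (fun w => linpart (Ul w) *m (M0 w)^T) z
    ((l ^ (-2) * bz z / 2) *: (linpart (Ul z) *m (M0 z)^T *m Li))
    ((l ^ 2 * conjc (bz z) / 2) *: (linpart (Ul z) *m (M0 z)^T *m Li)).
Proof.
move=> Dz; have [Fd _] := extended_frame_d Dz.
have h := mhas_dM Fd (mhas_d_tr (mxCk1_d M0C Dz)).
have M0t w : D w -> (M0 w)^T *m M0 w = 1%:M by move=> /M0_tr[].
have [orth1 orth2] := mxd_orthogonal oD M0C M0t Dz.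
have E (a : R[i]) (P : 'M[R[i]]_4) : (M0 z)^T *m P = - (P^T *m M0 z) ->
   linpart (Ul z) *m (a *: Li + (M0 z)^T *m P) *m (M0 z)^T + linpart (Ul z) *m P^T =
   a *: (linpart (Ul z) *m (M0 z)^T *m Li).
  move=> ->; rewrite mulmxDr mulmxDl mulmxN mulNmx -!mulmxA (M0_tr Dz).2 mulmx1 -addrA addNr addr0.
  by rewrite -scalemxAl -scalemxAr -M0t_Li.
apply: (mhas_d_eq h); first by rewrite E // mulrA.
by rewrite (addrC (_ *m mxdzbar M0 z)) E // mulrA.
Qed.

Lemma relative_frame_cts z : D z -> mcts (fun w => linpart (Ul w) *m (M0 w)^T) z.
Proof.
move=> Dz; have [cU _] := mxCk_cts oD UlC Dz; have [cM _] := mxCk_cts oD M0C Dz.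
apply: mctsM => i j.
  under [X in {for _, continuous X}]eq_fun do rewrite /linpart !mxE.
  exact: cU.
under [X in {for _, continuous X}]eq_fun do rewrite mxE.
exact: cM.
Qed.

End ExtendedFrame.

Variables (s : R) (z0 : R[i]) (Ul : R[i] -> R[i] -> 'M[R[i]]_(4 + 1)).
Hypothesis s12 : 1 / 2 < s.
Hypothesis Dz0 : D z0.
Hypothesis pathD : forall x y, D x -> D y -> exists p : R -> R[i],
  [/\ {within `[0, 1], continuous p}, p 0 = x, p 1 = y & forall t, 0 <= t <= 1 -> D (p t)].
Hypothesis beta0 : beta z0 = 0.
Hypothesis U0 : U z0 = aff 1%:M 0.
Hypothesis UlC : forall l, S1 l -> mxCk 1 D (Ul l).
Hypothesis Ul0 : forall l, S1 l -> Ul l z0 = 1%:M.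
Hypothesis Ulloop : forall z, D z -> loopG_tau s (fun l => Ul l z).
Hypothesis Uld : forall l, S1 l -> forall z, D z ->
  mxdz (Ul l) z = Ul l z *m (l ^- 2 *: lie ((bz z / 2) *: Li) 0 + l^-1 *: lie 0 (t1 z)
    + lie ((M0 z)^T *m mxdz M0 z) 0) /\
  mxdzbar (Ul l) z = Ul l z *m (lie ((M0 z)^T *m mxdzbar M0 z) 0 + l *: lie 0 (t2 z)
    + l ^+ 2 *: lie ((conjc (bz z) / 2) *: Li) 0).

Lemma Ulgrp l z : S1 l -> D z -> Grp (Ul l z).
Proof. by move=> l1 Dz; have [_ h _] := Ulloop Dz; exact: h. Qed.

Definition relframe l z := linpart (Ul l z) *m (M0 z)^T.

Lemma relframe_d l : S1 l -> forall z, D z -> mhas_d (relframe l) z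
  ((l ^ (-2) * bz z / 2) *: (relframe l z *m Li)) ((l ^ 2 * conjc (bz z) / 2) *: (relframe l z *m Li)).
Proof.
move=> l1 z Dz.
exact: (relative_frame_d (UlC l1) (fun w Dw => Ulgrp l1 Dw) (Uld l1) Dz).
Qed.

Lemma relframe_cts l : S1 l -> forall z, D z -> forall i j, {for z, continuous (fun w => relframe l w i j)}.
Proof. by move=> l1 z Dz; exact: (relative_frame_cts (UlC l1) Dz). Qed.

Lemma relframe0 l : S1 l -> relframe l z0 = 1%:M.
Proof.
move=> l1; have := FE Dz0; rewrite U0 linpart_aff beta0 mul0r expmx_Li expLi0 mul1mx => M01.
by rewrite /relframe Ul0 // -aff1 linpart_aff -M01 trmx1 mulmx1.
Qed.

Lemma conjugate_potential : exists gamma : R[i] -> R,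
  gamma z0 = 0 /\ forall z, D z -> conj_d bz gamma z.
Proof. exact: (conjugate_exists oD Dz0 pathD beta0 beta_d relframe0 relframe_d relframe_cts). Qed.

Lemma is_gammaP (gamma : R[i] -> R) : is_gamma D z0 beta gamma <->
  gamma z0 = 0 /\ forall z, D z -> conj_d bz gamma z.
Proof.
have E g : (fun w => 2^-1 * (beta w +i* g w)) = fun w => 2^-1 * ((beta w)%:C + 'i%C * (g w)%:C).
  apply/funext => w; congr (_ * _); apply/eqP; rewrite eq_complex /=.
  by apply/andP; split; apply/eqP; ring.
split=> [[gC g0 gd]|[g0 gd]].
  split=> // z Dz; have := gd z Dz; rewrite E.
  have h := real_has_d gC Dz; set p := dz (fun w => (gamma w)%:C) z in h.
  have [-> -> _ _] := has_dE (has_dZ 2^-1 (has_dD (beta_d Dz) (has_dZ 'i%C h))).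
  rewrite -/(bz z) => -[e1 e2].
  have p1 : p = - 'i%C * bz z.
    have -> : p = - ('i%C * 'i%C) * p by rewrite sqri opprK mul1r.
    have alg (x y : R[i]) : x = 2 * (2^-1 * (y + x)) - y by field.
    have : 'i%C * p = bz z by rewrite (alg ('i%C * p) (bz z)) e1; ring.
    by move=> <-; ring.
  by apply: (has_d_eq h) => //; rewrite p1 conjcM conjcN conjc_i opprK.
split=> [|//|z Dz].
  apply: (C1_d_Ck (a := fun z => - 'i%C * bz z) (b := fun z => 'i%C * conjc (bz z)) oD).
  have [_ bc _] := Ck_C1_d betaC.
  split=> [z Dz|z Dz|z Dz]; [exact: gd|exact: ctsZ (bc z Dz)|].
  exact: (ctsZ (cts_conj (bc z Dz))).
rewrite E; have [-> -> _ _] := has_dE (has_dZ 2^-1 (has_dD (beta_d Dz) (has_dZ 'i%C (gd z Dz)))).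
have alg (j b : R[i]) : 2^-1 * (b + j * (- j * b)) = 2^-1 * (b - j * j * b) by ring.
have alg' (j b : R[i]) : 2^-1 * (b + j * (j * b)) = 2^-1 * (b + j * j * b) by ring.
rewrite alg alg' sqri !mulN1r opprK subrr mulr0; split=> //.
by rewrite -/(bz z); field.
Qed.

Section Factorization.
Variable gamma : R[i] -> R.
Hypothesis gamma0 : gamma z0 = 0.
Hypothesis gamma_d : forall z, D z -> conj_d bz gamma z.

Definition cz z : R[i] := (beta z +i* gamma z) / 4.

Lemma cz_d z : D z -> has_d cz z (bz z / 2) 0.
Proof.
move=> Dz; have h := has_dZ 4^-1 (has_dD (beta_d Dz) (has_dZ 'i%C (gamma_d Dz))).
rewrite (_ : cz = fun w => 4^-1 * ((beta w)%:C + 'i%C * (gamma w)%:C)); last first.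
  apply/funext => w; rewrite /cz mulrC; congr (_ * _); apply/eqP; rewrite eq_complex /=.
  by apply/andP; split; apply/eqP; ring.
have alg (j b : R[i]) : 4^-1 * (b + j * (- j * b)) = 4^-1 * (b - j * j * b) by ring.
have alg' (j b : R[i]) : 4^-1 * (b + j * (j * b)) = 4^-1 * (b + j * j * b) by ring.
by apply: (has_d_eq h); rewrite ?alg ?alg' sqri mulN1r ?opprK ?subrr ?mulr0 //; field.
Qed.

Lemma Eneg_cz m z : Eneg beta gamma m z = expLi (- (cz z * m ^ (-2))).
Proof.
rewrite /Eneg expmx_Li; congr (expLi (- _)); rewrite /cz -[m ^ (-2)]/(m ^- 2).
by rewrite mulrC mulrA mulrAC.
Qed.

Lemma Epos_cz m z : Epos beta gamma m z = expLi (cz z * m ^ (-2)).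
Proof.
rewrite /Epos expmx_Li; congr (expLi _); rewrite /cz -[m ^ (-2)]/(m ^- 2).
by rewrite mulrC mulrA mulrAC.
Qed.

Lemma angle_cz l z : S1 l ->
  (angle l (beta z) (gamma z))%:C = cz z * l ^ (-2) + conjc (cz z) * l ^ 2.
Proof.
move=> l1; rewrite -(S1_conj2 l1) /cz /angle; case: (l ^ 2) => x y.
have c4 : conjc (4^-1 : R[i]) = (4^-1 : R)%:C by rewrite fmorphV rmorph_nat fmorphV rmorph_nat.
have -> : (4^-1 : R[i]) = (4^-1 : R)%:C by rewrite fmorphV rmorph_nat.
rewrite conjcM conjc_real; apply/eqP; rewrite eq_complex /=.
by apply/andP; split; apply/eqP; field.
Qed.

Lemma frame_formula l z : S1 l -> D z ->
  linpart (Ul l z) = expLi (cz z * l ^ (-2) + conjc (cz z) * l ^ 2) *m M0 z.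
Proof.
move=> l1 Dz; rewrite -angle_cz //.
rewrite -(N_angle oD Dz0 pathD beta0 beta_d relframe0 relframe_d gamma0 gamma_d l1 Dz) /relframe.
by rewrite -mulmxA (M0_tr Dz).1 mulmx1.
Qed.

(** The loop of which the two projections are taken. *)
Definition shifted l z := expLi (- (cz z * l ^ (-2))) *m trpart (Ul l z).
Definition vcoef n z : 'cV[R[i]]_4 := \col_i fourier (fun l => shifted l z i 0) n.

Lemma trpart_rep z : D z -> exists x, vrep s (fun l => trpart (Ul l z)) x.
Proof.
move=> Dz; have [h _ _] := Ulloop Dz.
exists (fun n => \col_i fourier (fun l => trpart (Ul l z) i 0) n).
apply: (vrep_exists s12) => i; have := h (lshift 1 i) (rshift 4 0).
congr (Hs s _); apply/funext => l; rewrite /trpart !mxE.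
by [].
Qed.

Lemma trpart_twisted z : D z -> twisted (fun l => trpart (Ul l z)).
Proof.
by move=> Dz l l1; have [_ _ ->] := Ulloop Dz; rewrite // /tau trpart_aff.
Qed.

Lemma shifted_rep z : D z -> vrep s (shifted ^~ z) (vcoef ^~ z).
Proof.
move=> /trpart_rep[x xr]; have [v vr] := vrep_expLi s12 (- cz z) (-2) xr.
apply: (vrep_exists s12) => i.
by apply: (Hrep_Hs s12 (eq_Hrep _ (vr i))) => l _; rewrite mulNr.
Qed.

Lemma shifted_twisted z : D z -> twisted (shifted ^~ z).
Proof.
move=> Dz l l1; rewrite /shifted trpart_twisted //.
have -> : cz z * ('i%C * l) ^ (-2) = - (cz z * l ^ (-2)).
  have i2 : ('i%C : R[i]) ^ (-2) = -1.
    by rewrite -[LHS]invr_expz -exprnP expr2 sqri invrN1.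
  rewrite exprzMl; first by rewrite i2 mulN1r mulrN.
    by rewrite unitfE ci_neq0.
  by rewrite unitfE (S1_neq0 l1).
rewrite opprK mulmxN; congr (- _).
by rewrite [RHS]mulmxA Lj_expLi opprK mulmxA.
Qed.

Lemma frame_factorization z : D z ->
  birkhoff s (fun l => Ul l z) (fun l => Uminus beta gamma Ul l z) (fun l => Uplus beta gamma Ul l z).
Proof.
move=> Dz; have [x xr] := trpart_rep Dz.
have := birkhoff_factors s12 (M0G Dz) xr (trpart_twisted Dz) (fun l l1 => frame_formula l1 Dz).
rewrite /= => -[hm hp hE].
have V_E : (fun m => Eneg beta gamma m z *m trpart (Ul m z)) =
    fun m => expLi (- (cz z * m ^ (-2))) *m trpart (Ul m z).
  by apply/funext => m; rewrite Eneg_cz.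
have mE : (fun l => Uminus beta gamma Ul l z) = fun l => aff (expLi (cz z * l ^ (-2)))
    (expLi (cz z * l ^ (-2)) *m Qminus (fun m => expLi (- (cz z * m ^ (-2))) *m trpart (Ul m z)) l).
  by apply/funext => l; rewrite /Uminus Epos_cz V_E.
have pE : (fun l => Uplus beta gamma Ul l z) = fun l => aff (expLi (- (cz z * l ^ (-2))) *m linpart (Ul l z))
    (Qplus (fun m => expLi (- (cz z * m ^ (-2))) *m trpart (Ul m z)) l).
  by apply/funext => l; rewrite /Uplus Eneg_cz V_E.
rewrite mE pE; split; [exact: hm|exact: hp|move=> l l1].
have E : Ul l z = aff (linpart (Ul l z)) (trpart (Ul l z)).
  by have [G [T [_ ->]]] := Ulgrp l1 Dz; rewrite linpart_aff trpart_aff.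
by rewrite [LHS]E; exact: hE.
Qed.

Hypothesis UC2 : mxCk 2 D U.
Hypothesis betaC2 : Ck 2 D (fun z => (beta z)%:C).
Hypothesis harmonic : hamiltonian_stationary D beta.

(** The [dzbar]-derivative is a quarter of the Laplacian of [beta]. *)
Lemma bz_C1 : C1_d D bz (dz bz) (fun=> 0).
Proof.
have [[h c1 c2] _] := Ck2_C1 oD betaC2; split=> [z Dz|z Dz|z Dz]; [|exact: c1|exact: cts_cst].
apply: (has_d_eq (h z Dz)) => //.
have [_] := dz_dzbar oD betaC2 Dz; rewrite harmonic // => /esym/eqP.
by rewrite mulf_eq0 pnatr_eq0 /= => /eqP.
Qed.

(** [mm1 dz + mm2 dzbar] is [exp (- beta Li / 2) dX]; unlike those of [dX], its two
    coefficients lie in eigenspaces of [Lj]. *)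
Definition mm1 z := M0 z *m t1 z.
Definition mm2 z := M0 z *m t2 z.
Definition X0 z := trpart (U z).

Lemma mhas_d_scale m n (c : R[i]) (A : R[i] -> 'M[R[i]]_(m, n)) z P Q :
  mhas_d A z P Q -> mhas_d (fun w => c *: A w) z (c *: P) (c *: Q).
Proof. by move=> h i j; under eq_fun do rewrite mxE; rewrite !mxE; exact: has_dZ. Qed.

Lemma Vm_d (A : R[i] -> 'cV[R[i]]_4) z P Q : (forall w, D w -> Vm (A w)) -> D z ->
  mhas_d A z P Q -> Vm P /\ Vm Q.
Proof.
move=> AV Dz Ad; have h := mhas_d_in oD Dz AV (mhas_dM (mhas_d_cst Lj z) Ad).
by have [] := mhas_d_unique h (mhas_d_scale 'i%C Ad); rewrite !mul0mx !add0r.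
Qed.

Lemma Vp_d (A : R[i] -> 'cV[R[i]]_4) z P Q : (forall w, D w -> Vp (A w)) -> D z ->
  mhas_d A z P Q -> Vp P /\ Vp Q.
Proof.
move=> AV Dz Ad; have h := mhas_d_in oD Dz AV (mhas_dM (mhas_d_cst Lj z) Ad).
by have [] := mhas_d_unique h (mhas_d_scale (- 'i%C) Ad); rewrite !mul0mx !add0r.
Qed.

Lemma mmE z : D z -> mm1 z = expLi (- (beta z / 2)%:C) *m mxdz X0 z /\
  mm2 z = expLi (- (beta z / 2)%:C) *m mxdzbar X0 z.
Proof.
move=> Dz; rewrite /mm1 /mm2 -(Xz Dz) -(Xzb Dz) (invmx_eq (linpartV Dz)).
have E (B : 'M[R[i]]_4) (Y : 'cV[R[i]]_4) : M0 z *m ((M0 z)^T *m B *m Y) = B *m Y.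
  by rewrite -(mulmxA _ B) mulmxA (M0_tr Dz).2 mul1mx.
by split; exact: E.
Qed.

Lemma mm1_V z : D z -> Vm (mm1 z).
Proof. by move=> Dz; apply: Vm_commute (t1V Dz); exact: G0C_Lj (M0G Dz). Qed.

Lemma mm2_V z : D z -> Vp (mm2 z).
Proof. by move=> Dz; apply: Vp_commute (t2V Dz); exact: G0C_Lj (M0G Dz). Qed.

(** The product rule for [Y = exp (- beta Li / 2) X'], when [beta' = a] and [X'' = Z]. *)
Definition mm_d (Y : 'cV[R[i]]_4) (a : R[i]) (Z : 'cV[R[i]]_4) z :=
  (- (a / 2)) *: (Li *m Y) + expLi (- (beta z / 2)%:C) *m Z.

Lemma X0_C2 i : Ck 2 D (fun w => X0 w i 0).
Proof.
have := UC2 (lshift 1 i) (rshift 4 0); congr (Ck 2 D _).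
by apply/funext => w; rewrite /X0 /trpart !mxE.
Qed.

Lemma mxdX0_C1 : mxCk 1 D (mxdz X0) /\ mxCk 1 D (mxdzbar X0).
Proof.
split=> i j; rewrite (ord1 j); have [C C'] := Ck2_C1 oD (X0_C2 i).
  rewrite (_ : (fun w => _) = dz (fun w => X0 w i 0)); first exact: C1_d_Ck oD C.
  by apply/funext => w; rewrite mxE.
rewrite (_ : (fun w => _) = dzbar (fun w => X0 w i 0)); first exact: C1_d_Ck oD C'.
by apply/funext => w; rewrite mxE.
Qed.

(** The Maurer-Cartan coefficients along [dz] and [dzbar] lie in different eigenspaces of
    [Lj], so the symmetry of the second derivatives of [X] gives one equation in each. *)
Lemma mm1_d z : D z ->
  mhas_d mm1 z (mm_d (mm1 z) (bz z) (mxdz (mxdz X0) z) z) ((bz z / 2) *: (Li *m mm2 z)).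
Proof.
move=> Dz; have [h1 h2] : _ /\ _ := conj (mxCk1_d mxdX0_C1.1 Dz) (mxCk1_d mxdX0_C1.2 Dz).
have ed := mhas_d_expLi (has_dN (half_beta_d Dz)).
have m1 := mhas_d_in oD Dz (fun w Dw => esym (mmE Dw).1) (mhas_dM ed h1).
have m2 := mhas_d_in oD Dz (fun w Dw => esym (mmE Dw).2) (mhas_dM ed h2).
have [E1 E2] := mmE Dz.
have assoc (a : R[i]) (B : 'M[R[i]]_4) (Y Z : 'cV[R[i]]_4) :
    a *: (Li *m B) *m Y + Z = a *: (Li *m (B *m Y)) + Z.
  by rewrite -scalemxAl -mulmxA.
rewrite !assoc -E1 in m1; rewrite !assoc -E2 in m2.
apply: (mhas_d_eq m1); first by [].
have [_ Q1] := Vm_d mm1_V Dz m1; have [P2 _] := Vp_d mm2_V Dz m2.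
have sym : mxdzbar (mxdz X0) z = mxdz (mxdzbar X0) z.
  apply/colP => i; rewrite !mxE; under eq_fun do rewrite mxE.
  under [in RHS]eq_fun do rewrite mxE.
  exact: (dz_dzbar oD (X0_C2 i) Dz).1.
have alg (a b : R[i]) (x y r r' : 'cV[R[i]]_4) : r = r' ->
    - a *: x + r + a *: x = b *: y + (- b *: y + r').
  by move=> ->; rewrite !scaleNr addNKr addrAC addNr add0r.
have S := alg (conjc (bz z) / 2) (bz z / 2) (Li *m mm1 z) (Li *m mm2 z) _ _
  (congr1 (mulmx (expLi (- (beta z / 2)%:C))) sym).
by have [-> _] := VmVp_sum Q1 (VpZ _ (Li_Vm (mm1_V Dz))) (VmZ _ (Li_Vp (mm2_V Dz))) P2 S.
Qed.

Lemma half_beta_cts z : D z -> mcts (fun w => expLi (- (beta w / 2)%:C)) z.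
Proof.
move=> Dz; apply: mcts_expLi; apply: ctsN.
have E : (fun w => (beta w / 2)%:C) = fun w => (beta w)%:C * 2^-1 :> R[i].
  by apply/funext => w; rewrite rmorphM /= fmorphV rmorph_nat.
by rewrite E; exact: (ctsMr (C1_continuous oD (Ck_C1_d betaC) Dz)).
Qed.

Lemma mm_cts z : D z -> [/\ mcts mm1 z, mcts mm2 z &
  mcts (fun w => mm_d (mm1 w) (bz w) (mxdz (mxdz X0) w) w) z].
Proof.
move=> Dz; have ec := half_beta_cts Dz.
have [c1 [c11 _]] := mxCk_cts oD mxdX0_C1.1 Dz; have [c2 _] := mxCk_cts oD mxdX0_C1.2 Dz.
have h1 : mcts mm1 z.
  by apply: (mcts_in oD Dz (fun w Dw => esym (mmE Dw).1)); exact: mctsM ec c1.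
have h2 : mcts mm2 z.
  by apply: (mcts_in oD Dz (fun w Dw => esym (mmE Dw).2)); exact: mctsM ec c2.
have [_ bzc _] := Ck_C1_d betaC.
split; [exact: h1|exact: h2|].
have c : {for z, continuous (fun w => - (bz w / 2))} by exact: (ctsN (ctsMr (bzc z Dz))).
exact: (mctsD (mctsZ c (mctsM (@mcts_cst R 4 4 Li z) h1)) (mctsM ec c11)).
Qed.

Lemma cz_C1 : C1_d D cz (fun z => bz z / 2) (fun=> 0).
Proof.
have [_ bzc _] := Ck_C1_d betaC.
by split=> [z Dz|z Dz|z Dz]; [exact: cz_d|exact: (ctsMr (bzc z Dz))|exact: cts_cst].
Qed.

(** The coefficient of [l^-1 dz] in the differential of [shifted]. *)
Definition potential z := mm1 z - (bz z / 2) *: (Li *m vcoef 1 z).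

Lemma potential_V z : D z -> Vm (potential z).
Proof.
move=> Dz; rewrite /potential -scaleNr; apply: VmD; first exact: mm1_V.
apply/VmZ/Li_Vp; rewrite /Vp.
have := twisted_coeff s12 (shifted_rep Dz) (shifted_twisted Dz) 1.
by rewrite expr1z scaleNr => ->; rewrite opprK.
Qed.

Lemma phi0 k lo : phi k lo 0 = 0 :> R[i].
Proof. by case: lo; rewrite /phi !mxE mulr0 addr0. Qed.

Lemma phi_rep k lo (V : R[i] -> 'cV[R[i]]_4) v : vrep s V v ->
  Hrep s (fun l => phi k lo (V l)) (fun n => phi k lo (v n)).
Proof.
move=> Vv; case: lo; rewrite /phi.
  exact: (HrepD s12 (Vv 2) (HrepZ k s12 (Vv 3))).
exact: (HrepD s12 (Vv 0) (HrepZ k s12 (Vv 1))).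
Qed.

Lemma phi_cts k lo (A : R[i] -> 'cV[R[i]]_4) z : mcts A z ->
  {for z, continuous (fun w => phi k lo (A w))}.
Proof.
move=> cA; case: lo; rewrite /phi.
  exact: (ctsD (@cA 2 0) (ctsZ (@cA 3 0))).
exact: (ctsD (@cA 0 0) (ctsZ (@cA 1 0))).
Qed.

Lemma phi_has_d k lo (A : R[i] -> 'cV[R[i]]_4) z p q : mhas_d A z p q ->
  has_d (fun w => phi k lo (A w)) z (phi k lo p) (phi k lo q).
Proof.
move=> Ad; case: lo; rewrite /phi.
  exact: (has_dD (Ad 2 0) (has_dZ k (Ad 3 0))).
exact: (has_dD (Ad 0 0) (has_dZ k (Ad 1 0))).
Qed.

Definition dressed l z := expLi (cz z * l ^ (-2)) *m Qminus (shifted ^~ z) l.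

(** Each component along an eigenvector of [Li] solves the scalar equation. *)
Section Component.
Variables (sg lo : bool).
Let k : R[i] := if sg then 'i%C else - 'i%C.
Let e z := k * cz z.
Let e' z := k * (bz z / 2).
Let et z := k * conjc (cz z).
Let m1 z := phi k lo (mm1 z).
Let m2 z := phi k lo (mm2 z).
Let x l z := phi k lo (trpart (Ul l z)).

Lemma component_e : C1_d D e e' (fun=> 0).
Proof.
have [h c _] := cz_C1; split=> [z Dz|z Dz|z Dz]; [|exact: ctsZ (c z Dz)|exact: cts_cst].
by apply: (has_d_eq (has_dZ k (h z Dz))) => //; rewrite mulr0.
Qed.

Lemma component_et z : D z -> {for z, continuous et}.
Proof. by move=> Dz; exact: (ctsZ (cts_conj (C1_continuous oD cz_C1 Dz))). Qed.

Lemma component_m1 z : D z -> {for z, continuous m1}.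
Proof. by move=> Dz; have [c _ _] := mm_cts Dz; exact: (phi_cts c). Qed.

Lemma component_m2 z : D z -> {for z, continuous m2}.
Proof. by move=> Dz; have [_ c _] := mm_cts Dz; exact: (phi_cts c). Qed.

Lemma component_x l : S1 l -> forall z, D z -> has_d (x l) z
  (l ^ (-1) * (cexp (e z * l ^ (-2) + et z * l ^ 2) * m1 z))
  (l ^ 1 * (cexp (e z * l ^ (-2) + et z * l ^ 2) * m2 z)).
Proof.
move=> l1 z Dz.
have [_ h] := extended_frame_d (UlC l1) (fun w Dw => Ulgrp l1 Dw) (Uld l1) Dz.
apply: (has_d_eq (phi_has_d k lo h)); rewrite phiZ frame_formula // -mulmxA phi_expLi -/k.
  by congr (_ * (cexp _ * _)); rewrite /e /et; ring.
by rewrite expr1z; congr (_ * (cexp _ * _)); rewrite /e /et; ring.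
Qed.

Lemma component_H z : D z -> exists c, Hrep s (x ^~ z) c.
Proof.
by move=> /trpart_rep[v vr]; exists (fun n => phi k lo (v n)); exact: phi_rep.
Qed.

Lemma hfamE l z : hfam e x l z = phi k lo (shifted l z).
Proof. by rewrite /hfam /shifted phi_expLi -/k; congr (cexp _ * _); rewrite /e; ring. Qed.

Lemma hcoefE n z : D z -> hcoef e x n z = phi k lo (vcoef n z).
Proof.
move=> Dz; have h := phi_rep k lo (shifted_rep Dz).
rewrite -(Hrep_fourier s12 h n) /hcoef; congr (fourier _ n).
by apply/funext => l; rewrite hfamE.
Qed.

Lemma component_h0 z : D z -> hcoef e x 0 z = 0.
Proof.
move=> Dz; rewrite hcoefE // (twisted_coeff0 s12 (shifted_rep Dz) (shifted_twisted Dz)).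
by rewrite phi0.
Qed.

Lemma component_dressing l z : S1 l -> D z -> dressing e x l z = phi k lo (dressed l z).
Proof.
move=> l1 Dz; rewrite /dressed phi_expLi -/k /dressing mulrA; congr (_ * _).
have h := phi_rep k lo (Qminus_rep s12 (shifted_rep Dz)).
rewrite h.2 //; apply: eq_zsum => n; congr (_ * _); rewrite /hneg; case: ifP => _.
  by rewrite hcoefE.
by rewrite phi0.
Qed.

Lemma component_A z : D z -> Adz e e' m1 x z = phi k lo (potential z).
Proof.
move=> Dz; have -> : potential z = mm1 z + (- (bz z / 2)) *: (Li *m vcoef 1 z).
  by rewrite scaleNr.
rewrite (phiD k lo (mm1 z)) (phiZ k lo) (phi_Li lo _ (ik2 R sg)) /Adz.
by rewrite -/k hcoefE // /m1 /e'; move: (phi k lo (mm1 z)) (phi k lo (vcoef 1 z)) => p q; ring.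
Qed.

Lemma component_dressed_d l : S1 l -> C1_d D (fun z => phi k lo (dressed l z))
  (fun z => phi k lo (l ^ (-1) *: (expLi (cz z * l ^ (-2)) *m potential z))) (fun=> 0).
Proof.
move=> l1.
have [h c _] := dressing_d s12 oD component_e component_et component_m1 component_m2
  component_x component_H component_h0 l1.
have E z : D z -> cexp (e z * l ^ (-2)) * (Adz e e' m1 x z * l ^ (-1)) =
    phi k lo (l ^ (-1) *: (expLi (cz z * l ^ (-2)) *m potential z)).
  move=> Dz; rewrite phiZ phi_expLi component_A // -/k (_ : e z * _ = k * (cz z * l ^ (-2))).
    by rewrite mulrA mulrC.
  by rewrite /e mulrA.
split=> [z Dz|z Dz|z Dz]; last exact: cts_cst.
  rewrite -E //; apply: (has_d_in oD Dz _ (h z Dz)) => w Dw.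
  exact: component_dressing.
by apply: (continuous_in oD Dz E); exact: c.
Qed.

Lemma component_holomorphic : holomorphic D (Adz e e' m1 x).
Proof.
have m1C : C1_d D m1 (fun z => phi k lo (mm_d (mm1 z) (bz z) (mxdz (mxdz X0) z) z))
    (fun z => e' z * m2 z).
  have [_ bc _] := Ck_C1_d betaC.
  split=> [z Dz|z Dz|z Dz].
  - apply: (has_d_eq (phi_has_d k lo (mm1_d Dz))) => //.
    rewrite phiZ phi_Li; last exact: ik2.
    by rewrite /e' /m2; ring.
  - by have [_ _ c] := mm_cts Dz; exact: (phi_cts c).
  - exact: (ctsM (ctsZ (ctsMr (bc z Dz))) (component_m2 Dz)).
have e'C : C1_d D e' (fun z => k * (dz bz z / 2)) (fun=> 0).
  have [h c _] := bz_C1; split=> [z Dz|z Dz|z Dz]; [| |exact: cts_cst].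
    apply: (has_d_eq (has_dZ k (has_dM (h z Dz) (has_d_cst 2^-1 z)))).
      by rewrite mulr0 addr0.
    by rewrite mul0r mulr0 addr0 mulr0.
  exact: (ctsZ (ctsMr (c z Dz))).
exact: (@Adz_holomorphic R s s12 D oD e e' et m1 m2 x component_e component_et component_m1
  component_m2 component_x component_H _ _ m1C e'C).
Qed.

End Component.

Lemma dressed_d l : S1 l -> forall z, D z ->
  mhas_d (dressed l) z (l ^ (-1) *: (expLi (cz z * l ^ (-2)) *m potential z)) 0.
Proof.
move=> l1 z Dz; apply: mhas_d_phi => sg lo k.
have [h _ _] := component_dressed_d sg lo l1.
by apply: (has_d_eq (h z Dz)); rewrite // phi0.
Qed.

Lemma dressed_cts l z : S1 l -> D z ->
  mcts (fun w => l ^ (-1) *: (expLi (cz w * l ^ (-2)) *m potential w)) z.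
Proof.
move=> l1 Dz; apply: mcts_phi => sg lo.
by have [_ h _] := component_dressed_d sg lo l1; exact: h.
Qed.

Lemma UminusE l z : Uminus beta gamma Ul l z =
  aff (expLi (cz z * l ^ (-2))) (dressed l z).
Proof.
rewrite /Uminus Epos_cz /dressed; congr (aff _ (_ *m Qminus _ l)).
by apply/funext => m; rewrite /shifted Eneg_cz.
Qed.

Lemma Uminus_d l z : S1 l -> D z -> mhas_d (Uminus beta gamma Ul l) z
  (lie ((bz z / 2 * l ^ (-2)) *: (Li *m expLi (cz z * l ^ (-2))))
     (l ^ (-1) *: (expLi (cz z * l ^ (-2)) *m potential z))) 0.
Proof.
move=> l1 Dz; have cd := has_dM (cz_d Dz) (has_d_cst (l ^ (-2)) z).
have h := mhas_d_aff (mhas_d_expLi cd) (dressed_d l1 Dz).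
rewrite (_ : Uminus beta gamma Ul l = fun z => aff (expLi (cz z * l ^ (-2))) (dressed l z)); last first.
  by apply/funext => w; exact: UminusE.
apply: (mhas_d_eq h).
  by congr (lie (_ *: _) _); rewrite mulr0 addr0.
by rewrite mul0r mulr0 addr0 scale0r /lie block_mx0.
Qed.

Lemma Uminus_C1 l : S1 l -> mxCk 1 D (Uminus beta gamma Ul l).
Proof.
move=> l1; rewrite (_ : Uminus beta gamma Ul l = fun z => aff (expLi (cz z * l ^ (-2))) (dressed l z)); last first.
  by apply/funext => w; exact: UminusE.
move=> i j; apply: (aff_entries (P := Ck 1 D)).
- move=> c; apply: (C1_d_Ck (a := fun=> 0) (b := fun=> 0) oD).
  by split=> z Dz; [exact: has_d_cst|exact: cts_cst|exact: cts_cst].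
- move=> {}i {}j; have [h c _] := cz_C1.
  have ez z : D z -> mhas_d (fun w => expLi (cz w * l ^ (-2))) z
      ((bz z / 2 * l ^ (-2)) *: (Li *m expLi (cz z * l ^ (-2)))) 0.
    move=> Dz; apply: (mhas_d_eq (mhas_d_expLi (has_dM (h z Dz) (has_d_cst (l ^ (-2)) z)))).
      by rewrite mulr0 addr0.
    by rewrite mul0r mulr0 addr0 scale0r.
  apply: (C1_d_Ck (a := fun z => ((bz z / 2 * l ^ (-2)) *: (Li *m expLi (cz z * l ^ (-2)))) i j) (b := fun=> 0) oD).
  split=> z Dz; [by have := ez z Dz i j; rewrite [X in has_d _ _ _ X]mxE| |exact: cts_cst].
  have c1 : {for z, continuous (fun z => bz z / 2 * l ^ (-2))} by exact: (ctsMr (c z Dz)).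
  have c2 : {for z, continuous (fun z => cz z * l ^ (-2))}.
    exact: (ctsMr (C1_continuous oD cz_C1 Dz)).
  exact: (mctsZ c1 (mctsM (@mcts_cst R 4 4 Li z) (mcts_expLi c2))).
- move=> {}i; apply: (C1_d_Ck (a := fun z => (l ^ (-1) *: (expLi (cz z * l ^ (-2)) *m potential z)) i 0) (b := fun=> 0) oD).
  split=> z Dz; [by have := dressed_d l1 Dz i 0; rewrite [X in has_d _ _ _ X]mxE| |exact: cts_cst].
  exact: (dressed_cts l1 Dz).
Qed.

(** The functions [a] and [b] are the coordinates of [potential] in [g_m1], computed
    from its components along the eigenvectors of [Li]. *)
Lemma weierstrass_data : exists a b : R[i] -> R[i], [/\ holomorphic D a, holomorphic D b &
  forall l, S1 l -> mxCk 1 D (Uminus beta gamma Ul l) /\ forall z, D z ->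
    invmx (Uminus beta gamma Ul l z) *m mxdz (Uminus beta gamma Ul l) z =
      lie ((l ^- 2 / 2 * bz z) *: Li) (l^-1 *: (a z *: eps + b z *: (Li *m epsbar))) /\
    invmx (Uminus beta gamma Ul l z) *m mxdzbar (Uminus beta gamma Ul l) z = 0].
Proof.
have h1 := @component_holomorphic true false; have h2 := @component_holomorphic false false.
have E1 z Dz := @component_A true false z Dz; have E2 z Dz := @component_A false false z Dz.
move: h1 h2 E1 E2; set A1 := Adz _ _ _ _; set A2 := Adz _ _ _ _ => h1 h2 E1 E2.
exists (fun z => A1 z + A2 z), (fun z => - 'i%C * (A1 z - A2 z)); split.
- by move=> z Dz; exact: (derivableD (h1 z Dz) (h2 z Dz)).
- move=> z Dz; apply: (derivableM (derivable_cst _ _ _)).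
  exact: (derivableB (h1 z Dz) (h2 z Dz)).
move=> l l1; split; first exact: Uminus_C1.
move=> z Dz; have [-> ->] := mhas_dE (Uminus_d l1 Dz); rewrite mulmx0; split=> //.
rewrite UminusE (invmx_aff _ (expLiNK _)) aff_lie; set E := expLi (cz z * _); set E' := expLi (- _).
have EE : E' *m E = 1%:M by exact: expLiKN.
have -> : E' *m ((bz z / 2 * l ^ (-2)) *: (Li *m E)) = (l ^- 2 / 2 * bz z) *: Li.
  rewrite -scalemxAr -expLi_Li mulmxA EE mul1mx; congr (_ *: _).
  by rewrite -[l ^ (-2)]/(l ^- 2) mulrC mulrA mulrAC.
have -> : E' *m (l ^ (-1) *: (E *m potential z)) = l^-1 *: potential z.
  by rewrite -scalemxAr mulmxA EE mul1mx.
congr (lie _ (_ *: _)); rewrite [LHS](Vm_coord (potential_V Dz)) E1 // E2 //.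
have [-> -> _ _] := phi_inv (potential z); move: (phi _ _ _) (phi _ _ _) => p q.
by congr (_ *: _ + _ *: _); field.
Qed.

End Factorization.

End MovingFrame.

(** * The factorization of the extended lift *)

Theorem theorem8 (R : realType) (s : R) (Omega : set R[i]) (z0 : R[i])
    (U : R[i] -> 'M[R[i]]_(4 + 1)) (beta : R[i] -> R)
    (Ul : R[i] -> R[i] -> 'M[R[i]]_(4 + 1))
    (s_gt : 1 / 2 < s)
    (Omega_open : open Omega)
    (Omega_sc : simply_connected Omega)
    (Omega_z0 : Omega z0)
    (U_lcli : LCLI Omega z0 U)
    (beta_angle : lagrangian_angle Omega z0 U beta)
    (beta_harmonic : hamiltonian_stationary Omega beta)
    (Ul_lift : extended_lift Omega z0 U Ul)
    (Ul_loop : forall z, Omega z -> loopG_tau s (fun l => Ul l z)) :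
  (exists gamma : R[i] -> R, is_gamma Omega z0 beta gamma) /\
  forall gamma : R[i] -> R, is_gamma Omega z0 beta gamma ->
    (forall z, Omega z ->
       birkhoff s (fun l => Ul l z)
         (fun l => Uminus beta gamma Ul l z)
         (fun l => Uplus beta gamma Ul l z) /\
       forall Vm Vp : R[i] -> 'M[R[i]]_(4 + 1),
         birkhoff s (fun l => Ul l z) Vm Vp ->
         forall l, S1 l ->
           Vm l = Uminus beta gamma Ul l z /\
           Vp l = Uplus beta gamma Ul l z) /\
    exists a b : R[i] -> R[i],
      [/\ holomorphic Omega a, holomorphic Omega b &
          forall l, S1 l ->
            mxCk 1 Omega (Uminus beta gamma Ul l) /\
            forall z, Omega z ->
              invmx (Uminus beta gamma Ul l z)
                  *m mxdz (Uminus beta gamma Ul l) z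
                = lie ((l ^- 2 / 2 * dz (fun w => (beta w)%:C) z) *: Li)
                      (l^-1 *: (a z *: eps + b z *: (Li *m epsbar))) /\
              invmx (Uminus beta gamma Ul l z)
                  *m mxdzbar (Uminus beta gamma Ul l) z = 0].
Proof.
have [_ pathO _] := Omega_sc.
have [U_C U_grp U_0 [K [f [_ K_G0 _ dX]]]] := U_lcli.
have [beta_C beta_0 [M0 [M0_C M0_G0 F_eq]]] := beta_angle.
have [pm1 [p0 [p1 [p2 [qm1 [q0 [q1 [q2 [comp Ul_d]]]]]]]]] := Ul_lift.
pose t1 z := (expR (f z))%:C *: (K z *m eps).
pose t2 z := (expR (f z))%:C *: (K z *m epsbar).
have t1_V z : Omega z -> Vm (t1 z).
  move=> Oz; apply/VmZ/Vm_commute; last exact: Vm_eps.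
  exact: G0C_Lj (G0_G0C (K_G0 z Oz)).
have t2_V z : Omega z -> Vp (t2 z).
  move=> Oz; apply/VpZ/Vp_commute; last exact: Vp_epsbar.
  exact: G0C_Lj (G0_G0C (K_G0 z Oz)).
have M0_G z : Omega z -> G0C (M0 z) by move=> Oz; exact: G0_G0C (M0_G0 z Oz).
have Xz z Oz := (dX z Oz).1; have Xzb z Oz := (dX z Oz).2.
have UlC l : S1 l -> mxCk 1 Omega (Ul l) by move=> /Ul_d[].
have Ul0 l : S1 l -> Ul l z0 = 1%:M by move=> /Ul_d[].
have Ul_mc l : S1 l -> forall z, Omega z ->
    mxdz (Ul l) z = Ul l z *m (l ^- 2 *: lie ((bz beta z / 2) *: Li) 0 + l^-1 *: lie 0 (t1 z)
      + lie ((M0 z)^T *m mxdz M0 z) 0) /\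
    mxdzbar (Ul l) z = Ul l z *m (lie ((M0 z)^T *m mxdzbar M0 z) 0 + l *: lie 0 (t2 z)
      + l ^+ 2 *: lie ((conjc (bz beta z) / 2) *: Li) 0).
  move=> l1 z Oz; have [_ _ /(_ z Oz)] := Ul_d l l1; have [c1 c2] := comp z Oz.
  by have [[-> -> ->] [-> -> ->]] := maurer_cartan_components Omega_open (U_C 1%N) U_grp
    (beta_C 1%N) (M0_C 1%N) M0_G F_eq Xz Xzb t1_V t2_V Oz c1 c2.
have gammaP := is_gammaP Omega_open (beta_C 1%N) z0.
split.
  have [gamma h] := conjugate_potential Omega_open (beta_C 1%N) (M0_C 1%N) M0_G F_eq Omega_z0
    pathO beta_0 U_0 UlC Ul0 Ul_loop Ul_mc.
  by exists gamma; apply/gammaP.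
move=> gamma /gammaP[gamma_0 gamma_d]; split.
  move=> z Oz; have B := frame_factorization Omega_open (beta_C 1%N) (M0_C 1%N) M0_G F_eq s_gt
    Omega_z0 pathO beta_0 U_0 UlC Ul0 Ul_loop Ul_mc gamma_0 gamma_d Oz.
  by split=> // Vm' Vp' B'; exact: (birkhoff_unique B B').
exact: (weierstrass_data Omega_open (beta_C 1%N) (M0_C 1%N) M0_G F_eq Xz Xzb t1_V t2_V s_gt
  Omega_z0 pathO beta_0 U_0 UlC Ul0 Ul_loop Ul_mc gamma_0 gamma_d (U_C 2%N) (beta_C 2%N) beta_harmonic).
Qed.
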